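(* Let $\beta\ge3$. The discrete variational inequality $$\text{find }\boldsymbol u_h\in K_h^s:\qquad a^s(\boldsymbol u_h,\boldsymbol v_h-\boldsymbol u_h)\ge F(\boldsymbol v_h-\boldsymbol u_h)\quad\text{for all }\boldsymbol v_h\in K_h^s$$ admits a unique solution $\boldsymbol u_h\in K_h^s$.
   Context: Domain and mesh. $0<\varepsilon\le1$. $\Omega\subset\mathbb R^d$ ($d\in\{2,3\}$) is a bounded simply connected Lipschitz domain with boundary $\Gamma=\partial\Omega$ and outer unit normal $\boldsymbol n=\boldsymbol n_\Omega$; $f\in L^2(\Omega)$. $(\cdot,\cdot)$ and $\|\cdot\|$ are the $L^2(\Omega)$ inner product and norm; $\langle\cdot,\cdot\rangle_{\partial\omega}$ is the (extended) $L^2(\partial\omega)$ duality. $\mathcal T$ is a finite conforming mesh of $\Omega$ of open simplices $T$, $\bigcup_{T\in\mathcal T}\overline T=\overline\Omega$; $\boldsymbol n_T$ is the outer unit normal on $\partial T$; $\mathcal S=\{\partial T:T\in\mathcal T\}$. $\nabla_{\mathcal T},\mathrm{div}_{\mathcal T},\Delta_{\mathcal T}$ are the $\mathcal T$-piecewise gradient, divergence, Laplacian. Skeleton spaces. $H^{1/2}(\mathcal S)$ is the set of $\widehat u\in\prod_TH^{1/2}(\partial T)$ for which there is $w\in H^1(\Omega)$ with $\widehat u|_{\partial T}=w|_{\partial T}$ for all $T$; $H^{-1/2}(\mathcal S)$ is the set of $\widehat\sigma\in\prod_TH^{-1/2}(\partial T)$ for which there is $\boldsymbol q\in\boldsymbol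 H(\mathrm{div},\Omega)$ with $\widehat\sigma|_{\partial T}=(\boldsymbol q\cdot\boldsymbol n_T)|_{\partial T}$ for all $T$. Norms: $\|\widehat u\|_{1/2,\mathcal S}$ is the infimum of $(\|w\|^2+\varepsilon^{1/2}\|\nabla w\|^2)^{1/2}$ over all such $w$; $\|\widehat\sigma\|_{-1/2,\mathcal S}$ is the infimum of $(\|\boldsymbol q\|^2+\varepsilon\|\mathrm{div}\,\boldsymbol q\|^2)^{1/2}$ over all such $\boldsymbol q$. Restrictions: $\widehat u|_\Gamma:=w|_\Gamma\in H^{1/2}(\Gamma)$, $\widehat\sigma|_\Gamma:=(\boldsymbol q\cdot\boldsymbol n_\Omega)|_\Gamma\in H^{-1/2}(\Gamma)$ (independent of the chosen $w,\boldsymbol q$). $\langle\widehat u,\boldsymbol\tau\cdot\boldsymbol n\rangle_{\mathcal S}=\sum_T\langle\widehat u|_{\partial T},\boldsymbol\tau\cdot\boldsymbol n_T\rangle_{\partial T}$, $\langle\widehat\sigma,v\rangle_{\mathcal S}=\sum_T\langle\widehat\sigma|_{\partial T},v\rangle_{\partial T}$. Trial and test spaces. $U$ is the set of $\boldsymbol u=(u,\boldsymbol\sigma,\rho,\widehat u^a,\widehat u^b,\widehat\sigma^a,\widehat\sigma^b)\in L^2(\Omega)\times L^2(\Omega)^d\times L^2(\Omega)\times H^{1/2}(\mathcal S)\times H^{1/2}(\mathcal S)\times H^{-1/2}(\mathcal S)\times H^{-1/2}(\mathcal S)$ with $\widehat u^a|_\Gamma=\widehat u^b|_\Gamma$. $V=H^1(\mathcal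 T)\times\boldsymbol H(\mathrm{div},\mathcal T)\times H^1(\Delta,\mathcal T)$, where $H^1(\mathcal T)$, $\boldsymbol H(\mathrm{div},\mathcal T)$ are the spaces of $L^2$ functions (fields) that are in $H^1(T)$, resp. $\boldsymbol H(\mathrm{div},T)$, on each $T$, and $H^1(\Delta,\mathcal T)=\{w\in H^1(\mathcal T):\Delta w|_T\in L^2(T)\ \forall T\}$; for $\boldsymbol v=(\mu,\boldsymbol\tau,v)\in V$, $\|\boldsymbol v\|_V^2=\varepsilon^{-1}\|\mu\|^2+\|\nabla_{\mathcal T}\mu\|^2+\varepsilon^{-1/2}\|\boldsymbol\tau\|^2+\|\mathrm{div}_{\mathcal T}\boldsymbol\tau\|^2+\|v\|^2+(\varepsilon^{1/2}+\varepsilon)\|\nabla_{\mathcal T}v\|^2+\varepsilon^{3/2}\|\Delta_{\mathcal T}v\|^2$, induced by the inner product $(\cdot,\cdot)_V$. Forms. For $\boldsymbol u\in U$, $\boldsymbol v=(\mu,\boldsymbol\tau,v)\in V$: $b(\boldsymbol u,\boldsymbol v)=(\rho,\mu)+(\boldsymbol\sigma,\nabla_{\mathcal T}\mu)-\langle\widehat\sigma^a,\mu\rangle_{\mathcal S}+\varepsilon^{-1/4}(\boldsymbol\sigma,\boldsymbol\tau)+(u,\mathrm{div}_{\mathcal T}\boldsymbol\tau)-\langle\widehat u^a,\boldsymbol\tau\cdot\boldsymbol n\rangle_{\mathcal S}+\varepsilon^{3/4}(\boldsymbol\sigma,\nabla_{\mathcal T}v)-\varepsilon^{3/4}\langle\widehat\sigma^b,v\rangle_{\mathcal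 S}+(u,v)+\varepsilon^{5/4}(\rho,\Delta_{\mathcal T}v)+\varepsilon^{1/4}(\boldsymbol\sigma,\nabla_{\mathcal T}v)-\varepsilon^{1/2}\langle\widehat u^b,\nabla_{\mathcal T}v\cdot\boldsymbol n\rangle_{\mathcal S}$, $L(\boldsymbol v)=(f,v-\varepsilon^{1/2}\Delta_{\mathcal T}v)$. $\Theta:U\to V$ is defined by $(\Theta\boldsymbol u,\boldsymbol v)_V=b(\boldsymbol u,\boldsymbol v)$ for all $\boldsymbol v\in V$; $\Theta_\beta=\beta\Theta$. Traces: $\gamma_0\boldsymbol u=\widehat u^a|_\Gamma$, $\gamma_{\boldsymbol n}\boldsymbol u=\widehat\sigma^a|_\Gamma$. Then $a^s(\boldsymbol u,\boldsymbol v)=b(\boldsymbol u,\Theta_\beta\boldsymbol v)+\tfrac12\varepsilon^{1/4}(\langle\gamma_{\boldsymbol n}\boldsymbol u,\gamma_0\boldsymbol v\rangle_\Gamma+\langle\gamma_{\boldsymbol n}\boldsymbol v,\gamma_0\boldsymbol u\rangle_\Gamma)$ and $F(\boldsymbol v)=L(\Theta_\beta\boldsymbol v)$ for $\boldsymbol u,\boldsymbol v\in U$. Orderings. $\widehat v\ge0$ in $H^{1/2}(\Gamma)$ means that $\widehat v$ is the weak $H^{1/2}(\Gamma)$-limit of a sequence of non-negative Lipschitz continuous functions on $\Gamma$. $\widehat\sigma\ge0$ in $H^{-1/2}(\Gamma)$ means $\langle\widehat\sigma,\widehat v\rangle_\Gamma\ge0$ for all $\widehat v\in H^{1/2}(\Gamma)$,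 $\widehat v\ge0$. Discrete spaces. $U_h$ is the subspace of $U$ of all elements of $P^0(\mathcal T)\times[P^0(\mathcal T)]^d\times P^0(\mathcal T)\times S^1(\mathcal S)\times S^1(\mathcal S)\times P^0(\mathcal S)\times P^0(\mathcal S)$ that belong to $U$ (i.e. satisfy $\widehat u^a|_\Gamma=\widehat u^b|_\Gamma$), where $P^0(\mathcal T)$ are the $\mathcal T$-element-wise constants, $P^0(\mathcal S)\subset H^{-1/2}(\mathcal S)$ consists of those elements that are constant on each facet of each $\partial T$, and $S^1(\mathcal S)\subset H^{1/2}(\mathcal S)$ consists of the globally continuous functions on the skeleton that are affine on each facet. $K_h^s=\{\boldsymbol v_h\in U_h:\gamma_0\boldsymbol v_h\ge0,\gamma_{\boldsymbol n}\boldsymbol v_h\ge0\}$. *)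

(* Defs.v *)
From HB Require Import structures.
From mathcomp Require Import all_boot all_order all_algebra.
From mathcomp Require Import all_classical all_reals all_analysis.
Set Implicit Arguments.
Unset Strict Implicit.
Unset Printing Implicit Defensive.
Import Order.TTheory GRing.Theory Num.Theory.
Import numFieldNormedType.Exports.
Local Open Scope classical_set_scope.
Local Open Scope ring_scope.

Definition rV_display : measure_display.
Proof. exact: default_measure_display. Qed.

(* 'rV[R]_n carries the product sigma-algebra, generated by the coordinates. *)

Section measurable_rV.
Context (R : realType) (n : nat).

Let coors (i : 'I_n) (x : 'rV[R]_n) : R := x 0 i.

Let rV_set0 : g_sigma_preimage coors set0.
Proof. exact: sigma_algebra0. Qed.

Let rV_setC A : g_sigma_preimage coors A -> g_sigma_preimage coors (~` A).
Proof. exact: sigma_algebraC. Qed.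

Let rV_bigcup (F : (set 'rV[R]_n)^nat) :
  (forall i, g_sigma_preimage coors (F i)) ->
  g_sigma_preimage coors (\bigcup_i F i).
Proof. exact: sigma_algebra_bigcup. Qed.

HB.instance Definition _ := @isMeasurable.Build rV_display
  'rV[R]_n (g_sigma_preimage coors) rV_set0 rV_setC rV_bigcup.

Lemma measurable_coord (i : 'I_n) :
  measurable_fun [set: 'rV[R]_n] (fun x : 'rV[R]_n => x 0 i).
Proof.
move=> _ Y mY; rewrite setTI; apply: sub_sigma_algebra => /=.
rewrite -bigcup_seq/=; exists i => /=; first by rewrite mem_index_enum.
by exists Y => //; rewrite setTI.
Qed.

Lemma measurable_fun_rV d (T : measurableType d) (f : T -> 'rV[R]_n) :
  (forall i, measurable_fun [set: T] (fun x => f x 0 i)) ->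
  measurable_fun [set: T] f.
Proof.
move=> mf _ A mA; rewrite setTI.
suff : g_sigma_preimage coors `<=` [set A | measurable (f @^-1` A)] by exact.
apply: smallest_sub.
  split=> /=.
  - by rewrite preimage_set0; exact: measurable0.
  - by move=> B mB; rewrite setTD preimage_setC; exact: measurableC.
  - by move=> F mF; rewrite preimage_bigcup; exact: bigcupT_measurable.
rewrite -bigcup_seq; apply: bigcup_sub => i _ _ [B mB <-] /=.
by rewrite setTI -[X in measurable X]setTI; exact: mf.
Qed.

End measurable_rV.

Section lebesgue_rV_succ.
Context (R : realType) (n : nat).

Definition rV_cons (p : R * 'rV[R]_n) : 'rV[R]_n.+1 :=
  \row_(i < n.+1) (if unlift ord0 i is Some j then p.2 0 j else p.1).

Lemma measurable_rV_cons : measurable_fun [set: R * 'rV[R]_n] rV_cons.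
Proof.
apply: measurable_fun_rV => i; case: (unliftP ord0 i) => [j|] ->.
- rewrite (_ : (fun _ => _) = (fun x : 'rV[R]_n => x 0 j) \o snd).
    exact: measurableT_comp (measurable_coord j) measurable_snd.
  by apply/funext => p; rewrite mxE liftK.
- rewrite (_ : (fun _ => _) = fst); first exact: measurable_fst.
  by apply/funext => p; rewrite mxE unlift_none.
Qed.

Let rV_uncons (x : 'rV[R]_n.+1) : R * 'rV[R]_n :=
  (x 0 ord0, \row_j x 0 (lift ord0 j)).

Let measurable_rV_uncons : measurable_fun [set: 'rV[R]_n.+1] rV_uncons.
Proof.
apply: measurable_fun_pair => /=; first exact: measurable_coord.
apply: measurable_fun_rV => i; under eq_fun do rewrite mxE.
exact: measurable_coord.
Qed.

Let rV_consK : cancel rV_cons rV_uncons.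
Proof.
move=> [a x]; rewrite /rV_uncons mxE unlift_none; congr pair.
by apply/rowP => j; rewrite !mxE liftK.
Qed.

Variable mu : {sigma_finite_measure set 'rV[R]_n -> \bar R}.

Definition lebesgue_rV_succ : set 'rV[R]_n.+1 -> \bar R :=
  pushforward (product_measure1 (@lebesgue_measure R) mu) rV_cons.


Let lebesgue_rV_succ0 : lebesgue_rV_succ set0 = 0%E.
Proof. by rewrite /lebesgue_rV_succ /pushforward preimage_set0 measure0. Qed.

Let lebesgue_rV_succ_ge0 A : (0 <= lebesgue_rV_succ A)%E.
Proof. by rewrite /lebesgue_rV_succ /pushforward measure_ge0. Qed.

Let lebesgue_rV_succ_sigma_additive : semi_sigma_additive lebesgue_rV_succ.
Proof.
exact: (@measure_semi_sigma_additive _ _ _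
  (measure_function_pushforward__canonical__measure_function_Measure
    (product_measure1 (@lebesgue_measure R) mu) measurable_rV_cons)).
Qed.

HB.instance Definition _ :=
  isMeasure.Build _ _ _ lebesgue_rV_succ
    lebesgue_rV_succ0 lebesgue_rV_succ_ge0 lebesgue_rV_succ_sigma_additive.

Let lebesgue_rV_succ_sigma_finite : sigma_finite setT lebesgue_rV_succ.
Proof.
have /sigma_finiteP[F [TF ndF Foo]] := sigma_finiteT (@lebesgue_measure R).
have /sigma_finiteP[G [TG ndG Goo]] := sigma_finiteT mu.
exists (fun k => rV_uncons @^-1` (F k `*` G k)).
  rewrite -preimage_bigcup; apply/esym; rewrite -subTset => x _ /=.
  have : [set: R] (rV_uncons x).1 by []. rewrite [X in X _]TF => -[k _ Fk].
  have : [set: 'rV[R]_n] (rV_uncons x).2 by []. rewrite [X in X _]TG => -[l _ Gl].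
  exists (maxn k l) => //; split.
    by move: Fk; apply/subsetPset/ndF/leq_maxl.
  by move: Gl; apply/subsetPset/ndG/leq_maxr.
move=> k; have [mF Fk] := Foo k; have [mG Gk] := Goo k; split.
  rewrite -[X in measurable X]setTI.
  by apply: measurable_rV_uncons => //; exact: measurableX.
rewrite /lebesgue_rV_succ /pushforward -comp_preimage.
rewrite (_ : rV_uncons \o rV_cons = id); last first.
  by apply/funext => p /=; exact: rV_consK.
by rewrite preimage_id product_measure1E// lte_mul_pinfty// ge0_fin_numE.
Qed.

HB.instance Definition _ := Measure_isSigmaFinite.Build _ _ _
  lebesgue_rV_succ lebesgue_rV_succ_sigma_finite.

End lebesgue_rV_succ.

(* Lebesgue measure on 'rV[R]_n, as an iterated product. *)
Fixpoint lebesgue_rV (R : realType) (n : nat) :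
    {sigma_finite_measure set 'rV[R]_n -> \bar R} :=
  if n is m.+1 then lebesgue_rV_succ (lebesgue_rV R m) else \d_(0 : 'rV[R]_0).

Section sobolev.
Context (R : realType) (d : nat).
Local Notation E := 'rV[R]_d.
Local Notation mu := (lebesgue_rV R d).
Implicit Types (omega A : set E) (w v phi g : E -> R) (q : E -> E).

Definition dot (x y : E) : R := \sum_i x 0 i * y 0 i.

Definition frontier A : set E := closure A `\` A°.

Definition L2 omega w : Prop := (w \_ omega : E -> R) \in Lfun mu 2%:E.

Definition L2vec omega q : Prop := forall i, L2 omega (fun x => q x 0 i).

Definition partial (i : 'I_d) w : E -> R := fun x => 'D_(delta_mx 0 i) w x.

Definition smooth w : Prop :=
  forall (s : seq 'I_d) (x : E), differentiable (foldr partial w s) x.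

Definition test_function omega phi : Prop :=
  smooth phi /\
  exists K : set E,
    [/\ compact K, K `<=` omega & forall x, ~ K x -> phi x = 0].

Definition is_weak_grad omega w p : Prop :=
  L2vec omega p /\
  forall phi, test_function omega phi -> forall i,
    \int[mu]_(x in omega) (w x * partial i phi x) =
    - \int[mu]_(x in omega) (p x 0 i * phi x).

Definition is_weak_div omega q w : Prop :=
  L2 omega w /\
  forall phi, test_function omega phi ->
    \int[mu]_(x in omega) (\sum_i q x 0 i * partial i phi x) =
    - \int[mu]_(x in omega) (w x * phi x).

Definition H1 omega w : Prop := L2 omega w /\ exists p, is_weak_grad omega w p.

Definition Hdiv omega q : Prop := L2vec omega q /\ exists w, is_weak_div omega q w.

(* Weak derivatives are determined almost everywhere on omega; these are       *)
(* arbitrary representatives.                                                  *)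
Definition grad omega w : E -> E :=
  xget (fun=> 0) [set p | is_weak_grad omega w p].

Definition div omega q : E -> R :=
  xget (fun=> 0) [set w | is_weak_div omega q w].

Definition H1Lap omega w : Prop := H1 omega w /\ Hdiv omega (grad omega w).

Definition lap omega w : E -> R := div omega (grad omega w).

Definition H1_sqnorm omega w : R :=
  \int[mu]_(x in omega) (w x ^+ 2) +
  \int[mu]_(x in omega) dot (grad omega w x) (grad omega w x).

(* H^1_0: the closure of the test functions in H^1. *)
Definition H10 omega w : Prop :=
  H1 omega w /\
  forall e : R, 0 < e ->
    exists2 phi, test_function omega phi & H1_sqnorm omega (w \- phi) < e.

(* H^{1/2} of the boundary of omega is the trace space H^1(omega)/H^1_0(omega); *)
(* a trace is the coset of all H^1 functions having it.                        *)
Definition trace_elt := set (E -> R).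

Definition trace omega w : trace_elt :=
  [set v | H1 omega v /\ H10 omega (v \- w)].

Definition Hhalf omega : set trace_elt := trace omega @` [set w | H1 omega w].

(* H^{-1/2} is the dual of H^{1/2}, and duality is evaluation. The value       *)
(* outside of Hhalf omega is fixed to 0 in order that Leibniz equality be      *)
(* equality of functionals.                                                    *)
Definition Hmhalf omega (f : trace_elt -> R) : Prop :=
  [/\ forall u, ~ Hhalf omega u -> f u = 0,
      forall (a : R) v w, H1 omega v -> H1 omega w ->
        f (trace omega (fun x => a * v x + w x)) =
        a * f (trace omega v) + f (trace omega w) &
      exists C : R, forall w, H1 omega w ->
        `|f (trace omega w)| <= C * Num.sqrt (H1_sqnorm omega w)].

(* The normal trace of q is the functional given by Green's formula. *)
Definition normal_trace omega q : trace_elt -> R :=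
  fun u => if `[< Hhalf omega u >] then
    let w := xget (fun=> 0) u in
    \int[mu]_(x in omega) (div omega q x * w x) +
    \int[mu]_(x in omega) dot (q x) (grad omega w x)
  else 0.

(* The continuous function g on the boundary of omega, seen in H^{1/2}. *)
Definition is_trace_of omega g (u : trace_elt) : Prop :=
  exists w, [/\ H1 omega w, {within closure omega, continuous w},
    {in frontier omega, w =1 g} & u = trace omega w].

Definition Hhalf_ge0 omega (u : trace_elt) : Prop :=
  Hhalf omega u /\
  exists (g : nat -> E -> R) (un : nat -> trace_elt),
    (forall k, [/\ [lipschitz g k x | x in frontier omega],
       forall x, frontier omega x -> 0 <= g k x &
       is_trace_of omega (g k) (un k)]) /\
    forall f, Hmhalf omega f -> f (un k) @[k --> \oo] --> f u.

Definition Hmhalf_ge0 omega (f : trace_elt -> R) : Prop :=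
  Hmhalf omega f /\ forall u, Hhalf_ge0 omega u -> 0 <= f u.

End sobolev.

Section domain.
Context (R : realType) (d : nat).
Local Notation E := 'rV[R]_d.

(* Locally, after a rigid motion z |-> z *m Q, the set is the strict epigraph  *)
(* of a Lipschitz function of all the coordinates but the j-th one.            *)
Definition lipschitz_boundary (Omega : set E) : Prop :=
  forall x, frontier Omega x ->
  exists (Q : 'M[R]_d) (j : 'I_d) (psi : 'rV[R]_d.-1 -> R) (delta : R),
    [/\ Q *m Q^T = 1%:M, [lipschitz psi y | y in [set: 'rV[R]_d.-1]],
        0 < delta &
        forall z, ball x delta z ->
          Omega z <-> psi (col' j (z *m Q)) < (z *m Q) 0 j].

Definition loops_contractible (Omega : set E) : Prop :=
  forall c : R -> E, {within `[0, 1], continuous c} ->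
    (forall t, t \in `[0, 1] -> Omega (c t)) -> c 0 = c 1 ->
  exists H : R * R -> E,
    [/\ {within `[0, 1] `*` `[0, 1], continuous H},
        forall s t, s \in `[0, 1] -> t \in `[0, 1] -> Omega (H (s, t)),
        forall t, t \in `[0, 1] -> H (0, t) = c t /\ H (1, t) = c 0 &
        forall s, s \in `[0, 1] -> H (s, 0) = c 0 /\ H (s, 1) = c 0].

Record lipschitz_domain (Omega : set E) : Prop := LipschitzDomain {
  domain_neq0 : Omega !=set0 ;
  domain_open : open Omega ;
  domain_connected : connected Omega ;
  domain_bounded : bounded_set Omega ;
  domain_lipschitz : lipschitz_boundary Omega ;
  domain_simply_connected : loops_contractible Omega
}.

End domain.

(* The space dimension is n.+1. The rows of X : 'M_(n.+2, n.+1) are the        *)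
(* vertices of a simplex.                                                      *)
Section simplex.
Context (R : realType) (n : nat).
Local Notation E := 'rV[R]_n.+1.
Implicit Types X : 'M[R]_(n.+2, n.+1).

Definition affinely_independent X : Prop :=
  row_free (row_mx (const_mx 1 : 'M[R]_(n.+2, 1)) X).

Definition open_simplex X : set E :=
  [set x | exists l : 'rV[R]_n.+2,
    [/\ forall k, 0 < l 0 k, \sum_k l 0 k = 1 & x = l *m X]].

Definition face X (B : {set 'I_n.+2}) : set E :=
  [set x | exists l : 'rV[R]_n.+2,
    [/\ forall k, 0 <= l 0 k, forall k, k \notin B -> l 0 k = 0,
        \sum_k l 0 k = 1 & x = l *m X]].

Definition facet X (k : 'I_n.+2) : set E := face X (~: [set k])%SET.

(* Integral over facet X k with respect to the surface measure, by the affine  *)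
(* parametrization of the facet over the unit simplex of dimension n; the      *)
(* square root is its Gram determinant.                                        *)
Definition facet_integral X (k : 'I_n.+2) (v : E -> R) : R :=
  let Y : 'M[R]_(n.+1, n.+1) := row' k X in
  let D : 'M[R]_(n, n.+1) := \matrix_(i, j) (Y (lift ord0 i) j - Y ord0 j) in
  Num.sqrt (\det (D *m D^T)) *
  \int[lebesgue_rV R n]_(y in [set y : 'rV[R]_n |
      (forall i, 0 <= y 0 i) /\ \sum_i y 0 i <= 1])
    v (row ord0 Y + y *m D).

End simplex.

Section mesh.
Context (R : realType) (n : nat) (Omega : set 'rV[R]_n.+1) (I : finType).
Variable X : I -> 'M[R]_(n.+2, n.+1).
Local Notation E := 'rV[R]_n.+1.
Local Notation mu := (lebesgue_rV R n.+1).
Local Notation T i := (open_simplex (X i)).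
Local Notation trace_elt := (trace_elt R n.+1).

Record conforming_mesh : Prop := ConformingMesh {
  mesh_nondegenerate : forall i, affinely_independent (X i) ;
  mesh_disjoint : forall i j, i != j -> T i `&` T j = set0 ;
  mesh_cover : \bigcup_i closure (T i) = closure Omega ;
  mesh_conforming : forall i j, i != j ->
    exists A B : {set 'I_n.+2},
      closure (T i) `&` closure (T j) = face (X i) A /\
      face (X i) A = face (X j) B
}.

Definition pw_int (F : I -> E -> R) : R := \sum_i \int[mu]_(x in T i) F i x.

Definition Hhalf_skel (u : I -> trace_elt) : Prop :=
  (forall i, Hhalf (T i) (u i)) /\
  exists w, H1 Omega w /\ forall i, u i = trace (T i) w.

Definition Hmhalf_skel (s : I -> trace_elt -> R) : Prop :=
  (forall i, Hmhalf (T i) (s i)) /\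
  exists q, Hdiv Omega q /\ forall i, s i = normal_trace (T i) q.

(* Restrictions to the boundary of Omega, through any extension to Omega. *)
Definition Hhalf_restr (u : I -> trace_elt) : trace_elt :=
  trace Omega (xget (fun=> 0)
    [set w | H1 Omega w /\ forall i, u i = trace (T i) w]).

Definition Hmhalf_restr (s : I -> trace_elt -> R) : trace_elt -> R :=
  normal_trace Omega (xget (fun=> 0)
    [set q | Hdiv Omega q /\ forall i, s i = normal_trace (T i) q]).

Definition P0 (w : E -> R) : Prop :=
  forall i, exists c, {ae mu, forall x, T i x -> w x = c}.

Definition P0_skel (s : I -> trace_elt -> R) : Prop :=
  Hmhalf_skel s /\
  forall i, exists c : 'I_n.+2 -> R,
    forall v, H1 (T i) v -> {within closure (T i), continuous v} ->
      s i (trace (T i) v) = \sum_k c k * facet_integral (X i) k v.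

Definition S1_skel (u : I -> trace_elt) : Prop :=
  Hhalf_skel u /\
  exists g : E -> R,
    [/\ {within \bigcup_i frontier (T i), continuous g},
        forall i k, exists (a : E) (b : R),
          forall x, facet (X i) k x -> g x = dot a x + b &
        forall i, is_trace_of (T i) g (u i)].

Record trial := Trial {
  t_u : E -> R ;
  t_sigma : E -> E ;
  t_rho : E -> R ;
  t_ua : I -> trace_elt ;
  t_ub : I -> trace_elt ;
  t_sa : I -> trace_elt -> R ;
  t_sb : I -> trace_elt -> R
}.

Record in_U (u : trial) : Prop := InU {
  U_u : L2 Omega (t_u u) ;
  U_sigma : L2vec Omega (t_sigma u) ;
  U_rho : L2 Omega (t_rho u) ;
  U_ua : Hhalf_skel (t_ua u) ;
  U_ub : Hhalf_skel (t_ub u) ;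
  U_sa : Hmhalf_skel (t_sa u) ;
  U_sb : Hmhalf_skel (t_sb u) ;
  U_bdry : Hhalf_restr (t_ua u) = Hhalf_restr (t_ub u)
}.

(* Equality in U: the field components are classes modulo almost everywhere    *)
(* equality.                                                                   *)
Definition U_eq (u v : trial) : Prop :=
  [/\ {ae mu, forall x, Omega x ->
        [/\ t_u u x = t_u v x, t_sigma u x = t_sigma v x &
            t_rho u x = t_rho v x]},
      t_ua u = t_ua v, t_ub u = t_ub v, t_sa u = t_sa v & t_sb u = t_sb v].

(* Subtraction of cosets is the Minkowski difference. *)
Definition trace_sub (u v : trace_elt) : trace_elt :=
  [set w | exists w1 w2, [/\ u w1, v w2 & w = w1 \- w2]].

Definition U_sub (u v : trial) : trial := Trial
  (t_u u \- t_u v) (t_sigma u \- t_sigma v) (t_rho u \- t_rho v)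
  (fun i => trace_sub (t_ua u i) (t_ua v i))
  (fun i => trace_sub (t_ub u i) (t_ub v i))
  (fun i => t_sa u i \- t_sa v i) (fun i => t_sb u i \- t_sb v i).

Record test := Test { t_mu : E -> R ; t_tau : E -> E ; t_v : E -> R }.

HB.instance Definition _ := gen_eqMixin test.
HB.instance Definition _ := gen_choiceMixin test.

Record in_V (v : test) : Prop := InV {
  V_mu : L2 Omega (t_mu v) /\ forall i, H1 (T i) (t_mu v) ;
  V_tau : L2vec Omega (t_tau v) /\ forall i, Hdiv (T i) (t_tau v) ;
  V_v : L2 Omega (t_v v) /\ forall i, H1Lap (T i) (t_v v)
}.

Definition V_scale (a : R) (v : test) : test := Test
  (fun x => a * t_mu v x) (fun x => a *: t_tau v x) (fun x => a * t_v v x).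

Variables (eps beta : R) (f : E -> R).

Definition V_inner (v v' : test) : R :=
  eps^-1 * \int[mu]_(x in Omega) (t_mu v x * t_mu v' x) +
  pw_int (fun i x => dot (grad (T i) (t_mu v) x) (grad (T i) (t_mu v') x)) +
  eps `^ (- (1 / 2)) * \int[mu]_(x in Omega) dot (t_tau v x) (t_tau v' x) +
  pw_int (fun i x => div (T i) (t_tau v) x * div (T i) (t_tau v') x) +
  \int[mu]_(x in Omega) (t_v v x * t_v v' x) +
  (eps `^ (1 / 2) + eps) *
    pw_int (fun i x => dot (grad (T i) (t_v v) x) (grad (T i) (t_v v') x)) +
  eps `^ (3 / 2) *
    pw_int (fun i x => lap (T i) (t_v v) x * lap (T i) (t_v v') x).

Definition bform (u : trial) (v : test) : R :=
  \int[mu]_(x in Omega) (t_rho u x * t_mu v x) +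
  pw_int (fun i x => dot (t_sigma u x) (grad (T i) (t_mu v) x)) -
  \sum_i t_sa u i (trace (T i) (t_mu v)) +
  eps `^ (- (1 / 4)) * \int[mu]_(x in Omega) dot (t_sigma u x) (t_tau v x) +
  pw_int (fun i x => t_u u x * div (T i) (t_tau v) x) -
  \sum_i normal_trace (T i) (t_tau v) (t_ua u i) +
  eps `^ (3 / 4) *
    pw_int (fun i x => dot (t_sigma u x) (grad (T i) (t_v v) x)) -
  eps `^ (3 / 4) * \sum_i t_sb u i (trace (T i) (t_v v)) +
  \int[mu]_(x in Omega) (t_u u x * t_v v x) +
  eps `^ (5 / 4) * pw_int (fun i x => t_rho u x * lap (T i) (t_v v) x) +
  eps `^ (1 / 4) *
    pw_int (fun i x => dot (t_sigma u x) (grad (T i) (t_v v) x)) -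
  eps `^ (1 / 2) *
    \sum_i normal_trace (T i) (grad (T i) (t_v v)) (t_ub u i).

Definition Lform (v : test) : R :=
  pw_int (fun i x => f x * (t_v v x - eps `^ (1 / 2) * lap (T i) (t_v v) x)).

(* The trial-to-test operator, i.e. the Riesz representative in V of           *)
(* bform u; it is determined up to almost everywhere equality.                 *)
Definition Theta (u : trial) : test :=
  xget (Test (fun=> 0) (fun=> 0) (fun=> 0))
    [set t | in_V t /\ forall v, in_V v -> V_inner t v = bform u v].

Definition Theta_beta (u : trial) : test := V_scale beta (Theta u).

Definition gamma0 (u : trial) : trace_elt := Hhalf_restr (t_ua u).

Definition gamman (u : trial) : trace_elt -> R := Hmhalf_restr (t_sa u).

Definition aform (u v : trial) : R :=
  bform u (Theta_beta v) +
  2^-1 * eps `^ (1 / 4) * (gamman u (gamma0 v) + gamman v (gamma0 u)).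

Definition Fform (v : trial) : R := Lform (Theta_beta v).

Record Uh (u : trial) : Prop := InUh {
  Uh_U : in_U u ;
  Uh_u : P0 (t_u u) ;
  Uh_sigma : forall j, P0 (fun x => t_sigma u x 0 j) ;
  Uh_rho : P0 (t_rho u) ;
  Uh_ua : S1_skel (t_ua u) ;
  Uh_ub : S1_skel (t_ub u) ;
  Uh_sa : P0_skel (t_sa u) ;
  Uh_sb : P0_skel (t_sb u)
}.

Definition Kh (v : trial) : Prop :=
  [/\ Uh v, Hhalf_ge0 Omega (gamma0 v) & Hmhalf_ge0 Omega (gamman v)].

Definition discrete_VI (u : trial) : Prop :=
  Kh u /\ forall v, Kh v -> aform u (U_sub v u) >= Fform (U_sub v u).

End mesh.

(* Main.v *)
(* By definition of Theta, a^s(u, v) is beta (Theta u, Theta v)_V plus the     *)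
(* symmetrized boundary term. Let phi be the solution of phi - eps lap phi = 0 *)
(* with trace gamma_0 u, and |||phi|||^2 = |phi|^2 + eps |grad phi|^2. An      *)
(* explicit t in V satisfies                                                   *)
(*   b(u, t) = |||phi|||^2 - eps^(3/4) <gamma_n u, gamma_0 u> and              *)
(*   |t|_V^2 <= 2 eps^(1/2) |||phi|||^2,                                       *)
(* so that, for beta >= 3, completing a square yields                          *)
(*   a^s(u, u) >= 2 |Theta u|_V^2 + (1/2) eps^(-1/2) |||phi|||^2.              *)
(* If a^s(u, u) <= 0, then b(u, .) = 0 and gamma_0 u = 0, and testing b with   *)
(* suitable solutions of second order problems shows that all components of u  *)
(* vanish. Hence a^s is an inner product on the finite-dimensional space U_h,  *)
(* and the solution is the a^s-projection onto K_h^s of the Riesz              *)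
(* representative of F. The set K_h^s is closed because the cone of            *)
(* nonnegative traces, a weak closure of a convex cone, is also its closure in *)
(* norm.                                                                       *)

From HB Require Import structures.
Require Import Defs.
From mathcomp Require Import all_boot all_order all_algebra.
From mathcomp Require Import all_classical all_reals all_analysis.
From mathcomp Require Import measurable_realfun ring lra.
Set Implicit Arguments.
Unset Strict Implicit.
Unset Printing Implicit Defensive.
Import Order.TTheory GRing.Theory Num.Theory.
Import numFieldNormedType.Exports.
Local Open Scope classical_set_scope.
Local Open Scope ring_scope.

(** * Semi-inner product spaces *)

(** The form a^s is symmetric, so the discrete inequality is the characterization of a projection
    once a^s is an inner product on U_h and K_h^s is a closed convex set. Everything rests on
    coercivity, on a trivial kernel, on finite dimension and on closedness of the sign conditions.
    Coercivity. a^s(u, u) is beta times the squared V-norm of Theta u plus the indefinite term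
    eps^(1/4) times the boundary pairing of gamma_n u with gamma_0 u. [coercive_test] builds a test
    function on which b takes a positive value minus eps^(3/4) times this pairing, with a V-norm
    controlled by the same positive value; [coercivity] completes the square in V. The
    representation of b by [theta] ([thetaP]) comes from Riesz in the complete space V
    ([V_complete]), since b(u, .) is bounded ([mesh_bform_bounded]). Kernel. If a^s(u, u) is at most
    0, then b(u, .) vanishes and gamma_0 u is zero. Testing on single elements and with global
    functions shows that u solves a homogeneous first order system: the fields vanish
    ([kernel_u_rho], [kernel_fields]), and then the skeleton components do ([kernel_wa],
    [kernel_qa], [kernel_wb], [kernel_qb]). The conclusion is collected in [rep_null_of_aform].
    Finite dimension. An element of U_h is determined by finitely many numbers ([coordinates_null]).
    For the skeleton components this needs two analytic facts: a function of H^1(T) that is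
    continuous up to the boundary and vanishes there lies in H^1_0(T) ([H10_of_continuous]), and a
    normal trace that vanishes on smooth functions vanishes on H^1(T) ([smooth_dense]). Both follow
    from mollification and from weak closedness of closed subspaces ([weak_limit_closed]).
    Completeness and continuity of linear functionals on U_h then come from [finite_dim_complete]
    and [finite_dim_cvg]. Cone. Nonnegativity of a trace is a weak sequential closure. By
    [Hmhalf_riesz] every functional on traces has the form w |-> (r, w)_{H^1} with lap r = r, and
    separation of a point from a closed convex cone identifies the weak closure with the norm
    closure ([Hhalf_ge0_closure]). Both sign conditions thus become inequalities for continuous
    linear functionals, and [admissible_closed] follows. [discrete_solution] projects the Riesz
    representative of F onto the admissible set; [discrete_unique] adds the two inequalities of two
    solutions. Functions are not identified almost everywhere, so all inner products are
    semidefinite, and each uniqueness statement is modulo vectors of zero norm; [U_eq_of_null]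
    translates this into equality in U. *)

Record lin_subspace (R : realType) (W : lmodType R) (S : W -> Prop) : Prop :=
  LinSubspace {
    subspace0 : S 0 ;
    subspaceL : forall a x y, S x -> S y -> S (a *: x + y)
  }.

(* Functions are not identified when they agree almost everywhere, so inner
   products are only semidefinite. *)
Record semi_inner (R : realType) (W : lmodType R) (S : W -> Prop)
    (ip : W -> W -> R) : Prop := SemiInner {
  si_subspace : lin_subspace S ;
  si_sym : forall x y, S x -> S y -> ip x y = ip y x ;
  si_lin : forall a x y z, S x -> S y -> S z ->
    ip (a *: x + y) z = a * ip x z + ip y z ;
  si_ge0 : forall x, S x -> 0 <= ip x x
}.

Lemma real_cauchy_cvg (R : realType) (u : nat -> R) :
  (forall e : R, 0 < e -> exists N, forall m n, (N <= m)%N -> (N <= n)%N ->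
    `|u m - u n| < e) ->
  exists a : R, u k @[k --> \oo] --> a.
Proof.
move=> h; apply/cvg_ex; apply/cauchy_cvgP; apply/cauchy_exP => e e0.
have [N hN] := h e e0; exists (u N); exists N => //= n Nn.
by rewrite /ball/=; exact: hN.
Qed.

Section semi_inner_theory.
Context (R : realType) (W : lmodType R).
Implicit Types (S M C D : W -> Prop) (ip : W -> W -> R) (u : nat -> W).

Definition ip_cauchy ip u : Prop := forall e : R, 0 < e ->
  exists N, forall m n, (N <= m)%N -> (N <= n)%N ->
    ip (u m - u n) (u m - u n) < e.

Definition ip_cvg ip u x : Prop := forall e : R, 0 < e ->
  exists N, forall n, (N <= n)%N -> ip (u n - x) (u n - x) < e.

Definition ip_complete S ip : Prop := forall u, (forall k, S (u k)) ->
  ip_cauchy ip u -> exists2 x, S x & ip_cvg ip u x.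

Definition ip_closed S ip C : Prop := forall u x, (forall k, C (u k)) ->
  S x -> ip_cvg ip u x -> C x.

Section subspace_theory.
Context S (sS : lin_subspace S).

Lemma subspaceZ a x : S x -> S (a *: x).
Proof. by move=> Sx; rewrite -[_ *: _]addr0; apply: subspaceL => //; apply: subspace0. Qed.

Lemma subspaceD x y : S x -> S y -> S (x + y).
Proof. by move=> Sx Sy; rewrite -[x]scale1r; apply: subspaceL. Qed.

Lemma subspaceN x : S x -> S (- x).
Proof. by rewrite -scaleN1r; apply: subspaceZ. Qed.

Lemma subspaceB x y : S x -> S y -> S (x - y).
Proof. by move=> Sx Sy; apply/subspaceD => //; apply: subspaceN. Qed.

Lemma subspace_sum (J : Type) (r : seq J) (F : J -> W) :
  (forall j, S (F j)) -> S (\sum_(j <- r) F j).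
Proof.
move=> SF; elim/big_ind: _ => //; first exact: subspace0.
by move=> x y; apply: subspaceD.
Qed.

End subspace_theory.

Section ip_theory.
Context S ip (hS : semi_inner S ip).
Let sS := si_subspace hS.

Lemma ipDl x y z : S x -> S y -> S z -> ip (x + y) z = ip x z + ip y z.
Proof. by move=> Sx Sy Sz; rewrite -[x]scale1r (si_lin hS)// mul1r scale1r. Qed.

Lemma ip0l z : S z -> ip 0 z = 0.
Proof.
move=> Sz; have := ipDl (subspace0 sS) (subspace0 sS) Sz.
by rewrite addr0 => /(congr1 (fun x => x - ip 0 z)); rewrite subrr addrK.
Qed.

Lemma ipZl a x z : S x -> S z -> ip (a *: x) z = a * ip x z.
Proof.
move=> Sx Sz; rewrite -[a *: x]addr0 (si_lin hS)//; last exact: subspace0.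
by rewrite ip0l// addr0.
Qed.

Lemma ipNl x z : S x -> S z -> ip (- x) z = - ip x z.
Proof. by move=> Sx Sz; rewrite -scaleN1r ipZl// mulN1r. Qed.

Lemma ipBl x y z : S x -> S y -> S z -> ip (x - y) z = ip x z - ip y z.
Proof. by move=> Sx Sy Sz; rewrite ipDl ?ipNl//; apply: subspaceN. Qed.

Lemma ip0r z : S z -> ip z 0 = 0.
Proof. by move=> Sz; rewrite (si_sym hS) ?ip0l//; apply: subspace0. Qed.

Lemma ipDr x y z : S x -> S y -> S z -> ip z (x + y) = ip z x + ip z y.
Proof.
by move=> Sx Sy Sz; rewrite !(si_sym hS Sz) ?ipDl//; apply: subspaceD.
Qed.

Lemma ipZr a x z : S x -> S z -> ip z (a *: x) = a * ip z x.
Proof. by move=> Sx Sz; rewrite !(si_sym hS Sz) ?ipZl//; apply: subspaceZ. Qed.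

Lemma ipNr x z : S x -> S z -> ip z (- x) = - ip z x.
Proof. by move=> Sx Sz; rewrite -scaleN1r ipZr// mulN1r. Qed.

Lemma ipBr x y z : S x -> S y -> S z -> ip z (x - y) = ip z x - ip z y.
Proof. by move=> Sx Sy Sz; rewrite ipDr ?ipNr//; apply: subspaceN. Qed.

Lemma cauchy_schwarz_ip x y : S x -> S y -> ip x y ^+ 2 <= ip x x * ip y y.
Proof.
move=> Sx Sy.
have h t : 0 <= ip x x + 2 * t * ip x y + t ^+ 2 * ip y y.
  have := si_ge0 hS (subspaceD sS Sx (subspaceZ sS t Sy)).
  have Sty := subspaceZ sS t Sy; have Sxy := subspaceD sS Sx Sty.
  rewrite ipDl ?ipDr ?ipZl ?ipZr ?(si_sym hS Sy Sx)//.
  by move=> h; apply: (le_trans h); rewrite le_eqVlt; apply/orP; left; apply/eqP; ring.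
have yy := si_ge0 hS Sy; have xx := si_ge0 hS Sx.
have [y0|y0] := eqVneq (ip y y) 0; last first.
  have := h (- (ip x y / ip y y)).
  have y1 : 0 < ip y y by rewrite lt_neqAle eq_sym y0.
  rewrite -(ler_pM2r y1) mul0r.
  suff -> : (ip x x + 2 * - (ip x y / ip y y) * ip x y +
    (- (ip x y / ip y y)) ^+ 2 * ip y y) * ip y y = ip x x * ip y y - ip x y ^+ 2.
    by rewrite subr_ge0.
  by field.
have [xy|xy] := eqVneq (ip x y) 0; first by rewrite xy expr0n/= y0 mulr0.
(* When [ip y y] is 0 the quadratic in [t] is affine. If its slope were not 0, this choice of [t]
   would give it the value -1. *)
have := h (- ((ip x x + 1) / (2 * ip x y))).
rewrite y0 mulr0 addr0.
have -> : 2 * - ((ip x x + 1) / (2 * ip x y)) * ip x y = - (ip x x + 1) by field.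
by lra.
Qed.

Lemma ip_null x y : S x -> S y -> ip x x = 0 -> ip x y = 0.
Proof.
move=> Sx Sy x0; have := cauchy_schwarz_ip Sx Sy.
by rewrite x0 mul0r => h; apply/eqP; rewrite -sqrf_eq0 eq_le h sqr_ge0.
Qed.

Lemma parallelogram x y : S x -> S y ->
  ip (x - y) (x - y) = 2 * ip x x + 2 * ip y y - ip (x + y) (x + y).
Proof.
move=> Sx Sy; have SN := subspaceN sS Sy.
rewrite !(ipDl,ipDr,ipNl,ipNr)//; do ?by apply: subspaceD.
by rewrite (si_sym hS Sy Sx); ring.
Qed.

Lemma ip_sqB x y : S x -> S y ->
  ip (x - y) (x - y) = ip x x - 2 * ip x y + ip y y.
Proof.
move=> Sx Sy; have SN := subspaceN sS Sy.
rewrite !(ipDl,ipDr,ipNl,ipNr)//; do ?by apply: subspaceD.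
by rewrite (si_sym hS Sy Sx); ring.
Qed.

Lemma ip_sqD x y : S x -> S y ->
  ip (x + y) (x + y) = ip x x + 2 * ip x y + ip y y.
Proof.
move=> Sx Sy.
rewrite !(ipDl,ipDr)//; do ?by apply: subspaceD.
by rewrite (si_sym hS Sy Sx); ring.
Qed.

Lemma ip_sqBC x y : S x -> S y -> ip (x - y) (x - y) = ip (y - x) (y - x).
Proof. by move=> Sx Sy; rewrite !ip_sqB// (si_sym hS Sy Sx); ring. Qed.

Lemma ip_sqD_le x y : S x -> S y -> ip (x + y) (x + y) <= 2 * ip x x + 2 * ip y y.
Proof.
move=> Sx Sy; have := parallelogram Sx Sy.
by have := si_ge0 hS (subspaceB sS Sx Sy); lra.
Qed.

Lemma ip_cvg_cst x : S x -> ip_cvg ip (fun=> x) x.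
Proof. by move=> Sx e e0; exists 0%N => n _; rewrite subrr ip0l//; apply: subspace0. Qed.

Lemma ip_cvgL a u v x y : (forall k, S (u k)) -> (forall k, S (v k)) ->
  S x -> S y -> ip_cvg ip u x -> ip_cvg ip v y ->
  ip_cvg ip (fun k => a *: u k + v k) (a *: x + y).
Proof.
move=> Su Sv Sx Sy ux vy e e0.
have c0 : 0 < 2 * (a ^+ 2 + 1) by rewrite mulr_gt0// ltr_wpDl// sqr_ge0.
have [|N hN] := ux (e / 2 / (2 * (a ^+ 2 + 1))); first by rewrite !divr_gt0.
have [|N' hN'] := vy (e / 4); first by rewrite !divr_gt0.
exists (maxn N N') => n; rewrite geq_max => /andP[/hN hn /hN' hn'].
have -> : a *: u n + v n - (a *: x + y) = a *: (u n - x) + (v n - y).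
  by rewrite scalerBr opprD addrACA.
have S1 := subspaceB sS (Su n) Sx; have S2 := subspaceB sS (Sv n) Sy.
apply: (le_lt_trans (ip_sqD_le (subspaceZ sS a S1) S2)).
rewrite ipZl ?ipZr//; last exact: subspaceZ.
have h1 : 2 * (a * (a * ip (u n - x) (u n - x))) <= e / 2.
  have /ltW := hn; rewrite ler_pdivlMr// => hn1.
  apply: le_trans hn1.
  have := si_ge0 hS S1; nra.
by lra.
Qed.

Lemma ip_cvg_ip u x y : (forall k, S (u k)) -> S x -> S y ->
  ip_cvg ip u x -> ip (u k) y @[k --> \oo] --> ip x y.
Proof.
move=> Su Sx Sy ux; apply/cvgrPdist_lt => e e0.
have [|N hN] := ux (e ^+ 2 / (ip y y + 1)).
  by rewrite divr_gt0 ?exprn_gt0// ltr_wpDl// (si_ge0 hS).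
exists N => // n /= /hN hn; rewrite distrC -ipBl//.
rewrite -(@ltr_pXn2r _ 2%N)// ?nnegrE ?normr_ge0// ?ltW//.
rewrite real_normK ?num_real//.
apply: (le_lt_trans (cauchy_schwarz_ip _ _)) => //; first exact: subspaceB.
have yy := si_ge0 hS Sy.
move: hn; rewrite ltr_pdivlMr ?ltr_wpDl// => hn.
have := si_ge0 hS (subspaceB sS (Su n) Sx); nra.
Qed.

Lemma ip_closed_subspace M : ip_closed S ip M -> lin_subspace M -> (forall x, M x -> S x) ->
  ip_complete S ip -> ip_complete M ip.
Proof.
move=> cM sM MS cS u Mu cu; have [x Sx ux] := cS u (fun k => MS _ (Mu k)) cu.
by exists x => //; apply: (cM u).
Qed.

Lemma semi_inner_sub M : lin_subspace M -> (forall x, M x -> S x) -> semi_inner M ip.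
Proof.
move=> sM MS; split => // [x y /MS Sx /MS|a x y z /MS Sx /MS Sy /MS|x /MS].
- exact: si_sym.
- exact: (si_lin hS).
- exact: (si_ge0 hS).
Qed.

End ip_theory.

(** * Projections, Riesz representation and weak limits *)

Section projection.
Context S ip (hS : semi_inner S ip) (cS : ip_complete S ip).
Let sS := si_subspace hS.

Definition convex_pred C : Prop := forall x y (t : R), C x -> C y ->
  0 <= t <= 1 -> C (x + t *: (y - x)).

(** A minimizing sequence for the distance to [x] is Cauchy: by the parallelogram identity the
    distance of two of its members is controlled by the midpoint, which lies in [C]. Its limit is in
    [C] by closedness, and moving from the limit towards [c] cannot decrease the distance, which is
    the stated inequality. *)
Lemma projection_convex C x : (forall y, C y -> S y) -> (exists y, C y) ->
  convex_pred C -> ip_closed S ip C -> S x ->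
  exists2 p, C p & forall c, C c -> ip (x - p) (c - p) <= 0.
Proof.
move=> CS [y0 Cy0] convC clC Sx.
pose A := [set r | exists2 y, C y & r = ip (x - y) (x - y)].
have A0 : A !=set0 by exists (ip (x - y0) (x - y0)), y0.
have SB y : C y -> S (x - y) by move=> /CS Sy; exact: subspaceB.
have lbA : lbound A 0 by move=> _ [y Cy ->]; apply: (si_ge0 hS); exact: SB.
have hA : has_inf A by split => //; exists 0.
pose d := inf A.
have dle y : C y -> d <= ip (x - y) (x - y).
  by move=> Cy; apply: ge_inf; [exists 0|exists y].
have d0 : 0 <= d by apply: lb_le_inf.
have near_inf k : exists y, C y /\ ip (x - y) (x - y) < d + k.+1%:R^-1.
  have [|_ [y Cy ->] hy] := @inf_adherent _ _ k.+1%:R^-1 _ hA; first by rewrite invr_gt0.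
  by exists y.
have [u hu] := choice near_inf.
have Cu k : C (u k) by case: (hu k).
have dist y z : C y -> C z -> ip (y - z) (y - z) <=
    2 * ip (x - y) (x - y) + 2 * ip (x - z) (x - z) - 4 * d.
  move=> Cy Cz.
  have -> : y - z = (x - z) - (x - y) by rewrite opprB [RHS]addrC addrA subrK.
  have S1 := SB _ Cz; have S2 := SB _ Cy.
  rewrite (parallelogram hS)//.
  have Cm : C (z + 2^-1 *: (y - z)) by apply: convC => //; lra.
  have -> : x - z + (x - y) = 2 *: (x - (z + 2^-1 *: (y - z))).
    rewrite scalerBr scalerDr scalerA divff// scale1r scaler_nat mulr2n scaler_nat mulr2n.
    by rewrite addrACA -opprD; congr (_ - _); rewrite -addrA; congr (_ + _); rewrite [RHS]addrC subrK.
  have Sm := SB _ Cm.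
  rewrite (ipZl hS) ?(ipZr hS)//; last exact: subspaceZ.
  by have := dle _ Cm; lra.
have cu : ip_cauchy ip u.
  move=> e e0; have [N _ hN] : \forall k \near \oo, k.+1%:R^-1 < e / 4 :> R.
    by apply: near_infty_natSinv_lt (PosNum _); rewrite divr_gt0.
  exists N => m n hm hn.
  have [_ um] := hu m; have [_ un] := hu n.
  have h1 := hN m hm; have h2 := hN n hn; rewrite /= in h1 h2.
  have {h1}um : ip (x - u m) (x - u m) < d + e / 4 by apply: (lt_trans um); rewrite ltrD2l.
  have {h2}un : ip (x - u n) (x - u n) < d + e / 4 by apply: (lt_trans un); rewrite ltrD2l.
  by apply: (le_lt_trans (dist _ _ (Cu m) (Cu n))); lra.
have [p Sp up] := cS (fun k => CS _ (Cu k)) cu.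
have Cp : C p by apply: clC up.
(* With D the squared distance of [p], the numbers (x - p, x - u_k) tend to D, while Cauchy-Schwarz
   bounds their squares by D (d + 1/(k+1)). In the limit D^2 <= D d. *)
have dp : ip (x - p) (x - p) <= d.
  have h1 : ip (x - p) (x - u k) @[k --> \oo] --> ip (x - p) (x - p).
    have := ip_cvg_ip hS (fun k => CS _ (Cu k)) Sp (SB _ Cp) up.
    have Sxp := SB _ Cp.
    under eq_fun do rewrite (si_sym hS (CS _ (Cu _)) Sxp).
    rewrite (si_sym hS Sp Sxp) => h.
    have -> : ip (x - p) (x - p) = ip (x - p) x - ip (x - p) p by rewrite -(ipBr hS).
    have -> : (fun k => ip (x - p) (x - u k)) = (fun k => ip (x - p) x - ip (x - p) (u k)).
      by apply/funext => k; rewrite (ipBr hS)//; exact: CS.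
    by apply: cvgB => //; exact: cvg_cst.
  rewrite leNgt; apply/negP => dlt.
  pose D := ip (x - p) (x - p).
  have D0 : 0 <= D by apply: (si_ge0 hS); exact: SB.
  have Dp : 0 < D by apply: le_lt_trans dlt.
  have h2 : ip (x - p) (x - u k) ^+ 2 @[k --> \oo] --> D ^+ 2.
    by rewrite expr2; under eq_fun do rewrite expr2; exact: cvgM.
  have h3 : D * (d + k.+1%:R^-1) @[k --> \oo] --> D * d.
    apply: cvgMr; rewrite -[X in _ --> X]addr0; apply: cvgD; first exact: cvg_cst.
    exact: cvg_harmonic.
  have : D ^+ 2 <= D * d.
    apply: (ler_cvg_to h2 h3); apply: nearW => k.
    apply: (le_trans (cauchy_schwarz_ip hS (SB _ Cp) (SB _ (Cu k)))).
    by apply: ler_wpM2l; [exact: ltW|apply: ltW; case: (hu k)].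
  by rewrite expr2 ler_pM2l// leNgt dlt.
exists p => // c Cc; rewrite leNgt; apply/negP => pos.
set b := ip (x - p) (c - p) in pos.
have Scp : S (c - p) by apply: subspaceB => //; exact: CS.
set q := ip (c - p) (c - p).
have q0 : 0 <= q := si_ge0 hS Scp.
(* Minimality at the point p + t (c - p) gives 2 b <= t q, whereas this [t] satisfies t q + t b = b,
   so that t q < b. *)
pose t := b / (q + b).
have qb : 0 < q + b by rewrite ltr_wpDl.
have t0 : 0 < t by rewrite divr_gt0.
have t1 : t <= 1 by rewrite ler_pdivrMr// mul1r lerDr.
have Ct : C (p + t *: (c - p)) by apply: convC => //; rewrite ltW.
have := dle _ Ct; rewrite opprD addrA.
rewrite (ip_sqB hS) ?SB ?(ipZl hS) ?(ipZr hS)//; do ?[exact: subspaceZ|exact: SB].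
rewrite -/b -/q => h.
have : 2 * b <= t * q.
  rewrite -(ler_pM2l t0); move: h dp; set D := ip _ _; lra.
have : t * (q + b) = b by rewrite /t mulfVK// gt_eqF.
nra.
Qed.

Lemma projection_subspace M x : lin_subspace M -> (forall y, M y -> S y) ->
  ip_closed S ip M -> S x ->
  exists2 p, M p & forall m, M m -> ip (x - p) m = 0.
Proof.
move=> sM MS clM Sx.
have [||p Mp hp] := projection_convex MS _ _ clM Sx.
- by exists 0; exact: subspace0.
- move=> y z t My Mz _; apply: subspaceD => //; apply: subspaceZ => //.
  exact: subspaceB.
exists p => // m Mm; have Sp := MS _ Mp.
have Sxp : S (x - p) := subspaceB sS Sx Sp.
have h1 := hp _ (subspaceD sM Mp Mm).
have h2 := hp _ (subspaceB sM Mp Mm).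
rewrite addrAC subrr add0r in h1.
rewrite addrAC subrr add0r (ipNr hS)// in h2; last exact: MS.
by apply/eqP; rewrite eq_le h1 -oppr_le0.
Qed.

(** The kernel of [l] is closed by the bound. If [l] is not identically 0, take [x0] outside the
    kernel and remove its projection; the remainder [e] is orthogonal to the kernel, and x - (l x /
    l e) e always lies in the kernel, so a multiple of [e] represents [l]. *)
Lemma riesz_representation (l : W -> R) (c : R) :
  (forall a x y, S x -> S y -> l (a *: x + y) = a * l x + l y) ->
  (forall x, S x -> l x ^+ 2 <= c * ip x x) ->
  exists2 r, S r & forall x, S x -> ip r x = l x.
Proof.
move=> lin bnd.
have l0 : l 0 = 0.
  have := lin 1 0 0 (subspace0 sS) (subspace0 sS).
  by rewrite scale1r addr0 mul1r => /(congr1 (fun x => x - l 0)); rewrite subrr addrK.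
have lZ a x : S x -> l (a *: x) = a * l x.
  by move=> Sx; rewrite -[a *: x]addr0 lin// ?l0 ?addr0//; exact: subspace0.
have lD x y : S x -> S y -> l (x + y) = l x + l y.
  by move=> Sx Sy; rewrite -[x]scale1r lin// scale1r mul1r.
have lB x y : S x -> S y -> l (x - y) = l x - l y.
  move=> Sx Sy; rewrite lD//; last exact: subspaceN.
  by rewrite -scaleN1r lZ// mulN1r.
pose M x := S x /\ l x = 0.
have sM : lin_subspace M.
  split; first by split => //; exact: subspace0.
  by move=> a x y [Sx x0] [Sy y0]; split; [exact: subspaceL|rewrite lin// x0 y0 mulr0 addr0].
have clM : ip_closed S ip M.
  move=> u x Mu Sx ux; split => //; apply/eqP; rewrite -sqrf_eq0; apply/eqP.
  apply/eqP; rewrite eq_le sqr_ge0 andbT; apply/ler_addgt0Pr => e e0.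
  have [|N hN] := ux (e / (`|c| + 1)); first by rewrite divr_gt0// ltr_wpDl.
  have [SN lN] := Mu N.
  have -> : l x = - l (u N - x) by rewrite lB// lN sub0r opprK.
  rewrite sqrrN add0r; have SS := subspaceB sS SN Sx.
  apply: (le_trans (bnd _ SS)).
  have := hN N (leqnn N); rewrite ltr_pdivlMr ?ltr_wpDl// => h.
  have := si_ge0 hS SS; have := ler_norm c; nra.
have [h|/existsNP[x0 /not_implyP[Sx0 lx0]]] := pselect (forall x, S x -> l x = 0).
  by exists 0; [exact: subspace0|move=> x Sx; rewrite h// (ip0l hS)].
have [p [Sp lp] hp] := projection_subspace sM (fun y => @proj1 _ _) clM Sx0.
pose e := x0 - p.
have Se : S e by exact: subspaceB.
have le : l e = l x0 by rewrite lB// lp subr0.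
have le0 : l e != 0 by rewrite le; apply/eqP.
have ee : ip e e != 0.
  apply/eqP => ee; have := bnd _ Se; rewrite ee mulr0 => h.
  by move/negP: le0; apply; rewrite -sqrf_eq0 eq_le h sqr_ge0.
exists ((l e / ip e e) *: e); first exact: subspaceZ.
move=> x Sx; rewrite (ipZl hS)//.
have := hp (x - (l x / l e) *: e).
have Sz : S ((l x / l e) *: e) by exact: subspaceZ.
rewrite (ipBr hS) ?(ipZr hS)// => h.
have {h} : ip e x - l x / l e * ip e e = 0.
  apply: h; split; first exact: subspaceB.
  by rewrite lB// lZ// divfK// subrr.
move/eqP; rewrite subr_eq0 => /eqP ->.
by field; apply/andP.
Qed.

(** A closed subspace is closed under limits of bounded sequences that converge only against a total
    set [D]. The vectors against which [z] converges to [x] form a closed subspace [N] containing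
    [D]. Let r = x - p be the component of [x] orthogonal to [M]. By totality [r] lies in [N]; but
    every (z_k, r) is 0, hence (x, r) = 0 and r has zero norm. *)
Lemma weak_limit_closed M D (z : nat -> W) x (c : R) : lin_subspace M -> (forall y, M y -> S y) ->
  ip_closed S ip M -> S x -> (forall k, M (z k)) ->
  (forall k, ip (z k) (z k) <= c) ->
  (forall e, D e -> S e) ->
  (forall r, S r -> (forall e, D e -> ip r e = 0) -> ip r r = 0) ->
  (forall e, D e -> ip (z k) e @[k --> \oo] --> ip x e) ->
  M x.
Proof.
move=> sM MS clM Sx Mz zc DS totD zD.
have Sz k := MS _ (Mz k).
pose N y := S y /\ ip (z k) y @[k --> \oo] --> ip x y.
have sN : lin_subspace N.
  split.
    split; first exact: subspace0.
    rewrite (ip0r hS)//; under eq_fun do rewrite (ip0r hS)//; exact: cvg_cst.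
  move=> a y1 y2 [S1 c1] [S2 c2]; split; first exact: subspaceL.
  have Sa := subspaceZ sS a S1.
  rewrite (ipDr hS) ?(ipZr hS)//.
  under eq_fun do rewrite (ipDr hS) ?(ipZr hS)//.
  by apply: cvgD; first exact: cvgMr.
pose c' := `|c| + ip x x + 1.
have xx := si_ge0 hS Sx.
have c'0 : 0 < c' by rewrite /c' ltr_wpDl// addr_ge0.
have zc' k : ip (z k) (z k) <= c'.
  by have := zc k; rewrite /c'; have := ler_norm c; lra.
have xc' : ip x x <= c' by rewrite /c'; have := normr_ge0 c; lra.
(* Three-term estimate: [y] is replaced by a member [u m] of [N] so close that the error is below
   e/3 for all z_k and for [x] at once, by their common bound [c']. *)
have clN : ip_closed S ip N.
  move=> u y Nu Sy uy; split => //; apply/cvgrPdist_lt => e e0.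
  have e3 : 0 < (e / 3) ^+ 2 / c' by rewrite divr_gt0// exprn_gt0// divr_gt0.
  have [m hm] := uy _ e3; have {hm} := hm m (leqnn m).
  have [Sm cm] := Nu m.
  rewrite ltr_pdivlMr// => hm.
  have /cvgrPdist_lt /(_ (e / 3)) := cm; rewrite divr_gt0// => /(_ isT) hcm.
  near=> k.
  have hk : `|ip x (u m) - ip (z k) (u m)| < e / 3 by near: k.
  have Sym := subspaceB sS Sm Sy.
  have small w : S w -> ip w w <= c' -> `|ip w (u m - y)| < e / 3.
    move=> Sw wc; rewrite -(@ltr_pXn2r _ 2%N)// ?nnegrE// ?divr_ge0 ?ltW//.
    rewrite real_normK ?num_real//; apply: (le_lt_trans (cauchy_schwarz_ip hS Sw Sym)).
    apply: le_lt_trans hm; rewrite mulrC; apply: ler_wpM2l => //.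
    exact: (si_ge0 hS).
  have s1 := small _ Sx xc'; have s2 := small _ (Sz k) (zc' k).
  rewrite (ipBr hS)// in s1; rewrite (ipBr hS)// in s2.
  have -> : ip x y - ip (z k) y = - (ip x (u m) - ip x y) +
    (ip x (u m) - ip (z k) (u m)) + (ip (z k) (u m) - ip (z k) y) by ring.
  apply: (le_lt_trans (ler_normD _ _)); rewrite -ltrBrDr.
  apply: (le_lt_trans (ler_normD _ _)); rewrite normrN; lra.
have NS y : N y -> S y by case.
have [p Mp hp] := projection_subspace sM MS clM Sx.
pose r := x - p.
have Sr : S r by apply: subspaceB => //; exact: MS.
have [q Nq hq] := projection_subspace sN NS clN Sr.
have Srq : S (r - q) by apply: subspaceB => //; exact: NS.
have rq : ip (r - q) (r - q) = 0.
  by apply: totD => // e De; apply: hq; split; [exact: DS|exact: zD].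
have [_ Nr] : N r.
  apply: (clN (fun=> q)) => // e e0; exists 0%N => n _.
  by rewrite (ip_sqBC hS) ?rq//; exact: NS.
have xr : ip x r = 0.
  have := cvg_lim (@Rhausdorff R) Nr => <-.
  under eq_fun => k.
    rewrite (si_sym hS (Sz k) Sr) /r hp//; over.
  exact: lim_cst.
have rr : ip r r = 0.
  rewrite {1}/r (ipBl hS) ?xr//; last exact: MS.
  by rewrite (si_sym hS (MS _ Mp) Sr) /r hp// subrr.
apply: (clM (fun=> p)) => // e e0; exists 0%N => n _.
by rewrite (ip_sqBC hS) ?rr//; exact: MS.
Unshelve. all: by end_near.
Qed.

End projection.

(** * Finite-dimensional semi-inner product spaces *)

Section finite_dimension.
Context S ip (hS : semi_inner S ip).
Let sS := si_subspace hS.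
Implicit Types l vs : seq W.

Definition fourier l x := \sum_(e <- l) ip x e *: e.

Fixpoint orthonormal l : Prop :=
  if l is e :: l' then
    [/\ S e, ip e e = 1, forall f, f \in l' -> ip f e = 0 & orthonormal l']
  else True.

Let onb_S l : orthonormal l -> forall e, e \in l -> S e.
Proof.
elim: l => //= e l IH [Se _ _ onl] f; rewrite inE => /orP[/eqP -> //|]; exact: IH.
Qed.

Let fourier_cons e l x : fourier (e :: l) x = ip x e *: e + fourier l x.
Proof. by rewrite /fourier big_cons. Qed.

Let S_fourier l x : orthonormal l -> S (fourier l x).
Proof.
move=> onl; have := onb_S onl; elim: l {onl} => [_|e l IH Sl].
  by rewrite /fourier big_nil; exact: subspace0.
rewrite fourier_cons; apply: (subspaceL sS); first by apply: Sl; rewrite mem_head.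
by apply: IH => f fl; apply: Sl; rewrite inE fl orbT.
Qed.

Let fourierL l a x y : orthonormal l -> S x -> S y ->
  fourier l (a *: x + y) = a *: fourier l x + fourier l y.
Proof.
move=> onl Sx Sy; have := onb_S onl; elim: l {onl} => [_|e l IH Sl].
  by rewrite /fourier !big_nil scaler0 addr0.
have Se : S e by apply: Sl; rewrite mem_head.
rewrite !fourier_cons IH; last by move=> f fl; apply: Sl; rewrite inE fl orbT.
by rewrite (si_lin hS)// scalerDl scalerDr addrACA scalerA.
Qed.

Let fourier_orth l x e : orthonormal l -> S x -> S e ->
  (forall f, f \in l -> ip f e = 0) -> ip (fourier l x) e = 0.
Proof.
move=> onl Sx Se; have := onb_S onl; elim: l onl => [_ _ _|f l IH /= [Sf _ _ onl] Sl h].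
  by rewrite /fourier big_nil (ip0l hS).
rewrite fourier_cons (si_lin hS)//; last exact: S_fourier.
rewrite h ?mem_head// mulr0 add0r IH// => g gl; [apply: Sl|apply: h];
  by rewrite inE gl orbT.
Qed.

Let fourier_null l x : (forall e, e \in l -> ip x e = 0) -> fourier l x = 0.
Proof. by move=> h; rewrite /fourier big_seq big1// => e /h ->; rewrite scale0r. Qed.

(** A vector whose residual has zero norm adds nothing to the list, since the claim holds only up to
    vectors of zero norm; otherwise the normalized residual is prepended. *)
Let gram_schmidt vs : (forall v, v \in vs -> S v) ->
  exists2 l, orthonormal l & forall v, v \in vs ->
    ip (v - fourier l v) (v - fourier l v) = 0.
Proof.
elim: vs => [_|v vs IH Svs]; first by exists [::].
have [|l onl hl] := IH; first by move=> w wvs; apply: Svs; rewrite inE wvs orbT.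
have Sv : S v by apply: Svs; rewrite mem_head.
pose r := v - fourier l v.
have Sr : S r by apply: subspaceB => //; exact: S_fourier.
have [r0|r0] := eqVneq (ip r r) 0.
  by exists l => // w; rewrite inE => /orP[/eqP ->|/hl].
have rr := si_ge0 hS Sr.
have rr0 : 0 < ip r r by rewrite lt_neqAle eq_sym r0.
pose s := Num.sqrt (ip r r); pose e := s^-1 *: r.
have s0 : 0 < s by rewrite sqrtr_gt0.
have Se : S e by exact: subspaceZ.
have ss : s * s = ip r r by rewrite -expr2 sqr_sqrtr.
have lr f : f \in l -> ip f r = 0.
  move=> fl; have Sf := onb_S onl fl.
  have : forall l', orthonormal l' -> f \in l' -> ip f (v - fourier l' v) = 0.
    elim=> // g l' IHl /= [Sg gg gl' onl'] fl'.
    rewrite fourier_cons.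
    have SP := S_fourier v onl'; have Sc := subspaceZ sS (ip v g) Sg.
    rewrite (ipBr hS)//; last exact: subspaceD.
    rewrite (ipDr hS)// (ipZr hS)//.
    move: fl'; rewrite inE => /orP[/eqP fg|fl'].
      rewrite fg gg mulr1 (si_sym hS Sg SP) (fourier_orth onl')//.
      by rewrite (si_sym hS Sg Sv) addr0 subrr.
    have := IHl onl' fl'; rewrite (ipBr hS)// (gl' _ fl') mulr0 add0r; exact.
  by apply.
have le f : f \in l -> ip f e = 0.
  by move=> fl; rewrite (ipZr hS) ?lr ?mulr0//; exact: onb_S fl.
exists (e :: l).
  split => //; rewrite (ipZl hS)// (ipZr hS)//.
  by rewrite -ss mulKf ?gt_eqF// mulVf ?gt_eqF.
have SPl w := S_fourier w onl.
have key w : S w -> ip w e = ip (w - fourier l w) e.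
  by move=> Sw; rewrite (ipBl hS)// (fourier_orth onl)// subr0.
move=> w; rewrite inE fourier_cons opprD addrA [w - _]addrC -addrA => /orP[/eqP ->|wvs].
  rewrite key// -/r {1 3}/e (ipZr hS)// -ss mulKf ?gt_eqF// scalerA divff ?gt_eqF//.
  by rewrite scale1r addNr (ip0l hS)//; exact: subspace0.
have Sw : S w by apply: Svs; rewrite inE wvs orbT.
have Sww : S (w - fourier l w) by exact: subspaceB.
rewrite key// (ip_null hS Sww Se (hl _ wvs)).
by rewrite scale0r oppr0 add0r hl.
Qed.

Definition spanning m (v : 'I_m -> W) : Prop := (forall j, S (v j)) /\
  forall x, S x -> exists c : 'I_m -> R,
    ip (x - \sum_j c j *: v j) (x - \sum_j c j *: v j) = 0.

Let orthonormal_basis m (v : 'I_m -> W) : spanning v -> exists2 l, orthonormal l &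
  forall x, S x -> ip (x - fourier l x) (x - fourier l x) = 0.
Proof.
move=> [Sv spanv]; have [|l onl hl] := @gram_schmidt [seq v j | j <- enum 'I_m].
  by move=> _ /mapP[j _ ->].
exists l => // x Sx; have [c hc] := spanv _ Sx.
have SPl w := S_fourier w onl.
pose N w := S w /\ ip (w - fourier l w) (w - fourier l w) = 0.
have NL a y z : N y -> N z -> N (a *: y + z).
  move=> [Sy Ny] [Sz Nz]; split; first exact: subspaceL.
  rewrite fourierL// opprD addrACA -scalerBr.
  have S1 : S (y - fourier l y) by exact: subspaceB.
  have S2 : S (z - fourier l z) by exact: subspaceB.
  have S3 := subspaceZ sS a S1.
  rewrite (ip_sqD hS)// (ipZl hS)// (ipZl hS)// (ipZr hS)//.
  by rewrite Ny Nz (ip_null hS)// !mulr0 !addr0.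
have sN : lin_subspace N.
  split => //; split; first exact: subspace0.
  by rewrite fourier_null ?subrr ?(ip0l hS)//; [exact: subspace0|
    move=> e el; rewrite (ip0l hS)//; exact: onb_S el].
pose y := \sum_j c j *: v j.
have Ny : N y.
  apply: (subspace_sum sN) => j; apply: (subspaceZ sN).
  by split => //; apply: hl; rewrite map_f// mem_enum.
have Sy : S y by case: Ny.
have Sxy : S (x - y) by exact: subspaceB.
have Nxy : N (x - y).
  split => //; rewrite fourier_null ?subr0//.
  by move=> e el; rewrite (ip_null hS)//; exact: onb_S el.
by rewrite -[x](subrK y); case: (subspaceD sN Nxy Ny).
Qed.

Lemma finite_dim_complete m (v : 'I_m -> W) : spanning v -> ip_complete S ip.
Proof.
move=> /orthonormal_basis[l onl hl] u Su cu.
have [y Sy uy] : exists2 y, S y & ip_cvg ip (fun k => fourier l (u k)) y.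
  elim: l onl {hl} => [_|e l IH /= [Se ee _ onl]].
    exists 0; first exact: subspace0.
    move=> e e0; exists 0%N => n _.
    by rewrite /fourier big_nil subrr (ip0l hS)//; exact: subspace0.
  have [y Sy uy] := IH onl.
  have [a /cvgrPdist_lt ua] : exists a : R, ip (u k) e @[k --> \oo] --> a.
    apply: real_cauchy_cvg => r r0.
    have [|N hN] := cu (r ^+ 2); first by rewrite exprn_gt0.
    exists N => i j hi hj; have := hN _ _ hi hj.
    have SB := subspaceB sS (Su i) (Su j).
    have := cauchy_schwarz_ip hS SB Se; rewrite ee mulr1 (ipBl hS)// => h1 h2.
    rewrite -(@ltr_pXn2r _ 2%N)// ?nnegrE ?normr_ge0 ?ltW//.
    by rewrite real_normK ?num_real//; exact: le_lt_trans h2.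
  exists (a *: e + y); first exact: subspaceL.
  under [X in ip_cvg _ X _]eq_fun do rewrite fourier_cons -[X in X + _]scale1r.
  rewrite -[X in X + y]scale1r.
  apply: (ip_cvgL hS) => //; try by move=> k; exact: subspaceZ.
  - by move=> k; exact: S_fourier.
  - exact: subspaceZ.
  move=> r r0; have [|N _ hN] := ua (Num.sqrt r); first by rewrite sqrtr_gt0.
  exists N => n /hN /=; rewrite -scalerBl.
  rewrite (ipZl hS)//; last exact: subspaceZ.
  rewrite (ipZr hS)// ee mulr1 -expr2 distrC => h.
  rewrite -(@sqr_sqrtr _ r) ?ltW// -real_normK ?num_real//.
  by rewrite ltr_pXn2r// nnegrE ?normr_ge0// sqrtr_ge0.
exists y => // e e0; have [|N hN] := uy (e / 2); first by rewrite divr_gt0.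
exists N => n /hN hn.
have SP := S_fourier (u n) onl.
have -> : u n - y = (u n - fourier l (u n)) + (fourier l (u n) - y).
  by rewrite addrA subrK.
have S1 : S (u n - fourier l (u n)) by exact: subspaceB.
have S2 : S (fourier l (u n) - y) by exact: subspaceB.
apply: (le_lt_trans (ip_sqD_le hS S1 S2)).
by rewrite hl//; lra.
Qed.

(** Up to a null vector, on which [f] vanishes, [y] equals its Fourier sum, so [f y] is a finite
    combination of the coefficients [ip y e], each of which is continuous. *)
Lemma finite_dim_cvg m (v : 'I_m -> W) (f : W -> R) u x : spanning v ->
  (forall a y z, S y -> S z -> f (a *: y + z) = a * f y + f z) ->
  (forall y, S y -> ip y y = 0 -> f y = 0) ->
  (forall k, S (u k)) -> S x -> ip_cvg ip u x ->
  f (u k) @[k --> \oo] --> f x.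
Proof.
move=> /orthonormal_basis[l onl hl] fL f0 Su Sx ux.
have fD y z : S y -> S z -> f (y + z) = f y + f z.
  by move=> Sy Sz; have := fL 1 _ _ Sy Sz; rewrite scale1r mul1r.
have fP y : S y -> f y = f (fourier l y).
  move=> Sy; have SP := S_fourier y onl.
  have SB : S (y - fourier l y) by exact: subspaceB.
  by rewrite -{1}(subrK (fourier l y) y) fD// f0 ?add0r// hl.
rewrite fP//; under eq_fun do rewrite fP//.
elim: l onl {hl fP} => [_|e l IH /= [Se _ _ onl]].
  under eq_fun do rewrite /fourier big_nil; rewrite /fourier big_nil.
  exact: cvg_cst.
rewrite fourier_cons fL//; last exact: S_fourier.
have -> : (fun k => f (fourier (e :: l) (u k))) =
    (fun k => ip (u k) e * f e + f (fourier l (u k))).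
  by apply/funext => k; rewrite fourier_cons fL//; exact: S_fourier.
apply: cvgD; last exact: IH.
by apply: cvgMl; exact: (ip_cvg_ip hS).
Qed.

End finite_dimension.

(** Here [rel x a] reads: [a] is a coordinate row of [x]. The attained rows need not fill the whole
    row space, so a family of attained rows of maximal rank is chosen; its preimages span, because a
    vector with coordinates 0 has zero norm. *)
Lemma coordinates_spanning S ip (N : nat) (rel : W -> 'rV[R]_N -> Prop) :
  semi_inner S ip ->
  (forall x, S x -> exists a, rel x a) ->
  (forall x a, rel x a -> S x) ->
  (forall t x y a b, rel x a -> rel y b -> rel (t *: x + y) (t *: a + b)) ->
  (forall x, rel x 0 -> ip x x = 0) ->
  exists m (v : 'I_m -> W), spanning S ip v.
Proof.
move=> hS tot relS relL rel0; have sS := si_subspace hS.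
pose D (a : 'rV[R]_N) := exists x, rel x a.
pose P r := `[< exists m (A : 'M[R]_(m, N)), (forall i, D (row i A)) /\ \rank A = r >].
have exP : exists r, P r.
  exists 0%N; apply/asboolP; exists 0%N, 0; split; last by rewrite mxrank0.
  by case.
have boundP r : P r -> (r <= N)%N.
  by move/asboolP => [m [A [_ <-]]]; exact: rank_leq_col.
case: (ex_maxnP exP boundP) => r /asboolP[m [A [DA rA]]] maxr.
have [v hv] := choice DA.
(* Appending [a] to the rows of [A] gives another family of attained rows; by maximality the rank
   does not grow, so [a] is in the row space of [A]. *)
have key a : D a -> exists t : 'rV[R]_m, a = t *m A.
  move=> Da; suff : (a <= A)%MS by move/submxP.
  have : P (\rank (col_mx A a)).
    apply/asboolP; exists (m + 1)%N, (col_mx A a); split => // i.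
    by case: (split_ordP i) => j ->; rewrite ?rowKu ?rowKd// row_id.
  move=> /maxr; rewrite -rA => h.
  have sub : (A <= col_mx A a)%MS by apply/submxP; exists (row_mx 1%:M 0); rewrite mul_row_col mul1mx mul0mx addr0.
  have := mxrank_leqif_sup sub; rewrite /leqif => -[_] /esym.
  rewrite eqn_leq h mxrankS// andbT => cA.
  apply: submx_trans cA; apply/submxP; exists (row_mx 0 1%:M).
  by rewrite mul_row_col mul1mx mul0mx add0r.
have Sv j : S (v j) by apply: relS; exact: hv.
exists m, v; split => // x Sx; have [a xa] := tot _ Sx.
have [t ta] := key a (ex_intro _ x xa).
exists (t 0); apply: rel0.
have rel00 : rel 0 0.
  by have := relL (-1) _ _ _ _ xa xa; rewrite !scaleN1r !addNr.
have relsum : rel (\sum_j t 0 j *: v j) (\sum_j t 0 j *: row j A).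
  elim: (index_enum _) => [|j r' IH]; first by rewrite !big_nil.
  by rewrite !big_cons; apply: relL.
move: relsum; rewrite -mulmx_sum_row -ta => /(relL (-1) _ _ _ _)/(_ xa).
by rewrite !scaleN1r addNr addrC.
Qed.


End semi_inner_theory.

(** * Integration on row vectors *)

Section square_integrable.
Context d (T : measurableType d) (R : realType) (mu : {measure set T -> \bar R}).
Implicit Types (D : set T) (f g : T -> R).

Definition sqint D f : Prop :=
  measurable_fun D f /\ mu.-integrable D (EFin \o (fun x => f x ^+ 2)).

Lemma sqint_mul D f g : measurable D -> sqint D f -> sqint D g ->
  mu.-integrable D (EFin \o (fun x => f x * g x)).
Proof.
move=> mD [mf f2] [mg g2].
apply: (@le_integrable _ _ _ _ _ _ _ (EFin \o (fun x => f x ^+ 2 + g x ^+ 2))) => //.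
- by apply/measurable_EFinP; exact: measurable_funM.
- move=> x Dx /=; rewrite lee_fin normrM [leRHS]ger0_norm ?addr_ge0 ?sqr_ge0//.
  rewrite -[f x ^+ 2]real_normK ?num_real// -[g x ^+ 2]real_normK ?num_real//.
  by have := sqr_ge0 (`|f x| - `|g x|); have := sqr_ge0 (`|f x| + `|g x|);
    rewrite sqrrB sqrrD; lra.
- exact: (integrableD mD f2 g2).
Qed.

Lemma sqint0 D : measurable D -> sqint D (fun=> 0).
Proof.
move=> mD; split; first exact: measurable_cst.
by under [X in _ \o X]eq_fun do rewrite expr0n/=; exact: integrable0.
Qed.

Lemma sqintL D a f g : measurable D -> sqint D f -> sqint D g ->
  sqint D (fun x => a * f x + g x).
Proof.
move=> mD hf hg; have [mf f2] := hf; have [mg g2] := hg.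
have ma : measurable_fun D (fun x => a * f x + g x).
  by apply: measurable_funD => //; exact: measurable_funM.
split => //.
apply: (@le_integrable _ _ _ _ _ _ _
  (EFin \o (fun x => 2 * a ^+ 2 * f x ^+ 2 + 2 * g x ^+ 2))) => //.
- by apply/measurable_EFinP; exact: measurable_funX.
- move=> x Dx /=; rewrite lee_fin ger0_norm ?sqr_ge0// ger0_norm; last first.
    by have := sqr_ge0 (a * f x); have := sqr_ge0 (g x); rewrite exprMn; lra.
  by have := sqr_ge0 (a * f x - g x); rewrite sqrrB sqrrD exprMn; lra.
- exact: (integrableD mD (integrableZl mD (2 * a ^+ 2) f2) (integrableZl mD 2 g2)).
Qed.

Lemma sqintB D f g : measurable D -> sqint D f -> sqint D g ->
  sqint D (fun x => f x - g x).
Proof.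
move=> mD hf hg.
have := sqintL (-1) mD hg hf.
by under eq_fun do rewrite mulN1r addrC.
Qed.

Lemma eq_sqint D f g : measurable D -> (forall x, D x -> f x = g x) -> sqint D f -> sqint D g.
Proof.
move=> mD fg [mf if2]; split.
  by apply: eq_measurable_fun mf => x; rewrite inE => /fg.
by apply: eq_integrable if2 => // x; rewrite inE => /fg /= ->.
Qed.

Lemma sqintS D D' f : measurable D -> measurable D' -> D' `<=` D ->
  sqint D f -> sqint D' f.
Proof.
move=> mD mD' DD' [mf fi]; split; first exact: measurable_funS mf.
exact: integrableS fi.
Qed.

Lemma EFin_Rintegral D f : measurable D -> mu.-integrable D (EFin \o f) ->
  (\int[mu]_(x in D) f x)%:E = (\int[mu]_(x in D) (f x)%:E)%E.
Proof. by move=> mD fi; rewrite /Rintegral fineK//; exact: integrable_fin_num. Qed.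

Lemma sqint_eq0_ae D f : measurable D -> sqint D f ->
  \int[mu]_(x in D) (f x ^+ 2) = 0 -> {ae mu, forall x, D x -> f x = 0}.
Proof.
move=> mD [mf fi] f0.
have : (\int[mu]_(x in D) `|(f x ^+ 2)%:E|)%E = 0%E.
  under eq_integral do rewrite gee0_abs ?lee_fin ?sqr_ge0//.
  by rewrite -EFin_Rintegral// f0.
move/(ae_eq_integral_abs mu mD); have h : measurable_fun D (fun x => (f x ^+ 2)%:E).
  by apply/measurable_EFinP; exact: measurable_funX.
move=> /(_ h); apply: filterS => x /= hx Dx; have := hx Dx.
by move=> [] /eqP; rewrite sqrf_eq0 => /eqP.
Qed.

(** Riesz-Fischer: a rapidly converging subsequence [v] converges pointwise off a null set, and
    Fatou's lemma bounds the distance of [u n] to the limit by the distances of [u n] to the members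
    of the subsequence. *)
Lemma sqint_complete D (u : nat -> T -> R) : measurable D ->
  (forall k, sqint D (u k)) ->
  (forall e : R, 0 < e -> exists N, forall m n, (N <= m)%N -> (N <= n)%N ->
    \int[mu]_(x in D) ((u m x - u n x) ^+ 2) < e) ->
  exists2 f, sqint D f & forall e : R, 0 < e -> exists N, forall n, (N <= n)%N ->
    \int[mu]_(x in D) ((u n x - f x) ^+ 2) < e.
Proof.
move=> mD su cu.
(* With this rate the integral of 2^k (v_{k+1} - v_k)^2 is at most 2^-(k+1), so the sum [g] of these
   functions is integrable and finite off a null set. *)
pose r k : R := (2 ^ k * 2 ^ k.+1)%:R^-1.
have r0 k : 0 < r k by rewrite invr_gt0 ltr0n muln_gt0 !expn_gt0.
have [N hN] := choice (fun k => cu _ (r0 k)).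
pose phi k := (\sum_(i < k.+1) (N i).+1)%N.
have phiN k : (N k <= phi k)%N by rewrite /phi big_ord_recr/= (leq_trans (leqnSn _))// leq_addl.
have phimono k : (phi k <= phi k.+1)%N by rewrite /phi [leqRHS]big_ord_recr leq_addr.
pose v k := u (phi k).
have sv k : sqint D (v k) by exact: su.
have mv k : measurable_fun D (v k) by case: (sv k).
have sB i j : sqint D (fun x => v i x - v j x) by exact: sqintB.
have vr k : \int[mu]_(x in D) ((v k.+1 x - v k x) ^+ 2) < r k.
  by apply: hN => //; apply: leq_trans (phimono k).
pose h k (x : T) : \bar R := ((2 ^ k)%:R * (v k.+1 x - v k x) ^+ 2)%:E.
have h0 k x : (0 <= h k x)%E by rewrite lee_fin mulr_ge0// sqr_ge0.
have mh k : measurable_fun D (h k).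
  apply/measurable_EFinP; apply: measurable_funM => //.
  by apply: measurable_funX; exact: measurable_funB.
pose g x := (\sum_(0 <= k <oo) h k x)%E.
have mg : measurable_fun D g.
  apply: (eq_measurable_fun (fun x => \sum_(0 <= i <oo | i \in predT) h i x)%E) => //.
  exact: ge0_emeasurable_sum.
have g0 x : (0 <= g x)%E by apply: nneseries_ge0.
have ig : mu.-integrable D g.
  apply/integrableP; split => //.
  under eq_integral do rewrite gee0_abs//.
  rewrite /g integral_nneseries//.
  apply: (@le_lt_trans _ _ (\sum_(0 <= k <oo) (1 / (2 ^ k.+1)%:R)%:E)%E); last first.
    by apply: (le_lt_trans (epsilon_trick0 _ _)); rewrite ?ltry.
  apply: lee_nneseries => k _; first by move=> _; exact: integral_ge0.
  rewrite /h; under eq_integral do rewrite EFinM.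
  have [_ iB] := sB k.+1 k.
  rewrite ge0_integralZl//; last 2 first.
  - by apply/measurable_EFinP; apply: measurable_funX; exact: measurable_funB.
  - by move=> x _; rewrite lee_fin sqr_ge0.
  rewrite -EFin_Rintegral// -EFinM lee_fin.
  apply: (@le_trans _ _ ((2 ^ k)%:R * r k)).
    by apply: ler_wpM2l => //; exact: ltW.
  by rewrite /r natrM invfM mulrA mulfV ?mul1r ?div1r// pnatr_eq0 expn_eq0.
have [Z [mZ Z0 hZ]] := integrable_ae mD ig.
have gfin x : D x -> ~ Z x -> g x \is a fin_num.
  by move=> Dx nZ; apply: contrapT => nf; apply: nZ; apply: hZ => /(_ Dx).
pose G := D `\` Z.
have mG : measurable G by exact: measurableD.
pose w k := v k \_ G.
have GD : G `<=` D by exact: subDsetl.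
have mw k : measurable_fun setT (w k).
  by apply/(measurable_restrictT _ _).1 => //; exact: measurable_funS (mv k).
have wc x : exists a : R, w k x @[k --> \oo] --> a.
  have [Gx|Gx] := pselect (G x); last first.
    exists 0; have -> : (fun k => w k x) = (fun=> 0) by apply/funext => k; rewrite /w patchE memNset.
    exact: cvg_cst.
  have -> : (fun k => w k x) = (fun k => v k x) by apply/funext => k; rewrite /w patchE mem_set.
  have [Dx Zx] := Gx; have := gfin x Dx Zx.
  move=> /fineK; set a := fine _ => ga.
  suff : cvgn (series (telescope (v^~ x))).
    move=> c; apply/cvg_ex; rewrite (_ : (fun k => v k x) =
      (fun k => v 0%N x + series (telescope (v^~ x)) k)); last first.
      by apply/funext => k; rewrite -eq_sum_telescope.
    by apply: is_cvgD => //; exact: is_cvg_cst.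
  apply: normed_cvg; apply: nondecreasing_is_cvgn.
    by apply: (@nondecreasing_series _ _ xpredT) => k _ _; exact: normr_ge0.
  exists (a + 2) => _ [k _ <-].
  (* Finiteness of [g x] controls weighted squares. The inequality |b| <= 2^i b^2 + 2^-i turns this
     into absolute summability of the increments; the geometric part contributes at most 2. *)
  apply: (@le_trans _ _ (\sum_(0 <= i < k) ((2 ^ i)%:R * (v i.+1 x - v i x) ^+ 2
      + (2 ^ i)%:R^-1))).
    apply: ler_sum => i _ /=; rewrite /telescope/=.
    set b := v i.+1 x - v i x; set c : R := (2 ^ i)%:R.
    have c0 : 0 < c by rewrite ltr0n expn_gt0.
    have : 0 <= (c * `|b| - 1) ^+ 2 by exact: sqr_ge0.
    rewrite -[b ^+ 2]real_normK ?num_real// => hb.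
    rewrite -(ler_pM2l c0) mulrDr mulfV ?gt_eqF//.
    have := normr_ge0 b; move: hb; rewrite sqrrB1 exprMn expr2; nra.
  rewrite big_split/= lerD//.
    rewrite -lee_fin ga; apply: le_trans (nneseries_lim_ge k _) => //.
    by rewrite sumEFin.
  rewrite -[leLHS]/(series (fun i => (2 ^ i)%:R^-1) k).
  have -> : (fun i => (2 ^ i)%:R^-1) = geometric (1 : R) (2^-1).
    by apply/funext => i; rewrite /= mul1r natrX exprVn.
  rewrite geometric_seriesE//; last by rewrite lt_eqF// invf_lt1// ltr1n.
  have -> : (1 : R) - 2^-1 = 2^-1 by lra.
  by rewrite /= invrK mul1r ler_piMl// gerBl exprn_ge0.
have [f hf] := choice wc.
have mf : measurable_fun setT f by apply: (measurable_fun_cvg mw).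
have phik k : (k <= phi k)%N.
  elim: k => // k IH; apply: (@leq_trans (phi k).+1) => //.
  by rewrite /phi [leqRHS]big_ord_recr/= addnS ltnS leq_addr.
(* Fatou's lemma for (u_n - w_k)^2 as k tends to infinity; [w k] is [v k] cut off on the null set,
   so that it converges everywhere. *)
have main n e : 0 < e -> (exists K, forall k, (K <= k)%N ->
    \int[mu]_(x in D) ((u n x - v k x) ^+ 2) <= e) ->
    (\int[mu]_(x in D) ((u n x - f x) ^+ 2)%:E <= e%:E)%E.
  move=> e0 [K he]; have [mun _] := su n.
  have mB (a : T -> R) : measurable_fun D a -> measurable_fun D (fun x => ((u n x - a x) ^+ 2)%:E).
    by move=> ma; apply/measurable_EFinP; apply: measurable_funX; exact: measurable_funB.
  have mwD k : measurable_fun D (w k) by exact: measurable_funTS.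
  have -> : (\int[mu]_(x in D) ((u n x - f x) ^+ 2)%:E =
      \int[mu]_(x in D) limn_einf (fun k => ((u n x - w k x) ^+ 2)%:E))%E.
    apply: eq_integral => x _; apply/esym.
    have c : ((u n x - w k x) ^+ 2)%:E @[k --> \oo] --> ((u n x - f x) ^+ 2)%:E.
      apply: cvg_EFin; first exact: nearW.
      rewrite expr2; under eq_fun do rewrite /= expr2.
      by apply: cvgM; (apply: cvgB; [exact: cvg_cst|exact: hf]).
    by rewrite is_cvg_limn_einfE; [exact/cvg_lim|apply/cvg_ex; eexists; exact: c].
  apply: (le_trans (fatou _ _ _ _)) => //.
  - by move=> k; exact: mB.
  - by move=> k x _; rewrite lee_fin sqr_ge0.
  rewrite limn_einf_lim; apply: lime_le; first exact: is_cvg_einfs.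
  apply: nearW => k; apply: (@le_trans _ _
    (\int[mu]_(x in D) ((u n x - w (maxn K k) x) ^+ 2)%:E)%E).
    by apply: ereal_inf_lbound; exists (maxn K k) => //=; exact: leq_maxr.
  have sBk : sqint D (fun x => u n x - v (maxn K k) x) by exact: sqintB.
  rewrite (@ge0_ae_eq_integral _ _ _ mu D _ (fun x => ((u n x - v (maxn K k) x) ^+ 2)%:E))//.
  - by rewrite -EFin_Rintegral//; [rewrite lee_fin; apply: he; exact: leq_maxl|case: sBk].
  - exact: mB.
  - exact: mB.
  - by move=> x _; rewrite lee_fin sqr_ge0.
  - by move=> x _; rewrite lee_fin sqr_ge0.
  exists Z; split => // x /= hx; apply: contrapT => nZ; apply: hx => Dx.
  by rewrite /w patchE mem_set.
have fin n e : 0 < e -> (exists K, forall k, (K <= k)%N ->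
    \int[mu]_(x in D) ((u n x - v k x) ^+ 2) <= e) ->
    sqint D (fun x => u n x - f x).
  move=> e0 /(main _ _ e0) hne; have [mun _] := su n.
  have mB : measurable_fun D (fun x => u n x - f x).
    by apply: measurable_funB => //; exact: measurable_funTS.
  split => //; apply/integrableP; split.
    by apply/measurable_EFinP; exact: measurable_funX.
  apply: le_lt_trans (ltry e); apply: le_trans hne.
  rewrite (eq_integral (fun x => ((u n x - f x) ^+ 2)%:E))// => x _.
  by rewrite /= ger0_norm ?sqr_ge0.
have cuv e : 0 < e -> exists N0, forall n, (N0 <= n)%N ->
    exists K, forall k, (K <= k)%N -> \int[mu]_(x in D) ((u n x - v k x) ^+ 2) <= e.
  move=> e0; have [N0 hN0] := cu e e0; exists N0 => n Nn; exists N0 => k Nk.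
  by apply/ltW/hN0 => //; exact: leq_trans (phik k).
have sf : sqint D f.
  have [N0 hN0] := cuv 1 ltr01.
  have := sqintB mD (su N0) (fin _ _ ltr01 (hN0 N0 (leqnn _))).
  by apply: eq_sqint => // x _; rewrite opprB addrCA subrr addr0.
exists f => // e e0; have [|N0 hN0] := cuv (e / 2); first by rewrite divr_gt0.
exists N0 => n /hN0 hn; have e2 : 0 < e / 2 by rewrite divr_gt0.
have := main _ _ e2 hn; have [_ iB] := fin _ _ e2 hn.
by rewrite -EFin_Rintegral// lee_fin => h1; apply: (le_lt_trans h1); lra.
Qed.

Lemma Rintegral_dominated D (f_ : nat -> T -> R) f g : measurable D ->
  (forall k, measurable_fun D (f_ k)) ->
  (forall x, D x -> f_ k x @[k --> \oo] --> f x) ->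
  mu.-integrable D (EFin \o g) ->
  (forall k x, D x -> `|f_ k x| <= g x) ->
  \int[mu]_(x in D) f_ k x @[k --> \oo] --> \int[mu]_(x in D) f x.
Proof.
move=> mD mf ff ig fg.
have mf' : measurable_fun D f by exact: (measurable_fun_cvg mf).
have [|||||ifi _ h] := @dominated_convergence _ _ _ mu D mD (fun k => EFin \o f_ k) (EFin \o f) (EFin \o g).
- by move=> k; exact/measurable_EFinP.
- exact/measurable_EFinP.
- apply/aeW => x Dx /=; apply: cvg_EFin; first exact: nearW.
  exact: ff.
- by [].
- by apply/aeW => x Dx k /=; rewrite lee_fin; exact: fg.
move: h; rewrite -(EFin_Rintegral mD ifi) => /fine_cvg.
exact.
Qed.

End square_integrable.

(** * Borel sets and affine changes of variables for row vectors *)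

Section lebesgue_rV_theory.
Context (R : realType).
Local Notation mu n := (lebesgue_rV R n).

Lemma measurable_box n (P : 'I_n -> set R) : (forall i, measurable (P i)) ->
  measurable [set x : 'rV[R]_n | forall i, P i (x 0 i)].
Proof.
move=> mP; rewrite (_ : [set x | _] = \bigcap_(i in setT) (fun x : 'rV[R]_n => x 0 i) @^-1` P i).
  apply: fin_bigcap_measurable => // i _; rewrite -[X in measurable X]setTI.
  exact: measurable_coord.
by apply/seteqP; split => x /= h i; [move=> _; exact: h|exact: h].
Qed.

Definition obox n (a b : 'I_n -> R) : set 'rV[R]_n := [set x | forall i, a i < x 0 i < b i].

Definition cbox n (a b : 'I_n -> R) : set 'rV[R]_n := [set x | forall i, a i <= x 0 i <= b i].

Lemma measurable_obox n (a b : 'I_n -> R) : measurable (obox a b).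
Proof.
rewrite (_ : obox a b = [set x | forall i, [set` `](a i), (b i)[] (x 0 i)]).
  by apply: (@measurable_box _ (fun i => [set` `](a i), (b i)[])) => i; exact: measurable_itv.
by apply/seteqP; split => x h i; have := h i; rewrite /= in_itv.
Qed.

(** The boxes have rational centres and half-widths 1/(m+1), enumerated by [pickle]. The closed
    boxes stay in [A], so that a smooth bump supported on such a box is a test function of [A]. *)
Lemma open_obox_cover n (A : set 'rV[R]_n) : open A ->
  exists (P : set nat) (a b : nat -> 'I_n -> R),
    (forall k, P k -> cbox (a k) (b k) `<=` A) /\ A `<=` \bigcup_(k in P) obox (a k) (b k).
Proof.
move=> oA.
pose rat_box (p : 'rV[rat]_n * nat) : ('I_n -> R) * ('I_n -> R) :=
  (fun i => ratr (p.1 0 i) - p.2.+1%:R^-1, fun i => ratr (p.1 0 i) + p.2.+1%:R^-1).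
pose ab k := if unpickle k is Some p then rat_box p else (fun=> 0, fun=> 0).
exists [set k | cbox (ab k).1 (ab k).2 `<=` A], (fun k => (ab k).1), (fun k => (ab k).2).
split=> // x Ax.
have [e /= e0 xeA] : exists2 e : R, 0 < e & ball x e `<=` A.
  by have /nbhs_ballP[e e0 h] := open_nbhs_nbhs (conj oA Ax); exists e.
have [r _ /(_ r (leqnn r)) hr] : \forall k \near \oo, k.+1%:R^-1 < e / 2 :> R.
  by apply: near_infty_natSinv_lt (PosNum _); rewrite divr_gt0.
have [s [rs s0 se]] : exists s : R, [/\ r.+1%:R^-1 = s, 0 < s & s < e / 2].
  by exists r.+1%:R^-1; split => //; rewrite invr_gt0.
have hex i : exists q : rat, ratr q \in `](x 0 i - s), (x 0 i + s)[.
  by have [|q hq] := @rat_in_itvoo R (x 0 i - s) (x 0 i + s); [lra|exists q].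
have [q hq] := choice hex.
pose p := (\row_i q i, r) : 'rV[rat]_n * nat.
have abE : ab (pickle p) = (fun i => ratr (q i) - s, fun i => ratr (q i) + s).
  by rewrite /ab pickleK /rat_box /= rs; congr (_, _); apply/funext => i; rewrite mxE.
exists (pickle p); rewrite /= abE.
  move=> y By; apply: xeA; split => // i j; rewrite ord1 /ball/=.
  by have := By j; have := hq j; rewrite /= !in_itv/= ltr_norml; lra.
by move=> i /=; have := hq i; rewrite !in_itv/=; lra.
Qed.

Lemma obox_cbox n (a b : 'I_n -> R) : obox a b `<=` cbox a b.
Proof. by move=> x h i; have /andP[/ltW -> /ltW ->] := h i. Qed.

Lemma open_bigcup_obox n (A : set 'rV[R]_n) : open A -> exists F : nat -> set 'rV[R]_n,
  A = \bigcup_k F k /\ forall k, F k = set0 \/ exists a b, F k = obox a b.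
Proof.
move=> /open_obox_cover[P [a [b [PA AP]]]].
exists (fun k => if `[< P k >] then obox (a k) (b k) else set0); split.
  apply/seteqP; split => [x /AP[k Pk h]|x [k _]]; first by exists k => //; rewrite asboolT.
  by case: ifPn => // /asboolP /PA h /obox_cbox /h.
by move=> k; case: ifPn => _; [right; exists (a k), (b k)|left].
Qed.

Lemma open_measurable_rV n (A : set 'rV[R]_n) : open A -> measurable A.
Proof.
move=> /open_bigcup_obox[F [-> hF]]; apply: bigcupT_measurable => k.
by case: (hF k) => [->|[a [b ->]]]; [exact: measurable0|exact: measurable_obox].
Qed.

(** The sigma-algebra of row vectors is defined by the coordinates. Open boxes form a family stable
    under intersection, which is what the monotone class argument of [integral_obox_eq0] needs as
    generator. *)
Lemma measurable_obox_generated n : rV_display.-measurable `<=`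
  <<s [set A : set 'rV[R]_n | exists a b, A = obox a b] >>.
Proof.
set G := [set A | _].
have sG : sigma_algebra setT <<s G >> by exact: smallest_sigma_algebra.
have oG A : open A -> <<s G >> A.
  move=> /open_bigcup_obox[F [-> hF]]; apply: (sigma_algebra_bigcup) => k.
  case: (hF k) => [->|[a [b ->]]]; first exact: sigma_algebra0.
  by apply: sub_gen_smallest; exists a, b.
apply: smallest_sub => //; rewrite -bigcup_seq; apply: bigcup_sub => i _ _ [Y mY <-].
have mi : measurable_fun [set: g_sigma_algebraType G]
    (fun x : g_sigma_algebraType G => (x : 'rV[R]_n) 0 i).
  apply: (measurability _ (RGenOpens.measurableE R)).
  move=> _ [_ [a [b ->]] <-]; rewrite setTI; apply: oG.
  have /continuousP := @coord_continuous R 1 n 0 i.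
  by apply; exact: interval_open.
by rewrite setTI -[X in <<s G >> X]setTI; exact: mi.
Qed.

Lemma continuous_measurable_rV n (f : 'rV[R]_n -> R) : continuous f -> measurable_fun setT f.
Proof.
move=> /continuousP cf; apply: (measurability _ (RGenOpens.measurableE R)).
move=> _ [_ [a [b ->]] <-]; rewrite setTI; apply: open_measurable_rV.
exact/cf/interval_open.
Qed.

Lemma ge0_integral_lebesgue_rVS n (f : 'rV[R]_n.+1 -> \bar R) :
  measurable_fun setT f -> (forall x, (0 <= f x)%E) ->
  (\int[mu n.+1]_x f x = \int[@lebesgue_measure R]_a \int[mu n]_x f (rV_cons (a, x)))%E.
Proof.
move=> mf f0.
have -> : (\int[mu n.+1]_x f x = \int[pushforward (product_measure1 (@lebesgue_measure R) (mu n)) (@rV_cons R n)]_x f x)%E by [].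
rewrite ge0_integral_pushforward//; last exact: measurable_rV_cons.
rewrite preimage_setT fubini_tonelli1//.
- by apply: measurableT_comp => //; exact: measurable_rV_cons.
- by move=> x; exact: f0.
Qed.

(** The image of Lebesgue measure under t |-> a t + b, multiplied by |a|, agrees with Lebesgue
    measure on half-open intervals, hence everywhere. A negative [a] exchanges the open and the
    closed end of the interval. *)
Lemma lebesgue_measure_affine (a b : R) (A : set R) : a != 0 -> measurable A ->
  lebesgue_measure ((fun x => a * x + b) @^-1` A) = (`|a|^-1%:E * lebesgue_measure A)%E.
Proof.
move=> a0 mA.
pose phi x := a * x + b.
have mphi : measurable_fun setT (phi : measurableTypeR R -> measurableTypeR R).
  by apply: measurable_funD => //; exact: measurable_funM.
pose k : {nonneg R} := NngNum (normr_ge0 a).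
have := @lebesgue_measure_unique R (mscale k (measure_function_pushforward__canonical__measure_function_Measure lebesgue_measure mphi)) _ A mA.
rewrite /mscale/= /pushforward -/phi => -> //.
  by rewrite muleA -EFinM mulVf ?normr_eq0// mul1e.
move=> _ [[x y] _ <-] /=.
rewrite /mscale/= /pushforward.
have [xy|yx] := ltP x y; last first.
  have -> : `]x, y]%classic = set0 by apply: set_itv_ge; rewrite bnd_simp -leNgt.
  by rewrite preimage_set0 !measure0 mule0.
have [a_gt0|a_lt0] := ltP 0 a.
  have -> : phi @^-1` `]x, y] = `]((x - b) / a), ((y - b) / a)]%classic.
    apply/seteqP; split => t /=; rewrite !in_itv/= /phi ltr_pdivrMr// ler_pdivlMr// ltrBlDr lerBrDr [t * a]mulrC//.
  rewrite !lebesgue_measure_itv/= !lte_fin xy ltr_pM2r ?invr_gt0// ltrD2r xy.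
  rewrite gtr0_norm// -!EFinB -EFinM; congr (_%:E); field.
  by rewrite gt_eqF.
have {}a_lt0 : a < 0 by rewrite lt_neqAle a0.
have -> : phi @^-1` `]x, y] = `[((y - b) / a), ((x - b) / a)[%classic.
  apply/seteqP; split => t /=; rewrite !in_itv/= /phi ltr_ndivlMr// ler_ndivrMr// ltrBlDr lerBrDr [t * a]mulrC andbC//.
rewrite !lebesgue_measure_itv/= !lte_fin xy ltr_nM2r ?invr_lt0// ltrD2r xy.
rewrite ltr0_norm// -!EFinB -EFinM; congr (_%:E); field.
by rewrite lt_eqF.
Qed.

Lemma ge0_integral_affine (a b : R) (f : measurableTypeR R -> \bar R) : a != 0 ->
  measurable_fun setT f -> (forall x, (0 <= f x)%E) ->
  (\int[lebesgue_measure]_x f (a * x + b)%R = `|a|^-1%:E * \int[lebesgue_measure]_x f x)%E.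
Proof.
move=> a0 mf f0; pose phi x := a * x + b.
have mphi : measurable_fun setT (phi : measurableTypeR R -> measurableTypeR R).
  by apply: measurable_funD => //; exact: measurable_funM.
have k0 : 0 <= `|a|^-1 by rewrite invr_ge0.
rewrite -[in LHS]/(f \o phi) -[X in (\int[_]_(_ in X) _ = _)%E](preimage_setT phi).
rewrite -(ge0_integral_pushforward mphi)//.
rewrite -[RHS](ge0_integral_mscale _ _ (NngNum k0))//.
apply: eq_measure_integral => A mA _.
exact: lebesgue_measure_affine.
Qed.

Lemma measurable_affine_rV n (a : R) (b : 'rV[R]_n) :
  measurable_fun setT (fun x : 'rV[R]_n => a *: x + b).
Proof.
apply: measurable_fun_rV => i; under eq_fun do rewrite !mxE.
by apply: measurable_funD => //; apply: measurable_funM => //; exact: measurable_coord.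
Qed.

Lemma rV_cons_affine n (a t : R) (b : 'rV[R]_n.+1) (x : 'rV[R]_n) :
  a *: rV_cons (t, x) + b = rV_cons (a * t + b 0 ord0, a *: x + \row_j b 0 (lift ord0 j)).
Proof.
by apply/rowP => i; rewrite !mxE/=; case: unliftP => [j|] ->; rewrite ?mxE.
Qed.

Lemma ge0_integral_affine_rV n (a : R) (b : 'rV[R]_n) (f : 'rV[R]_n -> \bar R) : a != 0 ->
  measurable_fun setT f -> (forall x, (0 <= f x)%E) ->
  (\int[mu n]_x f (a *: x + b)%R = (`|a| ^- n)%:E * \int[mu n]_x f x)%E.
Proof.
move=> a0; elim: n => [|n IH] in b f *.
  move=> mf f0; rewrite expr0 invr1 mul1e; apply: eq_integral => x _.
  by congr f; apply/rowP => -[].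
move=> mf f0.
have mfc t : measurable_fun setT (fun x : 'rV[R]_n => f (rV_cons (t, x))).
  apply: measurableT_comp => //.
  exact: (measurableT_comp (@measurable_rV_cons R n) (measurable_pair1 t)).
rewrite !ge0_integral_lebesgue_rVS//; last first.
  by apply: measurableT_comp => //; exact: measurable_affine_rV.
under eq_integral => t _.
  under eq_integral do rewrite rV_cons_affine.
  rewrite (IH _ (fun x => f (rV_cons (a * t + b 0 ord0, x))))//.
  over.
pose G t := (\int[mu n]_x f (rV_cons (t, x)))%E.
have mG : measurable_fun setT (G : measurableTypeR R -> \bar R).
  apply: (measurable_fun_fubini_tonelli_F (fun p => f (rV_cons p))) => //.
  by apply: measurableT_comp => //; exact: measurable_rV_cons.
have G0 t : (0 <= G t)%E by exact: integral_ge0.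
have mGa : measurable_fun setT (fun t : measurableTypeR R => G (a * t + b 0 ord0)).
  apply: (measurableT_comp mG).
  by apply: measurable_funD => //; exact: measurable_funM.
transitivity ((`|a| ^- n)%:E * \int[lebesgue_measure]_t G (a * t + b 0 ord0)%R)%E.
  by apply: (@ge0_integralZl _ (measurableTypeR R) R lebesgue_measure setT measurableT _ mGa) => //; rewrite lee_fin invr_ge0 exprn_ge0.
rewrite (ge0_integral_affine _ a0 mG G0).
by rewrite muleA -EFinM exprS invfM mulrC.
Qed.

(** Apply the nonnegative case to the positive and negative parts. If one of them has infinite
    integral, [Rintegral] takes the value 0 on both sides, so measurability of [f] is enough. *)
Lemma integral_affine_rV n (a : R) (b : 'rV[R]_n) (f : 'rV[R]_n -> R) : a != 0 ->
  measurable_fun setT f ->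
  \int[mu n]_x f (a *: x + b) = `|a| ^- n * \int[mu n]_x f x.
Proof.
move=> a0 mf; rewrite /Rintegral integralE [in RHS]integralE.
have mEf : measurable_fun setT (EFin \o f) by exact/measurable_EFinP.
have a00 : 0 < `|a| ^- n by rewrite invr_gt0 exprn_gt0// normr_gt0.
rewrite (_ : (\int[mu n]_x _)%E = (\int[mu n]_x ((EFin \o f)^\+%E (a *: x + b)%R))%E); last first.
  by apply: eq_integral => x _; rewrite !funeposE.
rewrite (_ : (\int[mu n]_x ((fun x => (f (a *: x + b)%R)%:E)^\- x))%E =
  (\int[mu n]_x ((EFin \o f)^\-%E (a *: x + b)%R))%E); last by apply: eq_integral => x _; rewrite !funenegE.
rewrite (ge0_integral_affine_rV _ a0)//; last exact: measurable_funepos.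
rewrite (ge0_integral_affine_rV _ a0)//; last exact: measurable_funeneg.
set I1 := (\int[mu n]_x _)%E; set I2 := (\int[mu n]_x _)%E.
have h1 : (0 <= I1)%E by exact: integral_ge0.
have h2 : (0 <= I2)%E by exact: integral_ge0.
have [f1 f2] : (I1 \is a fin_num \/ I1 = +oo%E) /\ (I2 \is a fin_num \/ I2 = +oo%E).
  by split; [move: I1 h1|move: I2 h2] => -[r| |] //=; [left|right|left|right].
have a00y : ((`|a| ^- n)%:E * +oo = +oo :> \bar R)%E by rewrite gt0_muley// lte_fin.
case: f1 => [f1|->]; case: f2 => [f2|->]; rewrite ?a00y/=.
- by rewrite -(fineK f1) -(fineK f2) -!EFinM -!EFinB/= mulrBr.
- by rewrite -(fineK f1) -EFinM/= mulr0.
- by rewrite -(fineK f2) -EFinM/= mulr0.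
- by rewrite mulr0.
Qed.

Lemma integrable_affine_rV n (a : R) (b : 'rV[R]_n) (f : 'rV[R]_n -> R) : a != 0 ->
  (mu n).-integrable setT (EFin \o f) ->
  (mu n).-integrable setT (EFin \o (fun x => f (a *: x + b))).
Proof.
move=> a0 /integrableP[mf fi]; apply/integrableP; split.
  apply: (measurableT_comp mf); exact: measurable_affine_rV.
rewrite (ge0_integral_affine_rV b (f := fun x => `|(f x)%:E|%E) a0)//.
  by rewrite lte_mul_pinfty// lee_fin invr_ge0 exprn_ge0.
exact: measurableT_comp.
Qed.

Lemma lebesgue_rV_box n (r : R) :
  (mu n [set x : 'rV[R]_n | forall i, (`|x 0 i| <= r)%R] < +oo)%E.
Proof.
elim: n => [|n IH].
  by apply: (@le_lt_trans _ _ 1%E); rewrite ?ltry//= diracE lee_fin; case: (_ \in _).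
have mI : measurable [set x : R | `|x| <= r].
  rewrite (_ : [set _ | _] = `[(- r), r]%classic); first exact: measurable_itv.
  by apply/seteqP; split => x /=; rewrite in_itv/= ler_norml.
set B := [set _ | _] in IH; set B' := [set x | _].
have mB : measurable B by apply: (@measurable_box _ (fun=> [set x | `|x| <= r])).
have mB' : measurable B' by apply: (@measurable_box _ (fun=> [set x | `|x| <= r])).
pose Ir : set (measurableTypeR R) := `[(- r), r]%classic.
apply: (@le_lt_trans _ _ (product_measure1 (@lebesgue_measure R) (mu n) (Ir `*` B))).
  have -> : mu n.+1 B' = product_measure1 (@lebesgue_measure R) (mu n) (@rV_cons R n @^-1` B') by [].
  apply: le_measure; rewrite ?inE.
  - rewrite -[X in measurable X]setTI; exact: measurable_rV_cons.
  - apply: measurableX => //; exact: measurable_itv.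
  move=> [t x] /= h; split => /=.
    by have := h ord0; rewrite !mxE unlift_none /Ir/= in_itv/= ler_norml.
  by move=> i; have := h (lift ord0 i); rewrite !mxE liftK.
rewrite product_measure1E//; last exact: measurable_itv.
have Iry : (lebesgue_measure Ir < +oo)%E.
  by rewrite /Ir lebesgue_measure_itv/=; case: ifP => // _; rewrite -EFinB ltry.
by rewrite lte_mul_pinfty// ge0_fin_numE.
Qed.

End lebesgue_rV_theory.

(** * Smooth functions and test functions *)

Section flat_function.
Context (R : realType).

(* [flat 0] is the standard flat function; its derivatives stay in the span
   of the family. *)
Definition flat m (t : R) : R := if 0 < t then t ^- m * expR (- t^-1) else 0.

Lemma flat_ge0 m t : 0 <= flat m t.
Proof.
rewrite /flat; case: ifP => // t0.
by rewrite mulr_ge0 ?expR_ge0// invr_ge0 exprn_ge0// ltW.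
Qed.

Lemma flat0_le1 t : flat 0 t <= 1.
Proof.
rewrite /flat; case: ifP => // t0; rewrite expr0 invr1 mul1r -expR0 ler_expR.
by rewrite oppr_le0 invr_ge0 ltW.
Qed.

Lemma flat_gt0 m t : 0 < t -> 0 < flat m t.
Proof. by move=> t0; rewrite /flat t0 mulr_gt0 ?expR_gt0// invr_gt0 exprn_gt0. Qed.

Lemma flat_eq0 m t : t <= 0 -> flat m t = 0.
Proof. by rewrite /flat leNgt => /negbTE ->. Qed.

(** From exp(x) >= x^N / N! with x = 1/t and N = m + k + 1. Any power of t can thus be gained at
    0. *)
Lemma flat_le m k t : 0 < t -> flat m t <= (m + k.+1)`!%:R * t ^+ k.+1.
Proof.
move=> t0; rewrite /flat t0 expRN -invfM.
have tm : 0 < t ^+ m by rewrite exprn_gt0.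
have tk : 0 < t ^+ (m + k.+1) by rewrite exprn_gt0.
have f0 : 0 < (m + k.+1)`!%:R :> R by rewrite ltr0n fact_gt0.
rewrite invfM ler_pdivrMl// mulrCA -exprD.
rewrite -ler_pdivrMr ?mulr_gt0// ler_pdivrMl ?expR_gt0//.
have := @expR_ge1Dxn R t^-1 (m + k) ; rewrite -addnS exprVn => /(_ _).
rewrite invr_ge0 => /(_ (ltW t0)) h.
by rewrite -ler_pdivrMr//; apply: le_trans h; rewrite lerDr ler01.
Qed.

(** The derivative of t^-m exp(-1/t) is -m t^-(m+1) exp(-1/t) + t^-(m+2) exp(-1/t), again a
    combination of the family. At 0 the difference quotient tends to 0 by [flat_le] with the power
    t^2. *)
Lemma is_derive_flat m (t : R) :
  is_derive t 1 (flat m) (- m%:R * flat m.+1 t + flat m.+2 t).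
Proof.
have [t0|t0|->] := ltgtP t 0.
- rewrite !flat_eq0 ?(ltW t0)// mulr0 addr0.
  apply: (@near_eq_is_derive _ _ _ (cst 0)); rewrite ?oner_eq0//.
  near=> s; rewrite /cst flat_eq0//; apply: ltW; near: s.
  by apply: lt_nbhsl.
- have tn : t != 0 by rewrite gt_eqF.
  have dV : is_derive t (1 : R) (GRing.inv : R -> R) (- t ^- 2).
    have did : derivable (id : R -> R) t 1 by exact: derivable_id.
    apply: DeriveDef; first exact: (@derivableV _ _ id t 1 tn did).
    by have := @deriveV _ _ id t 1 tn did; rewrite derive_id /GRing.scale/= mulr1.
  have dNV : is_derive t (1 : R) (fun s : R => - s^-1) (t ^- 2).
    by apply: is_derive_eq; rewrite opprK.
  have dE : is_derive t (1 : R) (fun s : R => expR (- s^-1)) (expR (- t^-1) * t ^- 2).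
    exact: (@is_derive1_comp _ expR (fun s => - s^-1)).
  have dX : is_derive t (1 : R) (fun s : R => s^-1 ^+ m) (m%:R * t^-1 ^+ m.-1 * - t ^- 2).
    rewrite (_ : (fun s : R => s^-1 ^+ m) = (GRing.inv : R -> R) ^+ m).
      exact: (is_derive_eq (is_deriveX m dV)).
    by apply/funext => s; rewrite exprfctE.
  have dF : is_derive t (1 : R) (fun s : R => s^-1 ^+ m * expR (- s^-1))
      (- m%:R * flat m.+1 t + flat m.+2 t).
    apply: is_derive_eq; rewrite /GRing.scale/= /flat t0.
    rewrite -[t ^- m.+2]exprVn -[t ^- m.+1]exprVn -[t ^- 2]exprVn addrC.
    by case: m {dX} => [|k]; rewrite ?(mul0r,mulr0,oppr0) /= ?exprS; ring.
  apply: (near_eq_is_derive _ dF); rewrite ?oner_eq0//.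
  near=> s; rewrite /flat exprVn ifT//; near: s.
  by apply: lt_nbhsr.
- rewrite !flat_eq0// mulr0 addr0.
  have c : (fun h : R => h^-1 *: ((flat m \o shift (0 : R)) (h *: 1) - flat m 0)) @ 0^' --> (0 : R).
    rewrite flat_eq0//; apply/cvgrPdist_le => e e0.
    pose C : R := (m + 2)`!%:R; have C0 : 0 < C by rewrite ltr0n fact_gt0.
    near=> h; rewrite /= subr0 addr0 sub0r normrN /GRing.scale/= mulr1.
    have [h0|h0] := leP h 0; first by rewrite flat_eq0// mulr0 normr0 ltW.
    rewrite ger0_norm ?mulr_ge0 ?flat_ge0 ?invr_ge0 ?(ltW h0)// ler_pdivrMl//.
    apply: (le_trans (flat_le m 1 h0)); rewrite expr2 mulrCA ler_pM2l// -/C.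
    rewrite mulrC -ler_pdivlMr//; apply: le_trans (ler_norm h) _.
    near: h; apply: dnbhs0_le; exact: divr_gt0.
  apply: DeriveDef; last exact/cvg_lim.
  by apply/cvg_ex; exists 0.
Unshelve. all: by end_near. Qed.

End flat_function.

Section smooth.
Context (R : realType) (d : nat).
Local Notation E := 'rV[R]_d.
Implicit Types (f g : E -> R) (B : (E -> R) -> Prop).

(** Smoothness asks for differentiability of all iterated partial derivatives. This algebra is
    stable under partial derivatives as soon as those of the generators [B] stay in it, so one
    differentiability check for its members yields smoothness ([smooth_alg_smooth]). *)
Inductive smooth_alg B : (E -> R) -> Prop :=
| smooth_alg_base f : B f -> smooth_alg B f
| smooth_alg_cst c : smooth_alg B (fun=> c)
| smooth_alg_add f g : smooth_alg B f -> smooth_alg B g ->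
    smooth_alg B (fun x => f x + g x)
| smooth_alg_mul f g : smooth_alg B f -> smooth_alg B g ->
    smooth_alg B (fun x => f x * g x)
| smooth_alg_flat m f : smooth_alg B f -> smooth_alg B (fun x => flat m (f x)).

Lemma partial_cst i c : partial i (fun=> c : R) = (fun=> 0) :> (E -> R).
Proof. by apply/funext => x; rewrite /partial derive_cst. Qed.

Lemma partialD i f g : (forall x, differentiable f x) -> (forall x, differentiable g x) ->
  partial i (fun x => f x + g x) = fun x => partial i f x + partial i g x.
Proof.
by move=> df dg; apply/funext => x; apply: (deriveD (diff_derivable _) (diff_derivable _)).
Qed.

Lemma partialM i f g : (forall x, differentiable f x) -> (forall x, differentiable g x) ->
  partial i (fun x => f x * g x) = fun x => f x * partial i g x + g x * partial i f x.
Proof.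
by move=> df dg; apply/funext => x; apply: (deriveM (diff_derivable _) (diff_derivable _)).
Qed.

Lemma differentiable_flat m (t : R) : differentiable (@flat R m) t.
Proof. by apply/derivable1_diffP; have [] := is_derive_flat m t. Qed.

Lemma partial_flat i m f : (forall x, differentiable f x) ->
  partial i (fun x => flat m (f x)) =
  fun x => (- m%:R * flat m.+1 (f x) + flat m.+2 (f x)) * partial i f x.
Proof.
move=> df; apply/funext => x; rewrite /partial.
have dc : differentiable (@flat R m \o f) x.
  by apply: differentiable_comp => //; exact: differentiable_flat.
rewrite -[LHS]/('D_(delta_mx 0 i) (flat m \o f) x) deriveE// diff_comp//; last exact: differentiable_flat.
rewrite deriveE//= diff1E; last exact: differentiable_flat.
by have [_ h] := is_derive_flat m (f x); rewrite derive1E h; exact: mulrC.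
Qed.

Lemma smooth_alg_smooth B :
  (forall f, B f -> (forall x, differentiable f x) /\ forall i, smooth_alg B (partial i f)) ->
  forall f, smooth_alg B f -> smooth f.
Proof.
move=> hB.
have key f : smooth_alg B f -> (forall x, differentiable f x) /\ forall i, smooth_alg B (partial i f).
  elim=> {f} [f /hB //|c|f g _ [df pf] _ [dg pg]|f g hf [df pf] hg [dg pg]|m f hf [df pf]].
  - split => // i; rewrite partial_cst; exact: smooth_alg_cst.
  - split => [x|i]; first exact: (differentiableD (df x) (dg x)).
    by rewrite partialD//; exact: smooth_alg_add.
  - split => [x|i]; first exact: (differentiableM (df x) (dg x)).
    by rewrite partialM//; apply: smooth_alg_add; exact: smooth_alg_mul.
  - split => [x|i].
      by apply: (@differentiable_comp _ _ _ _ f (flat m)) => //; exact: differentiable_flat.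
    rewrite partial_flat//; apply: smooth_alg_mul => //; apply: smooth_alg_add.
      by apply: smooth_alg_mul; [exact: smooth_alg_cst|exact: smooth_alg_flat].
    exact: smooth_alg_flat.
move=> f hf s; have {hf} : smooth_alg B (foldr (@partial R d) f s).
  elim: s => //= i s IH; by have [] := key _ IH.
by move=> /key[].
Qed.

Lemma smooth_differentiable f : smooth f -> forall x, differentiable f x.
Proof. by move=> sf x; exact: (sf [::] x). Qed.

Lemma smooth_partial i f : smooth f -> smooth (partial i f).
Proof. by move=> sf s x; have := sf (rcons s i) x; rewrite foldr_rcons. Qed.

Lemma smooth_alg_of_smooth f : smooth_alg (@smooth R d) f -> smooth f.
Proof.
apply: smooth_alg_smooth => g sg; split => [|i]; first exact: smooth_differentiable.
by apply: smooth_alg_base; exact: smooth_partial.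
Qed.

Lemma smooth_cst (c : R) : smooth (fun _ : E => c).
Proof. by apply: smooth_alg_of_smooth; exact: smooth_alg_cst. Qed.

Lemma smoothD f g : smooth f -> smooth g -> smooth (fun x => f x + g x).
Proof.
by move=> sf sg; apply: smooth_alg_of_smooth; apply: smooth_alg_add; exact: smooth_alg_base.
Qed.

Lemma smoothM f g : smooth f -> smooth g -> smooth (fun x => f x * g x).
Proof.
by move=> sf sg; apply: smooth_alg_of_smooth; apply: smooth_alg_mul; exact: smooth_alg_base.
Qed.

Lemma smooth_flat m f : smooth f -> smooth (fun x => flat m (f x)).
Proof.
by move=> sf; apply: smooth_alg_of_smooth; apply: smooth_alg_flat; exact: smooth_alg_base.
Qed.

Lemma smooth_prod (J : Type) (r : seq J) (F : J -> E -> R) :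
  (forall j, smooth (F j)) -> smooth (fun x => \prod_(j <- r) F j x).
Proof.
move=> sF; elim: r => [|j r IH].
  by under eq_fun do rewrite big_nil; exact: smooth_cst.
by under eq_fun do rewrite big_cons; exact: smoothM.
Qed.

Lemma smooth_sum (J : Type) (r : seq J) (F : J -> E -> R) :
  (forall j, smooth (F j)) -> smooth (fun x => \sum_(j <- r) F j x).
Proof.
move=> sF; elim: r => [|j r IH].
  by under eq_fun do rewrite big_nil; exact: smooth_cst.
by under eq_fun do rewrite big_cons; exact: smoothD.
Qed.

Lemma partial_coord i j : partial i (fun x : E => x 0 j) = fun=> (i == j)%:R.
Proof.
apply/funext => x; rewrite /partial deriveE//; last exact: differentiable_coord.
have @f : {linear 'rV[R]_d -> R}.
  by exists (fun N : 'rV[R]_d => N 0 j); do 2![eexists]; do ?[constructor];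
     rewrite ?mxE// => ? *; rewrite ?mxE//; move=> ?; rewrite !mxE.
rewrite (_ : (fun x : E => x 0 j) = f)// diff_lin//.
  by rewrite /f/= mxE eqxx andTb eq_sym.
exact: coord_continuous.
Qed.

Lemma smooth_coord j : smooth (fun x : E => x 0 j).
Proof.
apply: (@smooth_alg_smooth (fun f => f = fun x => x 0 j)); last exact: smooth_alg_base.
move=> f ->; split => [x|i]; first exact: differentiable_coord.
rewrite partial_coord; exact: smooth_alg_cst.
Qed.

Lemma diff_rV_affine (a : R) (b x : E) : differentiable (fun y : E => a *: y + b) x.
Proof. by []. Qed.

Lemma partial_affine i (a : R) (b : E) f : (forall x, differentiable f x) ->
  partial i (fun x => f (a *: x + b)) = fun x => a * partial i f (a *: x + b).
Proof.
move=> df; apply/funext => x; rewrite /partial.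
have dA : differentiable (fun y : E => a *: y + b) x by exact: diff_rV_affine.
rewrite -[LHS]/('D_(delta_mx 0 i) (f \o (fun y => a *: y + b)) x) deriveE//; last exact: differentiable_comp.
rewrite diff_comp// /= deriveE//.
have -> : 'd (fun y : E => a *: y + b) x = (fun v => a *: v) :> (E -> E).
  by rewrite diff_val; apply/funext => v; rewrite /= addr0.
by rewrite linearZ.
Qed.

Lemma smooth_affine (a : R) (b : E) f : smooth f -> smooth (fun x => f (a *: x + b)).
Proof.
move=> sf; pose B g := exists2 h, smooth h & g = fun x => h (a *: x + b).
apply: (@smooth_alg_smooth B); last by apply: smooth_alg_base; exists f.
move=> _ [h sh ->]; split => [x|i].
  apply: (@differentiable_comp _ _ _ _ (fun x => a *: x + b) h) => //.
  exact: smooth_differentiable.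
rewrite partial_affine; last exact: smooth_differentiable.
apply: smooth_alg_mul; first exact: smooth_alg_cst.
by apply: smooth_alg_base; exists (partial i h) => //; exact: smooth_partial.
Qed.

End smooth.

Section test_functions.
Context (R : realType) (d : nat).
Local Notation E := 'rV[R]_d.
Implicit Types (omega A : set E) (phi f : E -> R).

Lemma rV_normP (x : E) (e : R) : 0 <= e -> (`|x| <= e) <-> (forall i, `|x 0 i| <= e).
Proof.
move=> e0; rewrite {1}/Num.norm/= mx_normrE; split.
  move=> /bigmax_leP[_ h] i; exact: (h (0, i)).
by move=> h; apply/bigmax_leP; split => // -[j i] _ /=; rewrite ord1.
Qed.

Lemma ler_coord (x : E) i : `|x 0 i| <= `|x|.
Proof. by move: i; apply/rV_normP. Qed.

Lemma test_function_smooth omega phi : test_function omega phi -> smooth phi.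
Proof. by case. Qed.

Lemma smooth_continuous f : smooth f -> continuous f.
Proof. by move=> sf x; apply: differentiable_continuous; exact: smooth_differentiable. Qed.

Lemma test_functionS omega A phi : omega `<=` A -> test_function omega phi -> test_function A phi.
Proof.
move=> sub [sphi [K [cK Ko K0]]]; split => //; exists K; split => //.
exact: subset_trans sub.
Qed.

Lemma partial_support (K : set E) phi i x : closed K -> (forall y, ~ K y -> phi y = 0) ->
  ~ K x -> partial i phi x = 0.
Proof.
move=> cK K0 Kx; rewrite /partial (near_eq_derive _ (g := cst 0)) ?derive_cst//.
have : nbhs x (~` K) by apply: open_nbhs_nbhs; split => //; exact: closed_openC.
by apply: filterS => y /K0.
Qed.

Lemma compact_closed_rV (K : set E) : compact K -> closed K.
Proof. by move=> cK; apply: compact_closed => //; exact: norm_hausdorff. Qed.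

Lemma test_function_partial omega phi i : test_function omega phi -> test_function omega (partial i phi).
Proof.
move=> [sphi [K [cK Ko K0]]]; split; first exact: smooth_partial.
exists K; split => // x Kx.
by apply: partial_support K0 Kx; exact: compact_closed_rV.
Qed.

Lemma test_function_bounded omega phi : test_function omega phi ->
  exists2 C : R, 0 < C & forall x, `|phi x| <= C.
Proof.
move=> [sphi [K [cK Ko K0]]].
have cphi : continuous (fun x => `|phi x|).
  by move=> x; have /cvg_norm := smooth_continuous sphi (x := x); exact.
have [K0'|/set0P[y Ky]] := eqVneq K set0.
  by exists 1 => // x; rewrite K0 ?normr0// K0'.
have [||c Kc hc] := @compact_EVT_max _ _ (fun x => `|phi x|) K _ cK.
- by exists y.
- exact: continuous_subspaceT.
exists (`|phi c| + 1); first by rewrite ltr_wpDl.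
move=> x; have [Kx|Kx] := pselect (K x).
  by apply: (le_trans (hc _ _)); rewrite ?inE// lerDl.
by rewrite K0// normr0 addr_ge0.
Qed.

Lemma test_functionL omega a phi psi : test_function omega phi -> test_function omega psi ->
  test_function omega (fun x => a * phi x + psi x).
Proof.
move=> [sphi [K [cK Ko K0]]] [spsi [K' [cK' Ko' K0']]]; split.
  by apply: smoothD => //; apply: smoothM => //; exact: smooth_cst.
exists (K `|` K'); split; first exact: compactU.
  by move=> x [/Ko|/Ko'].
by move=> x h; rewrite K0 ?K0' ?mulr0 ?addr0// => ?; apply: h; [right|left].
Qed.

Lemma test_functionM omega f phi : smooth f -> test_function omega phi ->
  test_function omega (fun x => f x * phi x).
Proof.
move=> sf [sphi [K [cK Ko K0]]]; split; first exact: smoothM.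
by exists K; split => // x /K0 ->; rewrite mulr0.
Qed.

Lemma test_function0 omega : test_function omega (fun=> 0).
Proof.
split; first exact: smooth_cst.
by exists set0; split => //; exact: compact0.
Qed.

Lemma diff_partial f x (v : E) : differentiable f x -> 'D_v f x = \sum_i v 0 i * partial i f x.
Proof.
move=> df; rewrite deriveE//.
rewrite {1}(matrix_sum_delta v) big_ord1 linear_sum; apply: eq_bigr => i _.
by rewrite linearZ /= /partial deriveE.
Qed.

(* Along the segment from x to x + h, by the mean value theorem. *)
Lemma is_derive_line f (x h : E) (t : R) : (forall y, differentiable f y) ->
  is_derive t (1 : R) (fun s : R => f (x + s *: h)) (\sum_i h 0 i * partial i f (x + t *: h)).
Proof.
move=> df.
have dl : is_diff t (fun s : R => x + s *: h) (0 + ( *:%R ^~ h)).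
  exact: (is_diffD (is_diff_cst x t) (is_diff_scalel t h)).
have dfl : is_diff t (f \o (fun s : R => x + s *: h)) ('d f (x + t *: h) \o (0 + ( *:%R ^~ h))).
  apply: is_diff_comp; exact: differentiableP.
have dd : derivable (fun s : R => f (x + s *: h)) t 1 by apply/derivable1_diffP; exact: ex_diff.
apply: DeriveDef => //.
rewrite deriveE; last exact/derivable1_diffP.
by rewrite diff_val /= /GRing.add /= add0r scale1r -deriveE// diff_partial.
Qed.

Lemma mean_value f x h : (forall y, differentiable f y) ->
  exists2 c : R, 0 <= c <= 1 & f (x + h) - f x = \sum_i h 0 i * partial i f (x + c *: h).
Proof.
move=> df; have dg s := is_derive_line x h s df.
have [|c c01 hc] := @MVT_segment _ (fun s : R => f (x + s *: h))
    (fun s => \sum_i h 0 i * partial i f (x + s *: h)) 0 1 ler01.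
- apply: continuous_subspaceT => s; apply: differentiable_continuous.
  by apply/derivable1_diffP; have [] := dg s.
exists c; first by move: c01; rewrite in_itv.
by rewrite -[RHS]mulr1 -[X in _ * X](subr0 (1 : R)) -hc scale1r scale0r addr0.
Qed.

Lemma ler_sum_coord (h : E) (F : 'I_d -> R) (C : R) : (forall i, `|F i| <= C) ->
  `|\sum_i h 0 i * F i| <= d%:R * C * `|h|.
Proof.
move=> FC; apply: (le_trans (ler_norm_sum _ _ _)).
apply: (@le_trans _ _ (\sum_(i < d) C * `|h|)).
  apply: ler_sum => i _; rewrite normrM mulrC; apply: ler_pM => //; exact: ler_coord.
by rewrite sumr_const card_ord -[leLHS]mulr_natl mulrA.
Qed.

Lemma lipschitz_partial f (C : R) : (forall y, differentiable f y) ->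
  (forall i x, `|partial i f x| <= C) ->
  forall x h, `|f (x + h) - f x| <= d%:R * C * `|h|.
Proof.
move=> df fC x h; have [c _ ->] := mean_value x h df.
by apply: ler_sum_coord.
Qed.

Lemma taylor_partial f (C : R) : smooth f ->
  (forall i j x, `|partial j (partial i f) x| <= C) ->
  forall x h, `|f (x + h) - f x - \sum_i h 0 i * partial i f x| <= d%:R ^+ 2 * C * `|h| ^+ 2.
Proof.
move=> sf fC x h; have [c /andP[c0 c1] ->] := mean_value x h (smooth_differentiable sf).
rewrite -sumrB; under eq_bigr do rewrite -mulrBr.
have -> : d%:R ^+ 2 * C * `|h| ^+ 2 = d%:R * (d%:R * C * `|h|) * `|h| by ring.
apply: ler_sum_coord => i.
apply: (le_trans (@lipschitz_partial _ C _ _ _ _)).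
- by apply: smooth_differentiable; exact: smooth_partial.
- by move=> j y; exact: fC.
rewrite normrZ; have C0 : 0 <= C by exact: le_trans (normr_ge0 _) (fC i i x).
by rewrite ler_wpM2l ?mulr_ge0// ler_piMl// ger0_norm.
Qed.

End test_functions.

(** * Integration by parts and the fundamental lemma of the calculus of variations *)

Section L2_theory.
Context (R : realType) (d : nat).
Local Notation E := 'rV[R]_d.
Local Notation mu := (lebesgue_rV R d).
Implicit Types (omega A B : set E) (w v phi f g : E -> R).

(** Passes from the extension by zero, through which [L2] is stated, to measurability and square
    integrability on [omega]. *)
Lemma L2P omega w : measurable omega -> L2 omega w <-> sqint mu omega w.
Proof.
move=> mo; have mr := measurable_restrictT w mo.
have sqE : (fun x => (w \_ omega) x ^+ 2) = (fun x => w x ^+ 2) \_ omega.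
  by apply/funext => x; rewrite !patchE; case: ifP => //; rewrite expr0n.
split.
  move=> Lw; have := Lfun2_integrable_sqr Lw.
  rewrite sqE => i2; split.
    by apply/mr; move: Lw; rewrite /L2 => /andP[+ _]; rewrite inE.
  by apply/(integrable_mkcond _ mo); rewrite restrict_EFin.
move=> [mw i2]; apply/andP; split; rewrite inE/=; first exact/mr.
rewrite /finite_norm unlock; apply: poweR_lty.
under eq_integral => x _ do rewrite /= powR_mulrn// real_normK ?num_real//.
have /integrable_mkcond := i2 => /(_ mo)/integrableP[_].
apply: le_lt_trans; apply: ge0_le_integral => //.
- by move=> x _; rewrite lee_fin sqr_ge0.
- apply/measurable_EFinP; apply: measurable_funX; exact/mr.
- apply: measurableT_comp => //; apply/(measurable_restrictT _ mo).
  by apply/measurable_EFinP; exact: measurable_funX.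
move=> x _; rewrite -[leLHS]/((((w \_ omega) x) ^+ 2)%:E) patchE [in leRHS]patchE.
case: ifP => _ /=; first by rewrite lee_fin ler_norm.
by rewrite normr0 -[point]/(0 : R) expr0n.
Qed.

Lemma bounded_support_integrable B f (C : R) : measurable B -> (mu B < +oo)%E ->
  measurable_fun setT f -> (forall x, `|f x| <= C) -> (forall x, ~ B x -> f x = 0) ->
  mu.-integrable setT (EFin \o f).
Proof.
move=> mB Boo mf fC f0.
have iB : mu.-integrable B (EFin \o f).
  apply: measurable_bounded_integrable => //; first exact: measurable_funTS.
  exists C; split; first exact: num_real.
  by move=> M CM x _ /=; apply: (le_trans (fC x)); exact: ltW.
have /(integrable_mkcond _ mB) : mu.-integrable B (EFin \o f) by [].
apply: eq_integrable => // x _; rewrite patchE; case: ifPn => //.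
by rewrite notin_setE => /f0 /= ->.
Qed.

Lemma bounded_support_integral B f (C : R) : measurable B -> (mu B < +oo)%E ->
  measurable_fun setT f -> (forall x, `|f x| <= C) -> (forall x, ~ B x -> f x = 0) ->
  `|\int[mu]_x f x| <= C * fine (mu B).
Proof.
move=> mB Boo mf fC f0.
have fi := bounded_support_integrable mB Boo mf fC f0.
have -> : \int[mu]_x f x = \int[mu]_(x in B) f x.
  rewrite [RHS]Rintegral_mkcond; apply: eq_Rintegral => x _.
  by rewrite patchE; case: ifPn => //; rewrite notin_setE => /f0.
have iB : mu.-integrable B (EFin \o f) by exact: integrableS fi.
apply: (le_trans (le_normr_Rintegral mB iB)).
rewrite -Rintegral_cst//; apply: le_Rintegral => //; first exact: integrable_norm.
apply: measurable_bounded_integrable => //.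
exists `|C|; split; [exact: num_real|move=> M CM x _ /=; exact: ltW].
Qed.

Lemma compact_box (K : set E) : compact K -> exists2 r : R, 0 < r &
  forall x, K x -> forall i, `|x 0 i| <= r.
Proof.
move=> /compact_bounded[N [_ hN]]; exists (`|N| + 1); first by rewrite ltr_wpDl.
move=> x Kx i; apply: (le_trans (ler_coord x i)); apply: hN => //.
by rewrite ltr_pwDr// ler_norm.
Qed.

Local Notation cube r := [set x : E | forall i, `|x 0 i| <= r].

Lemma measurable_cube (r : R) : measurable (cube r).
Proof.
apply: (@measurable_box _ _ (fun=> [set x | `|x| <= r])) => i.
rewrite (_ : [set _ | _] = `[(- r), r]%classic); first exact: measurable_itv.
by apply/seteqP; split => x /=; rewrite in_itv/= ler_norml.
Qed.

Lemma measurable_smooth f : smooth f -> measurable_fun setT f.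
Proof. by move=> sf; apply: continuous_measurable_rV; exact: smooth_continuous. Qed.

Lemma test_function_integrable omega phi : test_function omega phi ->
  mu.-integrable setT (EFin \o phi).
Proof.
move=> tp; have [C C0 hC] := test_function_bounded tp.
have [sp [K [cK _ K0]]] := tp; have [r r0 hr] := compact_box cK.
apply: (bounded_support_integrable (measurable_cube r) (lebesgue_rV_box d r) _ hC).
  exact: measurable_smooth.
by move=> x h; apply: K0 => Kx; apply: h => i; exact: hr.
Qed.

(** Translation invariance: phi(x + t e_i) and phi(x) have the same integral, so t times the
    integral of the partial derivative is the integral of a Taylor remainder, which is O(t^2) on a
    fixed cube. Divide by t and let t tend to 0. *)
Lemma integral_partial omega phi i : test_function omega phi ->
  \int[mu]_x partial i phi x = 0.
Proof.
move=> tp; have tpi := test_function_partial i tp.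
have [sp [K [cK _ K0]]] := tp; have [r r0 hr] := compact_box cK.
have mp := measurable_smooth sp; have mpi := measurable_smooth (smooth_partial i sp).
have [C C0 hC] : exists2 C : R, 0 < C & forall j k x, `|partial k (partial j phi) x| <= C.
  have h (jk : 'I_d * 'I_d) : exists C : R, 0 < C /\ forall x, `|partial jk.2 (partial jk.1 phi) x| <= C.
    have [C C0 hC] := test_function_bounded (test_function_partial jk.2 (test_function_partial jk.1 tp)).
    by exists C.
  have [C hC] := choice h.
  exists (1 + \sum_jk C jk).
    by rewrite ltr_pwDl// sumr_ge0// => jk _; apply: ltW; have [] := hC jk.
  move=> j k x; have [_ h1] := hC (j, k); apply: (le_trans (h1 x)).
  rewrite (bigD1 (j, k))//= addrCA lerDl addr_ge0// sumr_ge0// => jk _.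
  by apply: ltW; have [] := hC jk.
pose C' := d%:R ^+ 2 * C; have C'0 : 0 <= C' by rewrite mulr_ge0 ?exprn_ge0// ltW.
pose m := fine (mu (cube (r + 1))).
have m0 : 0 <= m by exact: fine_ge0.
have key t : 0 < t <= 1 -> `|\int[mu]_x partial i phi x| <= t * (C' * m).
  move=> /andP[t0 t1].
  pose h : E := t *: delta_mx 0 i.
  have nh : `|h| <= t.
    apply/rV_normP; first exact: ltW.
    move=> j; rewrite !mxE eqxx/=; case: (j == i); rewrite ?mulr1 ?mulr0 ?normr0 ?(ltW t0)//.
    by rewrite gtr0_norm.
  have sumE x : \sum_j h 0 j * partial j phi x = t * partial i phi x.
    rewrite (bigD1 i)//= !mxE !eqxx/= mulr1 big1 ?addr0// => j ji.
    by rewrite !mxE eqxx/= (negbTE ji) mulr0 mul0r.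
  pose g x := phi (x + h) - phi x - t * partial i phi x.
  have mph : measurable_fun setT (fun x : E => phi (x + h)).
    apply: (measurableT_comp mp); have := @measurable_affine_rV R d 1 h.
    by under eq_fun do rewrite scale1r.
  have mg : measurable_fun setT g.
    by apply: measurable_funB; [exact: measurable_funB|exact: measurable_funM].
  have gC x : `|g x| <= C' * t ^+ 2.
    have := taylor_partial sp hC x h; rewrite sumE => /le_trans; apply.
    by rewrite -/C' ler_wpM2l// lerXn2r// nnegrE ?(ltW t0).
  have out x : ~ cube (r + 1) x -> phi x = 0 /\ phi (x + h) = 0.
    move=> nx; split; apply: K0 => Kx; apply: nx => j.
      by apply: (le_trans (hr _ Kx j)); rewrite lerDl.
    have := hr _ Kx j; rewrite mxE => h1.
    have h2 : `|h 0 j| <= t by apply: le_trans nh; exact: ler_coord.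
    have -> : x 0 j = (x 0 j + h 0 j) - h 0 j by rewrite addrK.
    by apply: (le_trans (ler_normB _ _)); lra.
  have g0 x : ~ cube (r + 1) x -> g x = 0.
    move=> nx; rewrite /g; have [-> ->] := out _ nx.
    suff -> : partial i phi x = 0 by rewrite mulr0 !subrr.
    have nK : ~ K x.
      by move=> Kx; apply: nx => j; apply: (le_trans (hr _ Kx j)); rewrite lerDl.
    exact: (partial_support i (compact_closed_rV cK) K0 nK).
  have := bounded_support_integral (measurable_cube (r + 1)) (lebesgue_rV_box d (r + 1)) mg gC g0.
  have -> : \int[mu]_x g x = - (t * \int[mu]_x partial i phi x).
    have ip := test_function_integrable tp; have ipi := test_function_integrable tpi.
    have iph : mu.-integrable setT (EFin \o (fun x : E => phi (x + h))).
      have := integrable_affine_rV h (oner_neq0 _) ip.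
      by apply: eq_integrable => // x _ /=; rewrite scale1r.
    rewrite RintegralB//; last 2 first.
    - exact: (integrableB measurableT iph ip).
    - exact: (integrableZl measurableT t ipi).
    rewrite RintegralB// RintegralZl//.
    have := integral_affine_rV h (oner_neq0 R) mp.
    under eq_Rintegral do rewrite scale1r.
    by rewrite normr1 expr1n invr1 mul1r => ->; rewrite subrr sub0r.
  rewrite normrN normrM gtr0_norm// -/m => h1.
  by rewrite -(ler_pM2l t0); apply: (le_trans h1); rewrite expr2; nra.
set a := \int[mu]_x _ in key *; apply/eqP; rewrite -normr_eq0; apply/eqP.
have C'm : 0 <= C' * m by exact: mulr_ge0.
apply/eqP; rewrite eq_le normr_ge0 andbT; apply/ler_addgt0Pr => e e0; rewrite add0r.
pose t := Num.min 1 (e / (C' * m + 1)).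
have t0 : 0 < t by rewrite lt_min ltr01 divr_gt0// ltr_wpDl.
have /key /le_trans : 0 < t <= 1 by rewrite t0 ge_min lexx.
apply; apply: (@le_trans _ _ (e / (C' * m + 1) * (C' * m))).
  by apply: ler_wpM2r => //; rewrite ge_min lexx orbT.
by rewrite mulrAC -mulrA ler_piMr ?(ltW e0)// ler_pdivrMr ?ltr_wpDl// mul1r lerDl.
Qed.

Lemma compact_cbox (a b : 'I_d -> R) : compact (cbox a b).
Proof.
rewrite (_ : @cbox R d a b = [set v : 'rV[R]_d | forall i, [set` `[(a i), (b i)]] (v ord0 i)]).
  by apply: (@rV_compact _ d (fun i => `[(a i), (b i)]%classic)) => i; exact: segment_compact.
by apply/seteqP; split => x h i; have := h i; rewrite /= in_itv.
Qed.

(* Increases to the indicator function of the open box as k goes to infinity. *)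
Definition box_bump (k : R) (a b : 'I_d -> R) (x : E) : R :=
  \prod_i (flat 0 (k * (x 0 i - a i)) * flat 0 (k * (b i - x 0 i))).

Lemma smooth_bump k a b : smooth (box_bump k a b).
Proof.
apply: smooth_prod => i; apply: smoothM; apply: smooth_flat; apply: smoothM;
  do ?[exact: smooth_cst].
- apply: smoothD; [exact: smooth_coord|exact: smooth_cst].
- apply: smoothD; first exact: smooth_cst.
  have := smoothM (@smooth_cst R d (-1)) (@smooth_coord R d i).
  by under eq_fun do rewrite mulN1r.
Qed.

Lemma bump_ge0 k a b x : 0 <= box_bump k a b x.
Proof. by apply: prodr_ge0 => i _; rewrite mulr_ge0// flat_ge0. Qed.

Lemma bump_le1 k a b x : box_bump k a b x <= 1.
Proof.
suff /andP[] : 0 <= box_bump k a b x <= 1 by [].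
apply: (big_ind (fun y => 0 <= y <= 1)) => [|y z /andP[y0 y1] /andP[z0 z1]|i _].
- by rewrite ler01 lexx.
- by rewrite mulr_ge0//= mulr_ile1.
- by rewrite mulr_ge0 ?flat_ge0//= mulr_ile1 ?flat_ge0 ?flat0_le1.
Qed.

Lemma bump_gt0 k a b x : 0 < k -> obox a b x -> 0 < box_bump k a b x.
Proof.
move=> k0 h; apply: prodr_gt0 => i _; have /andP[h1 h2] := h i.
by rewrite mulr_gt0// flat_gt0// mulr_gt0// subr_gt0.
Qed.

Lemma bump_eq0 k a b x : 0 <= k -> ~ obox a b x -> box_bump k a b x = 0.
Proof.
move=> k0 /existsNP[i] h; rewrite /box_bump (bigD1 i)//=.
have [ax|xa] := ltP (a i) (x 0 i); last by rewrite flat_eq0 ?mul0r// mulr_ge0_le0// subr_le0.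
have [xb|bx] := ltP (x 0 i) (b i); first by exfalso; apply: h; rewrite ax xb.
by rewrite [flat 0 (k * (b i - _))]flat_eq0 ?mulr0 ?mul0r// mulr_ge0_le0// subr_le0.
Qed.

Lemma test_bump omega k a b : 0 <= k -> cbox a b `<=` omega -> test_function omega (box_bump k a b).
Proof.
move=> k0 sub; split; first exact: smooth_bump.
exists (cbox a b); split => //; first exact: compact_cbox.
by move=> x h; apply: bump_eq0 => // h1; apply: h => i; have /andP[/ltW -> /ltW ->] := h1 i.
Qed.

Lemma bump_cvg a b x : box_bump k%:R a b x @[k --> \oo] --> (\1_(obox a b) x : R).
Proof.
have [h|h] := pselect (obox a b x); last first.
  rewrite indicE memNset//.
  rewrite (_ : (fun k => _) = (fun=> 0)); first exact: cvg_cst.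
  by apply/funext => k; rewrite bump_eq0.
rewrite indicE mem_set//.
have fl (s : R) : 0 < s -> flat 0 (k%:R * s) @[k --> \oo] --> (1 : R).
  move=> s0; have : expR (- s^-1 * k.+1%:R^-1) @[k --> \oo] --> expR 0.
    apply: continuous_cvg; first exact: continuous_expR.
    rewrite -[X in _ --> X](mulr0 (- s^-1)); apply: cvgMr; exact: cvg_harmonic.
  rewrite expR0 -(cvg_shiftS (fun k => flat 0 (k%:R * s))).
  rewrite (_ : (fun k => expR _) = [sequence flat 0 (n.+1%:R * s)]_n)//.
  apply/funext => k; rewrite /= /flat mulr_gt0// expr0 invr1 mul1r.
  by rewrite invfM mulNr mulrC.
rewrite [X in _ --> X](_ : _ = \prod_(i : 'I_d) (1 * 1)); last by rewrite big1// => i _; rewrite mul1r.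
rewrite /box_bump; elim: (index_enum _) => [|i r IH].
  under eq_fun do rewrite big_nil; rewrite big_nil; exact: cvg_cst.
under eq_fun do rewrite big_cons; rewrite big_cons.
apply: cvgM; last exact: IH.
by have /andP[h1 h2] := h i; apply: cvgM; apply: fl; rewrite subr_gt0.
Qed.

Lemma Rintegral_setI_indic A B f : measurable A -> measurable B ->
  \int[mu]_(x in B `&` A) f x = \int[mu]_(x in B) (f x * \1_A x).
Proof.
move=> mA mB; rewrite Rintegral_mkcondr; apply: eq_Rintegral => x _.
by rewrite patchE indicE; case: ifP => _; rewrite ?mulr1 ?mulr0.
Qed.

Lemma oboxI (a b a' b' : 'I_d -> R) : obox a b `&` obox a' b' =
  obox (fun i => Num.max (a i) (a' i)) (fun i => Num.min (b i) (b' i)).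
Proof.
apply/seteqP; split => x /= => [[h h'] i|h].
  by rewrite gt_max lt_min; have /andP[-> ->] := h i; have /andP[-> ->] := h' i.
by split => i; have := h i; rewrite gt_max lt_min => /andP[/andP[h1 h2] /andP[h3 h4]];
  rewrite ?h1 ?h2 ?h3 ?h4.
Qed.

(** The sets A on which p integrates to 0 over B and A form a lambda-system containing the boxes,
    which are stable under intersection; so the integral vanishes over every measurable set, in
    particular where p is positive and where p is negative. *)
Lemma integral_obox_eq0 (B : set E) (p : E -> R) : measurable B ->
  mu.-integrable B (EFin \o p) ->
  \int[mu]_(x in B) p x = 0 ->
  (forall a b, \int[mu]_(x in B `&` obox a b) p x = 0) ->
  {ae mu, forall x, B x -> p x = 0}.
Proof.
move=> mB ip pB pbox.
have mp : measurable_fun B p by move/integrableP: ip => [/measurable_EFinP].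
have iS A : measurable A -> mu.-integrable (B `&` A) (EFin \o p).
  by move=> mA; apply: integrableS ip => //; exact: measurableI.
have all0 A : measurable A -> \int[mu]_(x in B `&` A) p x = 0.
  suff : rV_display.-measurable `<=` [set A | measurable A /\ \int[mu]_(x in B `&` A) p x = 0].
    by move=> h mA; have [] := h A mA.
  apply: (subset_trans (@measurable_obox_generated _ _)).
  apply: (@lambda_system_subset _ _ _ setT).
  - move=> _ _ [a [b ->]] [a' [b' ->]].
    exists (fun i => Num.max (a i) (a' i)), (fun i => Num.min (b i) (b' i)).
    exact: oboxI.
  - split => //.
    + by split; [exact: measurableT|rewrite setIT].
    + move=> {}A A' AA' [mA A0] [mA' A0']; split; first exact: measurableD.
      have := @Rintegral_setU _ _ _ mu (B `&` (A `\` A')) (B `&` A') p.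
      rewrite -setIUr setUC setDUK// A0 A0' addr0 => <- //.
      * by apply: measurableI => //; exact: measurableD.
      * exact: measurableI.
      * exact: iS.
      * by apply/disj_setPS => x [[_ [_ h]] [_ /h]].
    + move=> F ndF hF; have mF k : measurable (F k) by case: (hF k).
      have mU : measurable (\bigcup_k F k) by exact: bigcupT_measurable.
      split => //; rewrite Rintegral_setI_indic//.
      have : \int[mu]_(x in B) (p x * \1_(F k) x) @[k --> \oo] -->
          \int[mu]_(x in B) (p x * \1_(\bigcup_k F k) x).
        apply: (@Rintegral_dominated _ _ _ mu B _ _ (fun x => `|p x|)) => //.
        - move=> k; apply: measurable_funM => //; exact: measurable_indic.
        - move=> x Bx; apply: cvgMr.
          have [[m _ Fm]|nF] := pselect ((\bigcup_k F k) x).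
            apply: (cvg_near_cst); exists m => // k /= mk.
            rewrite !indicE !mem_set//; first by exists m.
            by move: Fm; apply/subsetPset; exact: ndF.
          rewrite (_ : (fun k => \1_(F k) x) = (fun=> \1_(\bigcup_k F k) x)); first exact: cvg_cst.
          apply/funext => k; rewrite !indicE !memNset// => h; apply: nF; by exists k.
        - exact: integrable_norm.
        - move=> k x _; rewrite normrM ler_piMr// indicE; case: (_ \in _); rewrite ?normr1 ?normr0//.
      rewrite (_ : (fun k => _) = (fun=> 0)); last first.
        by apply/funext => k; rewrite -Rintegral_setI_indic//; have [] := hF k.
      by move/(cvg_lim (@Rhausdorff R)) => <-; rewrite lim_cst.
  - by move=> _ [a [b ->]]; split => //; exact: measurable_obox.
  - by [].
(* The sign [s] treats the sets where p > 0 and where p < 0 together; on each of them s p = |p|. *)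
have half (s : R) : s = 1 \/ s = -1 -> {ae mu, forall x, (B `&` [set x | 0 < s * p x]) x -> p x = 0}.
  move=> s1; set A := [set x | 0 < s * p x].
  have mBA : measurable (B `&` A).
    have ms : measurable_fun B (fun x => s * p x) by exact: measurable_funM.
    have := ms mB _ (measurable_itv `]0, +oo[); congr measurable.
    by apply/seteqP; split => x /= [Bx]; rewrite /A/= in_itv/= andbT.
  have iA : mu.-integrable (B `&` A) (EFin \o p) by exact: integrableS ip.
  have : (\int[mu]_(x in B `&` A) `|(p x)%:E|)%E = 0%E.
    rewrite (_ : (\int[mu]_(x in _) _)%E = (\int[mu]_(x in B `&` A) (s * p x)%:E)%E); last first.
      apply: eq_integral => x; rewrite inE => -[_ /= sp]; congr (_%:E).
      rewrite -[RHS]gtr0_norm// normrM.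
      by case: s1 => ->; rewrite ?normrN normr1 mul1r.
    rewrite -(@EFin_Rintegral _ _ _ mu)//; last exact: (integrableZl mBA s iA).
    have -> : B `&` A = B `&` (B `&` A) by rewrite setIA setIid.
    rewrite RintegralZl//; first by rewrite all0// mulr0.
      by rewrite setIA setIid.
    by rewrite setIA setIid.
  move/(ae_eq_integral_abs mu mBA).
  have mpA : measurable_fun (B `&` A) (fun x => (p x)%:E).
    by apply/measurable_EFinP; exact: measurable_funS mp.
  by move=> /(_ mpA); apply: filterS => x hx /hx [].
have h1 := half 1 (or_introl erefl); have h2 := half (-1) (or_intror erefl).
apply: filterS2 h1 h2 => x /= h1 h2 Bx.
have [p0|p0|//] := ltgtP (p x) 0.
- by apply: h2; split => //; rewrite mulN1r oppr_gt0.
- by apply: h1; split => //; rewrite mul1r.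
Qed.

Lemma sqint_integrable B p : measurable B -> (mu B < +oo)%E -> sqint mu B p ->
  mu.-integrable B (EFin \o p).
Proof.
move=> mB Boo sp; have s1 : sqint mu B (fun=> 1).
  split; first exact: measurable_cst.
  rewrite (_ : _ \o _ = EFin \o cst 1); last by apply/funext => x /=; rewrite expr1n.
  apply: measurable_bounded_integrable => //.
  by exists 1; split; [exact: num_real|move=> M M1 x _ /=; rewrite normr1 ltW].
by have := sqint_mul mB sp s1; under eq_fun do rewrite mulr1.
Qed.

Lemma obox_lty (a b : 'I_d -> R) : (mu (obox a b) < +oo)%E.
Proof.
have [r r0 hr] := compact_box (@compact_cbox a b).
apply: le_lt_trans (lebesgue_rV_box d r); apply: le_measure; rewrite ?inE.
- exact: measurable_obox.
- exact: measurable_cube.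
- by move=> x /obox_cbox /hr.
Qed.

(** The bumps on a box converge boundedly to its indicator function, so p integrates to 0 over each
    box whose closure lies in [omega], and over each subbox. [integral_obox_eq0] applies on each box
    of a countable cover. *)
Lemma fundamental_lemma omega p : open omega -> sqint mu omega p ->
  (forall k (a b : 'I_d -> R), cbox a b `<=` omega ->
    \int[mu]_(x in omega) (p x * box_bump k%:R a b x) = 0) ->
  {ae mu, forall x, omega x -> p x = 0}.
Proof.
move=> oo sp hp; have mo := open_measurable_rV oo.
have box0 a b : cbox a b `<=` omega -> \int[mu]_(x in obox a b) p x = 0.
  move=> sub; have mB := @measurable_obox R d a b.
  have sB : obox a b `<=` omega by exact: subset_trans (@obox_cbox _ _ _ _) sub.
  have ipB : mu.-integrable (obox a b) (EFin \o p).
    by apply: sqint_integrable => //; [exact: obox_lty|exact: sqintS sp].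
  have mpB : measurable_fun (obox a b) p by move/integrableP: ipB => [/measurable_EFinP].
  have : \int[mu]_(x in obox a b) (p x * box_bump k%:R a b x) @[k --> \oo] -->
      \int[mu]_(x in obox a b) p x.
    apply: (@Rintegral_dominated _ _ _ mu _ _ _ (fun x => `|p x|)) => //.
    - move=> k; apply: measurable_funM => //; apply: measurable_funTS.
      by apply: measurable_smooth; exact: smooth_bump.
    - move=> x Bx; rewrite -[X in _ --> X]mulr1; apply: cvgMr.
      by have := @bump_cvg a b x; rewrite indicE mem_set.
    - exact: integrable_norm.
    - by move=> k x _; rewrite normrM ler_piMr// ger0_norm ?bump_ge0 ?bump_le1.
  rewrite (_ : (fun k => _) = (fun=> 0)).
    by move/(cvg_lim (@Rhausdorff R)) => <-; rewrite lim_cst.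
  apply/funext => k; rewrite -[RHS](hp k a b sub).
  rewrite [LHS]Rintegral_mkcond [RHS]Rintegral_mkcond; apply: eq_Rintegral => x _.
  rewrite !patchE; case: ifPn => [|]; rewrite ?inE ?notin_setE => hx.
    by rewrite mem_set//; exact: sB.
  by case: ifP => // _; rewrite bump_eq0// mulr0.
have [P [a [b [PA AP]]]] := open_obox_cover oo.
have boxae k : {ae mu, forall x, P k -> obox (a k) (b k) x -> p x = 0}.
  have [Pk|nP] := pselect (P k); last by apply: aeW.
  have mB := @measurable_obox R d (a k) (b k).
  have sB : obox (a k) (b k) `<=` omega by exact: subset_trans (@obox_cbox _ _ _ _) (PA k Pk).
  have ipB : mu.-integrable (obox (a k) (b k)) (EFin \o p).
    by apply: sqint_integrable => //; [exact: obox_lty|exact: sqintS sp].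
  have := integral_obox_eq0 mB ipB (box0 _ _ (PA k Pk)).
  have sub a' b' : \int[mu]_(x in obox (a k) (b k) `&` obox a' b') p x = 0.
    rewrite oboxI; apply: box0 => x h; apply: (PA k Pk) => i; have := h i.
    by rewrite ge_max le_min => /andP[/andP[-> _] /andP[-> _]].
  by move=> /(_ sub); apply: filterS => x h _; exact: h.
have : {ae mu, forall x, forall k, P k -> obox (a k) (b k) x -> p x = 0}.
  by apply/ae_foralln.
by apply: filterS => x h /AP[k Pk hk]; exact: h hk.
Qed.

End L2_theory.

(** * Graph norms, products and pairs of semi-inner product spaces *)

Section graph.
Context (R : realType) (W W' : lmodType R) (S : W -> Prop) (S' : W' -> Prop).
Context (ip : W -> W -> R) (ip' : W' -> W' -> R) (G : W -> W' -> Prop) (D : W -> W').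
Context (hS : semi_inner S ip) (hS' : semi_inner S' ip').
Context (G_dom : forall x p, G x p -> S x /\ S' p).
Context (G_0 : G 0 0).
Context (G_lin : forall a x y p q, G x p -> G y q -> G (a *: x + y) (a *: p + q)).
Context (G_null : forall p, G 0 p -> ip' p p = 0).
Context (G_D : forall x p, G x p -> G x (D x)).

Definition graph_dom (x : W) : Prop := exists p, G x p.

Lemma graph_domP x : graph_dom x -> G x (D x).
Proof. by case=> p; exact: G_D. Qed.

Lemma graph_dom_sub x : graph_dom x -> S x.
Proof. by move=> /graph_domP /G_dom[]. Qed.

Lemma graph_dom_S' x : graph_dom x -> S' (D x).
Proof. by move=> /graph_domP /G_dom[]. Qed.

Lemma graph_dom_subspace : lin_subspace graph_dom.
Proof.
split; first by exists 0.
by move=> a x y [p hp] [q hq]; exists (a *: p + q); exact: G_lin.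
Qed.

Lemma G_sub x y p q : G x p -> G y q -> G (x - y) (p - q).
Proof. by move=> hx hy; rewrite -2!scaleN1r addrC [p + _]addrC; exact: G_lin. Qed.

(** A derivative is a relation [G]: its value is unique only up to elements of zero norm, the values
    that [G] assigns to 0. Inner products with the selected value [D x] therefore agree with those
    of any other value, and the graph form is bilinear although [D] itself is not linear. *)
Lemma graph_unique x p q z : G x p -> G x q -> S' z -> ip' p z = ip' q z.
Proof.
move=> hp hq Sz; have [_ Sp] := G_dom hp; have [_ Sq] := G_dom hq.
apply/eqP; rewrite -subr_eq0 -(ipBl hS')//; apply/eqP.
apply: (ip_null hS') => //; first exact: (subspaceB (si_subspace hS')).
by apply: G_null; rewrite -(subrr x); exact: G_sub.
Qed.

Lemma graph_D x p z : G x p -> S' z -> ip' (D x) z = ip' p z.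
Proof. by move=> hp; apply: graph_unique (hp); exact: G_D hp. Qed.

Lemma graph_D2 x y p q : G x p -> G y q -> ip' (D x) (D y) = ip' p q.
Proof.
move=> hp hq; have [_ Sp] := G_dom hp; have [_ Sq] := G_dom hq.
have [_ Sy] := G_dom (G_D hq).
by rewrite (graph_D hp)// (si_sym hS')// (graph_D hq)// (si_sym hS').
Qed.

Context (a b : R) (a0 : 0 < a) (b0 : 0 < b).

Definition graph_ip (x y : W) : R := a * ip x y + b * ip' (D x) (D y).

Lemma graph_semi_inner : semi_inner graph_dom graph_ip.
Proof.
split; first exact: graph_dom_subspace.
- move=> x y hx hy; rewrite /graph_ip (si_sym hS) ?(si_sym hS' (graph_dom_S' hx))//;
    solve [exact: graph_dom_sub|exact: graph_dom_S'].
- move=> c x y z hx hy hz; rewrite /graph_ip (si_lin hS); do ?exact: graph_dom_sub.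
  rewrite (graph_D (G_lin c (graph_domP hx) (graph_domP hy)) (graph_dom_S' hz)).
  by rewrite (si_lin hS'); do ?exact: graph_dom_S'; ring.
- move=> x hx; rewrite /graph_ip addr_ge0// mulr_ge0 ?(ltW a0) ?(ltW b0)//.
    by apply: (si_ge0 hS); exact: graph_dom_sub.
  by apply: (si_ge0 hS'); exact: graph_dom_S'.
Qed.

Lemma graph_ipB x y p q : G x p -> G y q ->
  graph_ip (x - y) (x - y) = a * ip (x - y) (x - y) + b * ip' (p - q) (p - q).
Proof. by move=> hp hq; rewrite /graph_ip !(graph_D2 (G_sub hp hq) (G_sub hp hq)). Qed.

Lemma graph_cvg u x p q : (forall k, G (u k) (p k)) -> G x q ->
  ip_cvg ip u x -> ip_cvg ip' p q -> ip_cvg graph_ip u x.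
Proof.
move=> hu hx ux pq e e0.
have [|N1 h1] := ux (e / 2 / a); first by rewrite !divr_gt0.
have [|N2 h2] := pq (e / 2 / b); first by rewrite !divr_gt0.
exists (maxn N1 N2) => n; rewrite geq_max => /andP[/h1 {}h1 /h2 {}h2].
rewrite (graph_ipB (hu n) hx) [ltRHS](splitr e) ltrD//.
  by rewrite -ltr_pdivlMl// mulrC.
by rewrite -ltr_pdivlMl// mulrC.
Qed.

Lemma graph_cvg_inv u x p q : (forall k, G (u k) (p k)) -> G x q ->
  ip_cvg graph_ip u x -> ip_cvg ip u x /\ ip_cvg ip' p q.
Proof.
move=> hu hx ux.
have [Sx Sq] := G_dom hx.
have Su k : S (u k) /\ S' (p k) by exact: G_dom (hu k).
split=> e e0.
  have [|N hN] := ux (a * e); first by rewrite mulr_gt0.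
  exists N => n /hN; rewrite (graph_ipB (hu n) hx) => h; rewrite -(ltr_pM2l a0); apply: le_lt_trans h.
  rewrite lerDl mulr_ge0 ?(ltW b0)//; apply: (si_ge0 hS').
  by apply: (subspaceB (si_subspace hS')) => //; case: (Su n).
have [|N hN] := ux (b * e); first by rewrite mulr_gt0.
exists N => n /hN; rewrite (graph_ipB (hu n) hx) => h; rewrite -(ltr_pM2l b0); apply: le_lt_trans h.
rewrite lerDr mulr_ge0 ?(ltW a0)//; apply: (si_ge0 hS).
by apply: (subspaceB (si_subspace hS)) => //; case: (Su n).
Qed.

(** A Cauchy sequence for the graph form has limits in both components, and closedness of [G] says
    that the second limit is a value at the first one. *)
Lemma graph_complete : ip_complete S ip -> ip_complete S' ip' ->
  (forall u p x q, (forall k, G (u k) (p k)) -> S x -> S' q ->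
     ip_cvg ip u x -> ip_cvg ip' p q -> G x q) ->
  ip_complete graph_dom graph_ip.
Proof.
move=> cS cS' G_closed u du cu.
have Su k := graph_dom_sub (du k); have Sp k := graph_dom_S' (du k).
have hu k := graph_domP (du k).
have [||x Sx ux] := cS u => //.
  move=> e e0; have [|N hN] := cu (a * e); first by rewrite mulr_gt0.
  exists N => m n hm hn; move: (hN _ _ hm hn); rewrite (graph_ipB (hu m) (hu n)) => h; rewrite -(ltr_pM2l a0); apply: le_lt_trans h.
  rewrite lerDl mulr_ge0 ?(ltW b0)//; apply: (si_ge0 hS').
  exact: (subspaceB (si_subspace hS')).
have [||q Sq pq] := cS' (D \o u) => //.
  move=> e e0; have [|N hN] := cu (b * e); first by rewrite mulr_gt0.
  exists N => m n hm hn; move: (hN _ _ hm hn); rewrite (graph_ipB (hu m) (hu n)) => h; rewrite -(ltr_pM2l b0); apply: le_lt_trans h.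
  rewrite lerDr mulr_ge0 ?(ltW a0)//; apply: (si_ge0 hS).
  exact: (subspaceB (si_subspace hS)).
have Gxq : G x q by exact: G_closed hu Sx Sq ux pq.
by exists x; [exists q|exact: graph_cvg hu Gxq ux pq].
Qed.

End graph.

Section product.
Context (R : realType) (J : finType) (W : lmodType R) (S : J -> W -> Prop).
Context (ip : J -> W -> W -> R) (hS : forall j, semi_inner (S j) (ip j)).

Definition prod_dom (x : J -> W) : Prop := forall j, S j (x j).
Definition prod_ip (x y : J -> W) : R := \sum_j ip j (x j) (y j).

Lemma prod_semi_inner : semi_inner prod_dom prod_ip.
Proof.
split.
- split=> [j|a x y Sx Sy j]; first exact: (subspace0 (si_subspace (hS j))).
  exact: (subspaceL (si_subspace (hS j))).
- by move=> x y Sx Sy; apply: eq_bigr => j _; rewrite (si_sym (hS j)).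
- move=> a x y z Sx Sy Sz; rewrite /prod_ip mulr_sumr -big_split /=.
  by apply: eq_bigr => j _; rewrite (si_lin (hS j)).
- by move=> x Sx; apply: sumr_ge0 => j _; exact: (si_ge0 (hS j)).
Qed.

Lemma prod_cvg u x : (forall j, ip_cvg (ip j) (fun k => u k j) (x j)) -> ip_cvg prod_ip u x.
Proof.
move=> ux e e0; pose C : R := #|J|%:R + 1.
have C0 : 0 < C by rewrite ltr_wpDl.
have e1 : 0 < e / C by rewrite divr_gt0.
have [N hN] := choice (fun j => ux j _ e1).
exists (\max_j N j)%N => n hn.
apply: (@le_lt_trans _ _ (\sum_(j : J) e / C)).
  by apply: ler_sum => j _; apply/ltW/hN/leq_trans/hn; exact: leq_bigmax.
rewrite sumr_const -mulr_natr mulrAC ltr_pdivrMr// ltr_pM2l//.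
by rewrite ltrDl.
Qed.

Lemma prod_ge u x j : prod_dom u -> prod_dom x ->
  ip j (u j - x j) (u j - x j) <= prod_ip (u - x) (u - x).
Proof.
move=> Su Sx; rewrite /prod_ip (bigD1 j)//= lerDl sumr_ge0// => i _.
by apply: (si_ge0 (hS i)); exact: (subspaceB (si_subspace (hS i))).
Qed.

Lemma prod_cvg_inv u x j : (forall k, prod_dom (u k)) -> prod_dom x ->
  ip_cvg prod_ip u x -> ip_cvg (ip j) (fun k => u k j) (x j).
Proof.
move=> Su Sx ux e /ux[N hN]; exists N => n /hN; apply: le_lt_trans; exact: prod_ge.
Qed.

Lemma prod_complete : (forall j, ip_complete (S j) (ip j)) -> ip_complete prod_dom prod_ip.
Proof.
move=> cS u Su cu.
have H j : exists x, S j x /\ ip_cvg (ip j) (fun k => u k j) x.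
  have [||x Sx ux] := cS j (fun k => u k j); [by move=> k; exact: Su| |by exists x].
  move=> e /cu[N hN]; exists N => m n hm hn; move: (hN _ _ hm hn); apply: le_lt_trans.
  exact: prod_ge.
have [x hx] := choice H; exists x; first by move=> j; case: (hx j).
by apply: prod_cvg => j; case: (hx j).
Qed.

End product.

Section pair.
Context (R : realType) (W W' : lmodType R) (S : W -> Prop) (S' : W' -> Prop).
Context (ip : W -> W -> R) (ip' : W' -> W' -> R).
Context (hS : semi_inner S ip) (hS' : semi_inner S' ip').

Definition pair_dom (x : W * W') : Prop := S x.1 /\ S' x.2.
Definition pair_ip (x y : W * W') : R := ip x.1 y.1 + ip' x.2 y.2.

Lemma pair_semi_inner : semi_inner pair_dom pair_ip.
Proof.
split.
- split=> [|a x y [Sx1 Sx2] [Sy1 Sy2]]; split.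
  + exact: (subspace0 (si_subspace hS)).
  + exact: (subspace0 (si_subspace hS')).
  + exact: (subspaceL (si_subspace hS)).
  + exact: (subspaceL (si_subspace hS')).
- by move=> x y [? ?] [? ?]; rewrite /pair_ip (si_sym hS)// (si_sym hS').
- move=> a x y z [? ?] [? ?] [? ?]; rewrite /pair_ip /= (si_lin hS)// (si_lin hS')//; ring.
- by move=> x [? ?]; rewrite addr_ge0 ?(si_ge0 hS)// (si_ge0 hS').
Qed.

Lemma pair_complete : ip_complete S ip -> ip_complete S' ip' -> ip_complete pair_dom pair_ip.
Proof.
move=> cS cS' u Su cu; have Su1 k := (Su k).1; have Su2 k := (Su k).2.
have ge1 x y : pair_dom x -> pair_dom y -> 0 <= ip (x - y).1 (x - y).1 /\ 0 <= ip' (x - y).2 (x - y).2.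
  move=> [? ?] [? ?]; split; [apply: (si_ge0 hS)|apply: (si_ge0 hS')].
    exact: (subspaceB (si_subspace hS)).
  exact: (subspaceB (si_subspace hS')).
have [||x Sx ux] := cS (fun k => (u k).1) => //.
  move=> e /cu[N hN]; exists N => m n hm hn; move: (hN _ _ hm hn); apply: le_lt_trans.
  by rewrite /pair_ip lerDl; have [] := ge1 _ _ (Su m) (Su n).
have [||y Sy uy] := cS' (fun k => (u k).2) => //.
  move=> e /cu[N hN]; exists N => m n hm hn; move: (hN _ _ hm hn); apply: le_lt_trans.
  by rewrite /pair_ip lerDr; have [] := ge1 _ _ (Su m) (Su n).
exists (x, y) => // e e0.
have e2 : 0 < e / 2 by rewrite divr_gt0.
have [N1 h1] := ux _ e2; have [N2 h2] := uy _ e2.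
exists (maxn N1 N2) => n; rewrite geq_max => /andP[/h1 {}h1 /h2 {}h2].
by rewrite /pair_ip [ltRHS](splitr e) ltrD.
Qed.

End pair.

(** * Sobolev spaces and traces *)

Lemma Rintegral_sum d (T : measurableType d) (R : realType) (mu : {measure set T -> \bar R})
    (D : set T) (J : Type) (r : seq J) (F : J -> T -> R) : measurable D ->
  (forall j, mu.-integrable D (EFin \o F j)) ->
  \int[mu]_(x in D) \sum_(j <- r) F j x = \sum_(j <- r) \int[mu]_(x in D) F j x.
Proof.
move=> mD iF.
have iS s : mu.-integrable D (EFin \o (fun x => \sum_(j <- s) F j x)).
  rewrite (_ : _ \o _ = (fun x => \sum_(j <- s) (F j x)%:E)%E).
    apply: (@integrable_sum _ _ _ _ _ mD _ _ _ (fun j x => (F j x)%:E)) => j _.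
    exact: iF.
  by apply/funext => x /=; rewrite sumEFin.
elim: r => [|j r IHr].
  by under eq_Rintegral do rewrite big_nil; rewrite big_nil Rintegral_cst// mul0r.
under eq_Rintegral do rewrite big_cons.
by rewrite RintegralD// big_cons IHr.
Qed.

Section L2_spaces.
Context (R : realType) (d : nat) (omega : set 'rV[R]_d).
Local Notation E := 'rV[R]_d.
Local Notation mu := (lebesgue_rV R d).
Context (mo : measurable omega).
Implicit Types (f g w r phi : E -> R) (p q : E -> E).

Definition l2ip f g : R := \int[mu]_(x in omega) (f x * g x).
Definition l2vip p q : R := \int[mu]_(x in omega) dot (p x) (q x).
Definition comps p (i : 'I_d) : E -> R := fun x => p x 0 i.

Lemma L2_integrable f g : L2 omega f -> L2 omega g ->
  mu.-integrable omega (EFin \o (fun x => f x * g x)).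
Proof. by move=> /(L2P _ mo) sf /(L2P _ mo) sg; exact: sqint_mul. Qed.

Lemma l2_semi_inner : semi_inner (L2 omega) l2ip.
Proof.
split.
- split; first by apply/(L2P _ mo); exact: sqint0.
  by move=> a f g /(L2P _ mo) hf /(L2P _ mo) hg; apply/(L2P _ mo); exact: sqintL.
- by move=> f g _ _; apply: eq_Rintegral => x _; rewrite mulrC.
- move=> a f g h hf hg hh; rewrite /l2ip.
  under eq_Rintegral do rewrite mulrDl -mulrA.
  rewrite RintegralD//.
  + by rewrite RintegralZl//; exact: L2_integrable.
  + by have := integrableZl mo a (L2_integrable hf hh).
  + exact: L2_integrable.
- by move=> f _; apply: Rintegral_ge0 => x _; rewrite -expr2 sqr_ge0.
Qed.

Lemma l2_complete : ip_complete (L2 omega) l2ip.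
Proof.
move=> u hu cu; have [||f sf uf] := @sqint_complete _ _ _ mu omega u mo.
- by move=> k; apply/(L2P _ mo).
- move=> e /cu[N hN]; exists N => m n hm hn; have := hN m n hm hn.
  by congr (_ < _); apply: eq_Rintegral => x _; rewrite expr2.
exists f; first exact/(L2P _ mo).
move=> e /uf[N hN]; exists N => n /hN.
by congr (_ < _); apply: eq_Rintegral => x _; rewrite expr2.
Qed.

Lemma L2vec_prod p : L2vec omega p <-> prod_dom (fun=> L2 omega) (comps p).
Proof. by []. Qed.

Lemma l2vipE p q : L2vec omega p -> L2vec omega q ->
  l2vip p q = prod_ip (fun=> l2ip) (comps p) (comps q).
Proof.
move=> hp hq; rewrite /l2vip /prod_ip /dot Rintegral_sum// => i.
exact: L2_integrable (hp i) (hq i).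
Qed.

Let hC := prod_semi_inner (fun _ : 'I_d => l2_semi_inner).

Lemma L2vec_subspace : lin_subspace (L2vec omega : (E -> E) -> Prop).
Proof.
have [h0 hL] := si_subspace l2_semi_inner; split.
  by move=> i; have := h0; congr L2; apply/funext => x /=; rewrite mxE.
move=> a p q hp hq i; have := hL a _ _ (hp i) (hq i).
by congr L2; apply/funext => x /=; rewrite !mxE.
Qed.

Lemma comps_lin a p q : comps (a *: p + q) = a *: comps p + comps q.
Proof. by apply/funext => i; apply/funext => x; rewrite /comps /= !mxE. Qed.

Lemma compsB p q : comps (p - q) = comps p - comps q.
Proof. by apply/funext => i; apply/funext => x; rewrite /comps /= !mxE. Qed.

Lemma l2v_semi_inner : semi_inner (L2vec omega) l2vip.
Proof.
split; first exact: L2vec_subspace.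
- by move=> p q hp hq; rewrite !l2vipE// (si_sym hC).
- move=> a p q r hp hq hr; rewrite !l2vipE//; first by rewrite comps_lin (si_lin hC).
  exact: (subspaceL L2vec_subspace).
- by move=> p hp; rewrite l2vipE// (si_ge0 hC).
Qed.

Lemma l2v_cvg u p : (forall k, L2vec omega (u k)) -> L2vec omega p ->
  ip_cvg l2vip u p <-> ip_cvg (prod_ip (fun=> l2ip)) (comps \o u) (comps p).
Proof.
move=> hu hp; have sB := subspaceB L2vec_subspace.
by split=> h e /h[N hN]; exists N => n /hN; rewrite l2vipE ?compsB//; exact: sB.
Qed.

Lemma l2v_cvg_comps u p i : (forall k, L2vec omega (u k)) -> L2vec omega p ->
  ip_cvg l2vip u p -> ip_cvg l2ip (fun k => comps (u k) i) (comps p i).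
Proof.
move=> hu hp /(l2v_cvg hu hp); apply: (prod_cvg_inv (fun _ : 'I_d => l2_semi_inner)) => //.
Qed.

Lemma l2v_complete : ip_complete (L2vec omega) l2vip.
Proof.
move=> u hu cu; have sB := subspaceB L2vec_subspace.
have [||f hf uf] := prod_complete (fun _ : 'I_d => l2_semi_inner) (fun _ : 'I_d => l2_complete)
    (u := comps \o u) => //.
  move=> e /cu[N hN]; exists N => m n hm hn; have := hN m n hm hn.
  by rewrite l2vipE ?compsB//; exact: sB.
pose p x : E := \row_i f i x.
have pf : comps p = f by apply/funext => i; apply/funext => x; rewrite /comps mxE.
have hp : L2vec omega p by apply/L2vec_prod; rewrite pf.
by exists p => //; apply/l2v_cvg => //; rewrite pf.
Qed.

Lemma L2_delta g i : L2 omega g -> L2vec omega (fun x => g x *: delta_mx 0 i).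
Proof.
move=> hg j; rewrite /= (_ : (fun x => _) = (fun x => (j == i)%:R * g x)).
  exact: (subspaceZ (si_subspace l2_semi_inner)).
by apply/funext => x; rewrite !mxE eqxx mulrC.
Qed.

Lemma l2vip_delta p g i : l2vip p (fun x => g x *: delta_mx 0 i) = l2ip (comps p i) g.
Proof.
apply: eq_Rintegral => x _; rewrite /dot (bigD1 i)//= big1 ?addr0.
  by rewrite !mxE !eqxx mulr1.
by move=> j ji; rewrite !mxE (negbTE ji) andbF !mulr0.
Qed.

Lemma eq_L2 f g : (forall x, omega x -> f x = g x) -> L2 omega f -> L2 omega g.
Proof. by move=> fg /(L2P _ mo) sf; apply/(L2P _ mo); exact: eq_sqint sf. Qed.

Lemma l2ip_ae0 f g : {ae mu, forall x, omega x -> f x = 0} -> L2 omega f -> L2 omega g ->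
  l2ip f g = 0.
Proof.
move=> f0 hf hg; have i1 := L2_integrable hf hg.
rewrite /l2ip /Rintegral (ae_eq_integral (cst 0%E))//; first by rewrite integral0.
  by case/integrableP: i1.
by apply: filterS f0 => x h /h /= ->; rewrite mul0r.
Qed.

Lemma l2ip_null_ae f : L2 omega f -> l2ip f f = 0 -> {ae mu, forall x, omega x -> f x = 0}.
Proof.
move=> /(L2P _ mo) sf f0; apply: (sqint_eq0_ae mo sf); rewrite -[RHS]f0.
by apply: eq_Rintegral => x _; rewrite expr2.
Qed.

End L2_spaces.

Section L2_restriction.
Context (R : realType) (d : nat).
Local Notation E := 'rV[R]_d.
Implicit Types (A omega : set E) (phi : E -> R).

Lemma L2S A omega f : measurable A -> measurable omega -> A `<=` omega ->
  L2 omega f -> L2 A f.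
Proof. by move=> mA mo Ao /(L2P _ mo) sf; apply/(L2P _ mA); exact: sqintS sf. Qed.

Lemma L2vecS A omega p : measurable A -> measurable omega -> A `<=` omega ->
  L2vec omega p -> L2vec A p.
Proof. by move=> mA mo Ao hp i; exact: L2S (hp i). Qed.

Lemma test_L2 A omega phi : measurable omega -> test_function A phi -> L2 omega phi.
Proof.
move=> mo tp; apply/(L2P _ mo); split.
  by apply: measurable_funTS; apply: measurable_smooth; exact: test_function_smooth tp.
have := test_function_integrable (test_functionM (test_function_smooth tp) tp).
rewrite (_ : (fun x => phi x * phi x) = (fun x => phi x ^+ 2)).
  by move=> h; apply: integrableS h.
by apply/funext => x; rewrite expr2.
Qed.

Lemma l2_test_total omega r : open omega -> L2 omega r ->
  (forall phi, test_function omega phi -> l2ip omega r phi = 0) -> l2ip omega r r = 0.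
Proof.
move=> oo hr h; have mo := open_measurable_rV oo.
apply: (l2ip_ae0 mo) => //; apply: fundamental_lemma => //; first exact/(L2P _ mo).
by move=> k a b sub; apply: h; exact: test_bump.
Qed.

End L2_restriction.

Section sobolev_spaces.
Context (R : realType) (d : nat).
Local Notation E := 'rV[R]_d.
Local Notation mu := (lebesgue_rV R d).
Implicit Types (A omega : set E) (f g w v r phi : E -> R) (p q : E -> E).

Definition pgrad w : E -> E := fun x => \row_i partial i w x.

Lemma dot_pgrad q w x : dot (q x) (pgrad w x) = \sum_i q x 0 i * partial i w x.
Proof. by apply: eq_bigr => i _; rewrite mxE. Qed.

Lemma is_weak_divE omega q g : is_weak_div omega q g <->
  L2 omega g /\ forall phi, test_function omega phi ->
    l2vip omega q (pgrad phi) = - l2ip omega g phi.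
Proof.
split=> -[hg h]; split => // phi /h.
  by move=> <-; apply: eq_Rintegral => x _; rewrite dot_pgrad.
by move=> h1; rewrite -[RHS]h1; apply: eq_Rintegral => x _; rewrite dot_pgrad.
Qed.

Lemma test_pgrad A omega phi : measurable omega -> test_function A phi ->
  L2vec omega (pgrad phi).
Proof.
move=> mo tp i; rewrite (_ : (fun x => _) = partial i phi).
  exact: test_L2 mo (test_function_partial i tp).
by apply/funext => x; rewrite mxE.
Qed.

(** [grad] selects an arbitrary representative by [xget]. Arguments run on this relation, which
    inherits linearity and closedness from the defining integral identity; [gradP] and [grad_eq]
    return to the selected representative. *)
Definition grad_rel omega w p := L2 omega w /\ is_weak_grad omega w p.
Definition div_rel omega q g := L2vec omega q /\ is_weak_div omega q g.

Lemma H1_graph omega : H1 omega = graph_dom (grad_rel omega).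
Proof.
apply/funext => w; apply/propext; split.
  by move=> [hw [p hp]]; exists p.
by move=> [p [hw hp]]; split => //; exists p.
Qed.

Lemma Hdiv_graph omega : Hdiv omega = graph_dom (div_rel omega).
Proof.
apply/funext => w; apply/propext; split.
  by move=> [hw [p hp]]; exists p.
by move=> [p [hw hp]]; split => //; exists p.
Qed.

Section fixed_domain.
Context (omega : set E) (oo : open omega).
Let mo : measurable omega := open_measurable_rV oo.
Let hl := l2_semi_inner mo.
Let hv := l2v_semi_inner mo.

Lemma grad_rel_dom w p : grad_rel omega w p -> L2 omega w /\ L2vec omega p.
Proof. by move=> [hw [hp _]]. Qed.

Lemma grad_rel_lin a v w p q : grad_rel omega v p -> grad_rel omega w q ->
  grad_rel omega (a *: v + w) (a *: p + q).
Proof.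
move=> [hv' [hp vp]] [hw [hq wq]]; split; first exact: (subspaceL (si_subspace hl)).
split=> [|phi tp i]; first exact: (subspaceL (L2vec_subspace mo)).
have h1 := test_L2 mo tp; have h2 := test_L2 mo (test_function_partial i tp).
rewrite [LHS](si_lin hl)// [l2ip _ v _]vp// [l2ip _ w _]wq//.
transitivity (- l2ip omega (a *: comps p i + comps q i) phi); last first.
  by congr (- _); apply: eq_Rintegral => x _; rewrite !mxE.
by rewrite (si_lin hl)//; [rewrite opprD mulrN|exact: hp|exact: hq].
Qed.

Lemma grad_rel0 : grad_rel omega 0 0.
Proof.
split; first exact: (subspace0 (si_subspace hl)).
split=> [|phi tp i]; first exact: (subspace0 (L2vec_subspace mo)).
rewrite [LHS](ip0l hl); last exact: test_L2 mo (test_function_partial i tp).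
rewrite (_ : (fun x => _) = (0 : E -> R) \* phi) ?[X in - X](ip0l hl) ?oppr0//.
  exact: test_L2 mo tp.
by apply/funext => x; rewrite mxE.
Qed.

Lemma grad_rel_null p : grad_rel omega 0 p -> l2vip omega p p = 0.
Proof.
move=> [h0 [hp h]]; rewrite (l2vipE mo hp hp) /prod_ip big1// => i _.
apply: (l2_test_total oo (hp i)) => phi tp.
have := h phi tp i; rewrite [LHS](ip0l hl); last exact: test_L2 mo (test_function_partial i tp).
by move/eqP; rewrite eq_sym oppr_eq0 => /eqP.
Qed.

Lemma gradP w p : grad_rel omega w p -> grad_rel omega w (grad omega w).
Proof. by move=> [hw hp]; split => //; apply: xgetPex; exists p. Qed.

Lemma grad_rel_closed (u : nat -> E -> R) (p : nat -> E -> E) x q : (forall k, grad_rel omega (u k) (p k)) ->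
  L2 omega x -> L2vec omega q -> ip_cvg (l2ip omega) u x -> ip_cvg (l2vip omega) p q ->
  grad_rel omega x q.
Proof.
move=> hu hx hq ux pq; split => //; split => // phi tp i.
have hu1 k := (hu k).1; have hp k := (hu k).2.1.
have h1 := ip_cvg_ip hl hu1 hx (test_L2 mo (test_function_partial i tp)) ux.
have h2 := ip_cvg_ip hl (fun k => hp k i) (hq i) (test_L2 mo tp) (l2v_cvg_comps mo i hp hq pq).
have h3 := cvgN h2.
suff h4 : l2ip omega (u k) (partial i phi) @[k --> \oo] --> - l2ip omega (comps q i) phi.
  exact: (cvg_unique (@Rhausdorff R) h1 h4).
rewrite (_ : (fun k => _) = - (fun k => l2ip omega (comps (p k) i) phi)); first exact: h3.
by apply/funext => k; exact: (hu k).2.2.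
Qed.

Definition h1ip (a b : R) := graph_ip (l2ip omega) (l2vip omega) (grad omega) a b.

Lemma H1_grad w : H1 omega w -> grad_rel omega w (grad omega w).
Proof. by rewrite H1_graph => -[p]; exact: gradP. Qed.

Lemma H1_L2 w : H1 omega w -> L2 omega w.
Proof. by case. Qed.

Lemma H1_L2grad w : H1 omega w -> L2vec omega (grad omega w).
Proof. by move=> /H1_grad /grad_rel_dom[]. Qed.

Lemma h1_semi_inner a b : 0 < a -> 0 < b -> semi_inner (H1 omega) (h1ip a b).
Proof.
move=> a0 b0; rewrite H1_graph; apply: (graph_semi_inner hl hv) => //.
- exact: grad_rel_dom.
- exact: grad_rel0.
- exact: grad_rel_lin.
- exact: grad_rel_null.
- exact: gradP.
Qed.

Lemma h1_complete a b : 0 < a -> 0 < b -> ip_complete (H1 omega) (h1ip a b).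
Proof.
move=> a0 b0; rewrite H1_graph; apply: (graph_complete hl hv) => //.
- exact: grad_rel_dom.
- exact: grad_rel_lin.
- exact: grad_rel_null.
- exact: gradP.
- exact: l2_complete.
- exact: l2v_complete.
- exact: grad_rel_closed.
Qed.

Lemma grad_eq w p q : grad_rel omega w p -> L2vec omega q ->
  l2vip omega (grad omega w) q = l2vip omega p q.
Proof.
move=> wp hq; apply: (graph_D hv _ _ _ _ wp hq).
- exact: grad_rel_dom.
- exact: grad_rel_lin.
- exact: grad_rel_null.
- exact: gradP.
Qed.

Lemma grad_lin a v w q : H1 omega v -> H1 omega w -> L2vec omega q ->
  l2vip omega (grad omega (a *: v + w)) q =
  a * l2vip omega (grad omega v) q + l2vip omega (grad omega w) q.
Proof.
move=> hv' hw hq.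
rewrite (grad_eq (grad_rel_lin a (H1_grad hv') (H1_grad hw)) hq) (si_lin hv)//;
  exact: H1_L2grad.
Qed.

Lemma H1_subspace : lin_subspace (H1 omega : (E -> R) -> Prop).
Proof. exact: si_subspace (h1_semi_inner ltr01 ltr01). Qed.

Lemma div_rel_dom q g : div_rel omega q g -> L2vec omega q /\ L2 omega g.
Proof. by move=> [hw [hp _]]. Qed.

Lemma div_rel_lin a p q f g : div_rel omega p f -> div_rel omega q g ->
  div_rel omega (a *: p + q) (a *: f + g).
Proof.
move=> [hp /is_weak_divE[hf pf]] [hq /is_weak_divE[hg qg]].
split; first exact: (subspaceL (L2vec_subspace mo)).
apply/is_weak_divE; split=> [|phi tp]; first exact: (subspaceL (si_subspace hl)).
have h1 := test_L2 mo tp; have h2 := test_pgrad mo tp.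
by rewrite (si_lin hv)// (si_lin hl)// pf// qg// opprD mulrN.
Qed.

Lemma div_rel0 : div_rel omega 0 0.
Proof.
split; first exact: (subspace0 (L2vec_subspace mo)).
apply/is_weak_divE; split=> [|phi tp]; first exact: (subspace0 (si_subspace hl)).
rewrite (ip0l hv) ?(ip0l hl) ?oppr0//; first exact: test_L2 mo tp.
exact: test_pgrad mo tp.
Qed.

Lemma div_rel_null g : div_rel omega 0 g -> l2ip omega g g = 0.
Proof.
move=> [h0 /is_weak_divE[hg h]]; apply: (l2_test_total oo hg) => phi tp.
have := h phi tp; rewrite (ip0l hv); last exact: test_pgrad mo tp.
by move/eqP; rewrite eq_sym oppr_eq0 => /eqP.
Qed.

Lemma divP q g : div_rel omega q g -> div_rel omega q (div omega q).
Proof. by move=> [hq hg]; split => //; apply: xgetPex; exists g. Qed.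

Lemma div_rel_closed (u : nat -> E -> E) (p : nat -> E -> R) x g : (forall k, div_rel omega (u k) (p k)) ->
  L2vec omega x -> L2 omega g -> ip_cvg (l2vip omega) u x -> ip_cvg (l2ip omega) p g ->
  div_rel omega x g.
Proof.
move=> hu hx hg ux pg; split => //; apply/is_weak_divE; split => // phi tp.
have hu1 k := (hu k).1; have hp k := (hu k).2.1.
have h1 := ip_cvg_ip hv hu1 hx (test_pgrad mo tp) ux.
have h2 := cvgN (ip_cvg_ip hl hp hg (test_L2 mo tp) pg).
suff h4 : l2vip omega (u k) (pgrad phi) @[k --> \oo] --> - l2ip omega g phi.
  exact: (cvg_unique (@Rhausdorff R) h1 h4).
rewrite (_ : (fun k => _) = - (fun k => l2ip omega (p k) phi)); first exact: h2.
by apply/funext => k; have [_ /is_weak_divE[_ ->]] := hu k.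
Qed.

Definition hdivip (a b : R) := graph_ip (l2vip omega) (l2ip omega) (div omega) a b.

Lemma Hdiv_div q : Hdiv omega q -> div_rel omega q (div omega q).
Proof. by rewrite Hdiv_graph => -[p]; exact: divP. Qed.

Lemma Hdiv_L2 q : Hdiv omega q -> L2vec omega q.
Proof. by case. Qed.

Lemma Hdiv_L2div q : Hdiv omega q -> L2 omega (div omega q).
Proof. by move=> /Hdiv_div /div_rel_dom[]. Qed.

Lemma hdiv_semi_inner a b : 0 < a -> 0 < b -> semi_inner (Hdiv omega) (hdivip a b).
Proof.
move=> a0 b0; rewrite Hdiv_graph; apply: (graph_semi_inner hv hl) => //.
- exact: div_rel_dom.
- exact: div_rel0.
- exact: div_rel_lin.
- exact: div_rel_null.
- exact: divP.
Qed.

Lemma div_eq q g r : div_rel omega q g -> L2 omega r ->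
  l2ip omega (div omega q) r = l2ip omega g r.
Proof.
move=> wp hq; apply: (graph_D hl _ _ _ _ wp hq).
- exact: div_rel_dom.
- exact: div_rel_lin.
- exact: div_rel_null.
- exact: divP.
Qed.

Lemma Hdiv_subspace : lin_subspace (Hdiv omega : (E -> E) -> Prop).
Proof. exact: si_subspace (hdiv_semi_inner ltr01 ltr01). Qed.

Lemma div_lin a p q r : Hdiv omega p -> Hdiv omega q -> L2 omega r ->
  l2ip omega (div omega (a *: p + q)) r =
  a * l2ip omega (div omega p) r + l2ip omega (div omega q) r.
Proof.
move=> hp hq hr.
rewrite (div_eq (div_rel_lin a (Hdiv_div hp) (Hdiv_div hq)) hr) (si_lin hl)//;
  exact: Hdiv_L2div.
Qed.

End fixed_domain.
End sobolev_spaces.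

Lemma H10E (R : realType) (d : nat) (omega : set 'rV[R]_d) (w : 'rV[R]_d -> R) :
  H10 omega w <-> H1 omega w /\ forall e : R, 0 < e ->
    exists2 phi, test_function omega phi & H1_sqnorm omega (w \- phi) < e.
Proof. exact: iff_refl. Qed.

Lemma traceE (R : realType) (d : nat) (omega : set 'rV[R]_d) (w v : 'rV[R]_d -> R) :
  trace omega w v <-> H1 omega v /\ H10 omega (v - w).
Proof. exact: iff_refl. Qed.

Lemma ip_linr (R : realType) (W : lmodType R) (S : W -> Prop) (ip : W -> W -> R)
    (hS : semi_inner S ip) a x y z : S x -> S y -> S z ->
  ip z (a *: x + y) = a * ip z x + ip z y.
Proof.
move=> Sx Sy Sz; rewrite !(si_sym hS Sz)// ?(si_lin hS)//.
exact: (subspaceL (si_subspace hS)).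
Qed.


(** * Traces, Green's formula and the dual of the trace space *)

Section traces.
Context (R : realType) (d : nat).
Local Notation E := 'rV[R]_d.
Local Notation mu := (lebesgue_rV R d).
Implicit Types (A omega : set E) (f g w v r phi : E -> R) (p q : E -> E).

Lemma Rintegral_support A omega f : A `<=` omega ->
  (forall x, ~ A x -> f x = 0) -> \int[mu]_(x in A) f x = \int[mu]_(x in omega) f x.
Proof.
move=> Ao f0; rewrite [LHS]Rintegral_mkcond [RHS]Rintegral_mkcond.
apply: eq_Rintegral => x _; rewrite !patchE; case: ifPn; rewrite ?inE ?notin_setE => hx.
  by rewrite mem_set//; exact: Ao.
by case: ifP => // _; rewrite f0.
Qed.

Lemma test_supported A phi x : test_function A phi -> ~ A x -> phi x = 0.
Proof. by move=> [_ [K [_ KA h]]] nA; apply: h => /KA. Qed.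

(** The product of [w] with a test function is a test function, so its partial derivatives integrate
    to 0; the product rule turns this into the weak identity. *)
Lemma smooth_grad_rel omega w : measurable omega -> smooth w -> L2 omega w ->
  L2vec omega (pgrad w) -> grad_rel omega w (pgrad w).
Proof.
move=> mo sw hw hp; split => //; split => // phi tp i.
have sph := test_function_smooth tp.
have tw := test_functionM sw tp.
have dw := smooth_differentiable sw; have dp := smooth_differentiable sph.
have t1 := test_functionM sw (test_function_partial i tp).
have t2 := test_functionM (smooth_partial i sw) tp.
have := integral_partial i tw; rewrite (partialM i dw dp).
under eq_Rintegral do rewrite [X in _ + X]mulrC.
rewrite RintegralD//; last 2 first.
- exact: (test_function_integrable t1).
- exact: (test_function_integrable t2).
move/eqP; rewrite addr_eq0 => /eqP h.
rewrite (Rintegral_support (@subsetT _ omega)) ?h.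
  congr (- _); rewrite -(Rintegral_support (@subsetT _ omega)).
    by apply: eq_Rintegral => x _; rewrite mxE.
  by move=> x nx; exact: test_supported t2 nx.
by move=> x nx; exact: test_supported t1 nx.
Qed.

Lemma test_grad_rel A omega phi : measurable omega -> test_function A phi ->
  grad_rel omega phi (pgrad phi).
Proof.
move=> mo tp; apply: smooth_grad_rel => //.
- exact: test_function_smooth tp.
- exact: test_L2 mo tp.
- exact: test_pgrad mo tp.
Qed.

Lemma test_H1 A omega phi : measurable omega -> test_function A phi -> H1 omega phi.
Proof. by move=> mo tp; rewrite H1_graph; exists (pgrad phi); exact: test_grad_rel tp. Qed.

Lemma grad_relS A omega w p : measurable A -> measurable omega -> A `<=` omega ->
  grad_rel omega w p -> grad_rel A w p.
Proof.
move=> mA mo Ao [hw [hp h]]; split; first exact: L2S hw.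
split; first exact: L2vecS hp.
move=> phi tp i; have := h phi (test_functionS Ao tp) i.
rewrite -(Rintegral_support Ao) => [->|x nx]; last first.
  by rewrite (test_supported (test_function_partial i tp) nx) mulr0.
congr (- _); rewrite -(Rintegral_support Ao)// => x nx.
by rewrite (test_supported tp nx) mulr0.
Qed.

Lemma div_relS A omega q g : measurable A -> measurable omega -> A `<=` omega ->
  div_rel omega q g -> div_rel A q g.
Proof.
move=> mA mo Ao [hq [hg h]]; split; first exact: L2vecS hq.
split; first exact: L2S hg.
move=> phi tp; have := h phi (test_functionS Ao tp).
rewrite -(Rintegral_support Ao) => [->|x nx]; last first.
  by rewrite big1// => i _; rewrite (test_supported (test_function_partial i tp) nx) mulr0.
congr (- _); rewrite -(Rintegral_support Ao)// => x nx.
by rewrite (test_supported tp nx) mulr0.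
Qed.

Lemma H1S A omega w : measurable A -> measurable omega -> A `<=` omega ->
  H1 omega w -> H1 A w.
Proof. by move=> mA mo Ao; rewrite !H1_graph => -[p hp]; exists p; exact: grad_relS hp. Qed.

Lemma HdivS A omega q : measurable A -> measurable omega -> A `<=` omega ->
  Hdiv omega q -> Hdiv A q.
Proof. by move=> mA mo Ao; rewrite !Hdiv_graph => -[p hp]; exists p; exact: div_relS hp. Qed.

Section fixed_domain.
Context (omega : set E) (oo : open omega).
Let mo : measurable omega := open_measurable_rV oo.
Let hl := l2_semi_inner mo.
Let hv := l2v_semi_inner mo.
Let h1 : semi_inner (H1 omega) (h1ip omega 1 1) := h1_semi_inner oo ltr01 ltr01.

Lemma H1_sqnormE w : H1_sqnorm omega w = h1ip omega 1 1 w w.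
Proof.
by rewrite /H1_sqnorm /h1ip /graph_ip !mul1r; congr (_ + _).
Qed.

Lemma h1_cvg_graph a b (u : nat -> E -> R) w : 0 < a -> 0 < b ->
  (forall k, H1 omega (u k)) -> H1 omega w ->
  ip_cvg (h1ip omega a b) u w <->
  ip_cvg (l2ip omega) u w /\ ip_cvg (l2vip omega) (fun k => grad omega (u k)) (grad omega w).
Proof.
move=> a0 b0 hu hw.
have hu' k := H1_grad (hu k); have hw' := H1_grad hw.
split=> [uw|[uw guw]].
  apply: (graph_cvg_inv hl hv _ _ _ _ a0 b0 hu' hw' uw).
  - exact: grad_rel_dom.
  - exact: grad_rel_lin.
  - exact: grad_rel_null.
  - exact: gradP.
apply: (graph_cvg hv _ _ _ _ a0 b0 hu' hw' uw guw).
- exact: grad_rel_dom.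
- exact: grad_rel_lin.
- exact: grad_rel_null.
- exact: gradP.
Qed.

Lemma H10_H1 w : H10 omega w -> H1 omega w. Proof. by move/H10E => -[]. Qed.

Lemma H10_seq w : H10 omega w -> exists phi : nat -> E -> R,
  (forall k, test_function omega (phi k)) /\ ip_cvg (h1ip omega 1 1) phi w.
Proof.
move=> /H10E[hw h].
have e0 (k : nat) : 0 < k.+1%:R^-1 :> R by rewrite invr_gt0.
have /choice[phi hphi] : forall k : nat, exists phi, test_function omega phi /\
    H1_sqnorm omega (w \- phi) < k.+1%:R^-1.
  by move=> k; have [phi t1 t2] := h _ (e0 k); exists phi.
exists phi; split; first by move=> k; case: (hphi k).
move=> e ep.
have [N _ hN] := near_infty_natSinv_lt (PosNum ep).
exists N => n /hN /= hn; have [tn] := hphi n.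
rewrite H1_sqnormE -[w \- phi n]/(w - phi n) (ip_sqBC h1 hw (test_H1 mo tn)) => hlt.
exact: lt_trans hlt hn.
Qed.

Lemma H10_approx w : H1 omega w -> (forall e : R, 0 < e ->
  exists2 v, H10 omega v & h1ip omega 1 1 (w - v) (w - v) < e) -> H10 omega w.
Proof.
move=> hw h; apply/H10E; split=> [//|e e0].
have e4 : 0 < e / 4 by rewrite divr_gt0.
have [v /H10E[hv1 hv2] wv] := h _ e4; have [phi tp] := hv2 _ e4.
rewrite H1_sqnormE => vp; exists phi => //; rewrite H1_sqnormE.
have hp := test_H1 mo tp; have sB := subspaceB (H1_subspace oo).
have -> : w \- phi = (w - v) + (v - phi) by rewrite addrA subrK.
apply: (le_lt_trans (ip_sqD_le h1 (sB _ _ hw hv1) (sB _ _ hv1 hp))).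
by move: wv vp; rewrite (_ : v \- phi = v - phi)//; move: (h1ip _ _ _ _ _) (h1ip _ _ _ _ _) => s t; lra.
Qed.

Lemma H10_closed : ip_closed (H1 omega) (h1ip omega 1 1) (H10 omega).
Proof.
move=> u w hu hw uw; apply: H10_approx => // e /uw[N hN]; exists (u N) => //.
by rewrite (ip_sqBC h1)//; [exact: hN|exact: H10_H1].
Qed.

Lemma test_H10 phi : test_function omega phi -> H10 omega phi.
Proof.
move=> tp; apply/H10E; split; first exact: test_H1 tp.
move=> e e0; exists phi => //; rewrite H1_sqnormE.
rewrite (_ : phi \- phi = 0) ?(ip0l h1)//; first exact: (subspace0 (H1_subspace oo)).
by apply/funext => x /=; rewrite subrr.
Qed.

Lemma H10_subspace : lin_subspace (H10 omega : (E -> R) -> Prop).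
Proof.
have sL := subspaceL (H1_subspace oo).
split.
  apply/H10E; split; first exact: (subspace0 (H1_subspace oo)).
  move=> e e0; exists 0; last first.
    rewrite H1_sqnormE (_ : _ \- _ = 0) ?(ip0l h1)//; first exact: (subspace0 (H1_subspace oo)).
    by apply/funext => x /=; rewrite subrr.
  exact: test_function0.
move=> a v w hv1 hw1.
have [f [tf fv]] := H10_seq hv1; have [g [tg gw]] := H10_seq hw1.
have H1v := H10_H1 hv1; have H1w := H10_H1 hw1.
have hc := ip_cvgL h1 a (fun k => test_H1 mo (tf k)) (fun k => test_H1 mo (tg k)) H1v H1w fv gw.
apply: H10_closed hc; last exact: sL.
by move=> k; apply: test_H10; exact: test_functionL.
Qed.

Lemma div_rel_congr q q' g : L2vec omega q' ->
  (forall r : E -> E, L2vec omega r -> l2vip omega q r = l2vip omega q' r) ->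
  div_rel omega q g -> div_rel omega q' g.
Proof.
move=> hq' qq [hq /is_weak_divE[hg h]]; split; first exact: hq'.
apply/is_weak_divE; split; first exact: hg.
by move=> phi tp; rewrite -(qq _ (test_pgrad mo tp)) h.
Qed.

(** For f = div q this is the pairing of the normal trace of [q] with the trace of [w]. Keeping [f]
    apart allows any representative of the divergence. *)
Definition green f q w : R := l2ip omega f w + l2vip omega q (grad omega w).

Lemma green_lin f q a v w : L2 omega f -> L2vec omega q -> H1 omega v -> H1 omega w ->
  green f q (a *: v + w) = a * green f q v + green f q w.
Proof.
move=> hf hq H1v H1w.
have hs := subspaceL (H1_subspace oo) a H1v H1w.
have Ev := H1_L2grad H1v; have Ew := H1_L2grad H1w; have Es := H1_L2grad hs.
have e1 : l2ip omega f (a *: v + w) = a * l2ip omega f v + l2ip omega f w.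
  exact: (ip_linr hl a (H1_L2 H1v) (H1_L2 H1w) hf).
have e2 : l2vip omega q (grad omega (a *: v + w)) =
    a * l2vip omega q (grad omega v) + l2vip omega q (grad omega w).
  by rewrite (si_sym hv hq Es) (grad_lin oo a H1v H1w hq) (si_sym hv Ev hq) (si_sym hv Ew hq).
by rewrite /green e1 e2 mulrDr addrACA.
Qed.

Lemma green_bound f q : L2 omega f -> L2vec omega q -> exists C : R,
  forall w, H1 omega w -> `|green f q w| <= C * Num.sqrt (H1_sqnorm omega w).
Proof.
move=> hf hq; have hp := pair_semi_inner hl hv.
exists (Num.sqrt (pair_ip (l2ip omega) (l2vip omega) (f, q) (f, q))) => w hw.
have hfq : pair_dom (L2 omega) (L2vec omega) (f, q) by [].
have hw2 : pair_dom (L2 omega) (L2vec omega) (w, grad omega w).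
  by split; [exact: H1_L2|exact: H1_L2grad].
have := cauchy_schwarz_ip hp hfq hw2.
rewrite {1}/pair_ip /= -/(green f q w) => h.
rewrite -sqrtrM; last exact: (si_ge0 hp).
rewrite -sqrtr_sqr ler_wsqrtr//; apply: le_trans h _.
Qed.

Lemma green_cvg f q (u : nat -> E -> R) w : L2 omega f -> L2vec omega q ->
  (forall k, H1 omega (u k)) -> H1 omega w -> ip_cvg (h1ip omega 1 1) u w ->
  green f q (u k) @[k --> \oo] --> green f q w.
Proof.
move=> hf hq hu hw /(h1_cvg_graph ltr01 ltr01 hu hw)[uw guw].
apply: cvgD.
  rewrite (si_sym hl hf (H1_L2 hw)).
  rewrite (_ : (fun k => _) = (fun k => l2ip omega (u k) f)).
    by have h := ip_cvg_ip hl (fun k => H1_L2 (hu k)) (H1_L2 hw) hf uw; exact: h.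
  by apply/funext => k; rewrite (si_sym hl hf)//; exact: H1_L2.
rewrite (si_sym hv hq (H1_L2grad hw)).
rewrite (_ : (fun k => _) = (fun k => l2vip omega (grad omega (u k)) q)).
  by have h := ip_cvg_ip hv (fun k => H1_L2grad (hu k)) (H1_L2grad hw) hq guw; exact: h.
by apply/funext => k; rewrite (si_sym hv hq)//; exact: H1_L2grad.
Qed.

Lemma grad_test q phi A : L2vec omega q -> test_function A phi ->
  l2vip omega q (grad omega phi) = l2vip omega q (pgrad phi).
Proof.
move=> hq tp; have tr := test_grad_rel mo tp.
rewrite (si_sym hv)//; last by have := grad_rel_dom (gradP tr); case.
by rewrite (grad_eq oo tr hq) (si_sym hv)//; exact: test_pgrad tp.
Qed.

Lemma green_H10 f q w : L2 omega f -> L2vec omega q ->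
  (forall phi, test_function omega phi -> l2ip omega f phi + l2vip omega q (pgrad phi) = 0) ->
  H10 omega w -> green f q w = 0.
Proof.
move=> hf hq h hw; have [phi [tp cp]] := H10_seq hw.
have := green_cvg hf hq (fun k => test_H1 mo (tp k)) (H10_H1 hw) cp.
rewrite (_ : (fun k => _) = (fun=> 0)).
  by move/(cvg_lim (@Rhausdorff R)) => <-; rewrite lim_cst.
by apply/funext => k; rewrite /green (grad_test hq (tp k)) h.
Qed.

(** The weak divergence is Green's formula for test functions, and test functions are dense in
    H^1_0, on which [green] is continuous. In this form existence of a divergence is read off from
    an orthogonality in H^1_0. *)
Lemma div_rel_green q g : div_rel omega q g <->
  [/\ L2vec omega q, L2 omega g & forall w, H10 omega w -> green g q w = 0].
Proof.
split=> [[hq /is_weak_divE[hg h]]|[hq hg h]].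
  split => // w; apply: green_H10 => // phi tp.
  by rewrite h// subrr.
split => //; apply/is_weak_divE; split => // phi tp.
have := h _ (test_H10 tp); rewrite /green (grad_test hq tp) => /eqP.
by rewrite addrC addr_eq0 => /eqP.
Qed.

Lemma H10_self w : H10 omega (w - w).
Proof. by rewrite subrr; exact: (subspace0 H10_subspace). Qed.

Lemma trace_self w : H1 omega w -> trace omega w w.
Proof. by move=> hw; apply/traceE; split; [exact: hw|exact: H10_self]. Qed.

Lemma trace_eqP v w : H1 omega v -> H1 omega w ->
  trace omega v = trace omega w <-> H10 omega (v - w).
Proof.
move=> H1v H1w; split=> [h|h].
  by have := trace_self H1v; rewrite h => /traceE[].
apply/seteqP; split => u /traceE[H1u hu]; apply/traceE; split; try exact: H1u.
  have -> : u - w = (u - v) + (v - w) by rewrite addrA subrK.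
  exact: (subspaceD H10_subspace hu h).
have -> : u - v = (u - w) - (v - w) by rewrite opprB addrA subrK.
exact: (subspaceB H10_subspace hu h).
Qed.

Lemma trace_Hhalf w : H1 omega w -> Hhalf omega (trace omega w).
Proof. by move=> hw; exists w. Qed.

(** The definition evaluates Green's formula at an arbitrary member of the coset; it differs from
    [w] by an element of H^1_0, on which Green's formula vanishes. *)
Lemma normal_traceE q w : Hdiv omega q -> H1 omega w ->
  normal_trace omega q (trace omega w) = green (div omega q) q w.
Proof.
move=> hq hw; rewrite /normal_trace asboolT; last by exists w.
have /traceE[hx1 hx2] : trace omega w (xget (fun=> 0) (trace omega w)).
  by apply: xgetPex; exists w; exact: trace_self.
set x := xget _ _ in hx1 hx2 *.
rewrite -/(l2ip _ _ _) -/(l2vip _ _ _) -/(green _ _ _).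
have [_ _ h] := (div_rel_green _ _).1 (Hdiv_div hq).
have := green_lin 1 (Hdiv_L2div hq) (Hdiv_L2 hq) (H10_H1 hx2) hw.
rewrite (h _ hx2) mulr0 add0r => <-; congr green.
by rewrite scale1r subrK.
Qed.

Lemma green_Hmhalf f q (F : trace_elt R d -> R) : L2 omega f -> L2vec omega q ->
  (forall u, ~ Hhalf omega u -> F u = 0) ->
  (forall w, H1 omega w -> F (trace omega w) = green f q w) -> Hmhalf omega F.
Proof.
move=> hf hq F0 FE; split => //.
  move=> a v w H1v H1w.
  change (F (trace omega (a *: v + w)) = a * F (trace omega v) + F (trace omega w)).
  have FL := FE _ (subspaceL (H1_subspace oo) a H1v H1w).
  apply: (eq_trans FL); apply: (eq_trans (green_lin a hf hq H1v H1w)).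
  congr (_ * _ + _); apply/esym; exact: FE.
have [C hC] := green_bound hf hq; exists C => w hw; rewrite FE//; exact: hC.
Qed.

Lemma normal_trace_Hmhalf q : Hdiv omega q -> Hmhalf omega (normal_trace omega q).
Proof.
move=> hq; apply: (green_Hmhalf (Hdiv_L2div hq) (Hdiv_L2 hq)).
  by move=> u hu; rewrite /normal_trace asboolF.
by move=> w hw; exact: normal_traceE.
Qed.

Lemma Hmhalf_ext (F G : trace_elt R d -> R) : Hmhalf omega F -> Hmhalf omega G ->
  (forall w, H1 omega w -> F (trace omega w) = G (trace omega w)) -> F = G.
Proof.
move=> [F0 _ _] [G0 _ _] FG; apply/funext => u.
have [[w hw <-]|nu] := pselect (Hhalf omega u); first exact: FG.
by rewrite F0// G0.
Qed.

Lemma Hmhalf_trace0 (F : trace_elt R d -> R) w : Hmhalf omega F -> H10 omega w ->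
  F (trace omega w) = 0.
Proof.
move=> [_ hL _] hw; have z := subspace0 (H1_subspace oo).
have -> : trace omega w = trace omega 0.
  by apply/trace_eqP; [exact: H10_H1|exact: z|rewrite subr0].
have := hL 1 _ _ z z; rewrite (_ : (fun x => _) = 0).
  by rewrite mul1r => /eqP; rewrite -subr_eq0 opprD addrA subrr sub0r oppr_eq0 => /eqP.
by apply/funext => x /=; rewrite mulr0 addr0.
Qed.

(** Riesz in H^1 represents w |-> F(trace w) by some [r]. Since F vanishes on H^1_0, (r, .) is
    orthogonal to H^1_0 in the H^1 inner product, which says div grad r = r. So F is the normal
    trace of grad r, and every functional on traces is a pairing. *)
Lemma Hmhalf_riesz (F : trace_elt R d -> R) : Hmhalf omega F ->
  exists r, [/\ H1 omega r, div_rel omega (grad omega r) r &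
    forall w, H1 omega w -> F (trace omega w) = green r (grad omega r) w].
Proof.
move=> hF; have [F0 hL [C hC]] := hF.
have cS := h1_complete oo (@ltr01 R) (@ltr01 R).
have [||r hr rE] := @riesz_representation _ _ _ _ h1 cS (fun w => F (trace omega w)) (C ^+ 2).
- by move=> a v w H1v H1w; exact: hL.
- move=> w hw; rewrite -H1_sqnormE -[H1_sqnorm omega w]sqr_sqrtr.
    by rewrite -exprMn -[X in X <= _]ger0_norm ?sqr_ge0// normrX lerXn2r ?nnegrE//;
      [exact: le_trans (hC w hw)|exact: hC].
  by rewrite H1_sqnormE (si_ge0 h1).
have E1 w : H1 omega w -> F (trace omega w) = green r (grad omega r) w.
  by move=> hw; rewrite -rE// /h1ip /graph_ip !mul1r.
exists r; split => //; apply/div_rel_green; split; first exact: H1_L2grad.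
  exact: H1_L2.
by move=> w hw; rewrite -E1; [exact: Hmhalf_trace0|exact: H10_H1].
Qed.

End fixed_domain.
End traces.

(** * Convolution and density *)

Lemma differentiable_of_quadratic (R : realType) (d : nat) (f : 'rV[R]_d -> R)
    (p : 'I_d -> R) (x : 'rV[R]_d) (C : R) :
  (forall h, `|f (x + h) - f x - \sum_i h 0 i * p i| <= C * `|h| ^+ 2) ->
  differentiable f x /\ forall i, partial i f x = p i.
Proof.
move=> H; pose df (h : 'rV[R]_d) : R := \sum_i h 0 i * p i.
have df_lin : linear df.
  move=> a u v; rewrite /df scaler_sumr -big_split/=; apply: eq_bigr => i _.
  by rewrite !mxE mulrDl -mulrA.
pose dfl : {linear 'rV[R]_d -> R} := HB.pack df (GRing.isLinear.Build _ _ _ _ df df_lin).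
have cdf : continuous dfl.
  apply: (@smooth_continuous R d df); apply: smooth_sum => i; apply: smoothM.
    exact: smooth_coord.
  exact: smooth_cst.
have E : f \o shift x = cst (f x) + dfl +o_ (0 : 'rV[R]_d) id.
  apply/eqaddoP => e e0; near=> h.
  rewrite [X in `|X|](_ : _ = f (x + h) - f x - df h); last first.
    by change (f (h + x) - (f x + df h) = f (x + h) - f x - df h); rewrite opprD addrA [h + x]addrC.
  apply: le_trans (H h) _; rewrite expr2 mulrA ler_wpM2r//.
  have C0 : 0 < `|C| + 1 by rewrite ltr_wpDl.
  apply: (@le_trans _ _ ((`|C| + 1) * `|h|)).
    by rewrite ler_wpM2r// (le_trans (ler_norm _))// lerDl.
  rewrite mulrC -ler_pdivlMr//.
  near: h; apply/nbhs_ballP; exists (e / (`|C| + 1)) => /=; first by rewrite divr_gt0.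
  by move=> h; rewrite -ball_normE /= sub0r normrN => /ltW.
have dE := diff_unique cdf E.
have dx : differentiable f x by apply/diff_locallyP; rewrite dE.
split => // i; rewrite /partial deriveE// dE /= /df (bigD1 i)//= big1.
  by rewrite mxE !eqxx mul1r addr0.
by move=> j ji; rewrite mxE (negbTE ji) andbF mul0r.
Unshelve. all: by end_near.
Qed.

Section convolution.
Context (R : realType) (d : nat).
Local Notation E := 'rV[R]_d.
Local Notation mu := (lebesgue_rV R d).
Implicit Types (f g w phi kappa : E -> R).

Definition bmeas g := measurable_fun setT g /\ exists C, forall x, `|g x| <= C.
Definition l1 w := mu.-integrable setT (EFin \o w).
Definition weighted_int w g : R := \int[mu]_x (w x * g x).

Lemma l1_meas w : l1 w -> measurable_fun setT w.
Proof. by move=> /integrableP[/measurable_EFinP]. Qed.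

Lemma l1_le w g : l1 w -> measurable_fun setT g -> (forall x, `|g x| <= `|w x|) -> l1 g.
Proof.
move=> iw mg gw; apply: le_integrable iw => //; first exact/measurable_EFinP.
by move=> x _ /=; rewrite lee_fin.
Qed.

Lemma l1Z a w : l1 w -> l1 (fun x => a * w x).
Proof. by move=> iw; have := integrableZl measurableT a iw. Qed.

Lemma l1D v w : l1 v -> l1 w -> l1 (fun x => v x + w x).
Proof. by move=> iv iw; have := integrableD measurableT iv iw. Qed.

Lemma l1_norm w : l1 w -> l1 (fun x => `|w x|).
Proof. by move=> iw; have := integrable_norm iw. Qed.

Lemma l1_bmeas w g : l1 w -> bmeas g -> l1 (fun x => w x * g x).
Proof.
move=> iw [mg [C hC]]; apply: (l1_le (l1Z C iw)).
  exact: measurable_funM (l1_meas iw) mg.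
move=> x; rewrite !normrM mulrC ler_wpM2r//.
by apply: le_trans (hC x) _; exact: ler_norm.
Qed.

Lemma bmeas_cst c : bmeas (fun=> c).
Proof. by split; [exact: measurable_cst|exists `|c|]. Qed.

Lemma bmeasM f g : bmeas f -> bmeas g -> bmeas (fun x => f x * g x).
Proof.
move=> [mf [C hC]] [mg [D hD]]; split; first exact: measurable_funM.
by exists (C * D) => x; rewrite normrM ler_pM.
Qed.

Lemma bmeasD f g : bmeas f -> bmeas g -> bmeas (fun x => f x + g x).
Proof.
move=> [mf [C hC]] [mg [D hD]]; split; first exact: measurable_funD.
by exists (C + D) => x; rewrite (le_trans (ler_normD _ _))// lerD.
Qed.

Lemma bmeas_sum (F : 'I_d -> E -> R) : (forall i, bmeas (F i)) -> bmeas (fun x => \sum_i F i x).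
Proof.
move=> h; elim: (index_enum _) => [|i r IH].
  by under eq_fun do rewrite big_nil; exact: bmeas_cst.
by under eq_fun do rewrite big_cons; exact: bmeasD.
Qed.

Lemma weighted_intL w a f g : l1 w -> bmeas f -> bmeas g ->
  weighted_int w (fun x => a * f x + g x) = a * weighted_int w f + weighted_int w g.
Proof.
move=> iw bf bg; rewrite /weighted_int.
under eq_Rintegral do rewrite mulrDr mulrCA.
rewrite RintegralD//.
- by rewrite RintegralZl//; exact: (l1_bmeas iw bf).
- exact: (l1Z a (l1_bmeas iw bf)).
- exact: (l1_bmeas iw bg).
Qed.

Lemma weighted_int_sum w (c : 'I_d -> R) (F : 'I_d -> E -> R) : l1 w -> (forall i, bmeas (F i)) ->
  weighted_int w (fun x => \sum_i c i * F i x) = \sum_i c i * weighted_int w (F i).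
Proof.
move=> iw h; rewrite /weighted_int.
under eq_Rintegral do rewrite mulr_sumr.
rewrite Rintegral_sum//.
  apply: eq_bigr => i _; under eq_Rintegral do rewrite mulrCA.
  by rewrite RintegralZl//; exact: (l1_bmeas iw (h i)).
move=> i; apply: (l1_bmeas iw); apply: bmeasM (h i); exact: bmeas_cst.
Qed.

Lemma weighted_int_bound w g C : l1 w -> bmeas g -> (forall x, w x != 0 -> `|g x| <= C) ->
  `|weighted_int w g| <= C * \int[mu]_x `|w x|.
Proof.
move=> iw bg hC; rewrite /weighted_int.
have i1 := l1_bmeas iw bg.
apply: le_trans (le_normr_Rintegral measurableT i1) _.
rewrite -RintegralZl//; last exact: (l1_norm iw).
apply: le_Rintegral => //.
- exact: (l1_norm i1).
- exact: (l1Z C (l1_norm iw)).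
move=> x _; rewrite normrM; have [->|w0] := eqVneq (w x) 0.
  by rewrite normr0 mul0r mulr0.
by rewrite mulrC ler_wpM2r// hC.
Qed.

Lemma test_reflect kappa (x : E) : test_function setT kappa -> bmeas (fun y => kappa (x - y)).
Proof.
move=> tk; split.
  have := measurable_smooth (smooth_affine (-1) x (test_function_smooth tk)).
  by congr measurable_fun; apply/funext => y; rewrite scaleN1r addrC.
by have [C _ hC] := test_function_bounded tk; exists C.
Qed.

Definition convolve w kappa (x : E) : R := weighted_int w (fun y => kappa (x - y)).

(** Taylor's formula bounds the remainder of the kernel by C |h|^2 uniformly in the integration
    variable; integrating against [w] gives the same bound for the convolution, and
    [differentiable_of_quadratic] applies. *)
Lemma conv_diff w kappa x : l1 w -> test_function setT kappa ->
  differentiable (convolve w kappa) x /\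
  forall i, partial i (convolve w kappa) x = convolve w (partial i kappa) x.
Proof.
move=> iw tk.
have tki i := test_function_partial i tk.
have [B hB] : exists B : R, forall i j y, `|partial j (partial i kappa) y| <= B.
  have h i j : exists B : R, forall y, `|partial j (partial i kappa) y| <= B.
    by have [B _ hB] := test_function_bounded (test_function_partial j (tki i)); exists B.
  have /choice[b hb] := fun ij : 'I_d * 'I_d => h ij.1 ij.2.
  exists (\sum_ij `|b ij|) => i j y; apply: le_trans (hb (i, j) y) _.
  by apply: le_trans (ler_norm _) _; rewrite (bigD1 (i, j))//= lerDl sumr_ge0.
apply: (@differentiable_of_quadratic _ _ _ _ _ (d%:R ^+ 2 * B * \int[mu]_x `|w x|)) => h.
have b1 := test_reflect (x + h) tk; have b2 := test_reflect x tk.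
have b3 i := test_reflect x (tki i).
have bs : bmeas (fun y => \sum_i h 0 i * partial i kappa (x - y)).
  by apply: bmeas_sum => i; apply: bmeasM (b3 i); exact: bmeas_cst.
have bA : bmeas (fun y => -1 * kappa (x - y) + kappa (x + h - y)).
  by apply: bmeasD => //; apply: bmeasM => //; exact: bmeas_cst.
rewrite /convolve -(weighted_int_sum _ iw b3).
have -> : weighted_int w (fun y => kappa (x + h - y)) - weighted_int w (fun y => kappa (x - y)) -
    weighted_int w (fun y => \sum_i h 0 i * partial i kappa (x - y)) =
    weighted_int w (fun y => -1 * (\sum_i h 0 i * partial i kappa (x - y)) +
      (-1 * kappa (x - y) + kappa (x + h - y))).
  by rewrite (weighted_intL (-1) iw bs bA) (weighted_intL (-1) iw b2 b1) !mulN1r;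
    move: (weighted_int _ _) (weighted_int _ _) (weighted_int _ _) => s t u; ring.
rewrite mulrAC; apply: weighted_int_bound => //.
  by apply: bmeasD => //; apply: bmeasM => //; exact: bmeas_cst.
move=> y _; have := taylor_partial (test_function_smooth tk) hB (x - y) h.
rewrite mulrAC; congr (`|_| <= _).
by rewrite !mulN1r addrC [- kappa _ + _]addrC addrAC.
Qed.

Lemma smooth_conv w kappa : l1 w -> test_function setT kappa -> smooth (convolve w kappa).
Proof.
move=> iw tk s x.
suff [k' tk' ->] : exists2 k', test_function setT k' & foldr (@partial R d) (convolve w kappa) s = convolve w k'.
  by have [] := conv_diff x iw tk'.
elim: s => [|i s [k' tk' IH]] /=; first by exists kappa.
exists (partial i k'); first exact: test_function_partial.
by rewrite IH; apply/funext => y; have [_] := conv_diff y iw tk'; exact.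
Qed.

Lemma partial_conv w kappa i : l1 w -> test_function setT kappa ->
  partial i (convolve w kappa) = convolve w (partial i kappa).
Proof. by move=> iw tk; apply/funext => y; have [_] := conv_diff y iw tk; exact. Qed.

Lemma bmeas_conv w kappa : l1 w -> test_function setT kappa -> bmeas (convolve w kappa).
Proof.
move=> iw tk; split; first by apply: measurable_smooth; exact: smooth_conv.
have [C _ hC] := test_function_bounded tk; exists (C * \int[mu]_x `|w x|) => x.
by apply: weighted_int_bound => //; exact: test_reflect.
Qed.


(** Fubini moves the mollification from [w] to [phi]. The triple product is integrable on the
    product space because [kappa] is bounded and the other two factors are integrable. *)
Lemma conv_swap w phi kappa (a : R) (b : E) : l1 w -> l1 phi -> test_function setT kappa ->
  l1 (fun y => w y * \int[mu]_x (phi x * kappa (a *: x + b - y))) /\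
  \int[mu]_x (phi x * convolve w kappa (a *: x + b)) =
  \int[mu]_y (w y * \int[mu]_x (phi x * kappa (a *: x + b - y))).
Proof.
move=> iw ip tk.
pose F (z : E * E) : R := phi z.2 * (w z.1 * kappa (a *: z.2 + b - z.1)).
have mF : measurable_fun setT F.
  apply: measurable_funM.
    exact: (measurableT_comp (l1_meas ip) measurable_snd).
  apply: measurable_funM.
    exact: (measurableT_comp (l1_meas iw) measurable_fst).
  have mk := measurable_smooth (test_function_smooth tk).
  apply: (measurableT_comp mk); apply: measurable_fun_rV => i.
  under eq_fun do rewrite !mxE.
  apply: measurable_funB.
    apply: measurable_funD; last exact: measurable_cst.
    apply: measurable_funM; first exact: measurable_cst.
    exact: (measurableT_comp (measurable_coord i) measurable_snd).
  exact: (measurableT_comp (measurable_coord i) measurable_fst).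
have [C C0 hC] := test_function_bounded tk.
have bk x : bmeas (fun y => kappa (a *: x + b - y)) by exact: test_reflect.
have bk2 y : bmeas (fun x => kappa (a *: x + b - y)).
  split; last by exists C.
  have := measurable_smooth (smooth_affine a (b - y) (test_function_smooth tk)).
  by congr measurable_fun; apply/funext => x; rewrite addrA.
have iF : (mu \x mu)%E.-integrable setT (EFin \o F).
  apply/integrable12ltyP; first exact/measurable_EFinP.
  apply: (@le_lt_trans _ _ (\int[mu]_y (`|w y| * (C * \int[mu]_x `|phi x|))%:E)%E).
    apply: ge0_le_integral => //.
    - by move=> x _; apply: integral_ge0.
    - have := @measurable_fun_fubini_tonelli_F _ _ _ _ _ mu (fun z => `|(F z)%:E|)%E.
      apply; last by move=> z.
      by do 2 apply: measurableT_comp => //.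
    - apply/measurable_EFinP; apply: measurable_funM => //.
      exact: (l1_meas (l1_norm iw)).
    move=> y _.
    have i2 := l1_norm (l1Z (w y) (l1_bmeas ip (bk2 y))).
    have -> : (\int[mu]_x `|(F (y, x))%:E| = (\int[mu]_x `|w y * (phi x * kappa (a *: x + b - y))|)%:E)%E.
      rewrite (EFin_Rintegral measurableT i2); apply: eq_integral => x _ /=.
      by congr (`|_|%:E); rewrite /F /= mulrCA.
    rewrite lee_fin mulrA -RintegralZl//; last exact: (l1_norm ip).
    apply: le_Rintegral => //; first exact: (l1Z (`|w y| * C) (l1_norm ip)).
    by move=> x _; rewrite !normrM -mulrA ler_wpM2l// mulrC ler_wpM2r.
  have i3 := l1Z (C * \int[mu]_x `|phi x|) (l1_norm iw).
  case/integrableP: i3 => _; congr (_ < _)%E; apply: eq_integral => x _ /=.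
  congr (_%:E); rewrite ger0_norm mulrC//.
  by rewrite !mulr_ge0//; [exact: ltW|apply: Rintegral_ge0].
have := Fubini iF.
have G2 y : (\int[mu]_x (EFin \o F) (y, x))%E =
    (w y * \int[mu]_x (phi x * kappa (a *: x + b - y)))%:E.
  have i1 := l1Z (w y) (l1_bmeas ip (bk2 y)).
  rewrite -RintegralZl//; last exact: (l1_bmeas ip (bk2 y)).
  rewrite (EFin_Rintegral measurableT i1); apply: eq_integral => x _.
  by rewrite /F /= mulrCA.
have G1 x : (\int[mu]_y (EFin \o F) (y, x))%E = (phi x * convolve w kappa (a *: x + b))%:E.
  have i1 := l1_bmeas iw (bk x).
  by rewrite /convolve /weighted_int -RintegralZl// (EFin_Rintegral measurableT (l1Z (phi x) i1)).
move=> FE; split.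
  have := integrable_fubini_F iF; congr (_.-integrable _ _).
  by apply/funext => y; exact: G2.
have H : (\int[mu]_x (phi x * convolve w kappa (a *: x + b))%:E)%E =
    (\int[mu]_y (w y * \int[mu]_x (phi x * kappa (a *: x + b - y)))%:E)%E.
  apply: etrans; last by apply: eq_integral => y _; exact: G2.
  by rewrite FE; apply: eq_integral => x _; rewrite G1.
exact: (congr1 fine H).
Qed.

Record mollifier (h : R) kappa : Prop := Mollifier {
  moll_test : test_function setT kappa ;
  moll_ge0 : forall x, 0 <= kappa x ;
  moll_int : \int[mu]_x kappa x = 1 ;
  moll_supp : forall x, h <= `|x| -> kappa x = 0 }.

Lemma moll_bmeas h kappa (a : R) (b : E) : mollifier h kappa ->
  bmeas (fun x => kappa (a *: x + b)).
Proof.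
move=> mk; have tk := moll_test mk; split.
  exact: measurable_smooth (smooth_affine a b (test_function_smooth tk)).
by have [C _ hC] := test_function_bounded tk; exists C.
Qed.

Lemma moll_l1 h kappa : mollifier h kappa -> l1 kappa.
Proof. by move=> mk; exact: test_function_integrable (moll_test mk). Qed.

Lemma moll_affine h kappa (a : R) (b : E) : mollifier h kappa -> 0 < a ->
  l1 (fun x => kappa (a *: x + b)) /\ \int[mu]_x kappa (a *: x + b) = a ^- d.
Proof.
move=> mk a0; have ik := moll_l1 mk; split.
  by apply: integrable_affine_rV ik; rewrite gt_eqF.
rewrite integral_affine_rV ?gt_eqF//; last exact: l1_meas.
by rewrite (moll_int mk) mulr1 gtr0_norm.
Qed.

Lemma moll_refl h kappa x : mollifier h kappa ->
  l1 (fun y => kappa (x - y)) /\ \int[mu]_y kappa (x - y) = 1.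
Proof.
move=> mk; have ik := moll_l1 mk.
have E1 : (fun y => kappa (x - y)) = (fun y => kappa (-1 *: y + x)).
  by apply/funext => y; rewrite scaleN1r addrC.
rewrite E1; split; first by apply: integrable_affine_rV ik; rewrite oppr_eq0 oner_eq0.
rewrite integral_affine_rV ?oppr_eq0 ?oner_eq0//; last exact: l1_meas.
by rewrite (moll_int mk) mulr1 normrN1 expr1n invr1.
Qed.

(** Jensen's inequality: with t the mean of [w] under the probability density kappa(x - .), expand
    the nonnegative integral of (w - t)^2 against it. *)
Lemma conv_sqr w kappa h x : l1 w -> l1 (fun y => w y ^+ 2) -> mollifier h kappa ->
  convolve w kappa x ^+ 2 <= convolve (fun y => w y ^+ 2) kappa x.
Proof.
move=> iw iw2 mk; have [ik Ik] := moll_refl x mk.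
have bk := test_reflect x (moll_test mk).
set t := convolve w kappa x.
have i1 := l1_bmeas iw2 bk; have i2 := l1_bmeas iw bk.
have : 0 <= \int[mu]_y ((w y - t) ^+ 2 * kappa (x - y)).
  by apply: Rintegral_ge0 => y _; rewrite mulr_ge0 ?sqr_ge0 ?(moll_ge0 mk).
have -> : \int[mu]_y ((w y - t) ^+ 2 * kappa (x - y)) =
    convolve (fun y => w y ^+ 2) kappa x + ((- (2 * t)) * t + t ^+ 2 * 1).
  rewrite -{2}Ik -RintegralZl// -[X in - (2 * t) * X]/(\int[mu]_y (w y * kappa (x - y))).
  rewrite -RintegralZl// -RintegralD//; last 2 first.
  - exact: (l1Z (- (2 * t)) i2).
  - exact: (l1Z (t ^+ 2) ik).
  rewrite -RintegralD//; last exact: (l1D (l1Z (- (2 * t)) i2) (l1Z (t ^+ 2) ik)).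
  by apply: eq_Rintegral => y _; ring.
by move: (convolve _ _ _) => s; nra.
Qed.

(** After [conv_sqr] and an exchange of integrals, the kernel integrates over x to at most a^-d, the
    Jacobian of the dilation. *)
Lemma conv_sq_bound w kappa h (B : set E) (a : R) (b : E) :
  l1 w -> l1 (fun y => w y ^+ 2) -> mollifier h kappa -> 0 < a ->
  measurable B -> (mu B < +oo)%E ->
  \int[mu]_(x in B) convolve w kappa (a *: x + b) ^+ 2 <= a ^- d * \int[mu]_y w y ^+ 2.
Proof.
move=> iw iw2 mk a0 mB Boo; have tk := moll_test mk.
have bc g : l1 g -> bmeas (fun x => convolve g kappa (a *: x + b)).
  move=> ig; have [_ [C hC]] := bmeas_conv ig tk; split; last by exists C.
  exact: measurable_smooth (smooth_affine a b (smooth_conv ig tk)).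
pose phi : E -> R := \1_B.
have mphi : measurable_fun setT phi by exact: measurable_indic.
have phi01 x : 0 <= phi x <= 1 by rewrite /phi indicE; case: (_ \in _) => /=; rewrite ?ler01 ?lexx.
have iphi : l1 phi.
  apply: (@bounded_support_integrable _ _ B _ 1) => //.
    by move=> x; have /andP[? ?] := phi01 x; rewrite ger0_norm.
  by move=> x nB; rewrite /phi indicE memNset.
have inB g : \int[mu]_(x in B) g x = \int[mu]_x (phi x * g x).
  rewrite [LHS]Rintegral_mkcond; apply: eq_Rintegral => x _.
  by rewrite patchE /phi indicE; case: ifP => _; rewrite ?mul1r ?mul0r.
apply: (@le_trans _ _ (\int[mu]_(x in B) convolve (fun y => w y ^+ 2) kappa (a *: x + b))).
  rewrite !inB; apply: le_Rintegral => //.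
  - by apply: (l1_bmeas iphi); have := bmeasM (bc _ iw) (bc _ iw); under eq_fun do rewrite -expr2.
  - exact: (l1_bmeas iphi (bc _ iw2)).
  - by move=> x _; rewrite ler_wpM2l ?(conv_sqr _ iw iw2 mk)//; have /andP[] := phi01 x.
have [isw swE] := conv_swap a b iw2 iphi tk.
have -> : a ^- d * \int[mu]_y w y ^+ 2 = \int[mu]_y (w y ^+ 2 * a ^- d).
  by under [RHS]eq_Rintegral do rewrite mulrC; rewrite RintegralZl.
rewrite inB swE.
have bk2 y : bmeas (fun x => kappa (a *: x + b - y)).
  by have := moll_bmeas a (b - y) mk; under eq_fun do rewrite addrA.
have E1 y : (fun x => kappa (a *: x + b - y)) = (fun x => kappa (a *: x + (b - y))).
  by apply/funext => x; rewrite addrA.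
have le1 y : 0 <= \int[mu]_x (phi x * kappa (a *: x + b - y)) <= a ^- d.
  apply/andP; split.
    by apply: Rintegral_ge0 => x _; rewrite mulr_ge0 ?(moll_ge0 mk)//; have /andP[] := phi01 x.
  have [ik Ik] := moll_affine (b - y) mk a0; rewrite -Ik.
  apply: le_Rintegral; [exact: measurableT|exact: (l1_bmeas iphi (bk2 y))|exact: ik|].
  move=> x _; rewrite -addrA; have /andP[_ p1] := phi01 x.
  exact: (ler_piMl (moll_ge0 mk _) p1).
apply: le_Rintegral; [exact: measurableT|exact: isw| |].
- exact: (l1_bmeas iw2 (bmeas_cst _)).
- by move=> y _; have /andP[_ h1] := le1 y; exact: (ler_wpM2l (sqr_ge0 _) h1).
Qed.

End convolution.

Opaque L2 H1 H10 trace Rintegral grad div.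

Section mollifier_existence.
Context (R : realType).
Local Notation mu d := (lebesgue_rV R d).

Lemma lebesgue_rV_box_gt0 n (r : R) : 0 < r ->
  (0 < mu n [set x : 'rV[R]_n | forall i, (`|x 0 i| <= r)%R])%E.
Proof.
move=> r0; elim: n => [|n IH].
  rewrite /= diracE mem_set; first by rewrite lte01.
  by move=> [].
set B := [set _ | _] in IH; set B' := [set x | _].
have mB : measurable B by exact: measurable_cube.
have mB' : measurable B' by exact: measurable_cube.
pose Ir : set (measurableTypeR R) := `[(- r), r]%classic.
have -> : mu n.+1 B' = product_measure1 (@lebesgue_measure R) (mu n) (@rV_cons R n @^-1` B') by [].
have -> : @rV_cons R n @^-1` B' = Ir `*` B.
  apply/seteqP; split => [[t x] /= h|[t x] [/= h1 h2] i].
    split => /=.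
      by have := h ord0; rewrite !mxE unlift_none /Ir/= in_itv/= ler_norml.
    by move=> i; have := h (lift ord0 i); rewrite !mxE liftK.
  case: (unliftP ord0 i) => [j|] ->; rewrite mxE ?liftK ?unlift_none//.
  by move: h1; rewrite /Ir/= in_itv/= ler_norml.
have Irp : (0 < lebesgue_measure Ir)%E.
  by rewrite /Ir lebesgue_measure_itv/= lte_fin gtrN// -EFinB lte_fin opprK addr_gt0.
rewrite product_measure1E//; last exact: measurable_itv.
exact: mule_gt0.
Qed.

Lemma mollifier_exists d (h : R) : 0 < h -> exists kappa : 'rV[R]_d -> R, mollifier h kappa.
Proof.
move=> h0; pose k0 := @box_bump R d 1 (fun=> - h) (fun=> h).
have tk : test_function setT k0 by apply: test_bump.
have ik := test_function_integrable tk.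
pose c := \int[mu d]_x k0 x.
have c0 : 0 <= c by apply: Rintegral_ge0 => x _; exact: bump_ge0.
(* If the integral were 0, the bump would vanish almost everywhere; it is positive on the open box,
   which contains a cube of positive measure. *)
have cn0 : c != 0.
  apply/eqP => c_0; pose O := @obox R d (fun=> - h) (fun=> h).
  have mO : measurable O by exact: measurable_obox.
  have : {ae mu d, forall x, setT x -> (EFin \o k0) x = 0%E}.
    apply/(ae_eq_integral_abs (mu d) measurableT); first by case/integrableP: ik.
    rewrite -[RHS]/(0%:E) -[in RHS]c_0 /c (EFin_Rintegral measurableT ik).
    by apply: eq_integral => x _; rewrite /= ger0_norm//; exact: bump_ge0.
  move=> ae0; have nO : (mu d).-negligible O.
    apply: negligibleS ae0 => x Ox /= /(_ I) [] k00.
    by have := bump_gt0 ltr01 Ox; rewrite -/k0 k00 ltxx.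
  have h2 : 0 < h / 2 by rewrite divr_gt0.
  have := lebesgue_rV_box_gt0 d h2; rewrite ltNge => /negP; case.
  have <- : (mu d) O = 0%E by apply: measure_negligible.
  apply: le_measure; rewrite ?inE//; first exact: measurable_cube.
  move=> x hx i; have := hx i; rewrite ler_norml => /andP[h3 h4]; apply/andP; split; lra.
have cp : 0 < c by rewrite lt_neqAle eq_sym cn0.
exists (fun x => c^-1 * k0 x); split.
- exact: test_functionM (smooth_cst c^-1) tk.
- by move=> x; apply: mulr_ge0; [rewrite invr_ge0 ltW|exact: bump_ge0].
- by rewrite RintegralZl// mulVf.
- move=> x hx; rewrite /k0 bump_eq0 ?mulr0// => hO.
  move: hx; rewrite leNgt => /negP; apply; rewrite /Num.norm/= mx_normrE.
  by apply/bigmax_ltP; split => // -[i j] _; rewrite ord1 ltr_norml; exact: hO.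
Qed.

End mollifier_existence.

(** * Weak approximation by mollified functions *)

Section approximation.
Context (R : realType) (d : nat).
Local Notation E := 'rV[R]_d.
Local Notation mu := (lebesgue_rV R d).
Implicit Types (f g w phi kappa : E -> R) (T : set E) (p : E -> E).

Lemma bounded_lty T : measurable T -> bounded_set T -> (mu T < +oo)%E.
Proof.
move=> mT [M [Mr hM]].
apply: le_lt_trans (lebesgue_rV_box d (`|M| + 1)); apply: le_measure; rewrite ?inE//.
  exact: measurable_cube.
move=> x Tx i; apply: le_trans (ler_coord x i) _; apply: hM Tx.
by rewrite (le_lt_trans (ler_norm _))// ltrDl.
Qed.

Lemma weighted_int_patch T w g : weighted_int (w \_ T) g = l2ip T w g.
Proof.
rewrite /weighted_int /l2ip [RHS]Rintegral_mkcond; apply: eq_Rintegral => x _.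
by rewrite !patchE; case: ifP => _ //; rewrite mul0r.
Qed.

Lemma L2_patch T w : measurable T -> (mu T < +oo)%E -> L2 T w ->
  [/\ l1 (w \_ T), l1 (fun y => (w \_ T) y ^+ 2) &
      \int[mu]_y ((w \_ T) y ^+ 2) = l2ip T w w].
Proof.
move=> mT Too hw; have sw := (L2P _ mT).1 hw; split.
- have := sqint_integrable mT Too sw; rewrite integrable_mkcond//.
  by congr (_.-integrable _ _); apply/funext => x; rewrite /= !patchE; case: ifP.
- case: sw => _; rewrite integrable_mkcond//.
  congr (_.-integrable _ _); apply/funext => x; rewrite /= !patchE; case: ifP => //.
  by rewrite expr0n.
- rewrite /l2ip [RHS]Rintegral_mkcond; apply: eq_Rintegral => x _.
  by rewrite !patchE; case: ifP => // _; rewrite expr0n.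
Qed.

Lemma moll_test_shift T h kappa x : 0 < h -> mollifier h kappa ->
  (forall y, `|x - y| <= h -> T y) -> test_function T (fun y => kappa (x - y)).
Proof.
move=> h0 mk hT; split.
  have := smooth_affine (-1) x (test_function_smooth (moll_test mk)).
  by congr smooth; apply/funext => y; rewrite scaleN1r addrC.
exists (@cbox R d (fun i => x 0 i - h) (fun i => x 0 i + h)); split.
- exact: compact_cbox.
- move=> y hy; apply: hT; apply/(rV_normP _ (ltW h0)) => i; rewrite !mxE.
  by have := hy i => /andP[h1 h2]; rewrite ler_norml; apply/andP; split; lra.
move=> y ny; apply: (moll_supp mk); rewrite leNgt; apply/negP => hlt; apply: ny => i.
have := le_lt_trans (ler_coord (x - y) i) hlt; rewrite !mxE ltr_norml => /andP[h1 h2].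
by apply/andP; split; lra.
Qed.

(** If the ball of radius h about x lies in T, then y |-> kappa(x - y) is a test function of T, so
    the weak gradient identity applies to it; the reflection changes the sign of the derivative,
    which cancels the minus sign of the identity. *)
Lemma convolve_grad T w p h kappa x i : measurable T -> grad_rel T w p -> 0 < h ->
  mollifier h kappa -> (forall y, `|x - y| <= h -> T y) ->
  convolve (w \_ T) (partial i kappa) x = convolve (comps p i \_ T) kappa x.
Proof.
move=> mT [hw [hp H]] h0 mk hT; have tT := moll_test_shift h0 mk hT.
have := H _ tT i; rewrite /convolve !weighted_int_patch.
have E1 : partial i (fun y => kappa (x - y)) = (fun y => -1 * partial i kappa (x - y)).
  have -> : (fun y => kappa (x - y)) = (fun y => kappa (-1 *: y + x)).
    by apply/funext => y; rewrite scaleN1r addrC.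
  rewrite partial_affine; last exact: smooth_differentiable (test_function_smooth (moll_test mk)).
  by apply/funext => y; rewrite scaleN1r addrC.
have t2 := test_L2 mT (test_function_partial i tT).
have hl := l2_semi_inner mT.
have E2 : (fun y => partial i kappa (x - y)) = -1 *: partial i (fun y => kappa (x - y)).
  rewrite scaleN1r E1; apply/funext => y.
  change (partial i kappa (x - y) = - (-1 * partial i kappa (x - y))).
  by rewrite mulN1r opprK.
move=> H1; rewrite E2 (ipZr hl (-1) t2 hw) mulN1r.
by rewrite [l2ip _ _ _]H1 opprK.
Qed.

(** Apply [weak_limit_closed] to the pairs (z, grad z) in L^2 with z in [N], a closed subspace. Test
    functions in each component form a total set. Convergence of the gradients against test
    functions follows from that of [z], by integrating by parts. *)
Lemma weak_limit_grad T (N : (E -> R) -> Prop) (z : nat -> E -> R) (p : nat -> E -> E) w (c : R) :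
  open T -> lin_subspace N -> (forall v, N v -> H1 T v) ->
  ip_closed (H1 T) (h1ip T 1 1) N ->
  (forall k, N (z k)) -> (forall k, grad_rel T (z k) (p k)) ->
  (forall k, l2ip T (z k) (z k) <= c) -> (forall k, l2vip T (p k) (p k) <= c) ->
  H1 T w ->
  (forall phi, test_function T phi -> l2ip T (z k) phi @[k --> \oo] --> l2ip T w phi) ->
  N w.
Proof.
move=> oT sN NH cN Nz zp zc pc hw zw; have mT := open_measurable_rV oT.
have hl := l2_semi_inner mT; have hv := l2v_semi_inner mT.
have hP := pair_semi_inner hl hv.
have cP := pair_complete hl hv (l2_complete mT) (l2v_complete mT).
pose M (x : (E -> R) * (E -> E)) := N x.1 /\ grad_rel T x.1 x.2.
pose D (e : (E -> R) * (E -> E)) := exists2 phi, test_function T phi &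
  e = (phi, 0) \/ exists i, e = (0, (fun x => phi x *: delta_mx 0 i)).
have L0 := subspace0 (si_subspace hl); have V0 := subspace0 (si_subspace hv).
have MS y : M y -> pair_dom (L2 T) (L2vec T) y.
  by move=> [_ /grad_rel_dom].
have gw := H1_grad hw; have [L2w L2g] := grad_rel_dom gw.
have sM : lin_subspace M.
  split; first by split; [exact: subspace0 sN|exact: grad_rel0].
  move=> a x y [x1 x2] [y1 y2]; split; first exact: (subspaceL sN).
  exact: (grad_rel_lin oT).
have cM : ip_closed (pair_dom (L2 T) (L2vec T)) (pair_ip (l2ip T) (l2vip T)) M.
  move=> u x Mu [x1 x2] ux.
  have ge0 k : 0 <= l2ip T ((u k).1 - x.1) ((u k).1 - x.1) /\
      0 <= l2vip T ((u k).2 - x.2) ((u k).2 - x.2).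
    have [k1 k2] := MS _ (Mu k).
    split; first exact: (si_ge0 hl (subspaceB (si_subspace hl) k1 x1)).
    exact: (si_ge0 hv (subspaceB (si_subspace hv) k2 x2)).
  have u1 : ip_cvg (l2ip T) (fun k => (u k).1) x.1.
    move=> e /ux[K hK]; exists K => n /hK; apply: le_lt_trans.
    by rewrite /pair_ip lerDl; case: (ge0 n).
  have u2 : ip_cvg (l2vip T) (fun k => (u k).2) x.2.
    move=> e /ux[K hK]; exists K => n /hK; apply: le_lt_trans.
    by rewrite /pair_ip lerDr; case: (ge0 n).
  have gx := grad_rel_closed oT (fun k => (Mu k).2) x1 x2 u1 u2.
  split; last exact: gx.
  apply: (cN (fun k => (u k).1)); first by move=> k; case: (Mu k).
    by rewrite H1_graph; exists x.2.
  apply: (graph_cvg hv _ _ _ _ ltr01 ltr01 (fun k => (Mu k).2) gx u1 u2).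
  - exact: grad_rel_dom.
  - exact: grad_rel_lin.
  - exact: grad_rel_null.
  - exact: gradP.
have zcv i phi : test_function T phi -> l2ip T (comps (p k) i) phi @[k --> \oo] -->
    l2ip T (comps (grad T w) i) phi.
  move=> tp; have h1 := cvgN (zw _ (test_function_partial i tp)).
  have -> : l2ip T (comps (grad T w) i) phi = - l2ip T w (partial i phi).
    by apply: oppr_inj; rewrite opprK; have [_ [_ H]] := gw; rewrite [RHS]H.
  rewrite (_ : (fun k => _) = - (fun k => l2ip T (z k) (partial i phi))); first exact: h1.
  apply/funext => k; apply: oppr_inj; have [_ [_ H]] := zp k.
  by rewrite [RHS]opprK [RHS]H.
suff [] : M (w, grad T w) by [].
apply: (@weak_limit_closed _ _ _ _ hP cP M D (fun k => (z k, p k)) _ (c + c) sM MS cM).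
- by split.
- by move=> k; split; [exact: Nz|exact: zp].
- by move=> k; exact: (lerD (zc k) (pc k)).
- move=> e [phi tp [->|[i ->]]]; split => //=.
  + exact: test_L2 tp.
  + by apply: L2_delta => //; exact: test_L2 tp.
- move=> r [r1 r2] hr; rewrite /pair_ip (l2_test_total oT r1) ?add0r.
    rewrite (l2vipE mT r2 r2) /prod_ip big1// => i _.
    apply: (l2_test_total oT (r2 i)) => phi tp.
    have := hr (0, (fun x => phi x *: delta_mx 0 i)); rewrite /pair_ip /= (ip0r hl r1) add0r.
    by rewrite l2vip_delta; apply; exists phi => //; right; exists i.
  move=> phi tp; have := hr (phi, 0); rewrite /pair_ip /= (ip0r hv r2) addr0; apply.
  by exists phi => //; left.
- move=> e [phi tp [->|[i ->]]]; rewrite /pair_ip /=.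
    rewrite (ip0r hv L2g) addr0.
    rewrite (_ : (fun k => _) = (fun k => l2ip T (z k) phi)); first exact: zw.
    by apply/funext => k; rewrite (ip0r hv) ?addr0//; have [] := MS (z k, p k) (conj (Nz k) (zp k)).
  rewrite (ip0r hl L2w) add0r l2vip_delta.
  rewrite (_ : (fun k => _) = (fun k => l2ip T (comps (p k) i) phi)); first exact: zcv.
  apply/funext => k; rewrite (ip0r hl) ?add0r ?l2vip_delta//.
  by have [] := MS (z k, p k) (conj (Nz k) (zp k)).
Qed.

Lemma test_lipschitz T phi : test_function T phi -> exists2 L : R, 0 <= L &
  forall x y, `|phi x - phi y| <= L * `|x - y|.
Proof.
move=> tp.
have h i : exists B : R, forall y, `|partial i phi y| <= B.
  by have [B _ hB] := test_function_bounded (test_function_partial i tp); exists B.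
have /choice[b hb] := h.
have hB i y : `|partial i phi y| <= \sum_i `|b i|.
  apply: le_trans (hb i y) _.
  by apply: le_trans (ler_norm _) _; rewrite (bigD1 i)//= lerDl sumr_ge0.
exists (d%:R * \sum_i `|b i|); first by rewrite mulr_ge0// sumr_ge0.
move=> x y.
have := lipschitz_partial (smooth_differentiable (test_function_smooth tp)) hB y (x - y).
by rewrite [y + _]addrC subrK.
Qed.

Lemma bmeas_L2 T g : measurable T -> (mu T < +oo)%E -> bmeas g -> L2 T g.
Proof.
move=> mT Too [mg [C hC]]; apply/(L2P _ mT); split; first exact: measurable_funTS.
apply: measurable_bounded_integrable => //.
  by apply: measurable_funTS; exact: measurable_funX.
exists (C ^+ 2); split; first exact: num_real.
move=> M CM x _ /=; rewrite (le_trans _ (ltW CM))// normrX lerXn2r ?nnegrE//.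
exact: le_trans (hC x).
Qed.

Lemma Rintegral_le_norm f g : l1 f -> l1 g -> (forall x, `|f x| <= g x) ->
  `|\int[mu]_x f x| <= \int[mu]_x g x.
Proof.
move=> lf lg fg; apply: le_trans (le_normr_Rintegral measurableT lf) _.
by apply: le_Rintegral => //; exact: (l1_norm lf).
Qed.

(** By [conv_swap] the dilated mollification acts on [phi] as an average: lam^d kappa(lam x + b - y)
    has integral 1 in x and, wherever w(y) is nonzero, charges only points x within B of y. So
    phi(y) changes by at most L B, and the error is integrated against |w|. *)
Lemma convolve_dilated_cvg T w phi kappa (h lam : R) (b : E) (L B : R) :
  l1 w -> test_function T phi -> mollifier h kappa -> 0 < lam ->
  (forall x y, `|phi x - phi y| <= L * `|x - y|) -> 0 <= L ->
  (forall x y, w y != 0 -> `|lam *: x + b - y| < h -> `|x - y| <= B) ->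
  `|lam ^+ d * (\int[mu]_x (phi x * convolve w kappa (lam *: x + b))) - weighted_int w phi|
    <= L * B * \int[mu]_y `|w y|.
Proof.
move=> lw tp mk l0 lip L0 hB.
have lp : l1 phi by exact: test_function_integrable tp.
have [lS ->] := conv_swap lam b lw lp (moll_test mk).
have bp : bmeas phi.
  split; first exact: measurable_smooth (test_function_smooth tp).
  by have [C _ hC] := test_function_bounded tp; exists C.
have lwp := l1_bmeas lw bp.
have ld0 : 0 < lam ^+ d by exact: exprn_gt0.
have -> : lam ^+ d * (\int[mu]_y (w y * \int[mu]_x (phi x * kappa (lam *: x + b - y)))) - weighted_int w phi
   = \int[mu]_y (lam ^+ d * (w y * \int[mu]_x (phi x * kappa (lam *: x + b - y))) - w y * phi y).
  rewrite RintegralB//; last exact: (l1Z (lam ^+ d) lS).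
  by rewrite RintegralZl.
have -> : L * B * \int[mu]_y `|w y| = \int[mu]_y (L * B * `|w y|).
  by rewrite RintegralZl//; exact: (l1_norm lw).
apply: Rintegral_le_norm.
- have lN := l1Z (-1) lwp.
  have := l1D (l1Z (lam ^+ d) lS) lN; congr l1; apply/funext => y; by rewrite mulN1r.
- exact: (l1Z (L * B) (l1_norm lw)).
move=> y; have [w0|w0] := eqVneq (w y) 0.
  by rewrite w0 !mul0r mulr0 subrr normr0 mulr0.
rewrite [lam ^+ d * _]mulrCA -mulrBr normrM mulrC ler_wpM2r//.
have [lk Ik] := moll_affine (b - y) mk l0.
have E1 : (fun x => kappa (lam *: x + b - y)) = (fun x => kappa (lam *: x + (b - y))).
  by apply/funext => x; rewrite addrA.
have bk : bmeas (fun x => kappa (lam *: x + b - y)).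
  by rewrite E1; exact: (moll_bmeas lam (b - y) mk).
rewrite -E1 in lk Ik.
have l2 := l1_bmeas lp bk.
have -> : phi y = lam ^+ d * \int[mu]_x (phi y * kappa (lam *: x + b - y)).
  by rewrite RintegralZl// Ik mulrCA divff ?mulr1// gt_eqF.
rewrite -mulrBr normrM (gtr0_norm ld0) -ler_pdivlMl// mulrC.
rewrite -RintegralB//; last exact: (l1Z (phi y) lk).
rewrite -Ik -RintegralZl//; apply: Rintegral_le_norm.
- have := l1D l2 (l1Z (-1) (l1Z (phi y) lk)); congr l1; apply/funext => x; by rewrite mulN1r.
- exact: (l1Z (L * B) lk).
move=> x; rewrite -mulrBl normrM [`|kappa _|]ger0_norm ?(moll_ge0 mk)//.
have [k0|k0] := eqVneq (kappa (lam *: x + b - y)) 0; first by rewrite k0 !mulr0.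
rewrite ler_wpM2r ?(moll_ge0 mk)//; apply: le_trans (lip x y) _.
rewrite ler_wpM2l//; apply: hB => //; rewrite ltNge; apply/negP => hx.
by move: k0; rewrite (moll_supp mk hx) eqxx.
Qed.

Lemma l2ip_test T w phi : measurable T -> test_function T phi ->
  l2ip T w phi = \int[mu]_x (phi x * w x).
Proof.
move=> mT tp; rewrite /l2ip; under eq_Rintegral do rewrite mulrC.
apply: Rintegral_support; first exact: subsetT.
by move=> x nx; rewrite (test_supported tp nx) mul0r.
Qed.

(* Dilating towards c and mollifying gives smooth functions, bounded in H^1, that
   converge weakly to w; a closed subspace is weakly closed. *)
Lemma smooth_dense T (c : E) (N : (E -> R) -> Prop) w : open T -> bounded_set T -> T c ->
  (forall x y (t : R), T x -> T y -> 0 <= t <= 1 -> T (x + t *: (y - x))) ->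
  lin_subspace N -> (forall v, N v -> H1 T v) -> ip_closed (H1 T) (h1ip T 1 1) N ->
  (forall v, smooth v -> H1 T v -> N v) ->
  H1 T w -> N w.
Proof.
move=> oT bT Tc cvx sN NH cN smN hw; have mT := open_measurable_rV oT.
have Too := bounded_lty mT bT.
have hl := l2_semi_inner mT; have hv := l2v_semi_inner mT.
have gw := H1_grad hw; have [L2w L2g] := grad_rel_dom gw.
have /nbhs_ballP[rho /= rho0 hrho] : nbhs c T by exact: open_nbhs_nbhs.
have [D [Dr hD]] := bT.
pose DD : R := `|D| + 1.
have hDD y : T y -> `|y| <= DD by move=> Ty; apply: hD Ty; rewrite (le_lt_trans (ler_norm _))// ltrDl.
(* Starting at 1/2 keeps the dilation factor 1 - s between 1/2 and 1. *)
pose s (k : nat) : R := k.+2%:R^-1.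
have s0 k : 0 < s k by rewrite invr_gt0.
have s12 k : s k <= 2^-1 by rewrite lef_pV2 ?posrE// ler_nat.
pose lam k : R := 1 - s k.
have lam0 k : 0 < lam k by have := s12 k; rewrite /lam; lra.
have lam1 k : lam k <= 1 by have := s0 k; rewrite /lam; lra.
pose h k : R := s k * (rho / 2).
have h0 k : 0 < h k by rewrite mulr_gt0// divr_gt0.
have /choice[kap mkap] := fun k => @mollifier_exists R d _ (h0 k).
pose b k : E := s k *: c.
(* By convexity the ball of radius s rho about (1 - s) x + s c is in T, since [c] has the ball of
   radius rho in T; the mollification radius s rho / 2 is below this. *)
have inT k x y : T x -> `|lam k *: x + b k - y| <= h k -> T y.
  move=> Tx hy; pose v := y - (lam k *: x + b k).
  have -> : y = x + s k *: ((c + (s k)^-1 *: v) - x).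
    rewrite scalerBr scalerDr scalerA divff ?gt_eqF// scale1r /v /lam /b.
    by apply/rowP => j; rewrite !mxE; ring.
  apply: cvx => //; last by apply/andP; split; [exact: ltW|have := s12 k; lra].
  apply: hrho; rewrite -ball_normE /= opprD addrA subrr sub0r normrN normrZ.
  rewrite gtr0_norm ?invr_gt0// mulrC ltr_pdivrMr//.
  rewrite (@le_lt_trans _ _ (h k))//; first by rewrite /v distrC.
  by rewrite /h mulrC ltr_pM2r// ltr_pdivrMr// mulr_natr mulr2n ltrDl.
have [lw lw2 w2E] := L2_patch mT Too L2w.
(* The factor lam^d compensates the Jacobian of the dilation, so that pairings with test functions
   converge to those of [w]. Since lam <= 1, it also keeps the L^2 bounds. *)
pose W k x := lam k ^+ d * convolve (w \_ T) (kap k) (lam k *: x + b k).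
have tk k := moll_test (mkap k).
have sc k := smooth_conv lw (tk k).
have scA k := smooth_affine (lam k) (b k) (sc k).
have sW k : smooth (W k) by apply: smoothM (scA k); exact: smooth_cst.
have baff k g : bmeas g -> measurable_fun setT (fun x : E => g (lam k *: x + b k)) ->
    bmeas (fun x => g (lam k *: x + b k)).
  by move=> [_ [C hC]] mg; split => //; exists C.
have bA k kap' : test_function setT kap' -> bmeas (fun x => convolve (w \_ T) kap' (lam k *: x + b k)).
  move=> t'; apply: (baff k _ (bmeas_conv lw t')).
  exact: measurable_smooth (smooth_affine (lam k) (b k) (smooth_conv lw t')).
have pW k i : partial i (W k) =
    (fun x => lam k ^+ d * (lam k * convolve (w \_ T) (partial i (kap k)) (lam k *: x + b k))).
  rewrite /W (partialM i (smooth_differentiable (smooth_cst _)) (smooth_differentiable (scA k))).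
  rewrite (partial_affine _ _ _ (smooth_differentiable (sc k))) (partial_conv i lw (tk k)).
  by rewrite partial_cst; apply/funext => x; rewrite mulr0 addr0.
have L2W k : L2 T (W k).
  by apply: bmeas_L2 => //; apply: bmeasM (bA k _ (tk k)); exact: bmeas_cst.
have L2pW k : L2vec T (pgrad (W k)).
  move=> i; apply: bmeas_L2 => //.
  rewrite (_ : (fun x => _) = partial i (W k)); last by apply/funext => x; rewrite mxE.
  rewrite pW; apply: bmeasM; first exact: bmeas_cst.
  by apply: bmeasM (bA k _ (test_function_partial i (tk k))); exact: bmeas_cst.
have gW k := smooth_grad_rel mT (sW k) (L2W k) (L2pW k).
have cbound k v : L2 T v -> \int[mu]_(x in T) (lam k ^+ d * convolve (v \_ T) (kap k) (lam k *: x + b k)) ^+ 2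
    <= l2ip T v v.
  move=> hv2; have [lv lv2 <-] := L2_patch mT Too hv2.
  under eq_Rintegral do rewrite exprMn.
  have ib : bmeas (fun x => convolve (v \_ T) (kap k) (lam k *: x + b k)).
    have [_ [C hC]] := bmeas_conv lv (tk k); split; last by exists C.
    exact: measurable_smooth (smooth_affine (lam k) (b k) (smooth_conv lv (tk k))).
  have := bmeas_L2 mT Too ib => L2c.
  rewrite RintegralZl//; last by case: ((L2P _ mT).1 L2c).
  have := conv_sq_bound (b k) lv lv2 (mkap k) (lam0 k) mT Too.
  have ld0 : 0 < lam k ^+ d by exact: exprn_gt0.
  have ld1 : lam k ^+ d <= 1 by rewrite exprn_ile1// ltW.
  have i0 : 0 <= \int[mu]_y (v \_ T) y ^+ 2 by apply: Rintegral_ge0 => y _; exact: sqr_ge0.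
  move: i0; move: (\int[mu]_y _) (\int[mu]_(x in T) _) => P Q P0 QP.
  rewrite expr2 -mulrA; apply: (@le_trans _ _ (lam k ^+ d * P)); last by rewrite ler_piMl.
  by rewrite ler_wpM2l ?(ltW ld0)// -ler_pdivlMl// mulrC.
have c1 k : l2ip T (W k) (W k) <= l2ip T w w.
  by apply: le_trans (cbound k w L2w); rewrite /l2ip; under eq_Rintegral do rewrite -expr2.
have c2 k : l2vip T (pgrad (W k)) (pgrad (W k)) <= l2vip T (grad T w) (grad T w).
  rewrite !(l2vipE mT)//; apply: ler_sum => i _.
  apply: le_trans (cbound k _ (L2g i)); rewrite /l2ip; apply: le_Rintegral => //.
  - exact: (L2_integrable mT (L2pW k i) (L2pW k i)).
  - have [lv _ _] := L2_patch mT Too (L2g i).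
    have ib : bmeas (fun x => convolve (comps (grad T w) i \_ T) (kap k) (lam k *: x + b k)).
      have [_ [C hC]] := bmeas_conv lv (tk k); split; last by exists C.
      exact: measurable_smooth (smooth_affine (lam k) (b k) (smooth_conv lv (tk k))).
    have L2c := bmeas_L2 mT Too (bmeasM (@bmeas_cst R d (lam k ^+ d)) ib).
    exact: (L2_integrable mT L2c L2c).
  move=> x Tx; rewrite -expr2 /comps mxE pW mulrCA.
  rewrite (convolve_grad i mT gw (h0 k) (mkap k)); last by move=> y; exact: inT.
  rewrite exprMn ler_piMl ?sqr_ge0//; rewrite exprn_ile1//; first exact: ltW.
have := @weak_limit_grad T N W (fun k => pgrad (W k)) w
  (l2ip T w w + l2vip T (grad T w) (grad T w)) oT sN NH cN.
apply => //.
- by move=> k; apply: smN => //; rewrite H1_graph; exists (pgrad (W k)).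
- by move=> k; rewrite (le_trans (c1 k))// lerDl (si_ge0 hv).
- by move=> k; rewrite (le_trans (c2 k))// lerDr (si_ge0 hl).
move=> phi tp; have [L L0 lip] := test_lipschitz tp.
pose K : R := 2 * (rho / 2 + (`|c| + DD)).
have bound k : `|l2ip T (W k) phi - l2ip T w phi| <= L * (s k * K) * \int[mu]_y `|(w \_ T) y|.
  rewrite (l2ip_test _ mT tp) -weighted_int_patch.
  under eq_Rintegral do rewrite /W mulrCA.
  have lp : l1 phi by exact: test_function_integrable tp.
  rewrite RintegralZl//; last exact: (l1_bmeas lp (bA k _ (tk k))).
  apply: (convolve_dilated_cvg lw tp (mkap k) (lam0 k) lip L0) => x y wy hxy.
  have Ty : T y by apply/not_notP => nT; move: wy; rewrite patchE memNset// eqxx.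
  have : lam k * `|x - y| <= s k * (rho / 2 + (`|c| + DD)).
    rewrite -[lam k]gtr0_norm// -normrZ.
    have -> : lam k *: (x - y) = (lam k *: x + b k - y) - s k *: (c - y).
      by rewrite /lam /b; apply/rowP => j; rewrite !mxE; ring.
    apply: le_trans (ler_normB _ _) _; rewrite mulrDr lerD ?(ltW hxy)//.
    rewrite normrZ gtr0_norm// ler_wpM2l ?(ltW (s0 k))//.
    by rewrite (le_trans (ler_normB _ _))// lerD// hDD.
  have l2 : 2^-1 <= lam k by have := s12 k; rewrite /lam; lra.
  have n0 : 0 <= `|x - y| by [].
  rewrite /K mulrCA; move: (`|x - y|) n0 (lam k) l2 (s k * _) => n n0 l l2 S hS; nra.
apply/cvgrPdist_le => e e0.
have S0 : 0 <= L * K * \int[mu]_y `|(w \_ T) y|.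
  rewrite !mulr_ge0//; last by apply: Rintegral_ge0.
  by rewrite !addr_ge0// divr_ge0// ltW.
move: S0 bound; move: (\int[mu]_y _) => J S0 bound.
have e1 : 0 < e / (L * K * J + 1) by rewrite divr_gt0// ltr_wpDl.
near=> k; rewrite distrC; apply: le_trans (bound k) _.
have sk : s k < e / (L * K * J + 1).
  near: k; have [M _ hM] := near_infty_natSinv_lt (PosNum e1).
  exists M => // k /hM; apply: le_lt_trans.
  by rewrite /s lef_pV2 ?posrE// ler_nat.
have -> : L * (s k * K) * J = s k * (L * K * J) by ring.
move: sk; rewrite ltr_pdivlMr ?ltr_wpDl//.
move: (L * K * J) S0 (s k) (s0 k) => A A0 t t0 h3; nra.
Unshelve. all: by end_near.
Qed.

(** Turns local radii into a single one by compactness: it yields uniform continuity on a compact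
    set and a positive distance of a compact subset from the complement of an open set. *)
Lemma near_covering_radius (K : set E) (P : R -> E -> Prop) : compact K ->
  (forall h h' x, 0 < h' -> h' <= h -> P h x -> P h' x) ->
  (forall x, K x -> exists2 r : R, 0 < r & forall y, `|x - y| < r -> P r y) ->
  exists2 h : R, 0 < h & forall x, K x -> P h x.
Proof.
move=> /compact_near_coveringP cK mono loc.
have inv0 k : 0 < k.+1%:R^-1 :> R by rewrite invr_gt0.
have [|M _ hM] := cK nat \oo (fun k x => P k.+1%:R^-1 x) _.
  move=> x Kx; have [r r0 hr] := loc x Kx.
  have [M _ hM] := near_infty_natSinv_lt (PosNum r0).
  exists (ball x r, [set k | (M <= k)%N]) => /=.
    by split; [exact: nbhsx_ballx|exists M].
  move=> [y k] /= [yr /hM /= kM].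
  apply: (mono r) => //; first exact: ltW.
  by apply: hr; move: yr; rewrite -ball_normE.
exists M.+1%:R^-1; first exact: inv0.
by move=> x Kx; apply: (hM M) => /=.
Qed.

Lemma flat_bound m (t : R) : flat m t <= m.+1`!%:R.
Proof.
have [t0|t0] := leP t 0; first by rewrite flat_eq0.
have [t1|t1] := leP t 1.
  apply: le_trans (flat_le m 0 t0) _; rewrite addn1 expr1 ler_piMr//.
have f1 : (1 : R) <= m.+1`!%:R by rewrite ler1n fact_gt0.
apply: le_trans f1; rewrite /flat t0 mulr_ile1 ?expR_ge0//.
- by rewrite invr_ge0 exprn_ge0// ltW.
- by rewrite invf_le1 ?exprn_gt0// exprn_ege1// ltW.
- by rewrite -[leRHS]expR0 ler_expR oppr_le0 invr_ge0 ltW.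
Qed.

(** This is the derivative of z |-> z flat 0 ((z / delta)^2 - 1), written in t = (z / delta)^2 - 1.
    The value 17 is 2 (2! + 3!) + 1, from the bounds of [flat_bound] for t flat 2 t = flat 1 t and
    for flat 2 t. *)
Lemma truncation_slope (t : R) : `|2 * (t + 1) * flat 2 t + flat 0 t| <= 17.
Proof.
have [t0|t0] := leP t 0; first by rewrite !flat_eq0// mulr0 addr0 normr0.
have E1 : t * flat 2 t = flat 1 t.
  by rewrite /flat t0 expr2 expr1 invfM !mulrA mulfV ?mul1r// gt_eqF.
have := flat_bound 2 t; have := flat_bound 1 t; have := flat0_le1 t.
have := flat_ge0 2 t; have := flat_ge0 1 t; have := flat_ge0 0 t.
rewrite (_ : 3`! = 6%N)// (_ : 2`! = 2%N)//.
have -> : 2 * (t + 1) * flat 2 t = 2 * (t * flat 2 t + flat 2 t) by ring.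
rewrite E1.
move: (flat 0 t) (flat 1 t) (flat 2 t) => p q r *.
rewrite ger0_norm; lra.
Qed.

(** For |t| <= 2 delta the damping factor lies in [0, 1]. Beyond that, 1 - exp(-1/s) <= 1/s with s =
    (t / delta)^2 - 1 > 3 makes the loss a fraction of delta. *)
Lemma truncation_dist (delta t : R) : 0 < delta ->
  `|t * flat 0 (delta^-1 * t * (delta^-1 * t) - 1) - t| <= 2 * delta.
Proof.
move=> d0; set s := _ - 1.
have f0 := flat_ge0 0 s; have f1 := flat0_le1 s.
have tE : t = delta * (delta^-1 * t) by rewrite mulrA divff ?mul1r// gt_eqF.
have -> : t * flat 0 s - t = t * (flat 0 s - 1) by ring.
rewrite normrM; have [t2|t2] := leP `|t| (2 * delta).
  have : `|flat 0 s - 1| <= 1 by rewrite ler_norml; apply/andP; split; lra.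
  have := normr_ge0 t; move: (`|t|) (`|flat 0 s - 1|) t2 => a b; nra.
set u := delta^-1 * t in s f0 f1 tE *.
have u2 : 2 < `|u|.
  by rewrite normrM gtr0_norm ?invr_gt0// mulrC ltr_pdivlMr.
have us : s = `|u| ^+ 2 - 1 by rewrite /s -expr2 real_normK// num_real.
have s0 : 3 < s by rewrite us; nra.
have fs : 1 - s^-1 <= flat 0 s.
  rewrite /flat (lt_trans _ s0)// expr0 invr1 mul1r.
  exact: expR_ge1Dx.
have -> : `|flat 0 s - 1| = 1 - flat 0 s by rewrite distrC ger0_norm// subr_ge0.
have -> : `|t| = delta * `|u| by rewrite [in LHS]tE normrM gtr0_norm.
have h1 : 1 - flat 0 s <= s^-1 by lra.
rewrite mulrAC [2 * _]mulrC -mulrA ler_wpM2l ?(ltW d0)//.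
apply: (@le_trans _ _ (s^-1 * `|u|)); first by rewrite ler_wpM2r.
rewrite mulrC ler_pdivrMr; last by rewrite (lt_trans _ s0).
rewrite us; move: (`|u|) u2 => a; nra.
Qed.

(* Mollify the extension of z by 0 and cut off the values below delta by
   t |-> t * flat 0 ((t / delta)^2 - 1): this gives test functions, bounded in H^1,
   that converge weakly to z. *)
Lemma H10_of_continuous T z : open T -> bounded_set T -> H1 T z ->
  {within closure T, continuous z} -> (forall x, frontier T x -> z x = 0) -> H10 T z.
Proof.
move=> oT bT hz cz z0; have mT := open_measurable_rV oT.
have Too := bounded_lty mT bT.
have hl := l2_semi_inner mT; have hv := l2v_semi_inner mT.
have gz := H1_grad hz; have [L2z L2g] := grad_rel_dom gz.
have [lz lz2 z2E] := L2_patch mT Too L2z.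
set zt := z \_ T.
have ztT x : T x -> zt x = z x by move=> Tx; rewrite /zt patchE mem_set.
have ztN x : ~ T x -> zt x = 0 by move=> Tx; rewrite /zt patchE memNset.
(* The extension by 0 is continuous on the whole space, because [z] vanishes on the frontier. *)
have ct x (e : R) : 0 < e -> exists2 r : R, 0 < r & forall y, `|x - y| < r -> `|zt x - zt y| < e.
  move=> e0; have [cx|ncx] := pselect (closure T x); last first.
    have : nbhs x (~` closure T).
      by apply: open_nbhs_nbhs; split => //; apply: closed_openC; exact: closed_closure.
    move=> /nbhs_ballP[r /= r0 hr]; exists r => // y hy.
    have nT (v : E) : ~ closure T v -> ~ T v by move=> nc /subset_closure.
    rewrite !ztN ?subrr ?normr0//; first by apply: nT; apply: hr; rewrite -ball_normE.
    exact: nT.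
  have /subspace_continuousP /(_ x cx) := cz.
  move=> /cvgrPdist_lt /(_ e e0) /nbhs_ballP[r /= r0 hr].
  have [Tx|nTx] := pselect (T x).
    have /nbhs_ballP[r' /= r'0 hr'] : nbhs x T by exact: open_nbhs_nbhs.
    exists (Num.min r r'); first by rewrite lt_min r0.
    move=> y; rewrite lt_min => /andP[h1 h2].
    have Ty : T y by apply: hr'; rewrite -ball_normE.
    by rewrite !ztT//; apply: hr; [rewrite -ball_normE|exact: subset_closure].
  exists r => // y hy; have zx0 : z x = 0.
    by apply: z0; split => //; move: oT; rewrite openE => oT' /interior_subset.
  have [Ty|nTy] := pselect (T y); last by rewrite !ztN// subrr normr0.
  rewrite (ztN _ nTx) -zx0 (ztT _ Ty).
  by apply: hr; [rewrite -ball_normE|exact: subset_closure].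
have bcl : bounded_set (closure T).
  have [M [Mr hM]] := bT; exists M; split => // m Mm x cx.
  have cB : closed [set y : E | `|y| <= m].
    apply: (@closed_comp E R (fun y : E => `|y|) [set a : R | a <= m]).
      by move=> y _; exact: norm_continuous.
    exact: closed_le.
  have : closure [set y : E | `|y| <= m] x by apply: closure_subset cx => y Ty; exact: hM Ty.
  by rewrite -(closure_id _).1.
have ccl : compact (closure T) by apply: bounded_closed_compact => //; exact: closed_closure.
have uc (e : R) : 0 < e -> exists2 h : R, 0 < h & forall x y, `|x - y| < h -> `|zt x - zt y| < e.
  move=> e0; have e2 : 0 < e / 2 by rewrite divr_gt0.
  have [|x _|h h0 H] := @near_covering_radius (closure T)
      (fun h x => forall y, `|x - y| < h -> `|zt x - zt y| < e) ccl.
  - by move=> h h' x _ hh H y hy; apply: H; exact: lt_le_trans hh.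
  - have [r r0 hr] := ct x _ e2; have r2 : 0 < r / 2 by rewrite divr_gt0.
    exists (r / 2) => // y xy v yv; rewrite (splitr e).
    have -> : zt y - zt v = (zt x - zt v) - (zt x - zt y) by move: (zt x) (zt y) (zt v) => ? ? ?; ring.
    rewrite (le_lt_trans (ler_normB _ _))// ltrD//; apply: hr.
      have -> : x - v = (x - y) + (y - v) by rewrite addrA subrK.
      by rewrite (splitr r) (le_lt_trans (ler_normD _ _))// ltrD.
    by rewrite (lt_trans xy)// ltr_pdivrMr// ltr_pMr// ltr1n.
  exists h => // x y xy.
  have [cx|ncx] := pselect (closure T x); first exact: H.
  have [cy|ncy] := pselect (closure T y); first by rewrite distrC; apply: H => //; rewrite distrC.
  by rewrite !ztN ?subrr ?normr0// => /subset_closure.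
pose delta (k : nat) : R := k.+1%:R^-1.
have d0 k : 0 < delta k by rewrite invr_gt0.
have d2 k : 0 < delta k / 2 by rewrite divr_gt0.
(* This compact subset of T will carry the truncated function: off it |zt| < delta / 2, so a
   mollification within delta / 2 of zt is at most delta and is cut off to 0. *)
pose K k := [set x | delta k / 2 <= `|zt x|].
have KT k : K k `<=` T.
  move=> x; apply: contraPP => nTx; apply/negP; rewrite -ltNge (ztN _ nTx) normr0; exact: d2.
have cztE : continuous (zt : E -> R).
  move=> x U /nbhs_ballP[e /= e0 he]; have [r r0 hr] := ct x e e0.
  apply/nbhs_ballP; exists r => // y; rewrite -ball_normE => xy.
  by apply: he; rewrite -ball_normE; exact: hr.
have clK k : closed (K k).
  apply: (@closed_comp E R (fun y : E => `|zt y|) [set a : R | delta k / 2 <= a]).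
    move=> y _; apply: continuous_comp; [exact: cztE|exact: norm_continuous].
  exact: closed_ge.
have cK k : compact (K k).
  apply: (subclosed_compact (clK k) ccl); apply: subset_trans (KT k) _; exact: subset_closure.
have H k : exists Z, [/\ test_function T Z, forall x, `|Z x - zt x| <= 3 * delta k,
    l2ip T Z Z <= l2ip T z z &
    l2vip T (pgrad Z) (pgrad Z) <= 17 ^+ 2 * l2vip T (grad T z) (grad T z)].
  have [h1 h10 uc1] := uc _ (d2 k).
  have [|x Kx|h2 h20 uc2] := @near_covering_radius (K k)
      (fun h x => forall y, `|x - y| <= h -> T y) (cK k).
  - by move=> h h' x _ hh Hx y hy; apply: Hx; exact: le_trans hh.
  - have /nbhs_ballP[r /= r0 hr] : nbhs x T by apply: open_nbhs_nbhs; split => //; exact: KT Kx.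
    have r2 : 0 < r / 2 by rewrite divr_gt0.
    exists (r / 2) => // y xy v yv; apply: hr; rewrite -ball_normE /=.
    have -> : x - v = (x - y) + (y - v) by rewrite addrA subrK.
    by rewrite (splitr r) (le_lt_trans (ler_normD _ _))// ltr_leD.
  (* [h1] keeps the mollification within delta / 2 of zt, by uniform continuity; [h2] keeps balls
     about points of K inside T, so that the gradient of the mollification is the mollified gradient
     there. *)
  pose h := Num.min h1 h2; have h0 : 0 < h by rewrite lt_min h10.
  have [kap mk] := @mollifier_exists R d h h0; have tk := moll_test mk.
  pose zh := convolve zt kap; have szh : smooth zh by exact: smooth_conv.
  have zhz x : `|zh x - zt x| <= delta k / 2.
    have [lk Ik] := moll_refl x mk; have bk := test_reflect x tk.
    have l3 := l1_bmeas lz bk.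
    have -> : zt x = \int[mu]_y (zt x * kap (x - y)) by rewrite RintegralZl// Ik mulr1.
    rewrite -RintegralB//; last exact: (l1Z (zt x) lk).
    have -> : delta k / 2 = \int[mu]_y (delta k / 2 * kap (x - y)) by rewrite RintegralZl// Ik mulr1.
    apply: Rintegral_le_norm.
    - have := l1D l3 (l1Z (-1) (l1Z (zt x) lk)); congr l1; apply/funext => y; by rewrite mulN1r.
    - exact: (l1Z (delta k / 2) lk).
    move=> y; rewrite -mulrBl normrM [`|kap _|]ger0_norm ?(moll_ge0 mk)//.
    have [k0|k0] := eqVneq (kap (x - y)) 0; first by rewrite k0 !mulr0.
    rewrite ler_wpM2r ?(moll_ge0 mk)// distrC; apply/ltW/uc1; rewrite ltNge; apply/negP => hx.
    have hx' : h <= `|x - y| by rewrite (le_trans _ hx)// ge_min lexx.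
    by move: k0; rewrite (moll_supp mk hx') eqxx.
  pose u x := (delta k)^-1 * zh x.
  pose g x := u x * u x + -1.
  pose Z x := zh x * flat 0 (g x).
  have su : smooth u by apply: smoothM szh; exact: smooth_cst.
  have sg : smooth g by apply: smoothD; [exact: smoothM|exact: smooth_cst].
  have sZ : smooth Z by apply: smoothM szh _; exact: smooth_flat.
  have ZN x : ~ K k x -> Z x = 0.
    move=> /negP; rewrite -ltNge => hx; rewrite /Z flat_eq0 ?mulr0//.
    have zd : `|zh x| <= delta k.
      have -> : zh x = (zh x - zt x) + zt x by rewrite subrK.
      by rewrite [leRHS](splitr) (le_trans (ler_normD _ _))// lerD// ltW.
    have u1 : `|u x| <= 1.
      by rewrite normrM gtr0_norm ?invr_gt0// mulrC ler_pdivrMr// mul1r.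
    by rewrite /g subr_le0 -expr2 -real_normK ?num_real// exprn_ile1.
  have tZ : test_function T Z by split => //; exists (K k); split => //; exact: KT.
  have pZ i x : partial i Z x = (2 * (g x + 1) * flat 2 (g x) + flat 0 (g x)) * partial i zh x.
    have D := smooth_differentiable.
    rewrite /Z (partialM i (D _ _ _ szh) (D _ _ _ (smooth_flat 0 sg))).
    rewrite (partial_flat i 0 (D _ _ _ sg)) /g.
    rewrite (partialD i (D _ _ _ (smoothM su su)) (D _ _ _ (smooth_cst _))) partial_cst.
    rewrite (partialM i (D _ _ _ su) (D _ _ _ su)) /u.
    rewrite (partialM i (D _ _ _ (smooth_cst _)) (D _ _ _ szh)) partial_cst.
    rewrite mulr0n oppr0 mul0r add0r !mulr0 !addr0; set G := _ - 1.
    have GE : G + 1 = (delta k)^-1 * zh x * ((delta k)^-1 * zh x) by rewrite subrK.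
    rewrite GE; move: (flat 0 G) (flat (0.+2)%N G) (zh x) (partial i zh x) ((delta k)^-1).
    by move=> *; ring.
  have bz v : L2 T v -> \int[mu]_(x in T) convolve (v \_ T) kap x ^+ 2 <= l2ip T v v.
    move=> hv2; have [lv lv2 <-] := L2_patch mT Too hv2.
    have := conv_sq_bound 0 lv lv2 mk ltr01 mT Too.
    rewrite expr1n invr1 mul1r; apply: le_trans.
    by rewrite le_eqVlt; apply/orP; left; apply/eqP; apply: eq_Rintegral => x _; rewrite scale1r addr0.
  have bL v : L2 T v -> L2 T (convolve (v \_ T) kap).
    move=> hv2; have [lv lv2 _] := L2_patch mT Too hv2.
    by apply: bmeas_L2 => //; exact: bmeas_conv.
  have L2Z := test_L2 mT tZ; have L2pZ := test_pgrad mT tZ.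
  exists Z; split => //.
  - move=> x; have -> : Z x - zt x = (Z x - zh x) + (zh x - zt x) by rewrite addrA subrK.
    apply: le_trans (ler_normD _ _) _.
    have := truncation_dist (zh x) (d0 k); have := zhz x; have := d0 k.
    rewrite /Z /g /u; move: (`|_ - zh x|) (`|zh x - zt x|) => a b; lra.
  - apply: le_trans (bz _ L2z); rewrite /l2ip; apply: le_Rintegral => //.
    + exact: (L2_integrable mT L2Z L2Z).
    + exact: (L2_integrable mT (bL _ L2z) (bL _ L2z)).
    move=> x _; rewrite -expr2 /Z exprMn ler_piMr ?sqr_ge0// exprn_ile1 ?flat_ge0//.
    exact: flat0_le1.
  rewrite !(l2vipE mT)// /prod_ip mulr_sumr; apply: ler_sum => i _.
  have Lgi := L2g i; have sl := subspaceZ (si_subspace hl) 17 (bL _ Lgi).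
  apply: (@le_trans _ _ (17 ^+ 2 * \int[mu]_(x in T) convolve (comps (grad T z) i \_ T) kap x ^+ 2)); last first.
    by rewrite ler_wpM2l ?sqr_ge0//; exact: bz.
  rewrite -RintegralZl//; last exact: (L2_integrable mT (bL _ Lgi) (bL _ Lgi)).
  rewrite /l2ip; apply: le_Rintegral => //.
  - exact: (L2_integrable mT (L2pZ i) (L2pZ i)).
  - have := L2_integrable mT sl sl; congr (_.-integrable _ _); apply/funext => x /=.
    congr (_%:E); pose cc := convolve (comps (grad T z) i \_ T) kap x.
    change ((17 * cc) * (17 * cc) = 17 ^+ 2 * cc ^+ 2); ring.
  move=> x Tx; rewrite -expr2 /comps mxE -exprMn -real_normK ?num_real// -[leRHS]real_normK ?num_real//.
  rewrite lerXn2r ?nnegrE// !normrM.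
  have [Kx|nKx] := pselect (K k x).
    rewrite pZ normrM /zh (partial_conv i lz tk) (convolve_grad i mT gz h0 mk); last first.
      by move=> y xy; apply: (uc2 x Kx); rewrite (le_trans xy)// ge_min lexx orbT.
    by rewrite ler_wpM2r// (le_trans (truncation_slope _))// ger0_norm.
  by rewrite (partial_support i (clK k) (ZN) nKx) normr0 mulr_ge0.
have /choice[Z hZ] := H.
have := @weak_limit_grad T (H10 T) Z (fun k => pgrad (Z k)) z
  (l2ip T z z + 17 ^+ 2 * l2vip T (grad T z) (grad T z)) oT (H10_subspace oT)
  (@H10_H1 _ _ T) (H10_closed oT).
have v0 : 0 <= 17 ^+ 2 * l2vip T (grad T z) (grad T z).
  by rewrite mulr_ge0 ?sqr_ge0// (si_ge0 hv).
apply => //.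
- by move=> k; apply: test_H10 => //; case: (hZ k).
- by move=> k; apply: (@test_grad_rel _ _ T) => //; case: (hZ k).
- by move=> k; case: (hZ k) => _ _ h _; rewrite (le_trans h)// lerDl.
- by move=> k; case: (hZ k) => _ _ _ h; rewrite (le_trans h)// lerDr (si_ge0 hl).
move=> phi tp; have lp : l1 phi by exact: test_function_integrable tp.
have L2p := test_L2 mT tp.
have bound k : `|l2ip T (Z k) phi - l2ip T z phi| <= 3 * delta k * \int[mu]_x `|phi x|.
  have [tZ Zz _ _] := hZ k; have L2Z := test_L2 mT tZ.
  rewrite -(ipBl hl L2Z L2z L2p) (l2ip_test _ mT tp).
  have Eq : \int[mu]_x (phi x * (Z k - z) x) = \int[mu]_x (phi x * (Z k x - zt x)).
    apply: eq_Rintegral => x _; have [Tx|nTx] := pselect (T x); first by rewrite (ztT _ Tx).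
    by rewrite (test_supported tp nTx) !mul0r.
  rewrite Eq -RintegralZl//; last exact: (l1_norm lp).
  apply: Rintegral_le_norm; last by move=> x; rewrite normrM mulrC ler_wpM2r.
  - apply: (l1_bmeas lp); split; last by exists (3 * delta k).
    apply: measurable_funB; first exact: measurable_smooth (test_function_smooth tZ).
    exact: l1_meas lz.
  - exact: (l1Z (3 * delta k) (l1_norm lp)).
apply/cvgrPdist_le => e e0.
have S0 : 0 <= \int[mu]_x `|phi x| by apply: Rintegral_ge0.
move: S0 bound; move: (\int[mu]_x _) => J S0 bound.
have e1 : 0 < e / (3 * J + 1) by rewrite divr_gt0// ltr_wpDl// mulr_ge0.
near=> k; rewrite distrC; apply: le_trans (bound k) _.
have sk : delta k < e / (3 * J + 1).
  near: k; have [M _ hM] := near_infty_natSinv_lt (PosNum e1).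
  by exists M.
move: sk; rewrite ltr_pdivlMr ?ltr_wpDl ?mulr_ge0//.
have := d0 k; move: (delta k) => t t0 h3.
have tJ : 0 <= t * J by rewrite mulr_ge0// ltW.
lra.
Unshelve. all: by end_near.
Qed.

End approximation.

(** * Simplices and meshes *)

Lemma lipschitzP (R : realType) (V W : normedModType R) (A : set V) (f : V -> W) :
  [lipschitz f x | x in A] <->
  exists k : R, forall x y, A x -> A y -> `|f x - f y| <= k * `|x - y|.
Proof.
split.
  move=> [M [Mr hM]]; exists (`|M| + 1) => x y Ax Ay.
  by apply: (hM _ _ (x, y)) => //; rewrite (le_lt_trans (ler_norm _))// ltrDl.
move=> [k hk]; exists k; split; first exact: num_real.
move=> M kM [x y] [/= Ax Ay]; apply: le_trans (hk _ _ Ax Ay) _.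
by rewrite ler_wpM2r// ltW.
Qed.

(** A point of the interior of the closure outside Omega would be a boundary point. In the local
    chart it lies on or below the graph; a small step downwards gives a point strictly below the
    graph that is still in the closure, hence a limit of points above the graph, against
    continuity. *)
Lemma lipschitz_boundary_interior (R : realType) (d : nat) (Omega : set 'rV[R]_d.+1) :
  open Omega -> lipschitz_boundary Omega -> (closure Omega)° `<=` Omega.
Proof.
move=> oO lip x ix; apply/not_notP => nOx.
have cx : closure Omega x by exact: interior_subset ix.
have fx : frontier Omega x by split => // /interior_subset.
have [Q [j [psi [delta [QQ /lipschitzP[k hk] d0 hO]]]]] := lip x fx.
have /nbhs_ballP[r /= r0 hr] : nbhs x (closure Omega) by [].
(* The vertical direction of the chart, rotated back: [v *m Q] is the j-th unit vector. *)
pose v : 'rV[R]_d.+1 := delta_mx 0 j *m Q^T.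
have vQ : v *m Q = delta_mx 0 j.
  rewrite /v -mulmxA; have -> : Q^T *m Q = 1%:M by exact: mulmx1C.
  by rewrite mulmx1.
pose m := Num.min r delta; have m0 : 0 < m by rewrite lt_min r0.
pose t := m / (`|v| + 1) / 2.
have v1 : 0 < `|v| + 1 by rewrite ltr_wpDl.
have t0 : 0 < t by rewrite !divr_gt0.
pose y := x - t *: v.
have xy : `|x - y| < m.
  rewrite /y opprB addrC subrK normrZ gtr0_norm//.
  apply: (@le_lt_trans _ _ (t * (`|v| + 1))); first by rewrite ler_wpM2l ?(ltW t0)// lerDl.
  rewrite /t mulrAC divfK ?gt_eqF//.
  by rewrite ltr_pdivrMr// ltr_pMr// ltr1n.
have : closure Omega y by apply: hr; rewrite -ball_normE; apply: lt_le_trans xy _; rewrite ge_min lexx.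
have [B B0 hB] : exists2 B : R, 0 < B & forall z : 'rV[R]_d.+1, forall i, `|(z *m Q) 0 i| <= B * `|z|.
  exists (\sum_a \sum_b `|Q a b| + 1).
    by rewrite ltr_wpDl// sumr_ge0// => *; exact: sumr_ge0.
  move=> z i; rewrite mxE (le_trans (ler_norm_sum _ _ _))//.
  apply: (@le_trans _ _ (\sum_a (`|Q a i| * `|z|))).
    by apply: ler_sum => a _; rewrite normrM mulrC ler_wpM2l// ler_coord.
  rewrite -mulr_suml ler_wpM2r// ler_wpDr//; apply: ler_sum => a _.
  by rewrite (bigD1 i)//= lerDl sumr_ge0.
(* Signed height over the graph: Omega is the set F > 0 near x, and F is Lipschitz with constant B
   (|k| + 1). *)
pose F (z : 'rV[R]_d.+1) := (z *m Q) 0 j - psi (col' j (z *m Q)).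
have hF z w : `|F z - F w| <= B * (`|k| + 1) * `|z - w|.
  have -> : F z - F w = ((z - w) *m Q) 0 j - (psi (col' j (z *m Q)) - psi (col' j (w *m Q))).
    rewrite /F mulmxBl !mxE; move: (\sum_(_ | _) _) (\sum_(_ | _) _) => *; ring.
  apply: le_trans (ler_normB _ _) _.
  rewrite mulrAC mulrDr mulr1 [leRHS]addrC lerD ?hB//.
  apply: le_trans (hk _ _ I I) _.
  apply: (@le_trans _ _ (`|k| * `|col' j (z *m Q) - col' j (w *m Q)|)).
    by rewrite ler_wpM2r// ler_norm.
  have -> : B * `|z - w| * `|k| = `|k| * (B * `|z - w|) by rewrite mulrC.
  rewrite ler_wpM2l//; apply/rV_normP; first by rewrite mulr_ge0// ltW.
  by move=> i; have := hB (z - w) (lift j i); rewrite mulmxBl !mxE.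
have Fx : F x <= 0.
  rewrite leNgt; apply/negP => Fx0; apply: nOx; apply/(hO x); first exact: ballxx.
  by rewrite -subr_gt0.
have Fy : F y <= - t.
  have yQ : y *m Q = x *m Q - t *: delta_mx 0 j by rewrite /y mulmxBl -scalemxAl vQ.
  have -> : F y = F x - t.
    rewrite /F yQ; have -> : col' j (x *m Q - t *: delta_mx 0 j) = col' j (x *m Q).
      by apply/rowP => i; rewrite !mxE eq_sym (negbTE (neq_lift _ _)) andbF mulr0 subr0.
    by rewrite !mxE !eqxx mulr1 addrAC.
  lra.
have k1 : 0 < `|k| + 1 by rewrite ltr_wpDl.
have Bk : 0 < B * (`|k| + 1) by rewrite mulr_gt0.
(* The first entry keeps F below F(y) + t <= 0 on the ball about y; the second keeps this ball in
   the chart. *)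
pose e := Num.min (t / (B * (`|k| + 1))) (m - `|x - y|).
have e0 : 0 < e by rewrite lt_min divr_gt0// subr_gt0.
move=> /(_ (ball y e) (nbhsx_ballx _ _ e0)) [z [Oz]].
rewrite -ball_normE /= lt_min => /andP[yz1 yz2].
have xz : ball x delta z.
  rewrite -ball_normE /=; have -> : x - z = (x - y) + (y - z) by rewrite addrA subrK.
  apply: le_lt_trans (ler_normD _ _) _; apply: (@lt_le_trans _ _ m); last by rewrite ge_min lexx orbT.
  by rewrite -ltrBrDl.
have := (hO z xz).1 Oz; rewrite -subr_gt0 -/(F z) => Fz.
move: yz1; rewrite ltr_pdivlMr// mulrC => yz1.
have := hF y z; rewrite ler_norml => /andP[h1 _]; clear -h1 Fz yz1 Fy t0.
move: (F y) (F z) (B * _ * _) Fz h1 yz1 Fy t0 => a b c; lra.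
Qed.

Section simplex_geometry.
Context (R : realType) (n : nat) (X : 'M[R]_(n.+2, n.+1)) (hX : affinely_independent X).
Local Notation E := 'rV[R]_n.+1.
Local Notation mu := (lebesgue_rV R n.+1).
Local Notation T := (open_simplex X).

Let A : 'M[R]_(n.+2, 1 + n.+1) := row_mx (const_mx 1) X.

(** Barycentric coordinates: the row l solving l A = (1, x), where the rows of A are the vertices
    preceded by 1. *)
Definition bary (x : E) : 'rV[R]_n.+2 := (row_mx 1%:M x : 'rV[R]_(1 + n.+1)) *m invmx (A : 'M[R]_n.+2).

Let uA : (A : 'M[R]_n.+2) \in unitmx.
Proof. by rewrite -row_free_unit; exact: hX. Qed.

Let mulA (l : 'rV[R]_n.+2) : l *m A = row_mx (\sum_k l 0 k)%:M (l *m X).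
Proof.
rewrite /A mul_mx_row; congr row_mx; apply/rowP => i; rewrite !mxE ord1 eqxx mulr1n.
by apply: eq_bigr => k _; rewrite mxE mulr1.
Qed.

Lemma bary_mul (l : 'rV[R]_n.+2) : \sum_k l 0 k = 1 -> bary (l *m X) = l.
Proof. by move=> l1; rewrite /bary -l1 -mulA (mulmxK uA). Qed.

Lemma bary_spec x : \sum_k bary x 0 k = 1 /\ bary x *m X = x.
Proof.
have := mulA (bary x); rewrite /bary (mulmxKV uA) => /eq_row_mx[h1 h2].
by split => //; move/rowP: h1 => /(_ 0); rewrite !mxE eqxx !mulr1n.
Qed.

Lemma open_simplexE x : T x <-> forall k, 0 < bary x 0 k.
Proof.
split; first by move=> [l [l0 l1 ->]]; rewrite bary_mul.
by move=> h; have [h1 h2] := bary_spec x; exists (bary x); split.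
Qed.

Lemma bary_affine x y t : bary (x + t *: (y - x)) = bary x + t *: (bary y - bary x).
Proof.
have [x1 x2] := bary_spec x; have [y1 y2] := bary_spec y.
rewrite -[RHS]bary_mul.
  by rewrite mulmxDl -scalemxAl mulmxBl x2 y2.
move: (bary x) (bary y) x1 y1 {x2 y2} => bx b' x1 y1.
under eq_bigr do rewrite !mxE.
by rewrite big_split/= -mulr_sumr sumrB x1 y1 subrr mulr0 addr0.
Qed.

Lemma bary_affineE x y t k :
  bary (x + t *: (y - x)) 0 k = bary x 0 k + t * (bary y 0 k - bary x 0 k).
Proof. by rewrite bary_affine; move: (bary x) (bary y) => u v; rewrite !mxE. Qed.

Lemma baryE x k : bary x 0 k = bary 0 0 k + \sum_j x 0 j * (invmx (A : 'M[R]_n.+2)) (rshift 1 j) k.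
Proof.
rewrite /bary !mxE !big_split_ord/= -addrA; congr (_ + _).
  by apply: eq_bigr => i _; rewrite !row_mxEl.
rewrite [X in _ = X + _]big1 ?add0r; last by move=> j _; rewrite row_mxEr mxE mul0r.
by apply: eq_bigr => j _; rewrite row_mxEr.
Qed.

Lemma continuous_bary k : continuous (fun x : E => bary x 0 k : R).
Proof.
under [X in continuous X]eq_fun do rewrite baryE.
apply: (@smooth_continuous R n.+1); apply: smoothD; first exact: smooth_cst.
by apply: smooth_sum => j; apply: smoothM; [exact: smooth_coord|exact: smooth_cst].
Qed.

Lemma open_simplex_open : open T.
Proof.
have -> : T = [set x | forall k, 0 < bary x 0 k].
  by apply/seteqP; split => x; rewrite open_simplexE.
rewrite openE => x hx /=.
have hk k : \forall y \near x, 0 < bary y 0 k.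
  have := @continuous_bary k x [set a | 0 < a]; apply.
  by apply: open_nbhs_nbhs; split; [exact: open_gt|exact: hx].
exact: (filter_forall _ hk).
Qed.

Lemma open_simplex_convex x y (t : R) : T x -> T y -> 0 <= t <= 1 -> T (x + t *: (y - x)).
Proof.
rewrite !open_simplexE => hx hy /andP[t0 t1] k; rewrite bary_affineE.
move: (bary x 0 k) (bary y 0 k) (hx k) (hy k) => a b a0 b0.
have [->|tn] := eqVneq t 1; first by rewrite mul1r addrC subrK.
have t1' : t < 1 by rewrite lt_neqAle tn.
have : 0 < (1 - t) * a by rewrite mulr_gt0// subr_gt0.
have : 0 <= t * b by rewrite mulr_ge0// ltW.
move=> h1 h2; have -> : a + t * (b - a) = (1 - t) * a + t * b by ring.
by rewrite ltr_pwDl.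
Qed.

Lemma open_simplex_neq0 : exists c, T c.
Proof.
pose l : 'rV[R]_n.+2 := const_mx n.+2%:R^-1.
have l1 : \sum_k l 0 k = 1.
  under eq_bigr do rewrite mxE.
  by rewrite sumr_const card_ord -[X in X = _]mulr_natl mulfV// pnatr_eq0.
by exists (l *m X), l; split => // k; rewrite mxE invr_gt0.
Qed.

Definition closed_simplex : set E := [set x | forall k, 0 <= bary x 0 k].

Lemma closed_simplex_closed : closed closed_simplex.
Proof.
have -> : closed_simplex = \bigcap_(k in [set: 'I_n.+2]) [set x | 0 <= bary x 0 k].
  by apply/seteqP; split => x h k => [_|]; exact: h.
apply: closed_bigI => k _.
apply: (@closed_comp E R (fun x => bary x 0 k) [set a : R | 0 <= a]); last exact: closed_ge.
by move=> y _; exact: continuous_bary.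
Qed.

Lemma closure_simplex : closure T `<=` closed_simplex.
Proof.
rewrite [X in _ `<=` X](closure_id _).1; last exact: closed_simplex_closed.
by apply: closure_subset => x /open_simplexE h k; exact: ltW.
Qed.

Lemma closed_simplex_bounded : exists M : R, forall x, closed_simplex x -> `|x| <= M.
Proof.
exists (\sum_k `|row k X|) => x hx; have [x1 x2] := bary_spec x.
rewrite -{1}x2 mulmx_sum_row (le_trans (ler_norm_sum _ _ _))//.
apply: ler_sum => k _; rewrite normrZ ger0_norm ?hx//.
rewrite ler_piMl// -x1 (bigD1 k)//= lerDl sumr_ge0// => j _; exact: hx.
Qed.

Lemma open_simplex_bounded : bounded_set T.
Proof.
have [M hM] := closed_simplex_bounded.
exists M; split; first exact: num_real.
move=> m Mm x /open_simplexE h /=; rewrite (le_trans _ (ltW Mm))// hM// => k; exact: ltW.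
Qed.

Lemma frontier_simplex x : frontier T x -> exists k, facet X k x.
Proof.
move=> [/closure_simplex hx nx].
have [k hk] : exists k, ~ 0 < bary x 0 k.
  apply/existsNP => h; apply: nx; have := open_simplex_open; rewrite openE; apply.
  exact/open_simplexE.
exists k, (bary x); have [x1 x2] := bary_spec x; split => //.
move=> j; rewrite !inE negbK => /eqP ->.
by apply/eqP; rewrite eq_le hx andbT leNgt; apply/negP.
Qed.

(** Contracting towards an interior point [c] by a factor s < 1 maps the closed simplex into the
    open one, so s^d times the measure of the former is at most that of the latter, in dimension d.
    As s tends to 1 the two measures agree. *)
Lemma closure_simplex_null : mu (closure T `\` T) = 0%E.
Proof.
have [c Tc] := open_simplex_neq0.
have mT : measurable T by exact: open_measurable_rV open_simplex_open.
have mC : measurable closed_simplex.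
  rewrite -[X in measurable X]setCK; apply: measurableC; apply: open_measurable_rV.
  exact: closed_openC closed_simplex_closed.
have [M hM] := closed_simplex_bounded.
have Coo : (mu closed_simplex < +oo)%E.
  apply: le_lt_trans (lebesgue_rV_box n.+1 `|M|); apply: le_measure; rewrite ?inE//.
    exact: measurable_cube.
  by move=> x hx i; rewrite (le_trans (ler_coord x i))// (le_trans (hM x hx))// ler_norm.
have TC : T `<=` closed_simplex by move=> x /open_simplexE h k; exact: ltW.
have Too : (mu T < +oo)%E by apply: le_lt_trans Coo; apply: le_measure; rewrite ?inE.
have h (s : R) : 0 < s < 1 -> (mu closed_simplex <= (s ^- n.+1)%:E * mu T)%E.
  move=> /andP[s0 s1]; pose b := (1 - s) *: c.
  have sn0 : s != 0 by rewrite gt_eqF.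
  have mi (B : set E) : measurable B -> measurable_fun setT (EFin \o (\1_B : E -> R)).
    by move=> mB; apply/measurable_EFinP; exact: measurable_indic.
  rewrite -(setIT closed_simplex) -(integral_indic _ measurableT mC).
  rewrite -(setIT T) -(integral_indic _ measurableT mT) -[s ^- _](gtr0_norm) ?invr_gt0 ?exprn_gt0//.
  rewrite normfV normrX.
  have i0 (x : E) : (0 <= (EFin \o (\1_T : E -> R)) x)%E by rewrite /= lee_fin.
  rewrite -(ge0_integral_affine_rV b sn0 (mi _ mT) i0).
  apply: ge0_le_integral => //.
  - exact: mi.
  - exact: (measurableT_comp (mi _ mT) (@measurable_affine_rV _ _ s b)).
  move=> x _; rewrite lee_fin !indicE; have [hx|nx] := boolP (x \in closed_simplex); last by [].
  rewrite mem_set//; apply/open_simplexE => k.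
  have -> : s *: x + b = c + s *: (x - c).
    by rewrite /b; apply/rowP => j; rewrite !mxE; ring.
  rewrite bary_affineE; move: hx; rewrite inE => /(_ k) hx; move/open_simplexE: Tc => /(_ k).
  move=> p0; move: (bary c 0 k) (bary x 0 k) p0 hx => p q p0 q0.
  have -> : p + s * (q - p) = (1 - s) * p + s * q by ring.
  by rewrite ltr_pwDl ?mulr_gt0 ?subr_gt0// mulr_ge0// ltW.
have pE := ge0_fin_numE (measure_ge0 mu closed_simplex); have qE := ge0_fin_numE (measure_ge0 mu T).
have CT : (mu closed_simplex <= mu T)%E.
  rewrite -[leLHS]fineK ?pE// -[leRHS]fineK ?qE// lee_fin.
  have h' (s : R) : 0 < s < 1 -> s ^+ n.+1 * fine (mu closed_simplex) <= fine (mu T).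
    move=> s01; have /andP[s0 _] := s01; have := h s s01.
    rewrite -[X in (X <= _)%E]fineK ?pE// -[X in (_ <= _ * X)%E]fineK ?qE// -EFinM lee_fin.
    by rewrite ler_pdivlMl ?exprn_gt0.
  have cv : (1 - harmonic k) ^+ n.+1 * fine (mu closed_simplex) @[k --> \oo] -->
      (1 - 0 : R) ^+ n.+1 * fine (mu closed_simplex).
    have cv1 : (1 - harmonic k : R) @[k --> \oo] --> (1 - 0 : R).
      apply: cvgB; first exact: cvg_cst.
      exact: cvg_harmonic.
    apply: cvgMl; elim: (n.+1) => [|m IH].
      by under eq_fun do rewrite expr0; rewrite expr0; exact: cvg_cst.
    by under eq_fun do rewrite exprS; rewrite exprS; exact: cvgM.
  rewrite subr0 expr1n mul1r in cv.
  apply: (ler_cvg_to cv (cvg_cst (fine (mu T)))).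
  (* Index 0 is left out, since 1 - 1/(k+1) is 0 there and the contraction must be nondegenerate. *)
  exists 1%N => // k /= k1; apply: h'.
  by rewrite /harmonic subr_gt0 ltrBlDr ltrDl invr_gt0 ltr0n andbT invf_lt1// ltr1n.
have mCT : measurable (closed_simplex `\` T) by exact: measurableD.
have nCT : mu (closed_simplex `\` T) = 0%E.
  rewrite measureD// (_ : closed_simplex `&` T = T); last by apply/setIidr.
  have E1 : mu closed_simplex = mu T.
    by apply/eqP; rewrite eq_le CT /=; apply: le_measure; rewrite ?inE.
  transitivity (mu T - mu T)%E; first by congr (_ - _)%E; exact: E1.
  by apply: subee; rewrite qE.
apply: subset_measure0 nCT => //; last by move=> x [/closure_simplex].
apply: measurableD => //; rewrite -[X in measurable X]setCK; apply: measurableC.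
apply: open_measurable_rV; apply: closed_openC; exact: closed_closure.
Qed.

End simplex_geometry.

(** * Restriction to the elements and gluing over the mesh *)

Section mesh_integration.
Context (R : realType) (n : nat) (Omega : set 'rV[R]_n.+1) (I : finType).
Context (X : I -> 'M[R]_(n.+2, n.+1)) (hO : lipschitz_domain Omega) (hX : conforming_mesh Omega X).
Local Notation E := 'rV[R]_n.+1.
Local Notation mu := (lebesgue_rV R n.+1).
Local Notation T i := (open_simplex (X i)).

Lemma Omega_open : open Omega. Proof. exact: domain_open hO. Qed.
Lemma T_open i : open (T i). Proof. exact: open_simplex_open (mesh_nondegenerate hX i). Qed.
Lemma mOmega : measurable Omega. Proof. exact: open_measurable_rV Omega_open. Qed.
Lemma mT i : measurable (T i).
Proof. by apply: open_measurable_rV; exact: T_open. Qed.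

(** The mesh covers only at the level of closures; an open simplex lies in the interior of the
    closure of Omega, and this interior is in Omega because the boundary is Lipschitz. *)
Lemma T_sub i : T i `<=` Omega.
Proof.
move=> x Tx; apply: (lipschitz_boundary_interior Omega_open (domain_lipschitz hO)).
have : nbhs x (T i) by apply: open_nbhs_nbhs; split => //; exact: T_open.
apply: filterS => y Ty.
by rewrite -(mesh_cover hX); exists i => //; exact: subset_closure.
Qed.

Lemma mesh_ae : {ae mu, forall x, Omega x -> exists i, T i x}.
Proof.
have h i : {ae mu, forall x, closure (T i) x -> T i x}.
  exists (closure (T i) `\` T i); split.
  - apply: measurableD (mT i); rewrite -[X in measurable X]setCK; apply: measurableC.
    by apply: open_measurable_rV; apply: closed_openC; exact: closed_closure.
  - exact: closure_simplex_null (mesh_nondegenerate hX i).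
  - by move=> x /= /not_implyP.
have : {ae mu, forall x, forall i, closure (T i) x -> T i x} by exact: filter_forall.
apply: filterS => x hx Ox.
have : closure Omega x by exact: subset_closure.
by rewrite -(mesh_cover hX) => -[i _ ci]; exists i; exact: hx.
Qed.

Lemma Rintegral_ae_eq D (f g : E -> R) : measurable D -> mu.-integrable D (EFin \o f) ->
  mu.-integrable D (EFin \o g) -> {ae mu, forall x, D x -> f x = g x} ->
  \int[mu]_(x in D) f x = \int[mu]_(x in D) g x.
Proof.
move=> mD jf jg fg.
suff H : (\int[mu]_(x in D) (f x)%:E)%E = (\int[mu]_(x in D) (g x)%:E)%E by exact: (congr1 fine H).
apply: ae_eq_integral => //.
- by case/integrableP: jf.
- by case/integrableP: jg.
- by apply: filterS fg => x h Dx; rewrite h.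
Qed.

Lemma l2ip_mesh f g : L2 Omega f -> L2 Omega g -> l2ip Omega f g = \sum_i l2ip (T i) f g.
Proof.
move=> hf hg; have jfg := L2_integrable mOmega hf hg.
have OT i : Omega `&` T i = T i by apply/setIidr; exact: T_sub.
have ji i : mu.-integrable Omega (EFin \o (fun x => f x * g x * \1_(T i) x)).
  have := integrableS mOmega (mT i) (@T_sub i) jfg.
  rewrite integrable_mkcond; last exact: mT.
  move=> h; have := integrableS measurableT mOmega (@subsetT _ _) h.
  congr (_.-integrable _ _); apply/funext => x; rewrite /= patchE indicE.
  by case: ifP => _; rewrite ?mulr1 ?mulr0.
transitivity (\int[mu]_(x in Omega) \sum_i (f x * g x * \1_(T i) x)).
  apply: Rintegral_ae_eq => //; first exact: mOmega.
    rewrite (_ : _ \o _ = (fun x => \sum_i (f x * g x * \1_(T i) x)%:E)%E).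
      by apply: (@integrable_sum _ _ _ _ _ mOmega _ _ _ (fun i x => (f x * g x * \1_(T i) x)%:E)) => i _; exact: ji.
    by apply/funext => x /=; rewrite sumEFin.
  apply: filterS mesh_ae => x h Ox; have [i Ti] := h Ox.
  rewrite (bigD1 i)//= big1 ?addr0; first by rewrite indicE mem_set// mulr1.
  move=> j ji'; rewrite indicE memNset ?mulr0// => Tj.
  have := mesh_disjoint hX ji'; rewrite -subset0 => /(_ x); apply.
  by split.
rewrite Rintegral_sum//; last exact: mOmega.
apply: eq_bigr => i _; rewrite /l2ip -{2}(OT i) Rintegral_setI_indic//; [exact: mT|exact: mOmega].
Qed.

Lemma l2vip_mesh p q : L2vec Omega p -> L2vec Omega q ->
  l2vip Omega p q = \sum_i l2vip (T i) p q.
Proof.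
move=> hp hq; rewrite (l2vipE mOmega hp hq) /prod_ip.
under eq_bigr do rewrite (l2ip_mesh (hp _) (hq _)).
rewrite exchange_big; apply: eq_bigr => i _.
have sT := @T_sub i.
by rewrite (l2vipE (mT i) (L2vecS (mT i) mOmega sT hp) (L2vecS (mT i) mOmega sT hq)).
Qed.

Lemma H1_T i w : H1 Omega w -> H1 (T i) w.
Proof. by apply: H1S; [exact: mT|exact: mOmega|exact: T_sub]. Qed.

Lemma Hdiv_T i q : Hdiv Omega q -> Hdiv (T i) q.
Proof. by apply: HdivS; [exact: mT|exact: mOmega|exact: T_sub]. Qed.

Lemma L2_T i w : L2 Omega w -> L2 (T i) w.
Proof. by apply: L2S; [exact: mT|exact: mOmega|exact: T_sub]. Qed.

Lemma L2vec_T i w : L2vec Omega w -> L2vec (T i) w.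
Proof. by apply: L2vecS; [exact: mT|exact: mOmega|exact: T_sub]. Qed.

Lemma grad_rel_T i w p : grad_rel Omega w p -> grad_rel (T i) w p.
Proof. by apply: grad_relS; [exact: mT|exact: mOmega|exact: T_sub]. Qed.

Lemma div_rel_T i w p : div_rel Omega w p -> div_rel (T i) w p.
Proof. by apply: div_relS; [exact: mT|exact: mOmega|exact: T_sub]. Qed.

Lemma green_mesh f q w : L2 Omega f -> L2vec Omega q -> H1 Omega w ->
  green Omega f q w = \sum_i green (T i) f q w.
Proof.
move=> hf hq hw; rewrite /green (l2ip_mesh hf (H1_L2 hw)) (l2vip_mesh hq (H1_L2grad hw)).
rewrite -big_split; apply: eq_bigr => i _ /=; congr (_ + _).
have hvi := l2v_semi_inner (mT i).
have gw := grad_rel_T i (H1_grad hw).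
have hqi := L2vec_T i hq.
rewrite (si_sym hvi hqi (L2vec_T i (H1_L2grad hw))) (si_sym hvi hqi (H1_L2grad (H1_T i hw))).
by rewrite (grad_eq (@T_open i) gw hqi).
Qed.

Lemma normal_trace_T i q w : Hdiv Omega q -> H1 (T i) w ->
  normal_trace (T i) q (trace (T i) w) = green (T i) (div Omega q) q w.
Proof.
move=> hq hw; rewrite (normal_traceE (@T_open i) (Hdiv_T i hq) hw) /green; congr (_ + _).
exact: (div_eq (@T_open i) (div_rel_T i (Hdiv_div hq)) (H1_L2 hw)).
Qed.

Lemma normal_trace_mesh q w : Hdiv Omega q -> H1 Omega w ->
  normal_trace Omega q (trace Omega w) =
  \sum_i normal_trace (T i) q (trace (T i) w).
Proof.
move=> hq hw; rewrite (normal_traceE Omega_open hq hw) (green_mesh (Hdiv_L2div hq) (Hdiv_L2 hq) hw).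
by apply: eq_bigr => i _; rewrite (normal_trace_T hq (H1_T i hw)).
Qed.

(** Approximate [w] on each element by a test function of that element. The elements are disjoint,
    so the sum of these is a test function of Omega that coincides with the i-th one on element i,
    and the squared H^1 errors add up. *)
Lemma H10_mesh w : H1 Omega w -> (forall i, H10 (T i) w) -> H10 Omega w.
Proof.
move=> hw h; apply: (H10_approx Omega_open hw) => e e0.
have e1 : 0 < e / (#|I|%:R + 1) by rewrite divr_gt0// ltr_wpDl.
have /choice[phi hphi] : forall i, exists phi, test_function (T i) phi /\
    H1_sqnorm (T i) (w \- phi) < e / (#|I|%:R + 1).
  by move=> i; have /H10E[_ /(_ _ e1)[phi t1 t2]] := h i; exists phi.
have tp i := (hphi i).1.
pose Phi : E -> R := \sum_i phi i.
have PhiE x : Phi x = \sum_i phi i x by rewrite /Phi fct_sumE.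
have tO i : test_function Omega (phi i) by apply: test_functionS (tp i); exact: T_sub.
have hPhi : H10 Omega Phi.
  by apply: (subspace_sum (H10_subspace Omega_open)) => i; apply: test_H10 => //; exact: Omega_open.
exists Phi => //.
have H1P := H10_H1 hPhi; have H1d := subspaceB (H1_subspace Omega_open) hw H1P.
have PT i x : T i x -> Phi x = phi i x.
  move=> Tx; rewrite PhiE (bigD1 i)//= big1 ?addr0// => j ji.
  apply: (test_supported (tp j)) => Tj.
  have := mesh_disjoint hX ji; rewrite -subset0 => /(_ x); apply.
  by split.
have -> : h1ip Omega 1 1 (w - Phi) (w - Phi) = \sum_i H1_sqnorm (T i) (w \- phi i).
  rewrite /h1ip /graph_ip !mul1r (l2ip_mesh (H1_L2 H1d) (H1_L2 H1d)).
  rewrite (l2vip_mesh (H1_L2grad H1d) (H1_L2grad H1d)) -big_split.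
  apply: eq_bigr => i _ /=.
  rewrite H1_sqnormE /h1ip /graph_ip !mul1r.
  have Eq x : T i x -> (w - Phi) x = (w \- phi i) x by move=> Tx /=; rewrite -(PT i x Tx).
  congr (_ + _).
    by apply: eq_Rintegral => x; rewrite inE => Tx; rewrite (Eq _ Tx).
  have gd := grad_rel_T i (H1_grad H1d).
  have [l2d [l2g gg]] := gd.
  have gd' : grad_rel (T i) (w \- phi i) (grad Omega (w - Phi)).
    split; first by apply: eq_L2 l2d => //; exact: mT.
    split => // psi tpsi j; rewrite -(gg psi tpsi j).
    by apply: eq_Rintegral => x; rewrite inE => Tx; rewrite (Eq _ Tx).
  have hvi := l2v_semi_inner (mT i).
  rewrite (grad_eq (@T_open i) gd'); last by have [] := grad_rel_dom (gradP gd').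
  rewrite (si_sym hvi l2g (grad_rel_dom (gradP gd')).2).
  by rewrite (grad_eq (@T_open i) gd' l2g).
apply: (@le_lt_trans _ _ (\sum_(i : I) e / (#|I|%:R + 1))).
  by apply: ler_sum => i _; apply/ltW; case: (hphi i).
have C0 : 0 < #|I|%:R + 1 :> R by rewrite ltr_wpDl.
rewrite sumr_const -[X in X < _]mulr_natr mulrAC ltr_pdivrMr// ltr_pM2l//.
by rewrite ltrDl.
Qed.

(** The restriction is defined through an arbitrary extension. Two extensions differ by an element
    of H^1_0 of each element, hence by [H10_mesh] of H^1_0(Omega). *)
Lemma Hhalf_restrE w : H1 Omega w -> Hhalf_restr Omega X (fun i => trace (T i) w) = trace Omega w.
Proof.
move=> hw; rewrite /Hhalf_restr.
set P := [set w' | _].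
have [h1 h2] : P (xget (fun=> 0) P) by apply: xgetPex; exists w.
set w' := xget _ _ in h1 h2 *.
apply/(trace_eqP Omega_open h1 hw).
have H1d := subspaceB (H1_subspace Omega_open) h1 hw.
apply: H10_mesh => // i; apply/(trace_eqP (@T_open i) (H1_T i h1) (H1_T i hw)).
exact: esym (h2 i).
Qed.

(** On traces of H^1(Omega) a global normal trace is the sum of the elementwise ones, which all
    extensions share. *)
Lemma Hmhalf_restrE q : Hdiv Omega q ->
  Hmhalf_restr Omega X (fun i => normal_trace (T i) q) = normal_trace Omega q.
Proof.
move=> hq; rewrite /Hmhalf_restr.
set P := [set w' | _].
have [h1 h2] : P (xget (fun=> 0) P) by apply: xgetPex; exists q.
set q' := xget _ _ in h1 h2 *.
apply: (Hmhalf_ext (normal_trace_Hmhalf Omega_open h1) (normal_trace_Hmhalf Omega_open hq)).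
move=> w hw; rewrite (normal_trace_mesh h1 hw) (normal_trace_mesh hq hw).
by apply: eq_bigr => i _; rewrite (h2 i).
Qed.

End mesh_integration.

(** * The trial-to-test operator *)

Section test_space.
Context (R : realType) (n : nat) (Omega : set 'rV[R]_n.+1) (I : finType).
Context (X : I -> 'M[R]_(n.+2, n.+1)) (hO : lipschitz_domain Omega) (hX : conforming_mesh Omega X).
Local Notation E := 'rV[R]_n.+1.
Local Notation T i := (open_simplex (X i)).

Let oO := Omega_open hO.
Let mO := mOmega hO.
Let oT := @T_open _ _ _ _ _ hX.
Let mTi := @mT _ _ _ _ _ hX.
Let hlO := l2_semi_inner mO.
Let hvO := l2v_semi_inner mO.
Let hl i := l2_semi_inner (mTi i).
Let hv i := l2v_semi_inner (mTi i).

Definition mesh_ip := prod_ip (fun i => l2ip (T i)).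
Definition mesh_vip := prod_ip (fun i => l2vip (T i)).
Definition mesh_grad (m : E -> R) (i : I) : E -> E := grad (T i) m.
Definition mesh_div (q : E -> E) (i : I) : E -> R := div (T i) q.
Definition mesh_lap (m : E -> R) (i : I) : E -> R := lap (T i) m.

Let hP : semi_inner (prod_dom (fun i => L2 (T i))) mesh_ip := prod_semi_inner hl.
Let hPv : semi_inner (prod_dom (fun i => L2vec (T i))) mesh_vip := prod_semi_inner hv.

Definition H1_mesh_rel (m : E -> R) (p : I -> E -> E) :=
  L2 Omega m /\ forall i, grad_rel (T i) m (p i).
Definition Hdiv_mesh_rel (q : E -> E) (g : I -> E -> R) :=
  L2vec Omega q /\ forall i, div_rel (T i) q (g i).
Definition H1_mesh := graph_dom H1_mesh_rel.
Definition Hdiv_mesh := graph_dom Hdiv_mesh_rel.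
(** The Laplacian is stacked as a second graph on top of the piecewise gradient, so that
    completeness of the third component of V follows by applying [graph_complete] twice. *)
Definition H1Lap_mesh_rel (m : E -> R) (g : I -> E -> R) :=
  H1_mesh m /\ forall i, div_rel (T i) (grad (T i) m) (g i).
Definition H1Lap_mesh := graph_dom H1Lap_mesh_rel.

Definition H1_mesh_ip := graph_ip (l2ip Omega) mesh_vip mesh_grad.
Definition Hdiv_mesh_ip := graph_ip (l2vip Omega) mesh_ip mesh_div.
Definition H1Lap_mesh_ip (a b c : R) := graph_ip (H1_mesh_ip a b) mesh_ip mesh_lap 1 c.

Lemma H1_mesh_rel_dom m p : H1_mesh_rel m p -> L2 Omega m /\ prod_dom (fun i => L2vec (T i)) p.
Proof. by move=> [hm h]; split => // i; have [] := grad_rel_dom (h i). Qed.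

Lemma H1_mesh_rel0 : H1_mesh_rel 0 0.
Proof. by split; [exact: subspace0 (si_subspace hlO)|move=> i; exact: (grad_rel0 (@oT i))]. Qed.

Lemma H1_mesh_rel_lin a x y p q : H1_mesh_rel x p -> H1_mesh_rel y q ->
  H1_mesh_rel (a *: x + y) (a *: p + q).
Proof.
move=> [hx hp] [hy hq]; split; first exact: (subspaceL (si_subspace hlO)).
by move=> i; exact: (grad_rel_lin (@oT i)).
Qed.

Lemma H1_mesh_rel_null p : H1_mesh_rel 0 p -> mesh_vip p p = 0.
Proof.
by move=> [_ hp]; rewrite /mesh_vip /prod_ip big1// => i _; exact: (grad_rel_null (@oT i)).
Qed.

Lemma mesh_gradP m p : H1_mesh_rel m p -> H1_mesh_rel m (mesh_grad m).
Proof. by move=> [hm hp]; split => // i; exact: gradP (hp i). Qed.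

Lemma H1_mesh_rel_closed (u : nat -> E -> R) (p : nat -> I -> E -> E) x q :
  (forall k, H1_mesh_rel (u k) (p k)) ->
  L2 Omega x -> prod_dom (fun i => L2vec (T i)) q -> ip_cvg (l2ip Omega) u x ->
  ip_cvg mesh_vip p q -> H1_mesh_rel x q.
Proof.
move=> hu hx hq ux pq; split => // i.
have hp k := (H1_mesh_rel_dom (hu k)).2.
have pqi := prod_cvg_inv hv i hp hq pq.
apply: (grad_rel_closed (@oT i) (fun k => (hu k).2 i)) => //.
- exact: (L2_T hO hX i hx).
have sT := @T_sub _ _ _ _ _ hO hX.
move=> e /ux[N hN]; exists N => k /hN; apply: le_lt_trans.
have hd := subspaceB (si_subspace hlO) (hu k).1 hx.
rewrite (l2ip_mesh hO hX hd hd) (bigD1 i)//= lerDl; apply: sumr_ge0 => j _.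
by apply: (si_ge0 (hl j)); exact: (L2_T hO hX j hd).
Qed.

Lemma H1_mesh_semi_inner a b : 0 < a -> 0 < b -> semi_inner H1_mesh (H1_mesh_ip a b).
Proof.
move=> a0 b0; apply: (graph_semi_inner hlO hPv) => //.
- exact: H1_mesh_rel_dom.
- exact: H1_mesh_rel0.
- exact: H1_mesh_rel_lin.
- exact: H1_mesh_rel_null.
- exact: mesh_gradP.
Qed.

Lemma H1_mesh_complete a b : 0 < a -> 0 < b -> ip_complete H1_mesh (H1_mesh_ip a b).
Proof.
move=> a0 b0; apply: (graph_complete hlO hPv) => //.
- exact: H1_mesh_rel_dom.
- exact: H1_mesh_rel_lin.
- exact: H1_mesh_rel_null.
- exact: mesh_gradP.
- exact: l2_complete mO.
- by apply: (prod_complete hv) => i; exact: l2v_complete (mTi i).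
- exact: H1_mesh_rel_closed.
Qed.

Lemma Hdiv_mesh_rel_dom q g : Hdiv_mesh_rel q g -> L2vec Omega q /\ prod_dom (fun i => L2 (T i)) g.
Proof. by move=> [hm h]; split => // i; have [] := div_rel_dom (h i). Qed.

Lemma Hdiv_mesh_rel0 : Hdiv_mesh_rel 0 0.
Proof. by split; [exact: subspace0 (si_subspace hvO)|move=> i; exact: (div_rel0 (@oT i))]. Qed.

Lemma Hdiv_mesh_rel_lin a x y p q : Hdiv_mesh_rel x p -> Hdiv_mesh_rel y q ->
  Hdiv_mesh_rel (a *: x + y) (a *: p + q).
Proof.
move=> [hx hp] [hy hq]; split; first exact: (subspaceL (si_subspace hvO)).
by move=> i; exact: (div_rel_lin (@oT i)).
Qed.

Lemma Hdiv_mesh_rel_null p : Hdiv_mesh_rel 0 p -> mesh_ip p p = 0.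
Proof.
by move=> [_ hp]; rewrite /mesh_ip /prod_ip big1// => i _; exact: (div_rel_null (@oT i)).
Qed.

Lemma mesh_divP m p : Hdiv_mesh_rel m p -> Hdiv_mesh_rel m (mesh_div m).
Proof. by move=> [hm hp]; split => // i; exact: divP (hp i). Qed.

Lemma Hdiv_mesh_rel_closed (u : nat -> E -> E) (p : nat -> I -> E -> R) x q :
  (forall k, Hdiv_mesh_rel (u k) (p k)) ->
  L2vec Omega x -> prod_dom (fun i => L2 (T i)) q -> ip_cvg (l2vip Omega) u x ->
  ip_cvg mesh_ip p q -> Hdiv_mesh_rel x q.
Proof.
move=> hu hx hq ux pq; split => // i.
have hp k := (Hdiv_mesh_rel_dom (hu k)).2.
have pqi := prod_cvg_inv hl i hp hq pq.
apply: (div_rel_closed (@oT i) (fun k => (hu k).2 i)) => //.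
- exact: (L2vec_T hO hX i hx).
move=> e /ux[N hN]; exists N => k /hN; apply: le_lt_trans.
have hd := subspaceB (si_subspace hvO) (hu k).1 hx.
rewrite (l2vip_mesh hO hX hd hd) (bigD1 i)//= lerDl; apply: sumr_ge0 => j _.
by apply: (si_ge0 (hv j)); exact: (L2vec_T hO hX j hd).
Qed.

Lemma Hdiv_mesh_semi_inner a b : 0 < a -> 0 < b -> semi_inner Hdiv_mesh (Hdiv_mesh_ip a b).
Proof.
move=> a0 b0; apply: (graph_semi_inner hvO hP) => //.
- exact: Hdiv_mesh_rel_dom.
- exact: Hdiv_mesh_rel0.
- exact: Hdiv_mesh_rel_lin.
- exact: Hdiv_mesh_rel_null.
- exact: mesh_divP.
Qed.

Lemma Hdiv_mesh_complete a b : 0 < a -> 0 < b -> ip_complete Hdiv_mesh (Hdiv_mesh_ip a b).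
Proof.
move=> a0 b0; apply: (graph_complete hvO hP) => //.
- exact: Hdiv_mesh_rel_dom.
- exact: Hdiv_mesh_rel_lin.
- exact: Hdiv_mesh_rel_null.
- exact: mesh_divP.
- exact: l2v_complete mO.
- by apply: (prod_complete hl) => i; exact: l2_complete (mTi i).
- exact: Hdiv_mesh_rel_closed.
Qed.

Lemma H1_mesh_H1 m i : H1_mesh m -> H1 (T i) m.
Proof. by move=> [p [_ hp]]; rewrite H1_graph; exists (p i); exact: hp. Qed.

Lemma H1Lap_mesh_rel_lin a x y p q : H1Lap_mesh_rel x p -> H1Lap_mesh_rel y q ->
  H1Lap_mesh_rel (a *: x + y) (a *: p + q).
Proof.
move=> [hx hp] [hy hq].
have hs := subspaceL (si_subspace (H1_mesh_semi_inner ltr01 ltr01)) a hx hy.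
split => // i.
have H1x := H1_mesh_H1 i hx; have H1y := H1_mesh_H1 i hy; have H1s := H1_mesh_H1 i hs.
apply: (div_rel_congr (@oT i)) (div_rel_lin (@oT i) a (hp i) (hq i)); first exact: H1_L2grad.
move=> r hr; rewrite (grad_lin (@oT i) a H1x H1y hr).
by rewrite (si_lin (hv i) a (H1_L2grad H1x) (H1_L2grad H1y) hr).
Qed.

Lemma H1Lap_mesh_rel0 : H1Lap_mesh_rel 0 0.
Proof.
have h0 : H1_mesh 0 by exists 0; exact: H1_mesh_rel0.
split => // i; apply: (div_rel_congr (@oT i)) (div_rel0 (@oT i)); first exact: H1_L2grad (H1_mesh_H1 i h0).
by move=> r hr; rewrite (grad_eq (@oT i) (grad_rel0 (@oT i)) hr).
Qed.

Lemma H1Lap_mesh_rel_null p : H1Lap_mesh_rel 0 p -> mesh_ip p p = 0.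
Proof.
move=> [h0 hp]; rewrite /mesh_ip /prod_ip big1// => i _; apply: (div_rel_null (@oT i)).
apply: (div_rel_congr (@oT i)) (hp i); first exact: (subspace0 (si_subspace (hv i))).
by move=> r hr; rewrite (grad_eq (@oT i) (grad_rel0 (@oT i)) hr).
Qed.

Lemma H1Lap_mesh_rel_dom q g : H1Lap_mesh_rel q g -> H1_mesh q /\ prod_dom (fun i => L2 (T i)) g.
Proof. by move=> [hm h]; split => // i; have [] := div_rel_dom (h i). Qed.

Lemma mesh_lapP m p : H1Lap_mesh_rel m p -> H1Lap_mesh_rel m (mesh_lap m).
Proof. by move=> [hm hp]; split => // i; exact: divP (hp i). Qed.

Lemma H1Lap_mesh_rel_closed a b (u : nat -> E -> R) (p : nat -> I -> E -> R) x q :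
  0 < a -> 0 < b -> (forall k, H1Lap_mesh_rel (u k) (p k)) ->
  H1_mesh x -> prod_dom (fun i => L2 (T i)) q -> ip_cvg (H1_mesh_ip a b) u x ->
  ip_cvg mesh_ip p q -> H1Lap_mesh_rel x q.
Proof.
move=> a0 b0 hu hx hq ux pq; split => // i.
have hp k := (H1Lap_mesh_rel_dom (hu k)).2.
have pqi := prod_cvg_inv hl i hp hq pq.
have hu1 k : H1_mesh_rel (u k) (mesh_grad (u k)) by have [[r hr] _] := hu k; exact: mesh_gradP hr.
have hx1 : H1_mesh_rel x (mesh_grad x) by have [r hr] := hx; exact: mesh_gradP hr.
have [||||_ gu] := graph_cvg_inv hlO hPv _ _ _ _ a0 b0 hu1 hx1 ux.
- exact: H1_mesh_rel_dom.
- exact: H1_mesh_rel_lin.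
- exact: H1_mesh_rel_null.
- exact: mesh_gradP.
have gu1 k := (H1_mesh_rel_dom (hu1 k)).2; have gx1 := (H1_mesh_rel_dom hx1).2.
have gui := prod_cvg_inv hv i gu1 gx1 gu.
apply: (div_rel_closed (@oT i) (fun k => (hu k).2 i)) => //.
Qed.

Lemma H1Lap_mesh_semi_inner a b c : 0 < a -> 0 < b -> 0 < c ->
  semi_inner H1Lap_mesh (H1Lap_mesh_ip a b c).
Proof.
move=> a0 b0 c0; apply: (graph_semi_inner (H1_mesh_semi_inner a0 b0) hP) => //.
- exact: H1Lap_mesh_rel_dom.
- exact: H1Lap_mesh_rel0.
- exact: H1Lap_mesh_rel_lin.
- exact: H1Lap_mesh_rel_null.
- exact: mesh_lapP.
Qed.

Lemma H1Lap_mesh_complete a b c : 0 < a -> 0 < b -> 0 < c ->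
  ip_complete H1Lap_mesh (H1Lap_mesh_ip a b c).
Proof.
move=> a0 b0 c0; apply: (graph_complete (H1_mesh_semi_inner a0 b0) hP) => //.
- exact: H1Lap_mesh_rel_dom.
- exact: H1Lap_mesh_rel_lin.
- exact: H1Lap_mesh_rel_null.
- exact: mesh_lapP.
- exact: H1_mesh_complete.
- by apply: (prod_complete hl) => i; exact: l2_complete (mTi i).
- by move=> u p x q; exact: H1Lap_mesh_rel_closed.
Qed.

Lemma H1_meshP m : H1_mesh m <-> L2 Omega m /\ forall i, H1 (T i) m.
Proof.
split=> [hm|[hm h]]; first by split; [have [p []] := hm|move=> i; exact: H1_mesh_H1].
by exists (mesh_grad m); split => // i; exact: H1_grad.
Qed.

Lemma Hdiv_meshP q : Hdiv_mesh q <-> L2vec Omega q /\ forall i, Hdiv (T i) q.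
Proof.
split=> [[g [hq h]]|[hq h]]; first by split => // i; rewrite Hdiv_graph; exists (g i).
by exists (mesh_div q); split => // i; exact: Hdiv_div.
Qed.

Lemma H1Lap_meshP v : H1Lap_mesh v <-> L2 Omega v /\ forall i, H1Lap (T i) v.
Proof.
split=> [[g [/H1_meshP[hv1 hv2] h]]|[hv1 h]].
  split => // i; split; first exact: hv2.
  by rewrite Hdiv_graph; exists (g i).
exists (mesh_lap v); split; first by apply/H1_meshP; split => // i; have [] := h i.
by move=> i; have [_ hd] := h i; exact: Hdiv_div.
Qed.

Definition test_of (x : (E -> R) * ((E -> E) * (E -> R))) : test R n := Test x.1 x.2.1 x.2.2.
Definition of_test (t : test R n) := (t_mu t, (t_tau t, t_v t)).

Lemma test_ofK t : test_of (of_test t) = t. Proof. by case: t. Qed.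

Definition V_dom := pair_dom H1_mesh (pair_dom Hdiv_mesh H1Lap_mesh).

Lemma V_domP x : V_dom x <-> in_V Omega X (test_of x).
Proof.
split.
  by move=> [/H1_meshP h1 [/Hdiv_meshP h2 /H1Lap_meshP h3]]; split.
by move=> [h1 h2 h3]; split; [apply/H1_meshP|split; [apply/Hdiv_meshP|apply/H1Lap_meshP]].
Qed.

Context (eps : R) (eps0 : 0 < eps).
Let pow a : 0 < eps `^ a. Proof. exact: powR_gt0. Qed.

Definition V_ip := pair_ip (H1_mesh_ip eps^-1 1)
  (pair_ip (Hdiv_mesh_ip (eps `^ (- (1 / 2))) 1)
     (H1Lap_mesh_ip 1 (eps `^ (1 / 2) + eps) (eps `^ (3 / 2)))).

Let ie0 : 0 < eps^-1. Proof. by rewrite invr_gt0. Qed.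
Let w0 : 0 < eps `^ (1 / 2) + eps. Proof. by rewrite addr_gt0. Qed.

Lemma V_semi_inner : semi_inner V_dom V_ip.
Proof.
apply: pair_semi_inner; first exact: H1_mesh_semi_inner.
apply: pair_semi_inner; first exact: Hdiv_mesh_semi_inner.
exact: H1Lap_mesh_semi_inner.
Qed.

Lemma V_complete : ip_complete V_dom V_ip.
Proof.
apply: pair_complete; [exact: H1_mesh_semi_inner|apply: pair_semi_inner| |apply: pair_complete].
- exact: Hdiv_mesh_semi_inner.
- exact: H1Lap_mesh_semi_inner.
- exact: H1_mesh_complete.
- exact: Hdiv_mesh_semi_inner.
- exact: H1Lap_mesh_semi_inner.
- exact: Hdiv_mesh_complete.
- exact: H1Lap_mesh_complete.
Qed.

Lemma V_innerE x y : V_inner Omega X eps (test_of x) (test_of y) = V_ip x y.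
Proof.
rewrite /V_ip /pair_ip /H1_mesh_ip /Hdiv_mesh_ip /H1Lap_mesh_ip /H1_mesh_ip /graph_ip.
rewrite /V_inner /pw_int /mesh_ip /mesh_vip /prod_ip /mesh_grad /mesh_div /mesh_lap /l2ip /l2vip /=.
by rewrite !mul1r !addrA.
Qed.

End test_space.

Lemma subrACA (V : zmodType) (a b c d : V) : (a - b) - (c - d) = (a - c) - (b - d).
Proof. by rewrite !opprD !opprK addrACA. Qed.

(** * Trial elements through global extensions *)

Section trial_representation.
Context (R : realType) (n : nat) (Omega : set 'rV[R]_n.+1) (I : finType).
Context (X : I -> 'M[R]_(n.+2, n.+1)) (hO : lipschitz_domain Omega) (hX : conforming_mesh Omega X).
Local Notation E := 'rV[R]_n.+1.
Local Notation T i := (open_simplex (X i)).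

Let oO := Omega_open hO.
Let mO := mOmega hO.
Let oT := @T_open _ _ _ _ _ hX.
Let mTi := @mT _ _ _ _ _ hX.
Let hlO := l2_semi_inner mO.
Let hvO := l2v_semi_inner mO.
Let hl i := l2_semi_inner (mTi i).
Let hv i := l2v_semi_inner (mTi i).
Let hP : semi_inner (prod_dom (fun i => L2 (T i))) (mesh_ip X) := prod_semi_inner hl.
Let hPv : semi_inner (prod_dom (fun i => L2vec (T i))) (mesh_vip X) := prod_semi_inner hv.

(* A trial element is represented by (u, sigma, rho, w^a, w^b, q^a, q^b), where the
   w's and q's extend its skeleton components to Omega. *)
Definition rep : Type :=
  ((E -> R) * ((E -> E) * ((E -> R) * ((E -> R) * ((E -> R) * ((E -> E) * (E -> E)))))))%type.
Implicit Types x y : rep.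
Definition ru x : E -> R := x.1.
Definition rs x : E -> E := x.2.1.
Definition rr x : E -> R := x.2.2.1.
Definition rwa x : E -> R := x.2.2.2.1.
Definition rwb x : E -> R := x.2.2.2.2.1.
Definition rqa x : E -> E := x.2.2.2.2.2.1.
Definition rqb x : E -> E := x.2.2.2.2.2.2.

HB.instance Definition _ := GRing.Lmodule.copy rep
  ((E -> R) * ((E -> E) * ((E -> R) * ((E -> R) * ((E -> R) * ((E -> E) * (E -> E)))))))%type.

Definition tr x : trial R n I := Trial (ru x) (rs x) (rr x)
  (fun i => trace (T i) (rwa x)) (fun i => trace (T i) (rwb x))
  (fun i => normal_trace (T i) (rqa x)) (fun i => normal_trace (T i) (rqb x)).

Record rep_dom x : Prop := RepDom {
  rd_u : L2 Omega (ru x) ; rd_s : L2vec Omega (rs x) ; rd_r : L2 Omega (rr x) ;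
  rd_wa : H1 Omega (rwa x) ; rd_wb : H1 Omega (rwb x) ;
  rd_qa : Hdiv Omega (rqa x) ; rd_qb : Hdiv Omega (rqb x) ;
  rd_bd : H10 Omega (rwa x - rwb x) }.

Lemma rep_dom_subspace : lin_subspace rep_dom.
Proof.
split.
  split; [exact: subspace0 (si_subspace hlO)|exact: subspace0 (si_subspace hvO)|
    exact: subspace0 (si_subspace hlO)|exact: subspace0 (H1_subspace oO)|
    exact: subspace0 (H1_subspace oO)|exact: subspace0 (Hdiv_subspace oO)|
    exact: subspace0 (Hdiv_subspace oO)|].
  have -> : rwa 0 - rwb 0 = 0 by exact: subrr.
  exact: subspace0 (H10_subspace oO).
move=> a x y [x1 x2 x3 x4 x5 x6 x7 x8] [y1 y2 y3 y4 y5 y6 y7 y8]; split.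
- exact: (subspaceL (si_subspace hlO) a x1 y1).
- exact: (subspaceL (si_subspace hvO) a x2 y2).
- exact: (subspaceL (si_subspace hlO) a x3 y3).
- exact: (subspaceL (H1_subspace oO) a x4 y4).
- exact: (subspaceL (H1_subspace oO) a x5 y5).
- exact: (subspaceL (Hdiv_subspace oO) a x6 y6).
- exact: (subspaceL (Hdiv_subspace oO) a x7 y7).
have -> : rwa (a *: x + y) - rwb (a *: x + y) = a *: (rwa x - rwb x) + (rwa y - rwb y).
  have -> : rwa (a *: x + y) = a *: rwa x + rwa y by [].
  have -> : rwb (a *: x + y) = a *: rwb x + rwb y by [].
  by rewrite scalerBr opprD addrACA.
exact: (subspaceL (H10_subspace oO) a x8 y8).
Qed.

Lemma in_U_tr x : rep_dom x -> in_U Omega X (tr x).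
Proof.
move=> [x1 x2 x3 x4 x5 x6 x7 x8]; split; [exact: x1|exact: x2|exact: x3| | | | |].
- split; last by exists (rwa x); split; [exact: x4|move=> i; reflexivity].
  by move=> i; exists (rwa x); [exact: (H1_T hO hX i x4)|reflexivity].
- split; last by exists (rwb x); split; [exact: x5|move=> i; reflexivity].
  by move=> i; exists (rwb x); [exact: (H1_T hO hX i x5)|reflexivity].
- split; last by exists (rqa x); split; [exact: x6|move=> i; reflexivity].
  by move=> i; exact: (normal_trace_Hmhalf (@oT i) (Hdiv_T hO hX i x6)).
- split; last by exists (rqb x); split; [exact: x7|move=> i; reflexivity].
  by move=> i; exact: (normal_trace_Hmhalf (@oT i) (Hdiv_T hO hX i x7)).
change (Hhalf_restr Omega X (fun i => trace (T i) (rwa x)) = Hhalf_restr Omega X (fun i => trace (T i) (rwb x))).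
refine (etrans (Hhalf_restrE hO hX x4) (etrans _ (esym (Hhalf_restrE hO hX x5)))).
exact: ((trace_eqP oO x4 x5).2 x8).
Qed.

Lemma in_U_rep t : in_U Omega X t -> exists2 x, rep_dom x & tr x = t.
Proof.
case: t => u s r ua ub sa sb [/= h1 h2 h3 [_ [wa [ha hwa]]] [_ [wb [hb hwb]]] [_ [qa [hqa hsa]]] [_ [qb [hqb hsb]]] hbd].
exists (u, (s, (r, (wa, (wb, (qa, qb)))))).
  split; [exact: h1|exact: h2|exact: h3|exact: ha|exact: hb|exact: hqa|exact: hqb|].
  apply: (trace_eqP oO ha hb).1.
  have Ea := funext hwa; have Eb := funext hwb; rewrite Ea Eb in hbd.
  exact: (etrans (esym (Hhalf_restrE hO hX ha)) (etrans hbd (Hhalf_restrE hO hX hb))).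
by rewrite /tr; congr Trial; apply/funext => i; apply: esym; [exact: hwa|exact: hwb|exact: hsa|exact: hsb].
Qed.

Lemma gamma0_tr x : rep_dom x -> gamma0 Omega X (tr x) = trace Omega (rwa x).
Proof. by move=> hx; exact: (Hhalf_restrE hO hX (rd_wa hx)). Qed.

Lemma gamman_tr x : rep_dom x -> gamman Omega X (tr x) = normal_trace Omega (rqa x).
Proof. by move=> hx; exact: (Hmhalf_restrE hO hX (rd_qa hx)). Qed.

Lemma trace_sub_trace i v w : H1 (T i) v -> H1 (T i) w ->
  trace_sub (trace (T i) v) (trace (T i) w) = trace (T i) (v - w).
Proof.
move=> H1v H1w; have sB := subspaceB (H10_subspace (@oT i)); have sB1 := subspaceB (H1_subspace (@oT i)).
apply/seteqP; split => [u [w1 [w2 [/traceE[h1 h2] /traceE[h3 h4] ->]]]|u /traceE[h1 h2]].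
  apply/traceE; split; first exact: (sB1 _ _ h1 h3).
  have -> : (w1 \- w2) - (v - w) = (w1 - v) - (w2 - w).
    exact: subrACA.
  exact: (sB _ _ h2 h4).
exists (u + w), w; split.
- apply/traceE; split; first exact: (subspaceD (H1_subspace (@oT i)) h1 H1w).
  have -> : u + w - v = u - (v - w) by rewrite opprB addrA.
  exact: h2.
- exact: (trace_self (@oT i) H1w).
- by change (u = u + w - w); rewrite addrK.
Qed.

Lemma normal_trace_sub i p q : Hdiv (T i) p -> Hdiv (T i) q ->
  normal_trace (T i) p \- normal_trace (T i) q = normal_trace (T i) (p - q).
Proof.
move=> hp hq; have hpq := subspaceB (Hdiv_subspace (@oT i)) hp hq.
apply/funext => u; have [[w hw <-]|nu] := pselect (Hhalf (T i) u); last first.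
  by rewrite /= /normal_trace !asboolF// subr0.
rewrite /= !(normal_traceE (@oT i))// /green.
have L2w := H1_L2 hw; have L2g := H1_L2grad hw.
have E1 : p - q = -1 *: q + p by rewrite scaleN1r addrC.
rewrite E1 (div_lin (@oT i) (-1) hq hp L2w) (si_lin (hv i) (-1) (Hdiv_L2 hq) (Hdiv_L2 hp) L2g).
move: (l2ip _ _ _) (l2ip _ _ _) (l2vip _ _ _) (l2vip _ _ _) => *; ring.
Qed.

Lemma tr_sub x y : rep_dom x -> rep_dom y -> U_sub (tr x) (tr y) = tr (x - y).
Proof.
move=> hx hy; rewrite /U_sub /tr /=; congr Trial.
- by apply/funext => i; apply: trace_sub_trace; apply: (H1_T hO hX); [exact: rd_wa hx|exact: rd_wa hy].
- by apply/funext => i; apply: trace_sub_trace; apply: (H1_T hO hX); [exact: rd_wb hx|exact: rd_wb hy].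
- by apply/funext => i; apply: normal_trace_sub; apply: (Hdiv_T hO hX); [exact: rd_qa hx|exact: rd_qa hy].
- by apply/funext => i; apply: normal_trace_sub; apply: (Hdiv_T hO hX); [exact: rd_qb hx|exact: rd_qb hy].
Qed.

End trial_representation.

Section pairing.
Context (R : realType) (d : nat) (omega : set 'rV[R]_d) (oo : open omega).
Local Notation E := 'rV[R]_d.
Let mo : measurable omega := open_measurable_rV oo.
Let hl := l2_semi_inner mo.
Let hv := l2v_semi_inner mo.

(** The boundary duality of the normal trace of [q] and the trace of [w], taken on functions instead
    of on cosets and therefore bilinear on representatives. *)
Definition pairing (q : E -> E) (w : E -> R) : R := green omega (div omega q) q w.

Lemma pairing_linl a p q w : Hdiv omega p -> Hdiv omega q -> H1 omega w ->
  pairing (a *: p + q) w = a * pairing p w + pairing q w.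
Proof.
move=> hp hq hw; have L2w := H1_L2 hw; have L2g := H1_L2grad hw.
rewrite /pairing /green (div_lin oo a hp hq L2w) (si_lin hv a (Hdiv_L2 hp) (Hdiv_L2 hq) L2g).
move: (l2ip _ _ _) (l2ip _ _ _) (l2vip _ _ _) (l2vip _ _ _) => *; ring.
Qed.

Lemma pairing_linr a q v w : Hdiv omega q -> H1 omega v -> H1 omega w ->
  pairing q (a *: v + w) = a * pairing q v + pairing q w.
Proof. by move=> hq hv' hw; exact: (green_lin oo a (Hdiv_L2div hq) (Hdiv_L2 hq) hv' hw). Qed.

Lemma pairing_rel q g w : div_rel omega q g -> H1 omega w -> pairing q w = green omega g q w.
Proof. by move=> hq hw; rewrite /pairing /green (div_eq oo hq (H1_L2 hw)). Qed.

Lemma pairing_H10 q w : Hdiv omega q -> H10 omega w -> pairing q w = 0.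
Proof. by move=> hq hw; have [_ _ h] := (div_rel_green oo q _).1 (Hdiv_div hq); exact: (h w hw). Qed.

Lemma pairing_congr q v w : Hdiv omega q -> H1 omega v -> H1 omega w -> H10 omega (v - w) ->
  pairing q v = pairing q w.
Proof.
move=> hq h1 h2 h; have := pairing_H10 hq h.
have -> : v - w = -1 *: w + v by rewrite scaleN1r addrC.
rewrite (pairing_linr (-1) hq h2 h1) => e; apply/eqP; rewrite -subr_eq0 -mulN1r addrC; apply/eqP; exact: e.
Qed.

Lemma normal_trace_pairing q w : Hdiv omega q -> H1 omega w ->
  normal_trace omega q (trace omega w) = pairing q w.
Proof. by move=> hq hw; exact: (normal_traceE oo hq hw). Qed.

Lemma H1Lap_rel w : H1Lap omega w -> div_rel omega (grad omega w) (lap omega w).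
Proof. by case=> _; exact: Hdiv_div. Qed.

Lemma lap_rel_lin a v w : H1Lap omega v -> H1Lap omega w ->
  div_rel omega (grad omega (a *: v + w)) (a *: lap omega v + lap omega w).
Proof.
move=> hv' hw; have H1s := subspaceL (H1_subspace oo) a hv'.1 hw.1.
apply: (div_rel_congr oo (H1_L2grad H1s)) (div_rel_lin oo a (H1Lap_rel hv') (H1Lap_rel hw)).
move=> r hr; rewrite (grad_lin oo a hv'.1 hw.1 hr).
by rewrite (si_lin hv a (H1_L2grad hv'.1) (H1_L2grad hw.1) hr).
Qed.

Lemma L2lap w : H1Lap omega w -> L2 omega (lap omega w).
Proof. by case=> _; exact: Hdiv_L2div. Qed.

Lemma lap_lin a v w r : H1Lap omega v -> H1Lap omega w -> L2 omega r ->
  l2ip omega (lap omega (a *: v + w)) r = a * l2ip omega (lap omega v) r + l2ip omega (lap omega w) r.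
Proof.
move=> hv' hw hr; refine (etrans (div_eq oo (lap_rel_lin a hv' hw) hr) _).
exact: (si_lin hl a (L2lap hv') (L2lap hw) hr).
Qed.

End pairing.

(** [V] has the shape of the squared V-norm. All seven unweighted squares are bounded by one
    multiple of it, so that each term of b is a bounded functional with the same constant. *)
Lemma weighted_sum_bound (R : realFieldType) (w1 w2 w3 w4 : R) (A1 A2 A3 A4 A5 A6 A7 : R) :
  0 < w1 -> 0 < w2 -> 0 < w3 -> 0 < w4 ->
  0 <= A1 -> 0 <= A2 -> 0 <= A3 -> 0 <= A4 -> 0 <= A5 -> 0 <= A6 -> 0 <= A7 ->
  let V := w1 * A1 + A2 + w2 * A3 + A4 + A5 + w3 * A6 + w4 * A7 in
  let C := w1^-1 + w2^-1 + 1 + w3^-1 + w4^-1 in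
  [/\ A1 <= C * V, A2 <= C * V, A3 <= C * V & A4 <= C * V] /\
  [/\ A5 <= C * V, A6 <= C * V & A7 <= C * V].
Proof.
move=> w10 w20 w30 w40 A10 A20 A30 A40 A50 A60 A70 V C.
have p1 : 0 <= w1 * A1 by rewrite mulr_ge0// ltW.
have p2 : 0 <= w2 * A3 by rewrite mulr_ge0// ltW.
have p3 : 0 <= w3 * A6 by rewrite mulr_ge0// ltW.
have p4 : 0 <= w4 * A7 by rewrite mulr_ge0// ltW.
have i1 : 0 < w1^-1 by rewrite invr_gt0.
have i2 : 0 < w2^-1 by rewrite invr_gt0.
have i3 : 0 < w3^-1 by rewrite invr_gt0.
have i4 : 0 < w4^-1 by rewrite invr_gt0.
have V0 : 0 <= V by rewrite /V !addr_ge0.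
have step a w : 0 < w -> w^-1 <= C -> w * a <= V -> a <= C * V.
  move=> w0 wC; rewrite mulrC -ler_pdivlMr// => /le_trans; apply.
  by rewrite mulrC ler_wpM2r.
split; split.
- by apply: (step _ w1); rewrite // /V /C; lra.
- by apply: (step _ 1); rewrite // ?invr1 ?mul1r /V /C; lra.
- by apply: (step _ w2); rewrite // /V /C; lra.
- by apply: (step _ 1); rewrite // ?invr1 ?mul1r /V /C; lra.
- by apply: (step _ 1); rewrite // ?invr1 ?mul1r /V /C; lra.
- by apply: (step _ w3); rewrite // /V /C; lra.
- by apply: (step _ w4); rewrite // /V /C; lra.
Qed.

(** Collects the twelve terms of b into one sum over the elements; [k2] appears twice because two
    terms carry the factor eps^(3/4). *)
Lemma sum_split12 (R : comNzRingType) (I : finType) (F1 F2 F3 F4 F5 F6 F7 F8 F9 F10 F11 F12 : I -> R)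
    (k1 k2 k3 k4 k5 t1 t2 t3 t4 t5 t6 t7 t8 t9 t10 t11 t12 : R) :
  t1 = \sum_i F1 i -> t2 = \sum_i F2 i -> t3 = \sum_i F3 i -> t4 = \sum_i F4 i ->
  t5 = \sum_i F5 i -> t6 = \sum_i F6 i -> t7 = \sum_i F7 i -> t8 = \sum_i F8 i ->
  t9 = \sum_i F9 i -> t10 = \sum_i F10 i -> t11 = \sum_i F11 i -> t12 = \sum_i F12 i ->
  t1 + t2 - t3 + k1 * t4 + t5 - t6 + k2 * t7 - k2 * t8 + t9 + k3 * t10 + k4 * t11 - k5 * t12 =
  \sum_i (F1 i + F2 i - F3 i + k1 * F4 i + F5 i - F6 i + k2 * F7 i - k2 * F8 i + F9 i +
    k3 * F10 i + k4 * F11 i - k5 * F12 i).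
Proof. by do 12!move=> ->; rewrite !big_split /= !sumrN !mulr_sumr. Qed.

(** * Boundedness of b and the Riesz representative Theta *)

Section trial_to_test.
Context (R : realType) (n : nat) (Omega : set 'rV[R]_n.+1) (I : finType).
Context (X : I -> 'M[R]_(n.+2, n.+1)) (hO : lipschitz_domain Omega) (hX : conforming_mesh Omega X).
Local Notation E := 'rV[R]_n.+1.
Local Notation T i := (open_simplex (X i)).
Local Notation Y := ((E -> R) * ((E -> E) * (E -> R)))%type.

Let oO := Omega_open hO.
Let mO := mOmega hO.
Let oT := @T_open _ _ _ _ _ hX.
Let mTi := @mT _ _ _ _ _ hX.
Let hlO := l2_semi_inner mO.
Let hvO := l2v_semi_inner mO.
Let hl i := l2_semi_inner (mTi i).
Let hv i := l2v_semi_inner (mTi i).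

Context (eps : R) (eps0 : 0 < eps).
Let pow a : 0 < eps `^ a. Proof. exact: powR_gt0. Qed.

Local Notation Vd := (V_dom Omega X).
Local Notation Vi := (V_ip Omega X eps).
Let hV : semi_inner Vd Vi := V_semi_inner hO hX eps0.

Lemma l2ip_T_le i f : L2 Omega f -> l2ip (T i) f f <= l2ip Omega f f.
Proof.
move=> hf; rewrite (l2ip_mesh hO hX hf hf) (bigD1 i)//= lerDl; apply: sumr_ge0 => j _.
by apply: (si_ge0 (hl j)); exact: (L2_T hO hX j hf).
Qed.

Lemma l2vip_T_le i f : L2vec Omega f -> l2vip (T i) f f <= l2vip Omega f f.
Proof.
move=> hf; rewrite (l2vip_mesh hO hX hf hf) (bigD1 i)//= lerDl; apply: sumr_ge0 => j _.
by apply: (si_ge0 (hv j)); exact: (L2vec_T hO hX j hf).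
Qed.

Lemma mesh_ip_ge i f : prod_dom (fun i => L2 (T i)) f -> l2ip (T i) (f i) (f i) <= mesh_ip X f f.
Proof.
move=> hf; rewrite /mesh_ip /prod_ip (bigD1 i)//= lerDl; apply: sumr_ge0 => j _.
by apply: (si_ge0 (hl j)); exact: hf.
Qed.

Lemma mesh_vip_ge i f : prod_dom (fun i => L2vec (T i)) f -> l2vip (T i) (f i) (f i) <= mesh_vip X f f.
Proof.
move=> hf; rewrite /mesh_vip /prod_ip (bigD1 i)//= lerDl; apply: sumr_ge0 => j _.
by apply: (si_ge0 (hv j)); exact: hf.
Qed.

Record V_local i (y : Y) : Prop := VLocal {
  vl_m : H1 (T i) y.1 ; vl_t : Hdiv (T i) y.2.1 ; vl_v : H1Lap (T i) y.2.2 }.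

Lemma V_dom_local i y : Vd y -> V_local i y.
Proof. by move=> [/H1_meshP[_ h1] [/Hdiv_meshP[_ h2] /H1Lap_meshP[_ h3]]]; split; [exact: h1|exact: h2|exact: h3]. Qed.

Lemma V_ipE y : Vi y y =
  eps^-1 * l2ip Omega y.1 y.1 + mesh_vip X (mesh_grad X y.1) (mesh_grad X y.1) +
  eps `^ (- (1 / 2)) * l2vip Omega y.2.1 y.2.1 + mesh_ip X (mesh_div X y.2.1) (mesh_div X y.2.1) +
  l2ip Omega y.2.2 y.2.2 +
  (eps `^ (1 / 2) + eps) * mesh_vip X (mesh_grad X y.2.2) (mesh_grad X y.2.2) +
  eps `^ (3 / 2) * mesh_ip X (mesh_lap X y.2.2) (mesh_lap X y.2.2).
Proof.
rewrite /V_ip /pair_ip /H1_mesh_ip /Hdiv_mesh_ip /H1Lap_mesh_ip /H1_mesh_ip /graph_ip.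
by rewrite !mul1r !addrA.
Qed.

Record V_bound i (C : R) (y : Y) : Prop := VBound {
  vb_m : l2ip (T i) y.1 y.1 <= C * Vi y y ;
  vb_gm : l2vip (T i) (grad (T i) y.1) (grad (T i) y.1) <= C * Vi y y ;
  vb_t : l2vip (T i) y.2.1 y.2.1 <= C * Vi y y ;
  vb_dt : l2ip (T i) (div (T i) y.2.1) (div (T i) y.2.1) <= C * Vi y y ;
  vb_v : l2ip (T i) y.2.2 y.2.2 <= C * Vi y y ;
  vb_gv : l2vip (T i) (grad (T i) y.2.2) (grad (T i) y.2.2) <= C * Vi y y ;
  vb_lv : l2ip (T i) (lap (T i) y.2.2) (lap (T i) y.2.2) <= C * Vi y y }.

Lemma V_part : exists2 C : R, 0 <= C & forall i y, Vd y -> V_bound i C y.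
Proof.
have p1 : 0 < eps^-1 by rewrite invr_gt0.
have p2 := pow (- (1 / 2)); have p3 : 0 < eps `^ (1 / 2) + eps by rewrite addr_gt0.
have p4 := pow (3 / 2).
exists (eps^-1^-1 + (eps `^ (- (1 / 2)))^-1 + 1 + (eps `^ (1 / 2) + eps)^-1 + (eps `^ (3 / 2))^-1).
  by rewrite !addr_ge0// ltW// invr_gt0.
move=> i y hy; have hyl j := V_dom_local j hy.
have [/H1_meshP[hm _] [/Hdiv_meshP[ht _] /H1Lap_meshP[hvv _]]] := hy.
have dg : prod_dom (fun i => L2vec (T i)) (mesh_grad X y.1) by move=> j; exact: H1_L2grad (vl_m (hyl j)).
have dd : prod_dom (fun i => L2 (T i)) (mesh_div X y.2.1) by move=> j; exact: Hdiv_L2div (vl_t (hyl j)).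
have dv : prod_dom (fun i => L2vec (T i)) (mesh_grad X y.2.2) by move=> j; exact: H1_L2grad (vl_v (hyl j)).1.
have dL : prod_dom (fun i => L2 (T i)) (mesh_lap X y.2.2) by move=> j; exact: L2lap (vl_v (hyl j)).
have a1 := l2ip_T_le i hm; have a2 := mesh_vip_ge i dg; have a3 := l2vip_T_le i ht.
have a4 := mesh_ip_ge i dd; have a5 := l2ip_T_le i hvv; have a6 := mesh_vip_ge i dv; have a7 := mesh_ip_ge i dL.
have b1 := si_ge0 (hl i) (H1_L2 (vl_m (hyl i))); have b2 := si_ge0 (hv i) (dg i).
have b3 := si_ge0 (hv i) (Hdiv_L2 (vl_t (hyl i))); have b4 := si_ge0 (hl i) (dd i).
have b5 := si_ge0 (hl i) (H1_L2 (vl_v (hyl i)).1); have b6 := si_ge0 (hv i) (dv i).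
have b7 := si_ge0 (hl i) (dL i).
have := weighted_sum_bound p1 p2 p3 p4 (le_trans b1 a1) (le_trans b2 a2) (le_trans b3 a3)
  (le_trans b4 a4) (le_trans b5 a5) (le_trans b6 a6) (le_trans b7 a7).
rewrite /= -V_ipE => -[[c1 c2 c3 c4] [c5 c6 c7]]; split.
- exact: (le_trans a1 c1).
- exact: (le_trans a2 c2).
- exact: (le_trans a3 c3).
- exact: (le_trans a4 c4).
- exact: (le_trans a5 c5).
- exact: (le_trans a6 c6).
- exact: (le_trans a7 c7).
Qed.

(** The hypotheses of [riesz_representation] on V, in a form that is stable under linear
    combinations and finite sums. *)
Definition bounded_functional (l : Y -> R) : Prop :=
  (forall a x y, Vd x -> Vd y -> l (a *: x + y) = a * l x + l y) /\
  exists2 C : R, 0 <= C & forall y, Vd y -> l y ^+ 2 <= C * Vi y y.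

Lemma bounded_functional_ext l l' : (forall y, Vd y -> l y = l' y) ->
  bounded_functional l -> bounded_functional l'.
Proof.
move=> e [h [C C0 hC]]; split.
  move=> a x y hx hy; rewrite -(e _ hx) -(e _ hy) -(e _ (subspaceL (si_subspace hV) a hx hy)).
  exact: h.
by exists C => // y hy; rewrite -(e _ hy); exact: hC.
Qed.

Lemma bounded_functionalL a l l' : bounded_functional l -> bounded_functional l' ->
  bounded_functional (fun y => a * l y + l' y).
Proof.
move=> [h [C C0 hC]] [h' [C' C0' hC']]; split.
  by move=> b x y hx hy; rewrite (h b x y hx hy) (h' b x y hx hy); ring.
exists (2 * a ^+ 2 * C + 2 * C').
  by have aC : 0 <= a ^+ 2 * C by [rewrite mulr_ge0// sqr_ge0]; lra.
move=> y hy; have := hC y hy; have := hC' y hy.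
move: (l y) (l' y) (Vi y y) => u v w hv' hu.
have s := sqr_ge0 (a * u - v); have a2 := sqr_ge0 a.
have hau : a ^+ 2 * u ^+ 2 <= a ^+ 2 * (C * w) by rewrite ler_wpM2l.
nra.
Qed.

Lemma bounded_functional0 : bounded_functional (fun=> 0).
Proof.
split; first by move=> a x y _ _; rewrite mulr0 addr0.
by exists 0 => // y _; rewrite mul0r expr0n.
Qed.

Lemma bounded_functional_sum (l : I -> Y -> R) : (forall i, bounded_functional (l i)) ->
  bounded_functional (fun y => \sum_i l i y).
Proof.
move=> h; elim: (index_enum I) => [|i s IH].
  by apply: bounded_functional_ext bounded_functional0 => y _; rewrite big_nil.
apply: bounded_functional_ext (bounded_functionalL 1 (h i) IH) => y _.
by rewrite big_cons mul1r.
Qed.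

Lemma bounded_functional_ip (W : lmodType R) (S : W -> Prop) (ip : W -> W -> R) (D : Y -> W) (C : R) p :
  semi_inner S ip -> S p -> 0 <= C ->
  (forall y, Vd y -> S (D y)) -> (forall y, Vd y -> ip (D y) (D y) <= C * Vi y y) ->
  (forall a x y, Vd x -> Vd y -> ip (D (a *: x + y)) p = a * ip (D x) p + ip (D y) p) ->
  bounded_functional (fun y => ip (D y) p).
Proof.
move=> hS Sp C0 hD hC hlin; split; first exact: hlin.
exists (ip p p * C); first by rewrite mulr_ge0// (si_ge0 hS).
move=> y hy; apply: (le_trans (cauchy_schwarz_ip hS (hD y hy) Sp)).
by rewrite -mulrA mulrC ler_wpM2l ?(si_ge0 hS) ?hC.
Qed.

Section base_functionals.
Context (i : I) (f : E -> R) (p : E -> E) (hf : L2 (T i) f) (hp : L2vec (T i) p).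

Lemma bf_m : bounded_functional (fun y => l2ip (T i) y.1 f).
Proof.
have [C C0 hC] := V_part; apply: (bounded_functional_ip (hl i) hf C0).
- by move=> y /(V_dom_local i)[h _ _]; exact: H1_L2 h.
- by move=> y /(hC i)[].
- move=> a x y /(V_dom_local i)[h _ _] /(V_dom_local i)[h' _ _].
  exact: (si_lin (hl i) a (H1_L2 h) (H1_L2 h') hf).
Qed.

Lemma bf_gm : bounded_functional (fun y => l2vip (T i) (grad (T i) y.1) p).
Proof.
have [C C0 hC] := V_part; apply: (bounded_functional_ip (hv i) hp C0).
- by move=> y /(V_dom_local i)[h _ _]; exact: H1_L2grad h.
- by move=> y /(hC i)[].
- move=> a x y /(V_dom_local i)[h _ _] /(V_dom_local i)[h' _ _].
  exact: (grad_lin (@oT i) a h h' hp).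
Qed.

Lemma bf_t : bounded_functional (fun y => l2vip (T i) y.2.1 p).
Proof.
have [C C0 hC] := V_part; apply: (bounded_functional_ip (hv i) hp C0).
- by move=> y /(V_dom_local i)[_ h _]; exact: Hdiv_L2 h.
- by move=> y /(hC i)[].
- move=> a x y /(V_dom_local i)[_ h _] /(V_dom_local i)[_ h' _].
  exact: (si_lin (hv i) a (Hdiv_L2 h) (Hdiv_L2 h') hp).
Qed.

Lemma bf_dt : bounded_functional (fun y => l2ip (T i) (div (T i) y.2.1) f).
Proof.
have [C C0 hC] := V_part; apply: (bounded_functional_ip (hl i) hf C0).
- by move=> y /(V_dom_local i)[_ h _]; exact: Hdiv_L2div h.
- by move=> y /(hC i)[].
- move=> a x y /(V_dom_local i)[_ h _] /(V_dom_local i)[_ h' _].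
  exact: (div_lin (@oT i) a h h' hf).
Qed.

Lemma bf_v : bounded_functional (fun y => l2ip (T i) y.2.2 f).
Proof.
have [C C0 hC] := V_part; apply: (bounded_functional_ip (hl i) hf C0).
- by move=> y /(V_dom_local i)[_ _ h]; exact: H1_L2 h.1.
- by move=> y /(hC i)[].
- move=> a x y /(V_dom_local i)[_ _ h] /(V_dom_local i)[_ _ h'].
  exact: (si_lin (hl i) a (H1_L2 h.1) (H1_L2 h'.1) hf).
Qed.

Lemma bf_gv : bounded_functional (fun y => l2vip (T i) (grad (T i) y.2.2) p).
Proof.
have [C C0 hC] := V_part; apply: (bounded_functional_ip (hv i) hp C0).
- by move=> y /(V_dom_local i)[_ _ h]; exact: H1_L2grad h.1.
- by move=> y /(hC i)[].
- move=> a x y /(V_dom_local i)[_ _ h] /(V_dom_local i)[_ _ h'].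
  exact: (grad_lin (@oT i) a h.1 h'.1 hp).
Qed.

Lemma bf_lv : bounded_functional (fun y => l2ip (T i) (lap (T i) y.2.2) f).
Proof.
have [C C0 hC] := V_part; apply: (bounded_functional_ip (hl i) hf C0).
- by move=> y /(V_dom_local i)[_ _ h]; exact: L2lap h.
- by move=> y /(hC i)[].
- move=> a x y /(V_dom_local i)[_ _ h] /(V_dom_local i)[_ _ h'].
  exact: (lap_lin (@oT i) a h h' hf).
Qed.

End base_functionals.

Local Notation c1 := (eps `^ (- (1 / 4))).
Local Notation c2 := (eps `^ (3 / 4)).
Local Notation c3 := (eps `^ (5 / 4)).
Local Notation c4 := (eps `^ (1 / 4)).
Local Notation c5 := (eps `^ (1 / 2)).
Local Notation rep := (rep R n).

Record rep_local i (x : rep) : Prop := RepLocal {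
  rl_u : L2 (T i) (ru x) ; rl_s : L2vec (T i) (rs x) ; rl_r : L2 (T i) (rr x) ;
  rl_wa : H1 (T i) (rwa x) ; rl_wb : H1 (T i) (rwb x) ;
  rl_qa : Hdiv (T i) (rqa x) ; rl_qb : Hdiv (T i) (rqb x) }.

Lemma rep_dom_local i x : rep_dom Omega x -> rep_local i x.
Proof.
move=> [x1 x2 x3 x4 x5 x6 x7 _]; split.
- exact: (L2_T hO hX i x1).
- exact: (L2vec_T hO hX i x2).
- exact: (L2_T hO hX i x3).
- exact: (H1_T hO hX i x4).
- exact: (H1_T hO hX i x5).
- exact: (Hdiv_T hO hX i x6).
- exact: (Hdiv_T hO hX i x7).
Qed.

Definition local_bform i (x : rep) (y : Y) : R :=
  l2ip (T i) (rr x) y.1 + l2vip (T i) (rs x) (grad (T i) y.1) - pairing (T i) (rqa x) y.1 +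
  c1 * l2vip (T i) (rs x) y.2.1 + l2ip (T i) (ru x) (div (T i) y.2.1) -
  pairing (T i) y.2.1 (rwa x) +
  c2 * l2vip (T i) (rs x) (grad (T i) y.2.2) - c2 * pairing (T i) (rqb x) y.2.2 +
  l2ip (T i) (ru x) y.2.2 + c3 * l2ip (T i) (rr x) (lap (T i) y.2.2) +
  c4 * l2vip (T i) (rs x) (grad (T i) y.2.2) -
  c5 * pairing (T i) (grad (T i) y.2.2) (rwb x).

Definition mesh_bform (x : rep) (y : Y) : R := \sum_i local_bform i x y.

Lemma bformE x y : rep_dom Omega x -> Vd y ->
  bform Omega X eps (tr X x) (test_of y) = mesh_bform x y.
Proof.
move=> hx hy; have hxl i := rep_dom_local i hx; have hyl i := V_dom_local i hy.
have [/H1_meshP[hm _] [/Hdiv_meshP[ht _] /H1Lap_meshP[hvv _]]] := hy.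
have [hu hs hr _ _ _ _ _] := hx.
have e1 := l2ip_mesh hO hX hr hm.
have e3 : \sum_i normal_trace (T i) (rqa x) (trace (T i) y.1) = \sum_i pairing (T i) (rqa x) y.1.
  by apply: eq_bigr => i _; exact: (normal_trace_pairing (@oT i) (rl_qa (hxl i)) (vl_m (hyl i))).
have e4 := l2vip_mesh hO hX hs ht.
have e6 : \sum_i normal_trace (T i) y.2.1 (trace (T i) (rwa x)) = \sum_i pairing (T i) y.2.1 (rwa x).
  by apply: eq_bigr => i _; exact: (normal_trace_pairing (@oT i) (vl_t (hyl i)) (rl_wa (hxl i))).
have e8 : \sum_i normal_trace (T i) (rqb x) (trace (T i) y.2.2) = \sum_i pairing (T i) (rqb x) y.2.2.
  by apply: eq_bigr => i _; exact: (normal_trace_pairing (@oT i) (rl_qb (hxl i)) (vl_v (hyl i)).1).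
have e9 := l2ip_mesh hO hX hu hvv.
have e12 : \sum_i normal_trace (T i) (grad (T i) y.2.2) (trace (T i) (rwb x)) =
    \sum_i pairing (T i) (grad (T i) y.2.2) (rwb x).
  by apply: eq_bigr => i _; exact: (normal_trace_pairing (@oT i) (vl_v (hyl i)).2 (rl_wb (hxl i))).
exact: (sum_split12 c1 c2 c3 c4 c5 e1 erefl e3 e4 erefl e6 erefl e8 e9 erefl erefl e12).
Qed.

Lemma local_bform_linl i a x x' y : rep_local i x -> rep_local i x' -> V_local i y ->
  local_bform i (a *: x + x') y = a * local_bform i x y + local_bform i x' y.
Proof.
move=> [x1 x2 x3 x4 x5 x6 x7] [z1 z2 z3 z4 z5 z6 z7] [y1 y2 y3]; rewrite /local_bform.
have hg := H1_L2grad y1; have hg' := H1_L2grad y3.1.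
have -> : l2ip (T i) (rr (a *: x + x')) y.1 = a * l2ip (T i) (rr x) y.1 + l2ip (T i) (rr x') y.1
  by exact: (si_lin (hl i) a x3 z3 (H1_L2 y1)).
have -> : l2vip (T i) (rs (a *: x + x')) (grad (T i) y.1) =
   a * l2vip (T i) (rs x) (grad (T i) y.1) + l2vip (T i) (rs x') (grad (T i) y.1)
  by exact: (si_lin (hv i) a x2 z2 hg).
have -> : pairing (T i) (rqa (a *: x + x')) y.1 = a * pairing (T i) (rqa x) y.1 + pairing (T i) (rqa x') y.1
  by exact: (pairing_linl (@oT i) a x6 z6 y1).
have -> : l2vip (T i) (rs (a *: x + x')) y.2.1 =
   a * l2vip (T i) (rs x) y.2.1 + l2vip (T i) (rs x') y.2.1
  by exact: (si_lin (hv i) a x2 z2 (Hdiv_L2 y2)).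
have -> : l2ip (T i) (ru (a *: x + x')) (div (T i) y.2.1) =
   a * l2ip (T i) (ru x) (div (T i) y.2.1) + l2ip (T i) (ru x') (div (T i) y.2.1)
  by exact: (si_lin (hl i) a x1 z1 (Hdiv_L2div y2)).
have -> : pairing (T i) y.2.1 (rwa (a *: x + x')) = a * pairing (T i) y.2.1 (rwa x) + pairing (T i) y.2.1 (rwa x')
  by exact: (pairing_linr (@oT i) a y2 x4 z4).
have -> : l2vip (T i) (rs (a *: x + x')) (grad (T i) y.2.2) =
   a * l2vip (T i) (rs x) (grad (T i) y.2.2) + l2vip (T i) (rs x') (grad (T i) y.2.2)
  by exact: (si_lin (hv i) a x2 z2 hg').
have -> : pairing (T i) (rqb (a *: x + x')) y.2.2 = a * pairing (T i) (rqb x) y.2.2 + pairing (T i) (rqb x') y.2.2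
  by exact: (pairing_linl (@oT i) a x7 z7 y3.1).
have -> : l2ip (T i) (ru (a *: x + x')) y.2.2 = a * l2ip (T i) (ru x) y.2.2 + l2ip (T i) (ru x') y.2.2
  by exact: (si_lin (hl i) a x1 z1 (H1_L2 y3.1)).
have -> : l2ip (T i) (rr (a *: x + x')) (lap (T i) y.2.2) =
   a * l2ip (T i) (rr x) (lap (T i) y.2.2) + l2ip (T i) (rr x') (lap (T i) y.2.2)
  by exact: (si_lin (hl i) a x3 z3 (L2lap y3)).
have -> : pairing (T i) (grad (T i) y.2.2) (rwb (a *: x + x')) =
   a * pairing (T i) (grad (T i) y.2.2) (rwb x) + pairing (T i) (grad (T i) y.2.2) (rwb x')
  by exact: (pairing_linr (@oT i) a y3.2 x5 z5).
move: c1 c2 c3 c4 c5 => k1 k2 k3 k4 k5.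
move: (l2ip _ (rr x) y.1) (l2ip _ (rr x') y.1) => t1 t1'.
move: (l2vip _ (rs x) (grad _ y.1)) (l2vip _ (rs x') (grad _ y.1)) => t2 t2'.
move: (pairing _ (rqa x) _) (pairing _ (rqa x') _) => t3 t3'.
move: (l2vip _ (rs x) y.2.1) (l2vip _ (rs x') y.2.1) => t4 t4'.
move: (l2ip _ (ru x) (div _ _)) (l2ip _ (ru x') (div _ _)) => t5 t5'.
move: (pairing _ _ (rwa x)) (pairing _ _ (rwa x')) => t6 t6'.
move: (l2vip _ (rs x) (grad _ y.2.2)) (l2vip _ (rs x') (grad _ y.2.2)) => t7 t7'.
move: (pairing _ (rqb x) _) (pairing _ (rqb x') _) => t8 t8'.
move: (l2ip _ (ru x) y.2.2) (l2ip _ (ru x') y.2.2) => t9 t9'.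
move: (l2ip _ (rr x) (lap _ _)) (l2ip _ (rr x') (lap _ _)) => t10 t10'.
move: (pairing _ _ (rwb x)) (pairing _ _ (rwb x')) => t12 t12'.
clear; ring.
Qed.

Lemma mesh_bform_linl a x x' y : rep_dom Omega x -> rep_dom Omega x' -> Vd y ->
  mesh_bform (a *: x + x') y = a * mesh_bform x y + mesh_bform x' y.
Proof.
move=> hx hx' hy; rewrite /mesh_bform mulr_sumr -big_split /=; apply: eq_bigr => i _.
exact: (local_bform_linl a (rep_dom_local i hx) (rep_dom_local i hx') (V_dom_local i hy)).
Qed.

(** Each boundary pairing is, by Green's formula, a sum of two L^2 products on the element; after
    that b is a combination of L^2 products with the components of y and their derivatives. *)
Lemma local_bform_bounded i x : rep_local i x -> bounded_functional (local_bform i x).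
Proof.
move=> [x1 x2 x3 x4 x5 x6 x7].
have bL := bounded_functionalL.
apply: bounded_functional_ext
  (bL 1 _ _ (bf_m x3) (bL 1 _ _ (bf_gm x2) (bL (-1) _ _ (bf_m (Hdiv_L2div x6)) (bL (-1) _ _ (bf_gm (Hdiv_L2 x6))
  (bL c1 _ _ (bf_t x2) (bL 1 _ _ (bf_dt x1) (bL (-1) _ _ (bf_dt (H1_L2 x4)) (bL (-1) _ _ (bf_t (H1_L2grad x4))
  (bL (c2 + c4) _ _ (bf_gv x2) (bL (- c2) _ _ (bf_v (Hdiv_L2div x7)) (bL (- c2) _ _ (bf_gv (Hdiv_L2 x7))
  (bL 1 _ _ (bf_v x1) (bL c3 _ _ (bf_lv x3) (bL (- c5) _ _ (bf_lv (H1_L2 x5)) (bL (- c5) _ _ (bf_gv (H1_L2grad x5))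
  bounded_functional0))))))))))))))).
move=> y /(V_dom_local i)[y1 y2 y3]; have hg := H1_L2grad y1; have hg' := H1_L2grad y3.1.
rewrite /local_bform /pairing /green -/(lap (T i) y.2.2).
rewrite (si_sym (hl i) x3 (H1_L2 y1)) (si_sym (hv i) x2 hg) (si_sym (hl i) (Hdiv_L2div x6) (H1_L2 y1)).
rewrite (si_sym (hv i) (Hdiv_L2 x6) hg) (si_sym (hv i) x2 (Hdiv_L2 y2)) (si_sym (hl i) x1 (Hdiv_L2div y2)).
rewrite (si_sym (hv i) x2 hg') (si_sym (hl i) (Hdiv_L2div x7) (H1_L2 y3.1)) (si_sym (hv i) (Hdiv_L2 x7) hg').
rewrite (si_sym (hl i) x1 (H1_L2 y3.1)) (si_sym (hl i) x3 (L2lap y3)).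
move: c1 c2 c3 c4 c5 => k1 k2 k3 k4 k5.
move: (l2ip _ _ (rr x)) (l2ip _ _ (rr x)) (l2vip _ _ (rs x)) (l2vip _ _ (rs x)) (l2vip _ _ (rs x)).
move: (l2ip _ _ (div _ (rqa x))) (l2ip _ _ (div _ (rqb x))) (l2vip _ _ (rqa x)) (l2vip _ _ (rqb x)).
move: (l2ip _ _ (ru x)) (l2ip _ _ (ru x)) (l2ip _ _ (rwa x)) (l2ip _ _ (rwb x)).
move: (l2vip _ _ (grad _ (rwa x))) (l2vip _ _ (grad _ (rwb x))).
clear; move=> *; ring.
Qed.

Lemma mesh_bform_bounded x : rep_dom Omega x -> bounded_functional (mesh_bform x).
Proof.
by move=> hx; apply: bounded_functional_sum => i; apply: local_bform_bounded; exact: rep_dom_local.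
Qed.

Lemma bounded_functional_riesz l : bounded_functional l -> exists2 r, Vd r & forall y, Vd y -> Vi r y = l y.
Proof. by move=> [h [C _ hC]]; exact: (riesz_representation hV (V_complete hO hX eps0) h hC). Qed.

Definition theta (x : rep) : Y := of_test (Theta Omega X eps (tr X x)).

(** [Theta] selects a Riesz representative by [xget]; boundedness of b shows that there is one, so
    the selected element has the defining property. *)
Lemma thetaP x : rep_dom Omega x -> Vd (theta x) /\ forall y, Vd y -> Vi (theta x) y = mesh_bform x y.
Proof.
move=> hx; have [r hr e] := bounded_functional_riesz (mesh_bform_bounded hx).
rewrite /theta /Theta; set P := [set t | _].
have [h1 h2] : P (xget (Test (fun=> 0) (fun=> 0) (fun=> 0)) P).
  apply: xgetPex; exists (test_of r); split; first exact/V_domP.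
  move=> t ht; have ht' : Vd (of_test t) by apply/V_domP; rewrite test_ofK.
  by rewrite -(test_ofK t) V_innerE e// bformE.
have h1' : Vd (of_test (xget (Test (fun=> 0) (fun=> 0) (fun=> 0)) P)) by apply/V_domP; rewrite test_ofK.
split; first exact: h1'.
move=> y hy; have hy' := (V_domP Omega X y).1 hy.
by rewrite -bformE// -(h2 _ hy') -V_innerE test_ofK.
Qed.

Lemma theta_lin a x x' y : rep_dom Omega x -> rep_dom Omega x' -> Vd y ->
  Vi (theta (a *: x + x')) y = a * Vi (theta x) y + Vi (theta x') y.
Proof.
move=> hx hx' hy; have hs := subspaceL (rep_dom_subspace hO) a hx hx'.
refine (etrans ((thetaP hs).2 y hy) (etrans (mesh_bform_linl a hx hx' hy) _)).
have e := (thetaP hx).2 y hy; have e' := (thetaP hx').2 y hy.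
exact: (congr2 (fun s t => a * s + t) (esym e) (esym e')).
Qed.

Lemma Lform_bounded f : L2 Omega f -> bounded_functional (fun y => Lform X eps f (test_of y)).
Proof.
move=> hf; have hfi i := L2_T hO hX i hf; have bL := bounded_functionalL.
apply: bounded_functional_ext (bounded_functional_sum
  (fun i => bL (- c5) _ _ (bf_lv (hfi i)) (bL 1 _ _ (bf_v (hfi i)) bounded_functional0))).
move=> y hy; apply: eq_bigr => i _; have [_ _ h] := V_dom_local i hy.
transitivity (l2ip (T i) f ((- c5) *: lap (T i) y.2.2 + y.2.2)).
  rewrite (ip_linr (hl i) (- c5) (L2lap h) (H1_L2 h.1) (hfi i)).
  rewrite (si_sym (hl i) (hfi i) (L2lap h)) (si_sym (hl i) (hfi i) (H1_L2 h.1)).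
  by move: (l2ip _ _ _) (l2ip _ _ _) => *; ring.
rewrite /l2ip; congr Rintegral; apply/funext => z.
by congr (_ * _); rewrite addrC -mulNr.
Qed.

End trial_to_test.

Lemma mesh_bformE (R : realType) (n : nat) (I : finType) (X : I -> 'M[R]_(n.+2, n.+1)) eps
    (x : rep R n) y : mesh_bform X eps x y = \sum_i local_bform X eps i x y.
Proof. by []. Qed.

(** * Coercivity and kernel *)

Opaque theta mesh_bform.

Lemma subrEL (R : nzRingType) (V : lmodType R) (x y : V) : x - y = -1 *: y + x.
Proof. by rewrite scaleN1r addrC. Qed.

Section dirichlet.
Context (R : realType) (d : nat) (omega : set 'rV[R]_d) (oo : open omega).
Local Notation E := 'rV[R]_d.
Let mo : measurable omega := open_measurable_rV oo.
Let hl := l2_semi_inner mo.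
Let hv := l2v_semi_inner mo.

Lemma H10_closed_weighted (a b : R) : 0 < a -> 0 < b -> ip_closed (H1 omega) (h1ip omega a b) (H10 omega).
Proof.
move=> a0 b0 u x hu hx ux; apply: (H10_closed oo hu hx).
apply/(h1_cvg_graph oo ltr01 ltr01 (fun k => H10_H1 (hu k)) hx).
exact/(h1_cvg_graph oo a0 b0 (fun k => H10_H1 (hu k)) hx).
Qed.

Lemma grad_eqr q w p : L2vec omega q -> grad_rel omega w p ->
  l2vip omega q (grad omega w) = l2vip omega q p.
Proof.
move=> hq hw; have [_ hp] := grad_rel_dom hw; have [_ hg] := grad_rel_dom (gradP hw).
by rewrite (si_sym hv hq hg) (grad_eq oo hw hq) (si_sym hv hp hq).
Qed.

Lemma green_H10_rel q dq w p : div_rel omega q dq -> grad_rel omega w p -> H10 omega w ->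
  l2ip omega dq w + l2vip omega q p = 0.
Proof.
move=> hq hw h; have [_ _ e] := (div_rel_green oo q dq).1 hq.
by rewrite -(grad_eqr (div_rel_dom hq).1 hw); exact: e.
Qed.

Lemma grad_rel_H1 w p : grad_rel omega w p -> H1 omega w.
Proof. by move=> h; rewrite H1_graph; exists p. Qed.

(** Riesz in H^1_0 for the form (z, w) + a (grad z, grad w), applied to w |-> (f, w) + (p, grad w).
    The resulting equation is Green's formula for p - a grad z, so by [div_rel_green] it provides a
    divergence, namely f - z. With p = 0 this solves z - a lap z = f. *)
Lemma dirichlet_solve (a : R) f p : 0 < a -> L2 omega f -> L2vec omega p ->
  exists2 z, H10 omega z & div_rel omega (p - a *: grad omega z) (f - z).
Proof.
move=> a0 hf hp; pose ip := h1ip omega 1 a.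
have h1 : semi_inner (H1 omega) ip := h1_semi_inner oo ltr01 a0.
have h10 : semi_inner (H10 omega) ip := semi_inner_sub h1 (H10_subspace oo) (@H10_H1 _ _ _).
have c10 : ip_complete (H10 omega) ip.
  exact: (@ip_closed_subspace _ _ _ _ _ (H10_closed_weighted ltr01 a0) (H10_subspace oo) (@H10_H1 _ _ _) (h1_complete oo ltr01 a0)).
have [||z hz ez] := @riesz_representation _ _ _ _ h10 c10 (green omega f p) (2 * l2ip omega f f + 2 * (l2vip omega p p / a)).
- by move=> b v w hv' hw; exact: (green_lin oo b hf hp (H10_H1 hv') (H10_H1 hw)).
- move=> w hw; have L2w := H1_L2 (H10_H1 hw); have L2g := H1_L2grad (H10_H1 hw).
  have i1 := cauchy_schwarz_ip hl hf L2w; have i2 := cauchy_schwarz_ip hv hp L2g.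
  have n1 := si_ge0 hl hf; have n2 := si_ge0 hv hp; have n3 := si_ge0 hl L2w; have n4 := si_ge0 hv L2g.
  rewrite /green /ip /h1ip /graph_ip; move: i1 i2 n1 n2 n3 n4.
  move: (l2ip omega f w) (l2vip omega p (grad omega w)) (l2ip omega f f) (l2vip omega p p)
    (l2ip omega w w) (l2vip omega (grad omega w) (grad omega w)) => A B F P W G i1 i2 n1 n2 n3 n4.
  have : 0 <= F * (a * G) by rewrite !mulr_ge0// ltW.
  have : 0 <= P / a * W by rewrite !mulr_ge0// invr_ge0 ltW.
  have : P / a * (a * G) = P * G by rewrite mulrA divfK// gt_eqF.
  have := sqr_ge0 (A - B); rewrite mul1r; nra.
exists z => //; apply/(div_rel_green oo).
have L2z := H1_L2 (H10_H1 hz); have L2gz := H1_L2grad (H10_H1 hz).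
have L2fz := subspaceB (si_subspace hl) hf L2z.
have L2az := subspaceZ (si_subspace hv) a L2gz.
have L2pz := subspaceB (si_subspace hv) hp L2az.
split => // w hw; have := ez w hw; have L2w := H1_L2 (H10_H1 hw); have L2g := H1_L2grad (H10_H1 hw).
rewrite /ip /h1ip /graph_ip /green.
rewrite (ipBl hl hf L2z L2w) (ipBl hv hp L2az L2g) (ipZl hv a L2gz L2g) mul1r.
by move: (l2ip _ f w) (l2ip _ z w) (l2vip _ p _) (l2vip _ _ _) => *; lra.
Qed.

(** Since [w] has zero norm, its gradient is also a gradient of 0, because the gradient relation is
    closed; so it has zero norm as well, and [w] is at H^1-distance 0 from the function 0. *)
Lemma H10_null w : H1 omega w -> l2ip omega w w = 0 -> H10 omega w.
Proof.
move=> hw w0; have hg := H1_L2grad hw.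
have h0 : grad_rel omega 0 (grad omega w).
  apply: (grad_rel_closed oo (fun _ : nat => H1_grad hw) (subspace0 (si_subspace hl)) hg).
    by move=> e e0; exists 0%N => k _; rewrite subr0 w0.
  exact: (@ip_cvg_cst _ _ _ _ hv _ hg).
have g0 := grad_rel_null oo h0.
apply: (H10_approx oo hw) => e e0; exists 0; first exact: (subspace0 (H10_subspace oo)).
by rewrite subr0 /h1ip /graph_ip w0 g0 !mulr0 addr0.
Qed.

End dirichlet.

Section quarter_powers.
Context (R : realType) (eps : R) (eps0 : 0 < eps).
Let k := eps `^ (1 / 4).

(** All weights of the forms become powers of k = eps^(1/4), so that the identities below are
    rational identities in k. *)
Lemma quarter_powers : [/\ 0 < k, eps = k ^+ 4, eps `^ (- (1 / 4)) = k^-1 & eps `^ (3 / 4) = k ^+ 3] /\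
  [/\ eps `^ (5 / 4) = k ^+ 5, eps `^ (1 / 2) = k ^+ 2, eps `^ (3 / 2) = k ^+ 6 & eps `^ (- (1 / 2)) = (k ^+ 2)^-1].
Proof.
have k0 : 0 < k by exact: powR_gt0.
have e m : k ^+ m = eps `^ (1 / 4 * m%:R) by rewrite powRrM powR_mulrn// ltW.
split; split; rewrite ?e -?powRN //.
- by rewrite (_ : 1 / 4 * 4%:R = 1) ?powRr1 ?ltW//; field.
- by congr (_ `^ _); field.
- by congr (_ `^ _); field.
- by congr (_ `^ _); field.
- by congr (_ `^ _); field.
- by congr (_ `^ _); field.
Qed.

End quarter_powers.

(** * The coercivity estimate *)

Section coercivity.
Context (R : realType) (n : nat) (Omega : set 'rV[R]_n.+1) (I : finType).
Context (X : I -> 'M[R]_(n.+2, n.+1)) (hO : lipschitz_domain Omega) (hX : conforming_mesh Omega X).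
Local Notation E := 'rV[R]_n.+1.
Local Notation T i := (open_simplex (X i)).

Let oO := Omega_open hO.
Let mO := mOmega hO.
Let oT := @T_open _ _ _ _ _ hX.
Let mTi := @mT _ _ _ _ _ hX.
Let hlO := l2_semi_inner mO.
Let hvO := l2v_semi_inner mO.
Let hl i := l2_semi_inner (mTi i).
Let hv i := l2v_semi_inner (mTi i).

Lemma mesh_grad_sum p m gm : L2vec Omega p -> grad_rel Omega m gm ->
  \sum_i l2vip (T i) p (grad (T i) m) = l2vip Omega p gm.
Proof.
move=> hp hm; rewrite (l2vip_mesh hO hX hp (grad_rel_dom hm).2); apply: eq_bigr => i _.
exact: (grad_eqr (@oT i) (L2vec_T hO hX i hp) (grad_rel_T hO hX i hm)).
Qed.

Lemma mesh_div_sum f q dq : L2 Omega f -> div_rel Omega q dq ->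
  \sum_i l2ip (T i) f (div (T i) q) = l2ip Omega f dq.
Proof.
move=> hf hq; rewrite (l2ip_mesh hO hX hf (div_rel_dom hq).2); apply: eq_bigr => i _.
have hqi := div_rel_T hO hX i hq; have hfi := L2_T hO hX i hf.
rewrite (si_sym (hl i) hfi (div_rel_dom (divP hqi)).2) (div_eq (@oT i) hqi hfi).
exact: (si_sym (hl i) (div_rel_dom hqi).2 hfi).
Qed.

Lemma mesh_pairing_sum q dq w : div_rel Omega q dq -> H1 Omega w ->
  \sum_i pairing (T i) q w = green Omega dq q w.
Proof.
move=> hq hw; have [h1 h2] := div_rel_dom hq; rewrite (green_mesh hO hX h2 h1 hw).
by apply: eq_bigr => i _; exact: (pairing_rel (@oT i) (div_rel_T hO hX i hq) (H1_T hO hX i hw)).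
Qed.

Lemma mesh_lap_rel i v gv lv : grad_rel Omega v gv -> div_rel Omega gv lv ->
  div_rel (T i) (grad (T i) v) lv.
Proof.
move=> hv' hg; have hvi := grad_rel_T hO hX i hv'.
apply: (div_rel_congr (@oT i) (grad_rel_dom (gradP hvi)).2) (div_rel_T hO hX i hg).
by move=> r hr; rewrite (grad_eq (@oT i) hvi hr).
Qed.

Lemma mesh_lap_sum f v gv lv : L2 Omega f -> grad_rel Omega v gv -> div_rel Omega gv lv ->
  \sum_i l2ip (T i) f (lap (T i) v) = l2ip Omega f lv.
Proof.
move=> hf hv' hg; rewrite (l2ip_mesh hO hX hf (div_rel_dom hg).2); apply: eq_bigr => i _.
have hqi := mesh_lap_rel i hv' hg; have hfi := L2_T hO hX i hf.
rewrite /lap (si_sym (hl i) hfi (div_rel_dom (divP hqi)).2) (div_eq (@oT i) hqi hfi).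
exact: (si_sym (hl i) (div_rel_dom hqi).2 hfi).
Qed.

Lemma mesh_pairing_lap v gv lv w : grad_rel Omega v gv -> div_rel Omega gv lv -> H1 Omega w ->
  \sum_i pairing (T i) (grad (T i) v) w = green Omega lv gv w.
Proof.
move=> hv' hg hw; have [h1 h2] := div_rel_dom hg; rewrite (green_mesh hO hX h2 h1 hw).
apply: eq_bigr => i _; have hwi := H1_T hO hX i hw.
rewrite (pairing_rel (@oT i) (mesh_lap_rel i hv' hg) hwi) /green.
by rewrite (grad_eq (@oT i) (grad_rel_T hO hX i hv') (H1_L2grad hwi)).
Qed.

Context (eps : R) (eps0 : 0 < eps).
Local Notation Vd := (V_dom Omega X).
Local Notation Vi := (V_ip Omega X eps).
Local Notation rep := (rep R n).
Local Notation k := (eps `^ (1 / 4)).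
Let hV : semi_inner Vd Vi := V_semi_inner hO hX eps0.

Section global_test.
Context m gm q dq v gv lv (hm : grad_rel Omega m gm) (hq : div_rel Omega q dq)
  (hvv : grad_rel Omega v gv) (hg : div_rel Omega gv lv).

Lemma global_V_dom : Vd (m, (q, v)).
Proof.
have [hm1 hm2] := grad_rel_dom hm; have [hq1 hq2] := div_rel_dom hq.
have [hv1 hv2] := grad_rel_dom hvv.
split; last split.
- by exists (fun=> gm); split => // i; exact: (grad_rel_T hO hX i hm).
- by exists (fun=> dq); split => // i; exact: (div_rel_T hO hX i hq).
exists (fun=> lv); split; last by move=> i; exact: (mesh_lap_rel i hvv hg).
by exists (fun=> gv); split => // i; exact: (grad_rel_T hO hX i hvv).
Qed.

(** For test functions that are conforming on all of Omega the elementwise integrals add up to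
    integrals over Omega, and the skeleton terms to pairings on the boundary of Omega. *)
Lemma global_bform x : rep_dom Omega x -> mesh_bform X eps x (m, (q, v)) =
  l2ip Omega (rr x) m + l2vip Omega (rs x) gm - green Omega (div Omega (rqa x)) (rqa x) m +
  eps `^ (- (1 / 4)) * l2vip Omega (rs x) q + l2ip Omega (ru x) dq - green Omega dq q (rwa x) +
  eps `^ (3 / 4) * l2vip Omega (rs x) gv -
  eps `^ (3 / 4) * green Omega (div Omega (rqb x)) (rqb x) v +
  l2ip Omega (ru x) v + eps `^ (5 / 4) * l2ip Omega (rr x) lv + k * l2vip Omega (rs x) gv -
  eps `^ (1 / 2) * green Omega lv gv (rwb x).
Proof.
move=> [x1 x2 x3 x4 x5 x6 x7 _]; apply: esym.
have [hm1 hm2] := grad_rel_dom hm; have [hq1 hq2] := div_rel_dom hq.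
have [hv1 hv2] := grad_rel_dom hvv.
have e1 := l2ip_mesh hO hX x3 hm1.
have e2 := esym (mesh_grad_sum x2 hm).
have e3 := esym (mesh_pairing_sum (Hdiv_div x6) (grad_rel_H1 hm)).
have e4 := l2vip_mesh hO hX x2 hq1.
have e5 := esym (mesh_div_sum x1 hq).
have e6 := esym (mesh_pairing_sum hq x4).
have e7 := esym (mesh_grad_sum x2 hvv).
have e8 := esym (mesh_pairing_sum (Hdiv_div x7) (grad_rel_H1 hvv)).
have e9 := l2ip_mesh hO hX x1 hv1.
have e10 := esym (mesh_lap_sum x3 hvv hg).
have e12 := esym (mesh_pairing_lap hvv hg x5).
exact: (sum_split12 _ _ _ _ _ e1 e2 e3 e4 e5 e6 e7 e8 e9 e10 e7 e12).
Qed.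

Lemma global_V_ip : Vi (m, (q, v)) (m, (q, v)) =
  eps^-1 * l2ip Omega m m + l2vip Omega gm gm + eps `^ (- (1 / 2)) * l2vip Omega q q +
  l2ip Omega dq dq + l2ip Omega v v + (eps `^ (1 / 2) + eps) * l2vip Omega gv gv +
  eps `^ (3 / 2) * l2ip Omega lv lv.
Proof.
have [hm1 hm2] := grad_rel_dom hm; have [hq1 hq2] := div_rel_dom hq.
have [hv1 hv2] := grad_rel_dom hvv; have [hg1 hg2] := div_rel_dom hg.
rewrite V_ipE /=.
have gg w gw : grad_rel Omega w gw -> mesh_vip X (mesh_grad X w) (mesh_grad X w) = l2vip Omega gw gw.
  move=> hw; rewrite (l2vip_mesh hO hX (grad_rel_dom hw).2 (grad_rel_dom hw).2).
  rewrite /mesh_vip /prod_ip /mesh_grad; apply: eq_bigr => i _.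
  have hwi := grad_rel_T hO hX i hw; have [_ h2] := grad_rel_dom hwi.
  by rewrite (grad_eq (@oT i) hwi (grad_rel_dom (gradP hwi)).2) (grad_eqr (@oT i) h2 hwi).
have dd (w : E -> E) (r : I -> E -> E) gw : (forall i, div_rel (T i) (r i) gw) -> L2 Omega gw ->
    \sum_i l2ip (T i) (div (T i) (r i)) (div (T i) (r i)) = l2ip Omega gw gw.
  move=> hw hgw; rewrite (l2ip_mesh hO hX hgw hgw); apply: eq_bigr => i _.
  have [_ h2] := div_rel_dom (hw i).
  have h3 := (div_rel_dom (divP (hw i))).2.
  by rewrite (div_eq (@oT i) (hw i) h3) (si_sym (hl i) h2 h3) (div_eq (@oT i) (hw i) h2).
rewrite (gg _ _ hm) (gg _ _ hvv).
have -> : mesh_ip X (mesh_div X q) (mesh_div X q) = l2ip Omega dq dq.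
  exact: (dd q (fun=> q) dq (fun i => div_rel_T hO hX i hq) hq2).
have -> : mesh_ip X (mesh_lap X v) (mesh_lap X v) = l2ip Omega lv lv.
  exact: (dd q (fun i => grad (T i) v) lv (fun i => mesh_lap_rel i hvv hg) hg2).
by [].
Qed.

End global_test.


Opaque V_ip.
Local Notation g x y := (pairing Omega (rqa x) (rwa y)).

Definition rep_aform (beta : R) (x y : rep) : R :=
  beta * Vi (theta Omega X eps x) (theta Omega X eps y) + 2^-1 * k * (g x y + g y x).

Lemma aformE beta x y : rep_dom Omega x -> rep_dom Omega y ->
  aform Omega X eps beta (tr X x) (tr X y) = rep_aform beta x y.
Proof.
move=> hx hy; have [tx ex] := thetaP hO hX eps0 hx; have [ty ey] := thetaP hO hX eps0 hy.
rewrite /aform (gamman_tr hO hX hx) (gamman_tr hO hX hy) (gamma0_tr hO hX hx) (gamma0_tr hO hX hy).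
rewrite (normal_trace_pairing oO (rd_qa hx) (rd_wa hy)) (normal_trace_pairing oO (rd_qa hy) (rd_wa hx)).
have e : Theta_beta Omega X eps beta (tr X y) = test_of (beta *: theta Omega X eps y) by [].
have h := subspaceZ (si_subspace hV) beta ty.
have -> : bform Omega X eps (tr X x) (Theta_beta Omega X eps beta (tr X y)) =
    beta * Vi (theta Omega X eps x) (theta Omega X eps y).
  rewrite e; refine (etrans (bformE hO hX eps hx h) _).
  by rewrite -(ex _ h) (ipZr hV beta ty tx).
by [].
Qed.

Lemma rep_aform_sym beta x y : rep_dom Omega x -> rep_dom Omega y ->
  rep_aform beta x y = rep_aform beta y x.
Proof.
move=> hx hy; have [tx _] := thetaP hO hX eps0 hx; have [ty _] := thetaP hO hX eps0 hy.
exact: (congr2 (fun s t => beta * s + 2^-1 * k * t) (si_sym hV tx ty) (addrC _ _)).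
Qed.

Lemma rep_aform_lin (beta a : R) x y z : rep_dom Omega x -> rep_dom Omega y -> rep_dom Omega z ->
  rep_aform beta (a *: x + y) z = a * rep_aform beta x z + rep_aform beta y z.
Proof.
move=> hx hy hz; have [tz _] := thetaP hO hX eps0 hz.
have e1 := theta_lin hO hX eps0 a hx hy tz.
have e2 : g (a *: x + y) z = a * g x z + g y z.
  exact: (pairing_linl oO a (rd_qa hx) (rd_qa hy) (rd_wa hz)).
have e3 : g z (a *: x + y) = a * g z x + g z y.
  exact: (pairing_linr oO a (rd_qa hz) (rd_wa hx) (rd_wa hy)).
refine (etrans (congr2 (fun s t => beta * s + 2^-1 * k * t) e1 (congr2 +%R e2 e3)) _).
rewrite /rep_aform.
have ring_id (s t u v w p b c : R) : b * (a * s + t) + c * (a * u + v + (a * w + p)) =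
    a * (b * s + c * (u + w)) + (b * t + c * (v + p)) by ring.
exact: ring_id.
Qed.


Lemma green_rel q dq w p : div_rel Omega q dq -> grad_rel Omega w p ->
  green Omega dq q w = l2ip Omega dq w + l2vip Omega q p.
Proof. by move=> [hq _] hw; rewrite /green (grad_eqr oO hq hw). Qed.

Lemma green_congr q dq v w : div_rel Omega q dq -> H1 Omega v -> H1 Omega w -> H10 Omega (v - w) ->
  green Omega dq q v = green Omega dq q w.
Proof.
move=> hq h1 h2 h; have hq' : Hdiv Omega q by rewrite Hdiv_graph; exists dq.
by rewrite -(pairing_rel oO hq h1) -(pairing_rel oO hq h2); exact: pairing_congr.
Qed.

(* phi is the extension of the trace of w^a with phi - eps lap phi = 0. The test
   function is (k^3 (phi - v), - eps grad phi - k^2 grad v, v) with k = eps^(1/4) and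
   v in H^1_0 such that v - k^2 lap v = phi. *)
Lemma coercive_test x : eps <= 1 -> rep_dom Omega x -> exists phi t N,
  [/\ H1 Omega phi, H10 Omega (phi - rwa x), Vd t & l2ip Omega phi phi <= N] /\
  mesh_bform X eps x t = N - eps `^ (3 / 4) * g x x /\ Vi t t <= 2 * eps `^ (1 / 2) * N.
Proof.
move=> eps1 hx; have [x1 x2 x3 x4 x5 x6 x7 x8] := hx.
have [[k0 ek ek1 ek2] [ek3 ek4 ek5 ek6]] := quarter_powers eps0.
have k20 : 0 < k ^+ 2 by rewrite exprn_gt0.
have k21 : k ^+ 2 <= 1 by rewrite -(@expr_le1 _ 2)// ?(ltW k20)// -exprM -ek.
have sl := si_subspace hlO; have sv := si_subspace hvO.
have hwa := H1_grad x4; have [L2wa L2gwa] := grad_rel_dom hwa.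
(* Here [z] is the H^1_0 part w^a - phi: the equation says that eps (grad w^a - grad z) has
   divergence w^a - z. *)
have [z hz dz] := dirichlet_solve oO eps0 L2wa (subspaceZ sv eps L2gwa).
have hgz := H1_grad (H10_H1 hz).
have [phi ephi] : exists phi, phi = rwa x - z by eexists.
have [gp egp] : exists gp, gp = grad Omega (rwa x) - grad Omega z by eexists.
have hphi : grad_rel Omega phi gp.
  rewrite ephi egp (subrEL (rwa x)) (subrEL (grad Omega (rwa x))).
  exact: (grad_rel_lin oO (-1) hgz hwa).
have dphi : div_rel Omega (eps *: gp) phi by rewrite egp ephi scalerBr; exact: dz.
have pwa : H10 Omega (phi - rwa x).
  have -> : phi - rwa x = - z by rewrite ephi addrAC subrr add0r.
  exact: (subspaceN (H10_subspace oO) hz).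
(* phi also extends the boundary trace of w^b, because the two traces of a trial element agree
   there; this evaluates the last term of b. *)
have pwb : H10 Omega (phi - rwb x).
  have -> : phi - rwb x = (phi - rwa x) + (rwa x - rwb x) by rewrite addrA subrK.
  exact: (subspaceD (H10_subspace oO) pwa x8).
clear dz ephi egp hgz hz z.
have [L2p L2gp] := grad_rel_dom hphi.
have [v hv10 dv] := dirichlet_solve oO k20 L2p (subspace0 sv).
have hvg := H1_grad (H10_H1 hv10).
have [gv egv] : exists gv, gv = grad Omega v by eexists.
rewrite -egv in hvg dv; have [L2v L2gv] := grad_rel_dom hvg.
have dgv : div_rel Omega gv ((k ^+ 2)^-1 *: (v - phi)).
  have := div_rel_lin oO (- (k ^+ 2)^-1) dv (div_rel0 oO).
  rewrite !addr0 add0r scaleNr scalerN opprK scalerA mulVf ?gt_eqF// scale1r.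
  by rewrite scaleNr -scalerN opprB.
clear egv.
have [lv elv] : exists lv, lv = (k ^+ 2)^-1 *: (v - phi) by eexists.
have [m em] : exists m, m = k ^+ 3 *: (phi - v) by eexists.
have [gm egm] : exists gm, gm = k ^+ 3 *: (gp - gv) by eexists.
have [q eq] : exists q, q = - (eps *: gp) - k ^+ 2 *: gv by eexists.
have hm : grad_rel Omega m gm.
  have h := grad_rel_lin oO (-1) hvg hphi.
  have := grad_rel_lin oO (k ^+ 3) h (grad_rel0 oO).
  by rewrite !addr0 !scaleN1r [- v + _]addrC [- gv + _]addrC em egm.
have hq : div_rel Omega q (- v).
  have := div_rel_lin oO (-1) dphi dv.
  by rewrite !scaleN1r add0r eq addrA addNr add0r.
rewrite -elv in dgv.
exists phi, (m, (q, v)), (l2ip Omega phi phi + eps * l2vip Omega gp gp).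
have P0 := si_ge0 hlO L2p; have G0 := si_ge0 hvO L2gp.
split.
  split; [exact: (grad_rel_H1 hphi)|exact: pwa|exact: (global_V_dom hm hq hvg dgv)|].
  by rewrite lerDl mulr_ge0// ltW.
have L2pv := subspaceB sl L2p L2v; have L2vp := subspaceB sl L2v L2p.
have L2gpv := subspaceB sv L2gp L2gv.
have L2egp := subspaceZ sv eps L2gp; have L2kgv := subspaceZ sv (k ^+ 2) L2gv.
have L2N := subspaceN sv L2egp.
(* the equations of v and phi, both tested with v *)
have r1 := green_H10_rel oO dv hvg hv10.
have r2 := green_H10_rel oO dphi hvg hv10.
rewrite (ipBl hlO L2p L2v L2v) (ipBl hvO (subspace0 sv) L2kgv L2gv) (ip0l hvO L2gv) (ipZl hvO _ L2gv L2gv) in r1.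
rewrite (ipZl hvO _ L2gp L2gv) in r2.
rewrite (global_bform hm hq hvg dgv hx) (global_V_ip hm hq hvg dgv).
have E1 : l2ip Omega (rr x) m = k ^+ 3 * (l2ip Omega (rr x) phi - l2ip Omega (rr x) v).
  by rewrite em (ipZr hlO _ L2pv x3) (ipBr hlO L2p L2v x3).
have E2 : l2vip Omega (rs x) gm = k ^+ 3 * (l2vip Omega (rs x) gp - l2vip Omega (rs x) gv).
  by rewrite egm (ipZr hvO _ L2gpv x2) (ipBr hvO L2gp L2gv x2).
have E3 : green Omega (div Omega (rqa x)) (rqa x) m = k ^+ 3 * g x x.
  have H1p := grad_rel_H1 hphi; have H1v := H10_H1 hv10.
  have -> : m = k ^+ 3 *: phi + (- k ^+ 3) *: v by rewrite em scalerBr scaleNr.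
  have H1kv := subspaceZ (H1_subspace oO) (- k ^+ 3) H1v.
  have h10 := subspaceZ (H10_subspace oO) (- k ^+ 3) hv10.
  refine (etrans (pairing_linr oO (k ^+ 3) x6 H1p H1kv) _).
  by rewrite (pairing_congr oO x6 H1p x4 pwa) (pairing_H10 oO x6 h10) addr0.
have E4 : l2vip Omega (rs x) q = - eps * l2vip Omega (rs x) gp - k ^+ 2 * l2vip Omega (rs x) gv.
  rewrite eq (ipBr hvO L2N L2kgv x2) (ipNr hvO L2egp x2) (ipZr hvO _ L2gp x2) (ipZr hvO _ L2gv x2).
  by rewrite mulNr.
have E5 : l2ip Omega (ru x) (- v) = - l2ip Omega (ru x) v by rewrite (ipNr hlO L2v x1).
have E6 : green Omega (- v) q (rwa x) = - l2ip Omega v phi - eps * l2vip Omega gp gp - k ^+ 2 * l2vip Omega gv gp.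
  rewrite -(green_congr hq (grad_rel_H1 hphi) x4 pwa) (green_rel hq hphi) (ipNl hlO L2v L2p).
  rewrite eq (ipBl hvO L2N L2kgv L2gp) (ipNl hvO L2egp L2gp) (ipZl hvO _ L2gp L2gp) (ipZl hvO _ L2gv L2gp).
  by rewrite addrA.
have E8 : green Omega (div Omega (rqb x)) (rqb x) v = 0 by exact: (pairing_H10 oO x7 hv10).
have E10 : l2ip Omega (rr x) lv = (k ^+ 2)^-1 * (l2ip Omega (rr x) v - l2ip Omega (rr x) phi).
  by rewrite elv (ipZr hlO _ L2vp x3) (ipBr hlO L2v L2p x3).
have E12 : green Omega lv gv (rwb x) =
    (k ^+ 2)^-1 * (l2ip Omega v phi - l2ip Omega phi phi) + l2vip Omega gv gp.
  rewrite -(green_congr dgv (grad_rel_H1 hphi) x5 pwb) (green_rel dgv hphi).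
  by rewrite elv (ipZl hlO _ L2vp L2p) (ipBl hlO L2v L2p L2p).
have F1 : l2ip Omega m m = (k ^+ 3) ^+ 2 * (l2ip Omega phi phi - 2 * l2ip Omega phi v + l2ip Omega v v).
  by rewrite em (ipZl hlO _ L2pv (subspaceZ sl _ L2pv)) (ipZr hlO _ L2pv L2pv) (ip_sqB hlO L2p L2v) mulrA.
have F2 : l2vip Omega gm gm = (k ^+ 3) ^+ 2 * (l2vip Omega gp gp - 2 * l2vip Omega gp gv + l2vip Omega gv gv).
  by rewrite egm (ipZl hvO _ L2gpv (subspaceZ sv _ L2gpv)) (ipZr hvO _ L2gpv L2gpv) (ip_sqB hvO L2gp L2gv) mulrA.
have F3 : l2vip Omega q q = eps ^+ 2 * l2vip Omega gp gp + 2 * eps * k ^+ 2 * l2vip Omega gp gv +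
    (k ^+ 2) ^+ 2 * l2vip Omega gv gv.
  rewrite eq (ip_sqB hvO L2N L2kgv) (ipNl hvO L2egp L2N) (ipNr hvO L2egp L2egp) (ipNl hvO L2egp L2kgv).
  rewrite (ipZl hvO _ L2gp L2egp) (ipZr hvO _ L2gp L2gp) (ipZl hvO _ L2gp L2kgv) (ipZr hvO _ L2gv L2gp).
  rewrite (ipZl hvO _ L2gv L2kgv) (ipZr hvO _ L2gv L2gv).
  by move: (l2vip _ gp gp) (l2vip _ gp gv) (l2vip _ gv gv) => *; ring.
have F4 : l2ip Omega (- v) (- v) = l2ip Omega v v.
  by rewrite (ipNl hlO L2v (subspaceN sl L2v)) (ipNr hlO L2v L2v) opprK.
have F5 : l2ip Omega lv lv = (k ^+ 2)^-1 ^+ 2 * (l2ip Omega v v - 2 * l2ip Omega v phi + l2ip Omega phi phi).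
  by rewrite elv (ipZl hlO _ L2vp (subspaceZ sl _ L2vp)) (ipZr hlO _ L2vp L2vp) (ip_sqB hlO L2v L2p) mulrA.
have S1 := si_sym hlO L2v L2p; have S2 := si_sym hvO L2gv L2gp.
have H0 := si_ge0 hvO L2gv.
have L20 : L2 Omega v by exact: L2v.
rewrite E1 E2 E3 E4 E5 E6 E8 E10 E12 F1 F2 F3 F4 F5 S1 S2 ek1 ek2 ek3 ek4 ek5 ek6.
clear - r1 r2 P0 G0 H0 ek k0 k21; move: r1 r2 P0 G0 H0 ek k0 k21.
move: (eps `^ (1 / 4)) => kk r1 r2 P0 G0 H0 ek k0 k21; rewrite ek in r2 *.
have kn0 : kk != 0 by rewrite gt_eqF.
(* The terms in u, sigma and rho cancel, those with q^b vanish as v is in H^1_0, and the boundary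
   terms of w^a and w^b combine to N. *)
split; first by field.
move: r1 r2 P0 G0 H0.
move: (l2ip Omega phi phi) (l2ip Omega v v) (l2ip Omega phi v) (l2vip Omega gp gp) (l2vip Omega gv gv)
  (l2vip Omega gp gv) => P A Q G H K r1 r2 P0 G0 H0.
have -> : A = - (kk ^+ 4 * K) - kk ^+ 2 * H by lra.
have -> : Q = - (kk ^+ 4 * K) by lra.
rewrite -subr_ge0.
(* After eliminating |v|^2 and (phi, v) by the two equations, 2 k^2 N - |t|_V^2 equals k^4 (1 - k^2)
   |grad v|^2. Its sign is where eps <= 1 enters. *)
have : 0 <= kk ^+ 4 * (1 - kk ^+ 2) * H by rewrite !mulr_ge0// ?exprn_ge0 ?subr_ge0// ltW.
by congr (0 <= _); field.
Qed.

(** Expand |Theta u - s t|_V^2 >= 0 for the test function t: the mixed term is b(u, t), which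
    contains the boundary pairing with the sign that bounds it from below. One |Theta u|_V^2 out of
    beta is spent on this, and the two remaining ones give the first term of the estimate. *)
Theorem coercivity beta x : eps <= 1 -> 3 <= beta -> rep_dom Omega x -> exists phi,
  [/\ H1 Omega phi, H10 Omega (phi - rwa x) &
   2 * Vi (theta Omega X eps x) (theta Omega X eps x) +
     2^-1 * (eps `^ (1 / 2))^-1 * l2ip Omega phi phi <= rep_aform beta x x].
Proof.
move=> eps1 hb hx; have [phi [t [N [[h1 h2 ht hN] [eb hVt]]]]] := coercive_test eps1 hx.
exists phi; split; [exact: h1|exact: h2|].
have [[k0 _ _ ek2] [_ ek4 _ _]] := quarter_powers eps0.
have P0 := si_ge0 hlO (H1_L2 h1).
have [tx ex] := thetaP hO hX eps0 hx; have ett := ex t ht.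
(* The factor s = 1 / (2 k^2) minimizes -2 s N + 2 k^2 s^2 N. *)
have a0 : 0 < 2^-1 * (k ^+ 2)^-1 by rewrite mulr_gt0// invr_gt0// exprn_gt0.
have hs := subspaceB (si_subspace hV) tx (subspaceZ (si_subspace hV) (2^-1 * (k ^+ 2)^-1) ht).
have := si_ge0 hV hs.
rewrite (ip_sqB hV tx (subspaceZ (si_subspace hV) _ ht)) (ipZr hV _ ht tx).
rewrite (ipZl hV _ ht (subspaceZ (si_subspace hV) _ ht)) (ipZr hV _ ht ht) ett eb.
have T0 := si_ge0 hV tx; have t0 := si_ge0 hV ht.
rewrite /rep_aform ek4; rewrite ek4 in hVt; rewrite ek2.
clear - k0 hb hVt hN T0 t0 P0 a0.
move: (Vi (theta _ _ _ _) _) (Vi t t) (l2ip Omega phi phi) (g x x) hVt hN T0 t0 P0 a0.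
move: (eps `^ (1 / 4)) k0 => kk k0 VT Vt P gg hVt hN T0 t0 P0 a0 hh.
have kn0 : kk != 0 by rewrite gt_eqF.
have i0 : 0 < (kk ^+ 2)^-1 by rewrite invr_gt0 exprn_gt0.
have b1 : 2^-1 * (kk ^+ 2)^-1 * (2^-1 * (kk ^+ 2)^-1 * Vt) <= 2^-1 * (kk ^+ 2)^-1 * N.
  rewrite ler_wpM2l ?(ltW a0)//.
  have -> : N = 2^-1 * (kk ^+ 2)^-1 * (2 * kk ^+ 2 * N) by field.
  by rewrite ler_wpM2l// ltW.
have b2 : 2^-1 * (kk ^+ 2)^-1 * P <= 2^-1 * (kk ^+ 2)^-1 * N by rewrite ler_wpM2l// ltW.
have b3 : 3 * VT <= beta * VT by rewrite ler_wpM2r.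
have e3 : 2 * (2^-1 * (kk ^+ 2)^-1 * (N - kk ^+ 3 * gg)) = (kk ^+ 2)^-1 * N - kk * gg by field.
rewrite e3 in hh.
have -> : 2^-1 * kk * (gg + gg) = kk * gg by field.
have e4 : 2^-1 * (kk ^+ 2)^-1 * N = 2^-1 * ((kk ^+ 2)^-1 * N) by rewrite mulrA.
lra.
Qed.

End coercivity.

Lemma ip_congr (R : realType) (W : lmodType R) (S : W -> Prop) (ip : W -> W -> R)
    (hS : semi_inner S ip) f g h : S f -> S g -> S h -> ip (f - g) (f - g) = 0 -> ip f h = ip g h.
Proof.
move=> Sf Sg Sh e; have Sfg := subspaceB (si_subspace hS) Sf Sg.
by apply/eqP; rewrite -subr_eq0 -(ipBl hS Sf Sg Sh) (ip_null hS Sfg Sh e).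
Qed.

(** * Test problems that detect vanishing traces and normal traces *)

Section local_kernels.
Context (R : realType) (d : nat) (omega : set 'rV[R]_d) (oo : open omega).
Local Notation E := 'rV[R]_d.
Let mo : measurable omega := open_measurable_rV oo.
Let hl := l2_semi_inner mo.
Let hv := l2v_semi_inner mo.

(** Solve for z in H^1_0 with div(p - grad z) = f - z and use q = p - grad z as test field.
    Subtracting the equation of z tested with z leaves |p - grad z|^2 + |f - z|^2 = 0. *)
Lemma H10_of_div_orthogonal f p : L2 omega f -> L2vec omega p ->
  (forall q dq, div_rel omega q dq -> l2vip omega p q + l2ip omega f dq = 0) ->
  exists z, [/\ H10 omega z, l2ip omega (f - z) (f - z) = 0 &
    l2vip omega (p - grad omega z) (p - grad omega z) = 0].
Proof.
move=> hf hp h; have [z hz] := dirichlet_solve oo ltr01 hf hp; rewrite scale1r => dz.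
exists z; have [L2q L2g] := div_rel_dom dz.
have hzg := H1_grad (H10_H1 hz); have [L2z L2gz] := grad_rel_dom hzg.
have e1 := h _ _ dz; have e2 := green_H10_rel oo dz hzg hz.
have n1 := si_ge0 hl L2g; have n2 := si_ge0 hv L2q.
have s1 : l2ip omega (f - z) (f - z) = l2ip omega f (f - z) - l2ip omega z (f - z) by rewrite {1}(ipBl hl hf L2z L2g).
have s2 : l2vip omega (p - grad omega z) (p - grad omega z) =
    l2vip omega p (p - grad omega z) - l2vip omega (grad omega z) (p - grad omega z) by rewrite {1}(ipBl hv hp L2gz L2q).
have s3 := si_sym hl L2g L2z; have s4 := si_sym hv L2q L2gz.
move: e1 e2 n1 n2 s1 s2 s3 s4.
move: (l2ip _ (f - z) (f - z)) (l2vip _ (p - _) (p - _)) => A B.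
move: (l2ip _ (f - z) z) (l2ip _ z _) (l2ip _ f _) (l2vip _ (p - _) _) (l2vip _ (grad _ _) _) (l2vip _ p _).
by move=> *; split; [exact: hz|lra|lra].
Qed.

(* For r = w - z orthogonal to H^1_0 and z in H^1_0, take v in H^1_0 with
   lap v - v = r. *)
Lemma H10_of_lap_orthogonal w : H1 omega w ->
  (forall v gv lv, H10 omega v -> grad_rel omega v gv -> div_rel omega gv lv ->
     l2ip omega lv w + l2vip omega gv (grad omega w) = 0) ->
  H10 omega w.
Proof.
move=> hw h; have hwg := H1_grad hw; have [L2w L2gw] := grad_rel_dom hwg.
have [z hz] := dirichlet_solve oo ltr01 L2w L2gw; rewrite scale1r => dz.
have hzg := H1_grad (H10_H1 hz); have [L2z L2gz] := grad_rel_dom hzg.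
have [L2gr L2r] := div_rel_dom dz.
have [v hv10] := dirichlet_solve oo ltr01 (subspaceN (si_subspace hl) L2r) (subspace0 (si_subspace hv)).
rewrite scale1r add0r => dv.
have hvg := H1_grad (H10_H1 hv10); have [L2v L2gv] := grad_rel_dom hvg.
have dgv : div_rel omega (grad omega v) ((w - z) + v).
  have := div_rel_lin oo (-1) dv (div_rel0 oo).
  by rewrite !addr0 !scaleN1r opprK opprD !opprK.
have e1 := h _ _ _ hv10 hvg dgv.
have e2 := green_H10_rel oo dgv hzg hz.
have e3 := green_H10_rel oo dz hvg hv10.
rewrite (ipDl hl L2r L2v L2w) in e1; rewrite (ipDl hl L2r L2v L2z) in e2.
have s1 := ipBr hl L2w L2z L2r; have s2 := ipBr hl L2w L2z L2v; have s3 := ipBr hv L2gw L2gz L2gv.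
have s4 := si_sym hl L2r L2v; have s5 := si_sym hv L2gr L2gv.
have r0 : l2ip omega (w - z) (w - z) = 0.
  rewrite s4 s5 s2 s3 in e3; rewrite s1; move: e1 e2 e3.
  move: (l2ip omega (w - z) w) (l2ip omega (w - z) z) (l2ip omega v w) (l2ip omega v z)
    (l2vip omega (grad omega v) (grad omega w)) (l2vip omega (grad omega v) (grad omega z)).
  by clear; move=> *; lra.
have r10 := H10_null oo (subspaceB (H1_subspace oo) hw (H10_H1 hz)) r0.
have -> : w = (w - z) + z by rewrite subrK.
exact: (subspaceD (H10_subspace oo) r10 hz).
Qed.

(** By [Hmhalf_riesz] the normal trace of q is represented by some r with div grad r = r, itself an
    allowed test function; the pairing of q with r is the squared H^1 norm of r. *)
Lemma pairing_zero q : Hdiv omega q ->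
  (forall v, H1 omega v -> div_rel omega (grad omega v) v -> pairing omega q v = 0) ->
  forall w, H1 omega w -> pairing omega q w = 0.
Proof.
move=> hq h; have [r [hr dr er]] := Hmhalf_riesz oo (normal_trace_Hmhalf oo hq).
have hrg := H1_grad hr; have [L2r L2gr] := grad_rel_dom hrg.
have e0 := er r hr; rewrite (normal_trace_pairing oo hq hr) (h r hr dr) /green in e0.
have n1 := si_ge0 hl L2r; have n2 := si_ge0 hv L2gr.
have r0 : l2ip omega r r = 0 by move: e0 n1 n2; move: (l2ip _ _ _) (l2vip _ _ _) => *; lra.
have g0 : l2vip omega (grad omega r) (grad omega r) = 0.
  by move: e0 n1 n2; move: (l2ip _ _ _) (l2vip _ _ _) => *; lra.
move=> w hw; rewrite -(normal_trace_pairing oo hq hw) (er w hw) /green.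
by rewrite (ip_null hl L2r (H1_L2 hw) r0) (ip_null hv L2gr (H1_L2grad hw) g0) addr0.
Qed.

Lemma eq_l2ip f g f' g' : (forall x, omega x -> f x = f' x) -> (forall x, omega x -> g x = g' x) ->
  l2ip omega f g = l2ip omega f' g'.
Proof.
by move=> e e'; apply: eq_Rintegral => x; rewrite inE => hx; rewrite e// e'.
Qed.

Lemma eq_l2vip f g f' g' : (forall x, omega x -> f x = f' x) -> (forall x, omega x -> g x = g' x) ->
  l2vip omega f g = l2vip omega f' g'.
Proof.
by move=> e e'; apply: eq_Rintegral => x; rewrite inE => hx; rewrite e// e'.
Qed.

Lemma eq_grad_rel w w' p p' : (forall x, omega x -> w x = w' x) -> (forall x, omega x -> p x = p' x) ->
  grad_rel omega w p -> grad_rel omega w' p'.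
Proof.
move=> e e' [hw [hp h]]; split; first exact: (eq_L2 mo e hw).
split; first by move=> i; apply: (eq_L2 mo _ (hp i)) => x hx; rewrite e'.
move=> phi tp i.
have l1 : l2ip omega w (partial i phi) = l2ip omega w' (partial i phi) by exact: eq_l2ip.
have l2 : l2ip omega (fun x => p x 0 i) phi = l2ip omega (fun x => p' x 0 i) phi.
  by apply: eq_l2ip => // x hx; rewrite e'.
exact: (etrans (esym l1) (etrans (h phi tp i) (congr1 -%R l2))).
Qed.

Lemma eq_div_rel q q' g g' : (forall x, omega x -> q x = q' x) -> (forall x, omega x -> g x = g' x) ->
  div_rel omega q g -> div_rel omega q' g'.
Proof.
move=> e e' [hq /is_weak_divE[hg h]]; split.
  by move=> i; apply: (eq_L2 mo _ (hq i)) => x hx; rewrite e.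
apply/is_weak_divE; split; first exact: (eq_L2 mo e' hg).
move=> phi tp; rewrite -(@eq_l2vip q (pgrad phi) q' (pgrad phi) e (fun _ _ => erefl)).
by rewrite -(@eq_l2ip g phi g' phi e' (fun _ _ => erefl)); exact: h.
Qed.

End local_kernels.

Section zero_extension.
Context (R : realType) (n : nat) (Omega : set 'rV[R]_n.+1) (I : finType).
Context (X : I -> 'M[R]_(n.+2, n.+1)) (hO : lipschitz_domain Omega) (hX : conforming_mesh Omega X).
Local Notation E := 'rV[R]_n.+1.
Local Notation T i := (open_simplex (X i)).
Let oT := @T_open _ _ _ _ _ hX.
Let mTi := @mT _ _ _ _ _ hX.
Let hl i := l2_semi_inner (mTi i).
Let hv i := l2v_semi_inner (mTi i).
Context (i : I).

(** The test space is broken along the mesh, so a test function may be supported on a single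
    element. *)
Definition zero_ext (W : nmodType) (h : E -> W) : E -> W := fun z => if z \in T i then h z else 0.

Lemma zero_ext_in (W : nmodType) (h : E -> W) z : T i z -> h z = zero_ext h z.
Proof. by move=> hz; rewrite /zero_ext mem_set. Qed.

Lemma zero_ext_out (W : nmodType) (h : E -> W) j z : j != i -> T j z -> 0 = zero_ext h z.
Proof.
move=> ji hz; rewrite /zero_ext memNset// => hz'.
by have : (T j `&` T i) z by []; rewrite (mesh_disjoint hX ji).
Qed.

Lemma zero_ext_grad_rel m gm j : grad_rel (T i) m gm -> grad_rel (T j) (zero_ext m) (zero_ext gm).
Proof.
move=> h; have [->|ji] := eqVneq j i.
  by apply: (eq_grad_rel (@oT i) _ _ h) => x hx; exact: zero_ext_in.
by apply: (eq_grad_rel (@oT j) _ _ (grad_rel0 (@oT j))) => x hx; exact: (zero_ext_out _ ji hx).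
Qed.

Lemma zero_ext_div_rel m gm j : div_rel (T i) m gm -> div_rel (T j) (zero_ext m) (zero_ext gm).
Proof.
move=> h; have [->|ji] := eqVneq j i.
  by apply: (eq_div_rel (@oT i) _ _ h) => x hx; exact: zero_ext_in.
by apply: (eq_div_rel (@oT j) _ _ (div_rel0 (@oT j))) => x hx; exact: (zero_ext_out _ ji hx).
Qed.

Transparent L2.
Lemma zero_ext_L2 h : L2 (T i) h -> L2 Omega (zero_ext h).
Proof.
have e : zero_ext h \_ Omega = h \_ (T i).
  apply/funext => x; rewrite !patchE /zero_ext.
  case: ifPn => hx; case: ifPn => hx'; rewrite // ?memNset//.
  by case/negP: hx; apply/mem_set/(T_sub hO hX (i := i))/set_mem.
by rewrite /L2 e.
Qed.

Opaque L2.
Lemma zero_ext_L2vec h : L2vec (T i) h -> L2vec Omega (zero_ext h).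
Proof.
move=> hh j; have := zero_ext_L2 (hh j); congr (L2 Omega _).
by apply/funext => x; rewrite /zero_ext; case: ifP => // _; rewrite mxE.
Qed.

Lemma l2ip_zero_ext j f h : L2 (T j) f ->
  l2ip (T j) f (zero_ext h) = if j == i then l2ip (T i) f h else 0.
Proof.
move=> hf; have [->|ji] := eqVneq j i.
  by apply: eq_l2ip => // x hx; rewrite -zero_ext_in.
by rewrite -(ip0r (hl j) hf); apply: eq_l2ip => // x hx; exact: esym (zero_ext_out _ ji hx).
Qed.

Lemma l2vip_zero_ext j f h : L2vec (T j) f ->
  l2vip (T j) f (zero_ext h) = if j == i then l2vip (T i) f h else 0.
Proof.
move=> hf; have [->|ji] := eqVneq j i.
  by apply: eq_l2vip => // x hx; rewrite -zero_ext_in.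
by rewrite -(ip0r (hv j) hf); apply: eq_l2vip => // x hx; exact: esym (zero_ext_out _ ji hx).
Qed.

End zero_extension.

(** S stands for (sigma, grad v), the other letters for products of rho and u with v and f. The
    first two equations express Rv and Uv by S and Uf; in the third all multiples of S then
    cancel. *)
Lemma quarter_elimination (R : realFieldType) (k S Rv Uv Uf Rf : R) : 0 < k -> Rv + S = 0 ->
  k^-1 * S + (k ^+ 2)^-1 * (Uv - Uf) = 0 ->
  (k ^+ 3 + k) * S + Uv + k ^+ 5 * ((k ^+ 2)^-1 * (Rv - Rf)) = 0 -> Uf - k ^+ 3 * Rf = 0.
Proof.
move=> k0 e1 e2 e3; have kn0 : k != 0 by rewrite gt_eqF.
have e2' : k * S + (Uv - Uf) = 0 by rewrite -(mulr0 (k ^+ 2)) -e2; field.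
have e3' : (k ^+ 3 + k) * S + Uv + k ^+ 3 * (Rv - Rf) = 0 by rewrite -e3; field.
have eR : Rv = - S by lra.
by rewrite eR in e3'; lra.
Qed.

Lemma linear_rearrange (R : realFieldType) (k a b c d : R) :
  k * a + b = c + d -> k * a - d + (b - c) = 0.
Proof. lra. Qed.

Lemma linear_zeros (R : realFieldType) (a b c d p q : R) :
  a * 0 - a * p + 0 + b * 0 + c * 0 - d * q = 0 -> a * p + d * q = 0.
Proof. lra. Qed.

(** * Vanishing of all components when b(u, .) and gamma_0 u vanish *)

Section kernel.
Context (R : realType) (n : nat) (Omega : set 'rV[R]_n.+1) (I : finType).
Context (X : I -> 'M[R]_(n.+2, n.+1)) (hO : lipschitz_domain Omega) (hX : conforming_mesh Omega X).
Local Notation E := 'rV[R]_n.+1.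
Local Notation T i := (open_simplex (X i)).

Let oO := Omega_open hO.
Let mO := mOmega hO.
Let oT := @T_open _ _ _ _ _ hX.
Let mTi := @mT _ _ _ _ _ hX.
Let hlO := l2_semi_inner mO.
Let hvO := l2v_semi_inner mO.
Let hl i := l2_semi_inner (mTi i).
Let hv i := l2v_semi_inner (mTi i).
Context (eps : R) (eps0 : 0 < eps).
Local Notation Vd := (V_dom Omega X).
Local Notation rep := (rep R n).
Local Notation k := (eps `^ (1 / 4)).
Local Notation c1 := (eps `^ (- (1 / 4))).
Local Notation c2 := (eps `^ (3 / 4)).
Local Notation c3 := (eps `^ (5 / 4)).
Local Notation c5 := (eps `^ (1 / 2)).

(** The contribution of one element to b with pairings expanded by Green's formula and with given
    derivatives in place of the selected ones; it then depends on the test function through L^2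
    products only, which are additive and insensitive to extension by zero. *)
Definition local_rel_form i (x : rep) m gm q dq v gv lv : R :=
  l2ip (T i) (rr x) m + l2vip (T i) (rs x) gm -
  (l2ip (T i) (div (T i) (rqa x)) m + l2vip (T i) (rqa x) gm) +
  c1 * l2vip (T i) (rs x) q + l2ip (T i) (ru x) dq -
  (l2ip (T i) (rwa x) dq + l2vip (T i) (grad (T i) (rwa x)) q) +
  c2 * l2vip (T i) (rs x) gv -
  c2 * (l2ip (T i) (div (T i) (rqb x)) v + l2vip (T i) (rqb x) gv) +
  l2ip (T i) (ru x) v + c3 * l2ip (T i) (rr x) lv + k * l2vip (T i) (rs x) gv -
  c5 * (l2ip (T i) (rwb x) lv + l2vip (T i) (grad (T i) (rwb x)) gv).

Lemma sum12_congr (k1 k2 k3 k4 k5 t1 t2 t3 t4 t5 t6 t7 t8 t9 t10 t11 t12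
    s1 s2 s3 s4 s5 s6 s7 s8 s9 s10 s11 s12 : R) :
  t1 = s1 -> t2 = s2 -> t3 = s3 -> t4 = s4 -> t5 = s5 -> t6 = s6 -> t7 = s7 -> t8 = s8 ->
  t9 = s9 -> t10 = s10 -> t11 = s11 -> t12 = s12 ->
  t1 + t2 - t3 + k1 * t4 + t5 - t6 + k2 * t7 - k2 * t8 + t9 + k3 * t10 + k4 * t11 - k5 * t12 =
  s1 + s2 - s3 + k1 * s4 + s5 - s6 + k2 * s7 - k2 * s8 + s9 + k3 * s10 + k4 * s11 - k5 * s12.
Proof. by do 12!move=> ->. Qed.

Lemma sum_split6 (F1 F2 F3 F4 F5 : I -> R) (k1 k2 k3 k4 t1 t2 t3 t4 t5 : R) :
  t1 = \sum_i F1 i -> t2 = \sum_i F2 i -> t3 = \sum_i F3 i -> t4 = \sum_i F4 i ->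
  t5 = \sum_i F5 i -> k1 * t1 - k1 * t2 + t3 + k2 * t4 + k3 * t1 - k4 * t5 =
  \sum_i (k1 * F1 i - k1 * F2 i + F3 i + k2 * F4 i + k3 * F1 i - k4 * F5 i).
Proof. by do 5!move=> ->; rewrite !big_split /= !sumrN !mulr_sumr. Qed.

Section local_test.
Context (i : I) m gm q dq v gv lv (hm : grad_rel (T i) m gm) (hq : div_rel (T i) q dq)
  (hvv : grad_rel (T i) v gv) (hg : div_rel (T i) gv lv).

Lemma local_bform_rel (x : rep) : rep_local X i x ->
  local_bform X eps i x (m, (q, v)) = local_rel_form i x m gm q dq v gv lv.
Proof.
move=> [x1 x2 x3 x4 x5 x6 x7].
have [hm1 hm2] := grad_rel_dom hm; have [hq1 hq2] := div_rel_dom hq.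
have [hv1 hv2] := grad_rel_dom hvv; have [hg1 hg2] := div_rel_dom hg.
have [_ hgv] := grad_rel_dom (gradP hvv).
have dg : div_rel (T i) (grad (T i) v) lv.
  by apply: (div_rel_congr (@oT i) hgv) hg => r hr; rewrite (grad_eq (@oT i) hvv hr).
have [_ hdq] := div_rel_dom (divP hq); have [_ hdg] := div_rel_dom (divP dg).
have eg p : L2vec (T i) p -> l2vip (T i) p (grad (T i) m) = l2vip (T i) p gm
  by move=> hp; exact: (grad_eqr (@oT i) hp hm).
have ev p : L2vec (T i) p -> l2vip (T i) p (grad (T i) v) = l2vip (T i) p gv
  by move=> hp; exact: (grad_eqr (@oT i) hp hvv).
have ed f : L2 (T i) f -> l2ip (T i) f (div (T i) q) = l2ip (T i) f dq.
  by move=> hf; rewrite (si_sym (hl i) hf hdq) (div_eq (@oT i) hq hf) (si_sym (hl i) hf hq2).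
have el f : L2 (T i) f -> l2ip (T i) f (lap (T i) v) = l2ip (T i) f lv.
  by move=> hf; rewrite /lap (si_sym (hl i) hf hdg) (div_eq (@oT i) dg hf) (si_sym (hl i) hf hg2).
apply: sum12_congr => /=.
- by [].
- exact: (eg _ x2).
- by rewrite (pairing_rel (@oT i) (Hdiv_div x6) (grad_rel_H1 hm)) /green (eg _ (Hdiv_L2 x6)).
- by [].
- exact: (ed _ x1).
- rewrite (pairing_rel (@oT i) hq x4) /green (si_sym (hl i) hq2 (H1_L2 x4)).
  by rewrite (si_sym (hv i) hq1 (H1_L2grad x4)).
- exact: (ev _ x2).
- by rewrite (pairing_rel (@oT i) (Hdiv_div x7) (grad_rel_H1 hvv)) /green (ev _ (Hdiv_L2 x7)).
- by [].
- exact: (el _ x3).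
- exact: (ev _ x2).
- rewrite (pairing_rel (@oT i) dg x5) /green (si_sym (hl i) hg2 (H1_L2 x5)).
  by rewrite (si_sym (hv i) hgv (H1_L2grad x5)) (ev _ (H1_L2grad x5)).
Qed.

End local_test.

Context (x : rep) (hx : rep_dom Omega x) (hB : forall y, Vd y -> mesh_bform X eps x y = 0).
Context (h10a : H10 Omega (rwa x)).

Let hxl i : rep_local X i x := rep_dom_local hO hX i hx.

(** Extend the local test function by zero: all other elements contribute nothing to b, so its i-th
    contribution vanishes alone. *)
Lemma kernel_local i m gm q dq v gv lv : grad_rel (T i) m gm -> div_rel (T i) q dq ->
  grad_rel (T i) v gv -> div_rel (T i) gv lv -> local_rel_form i x m gm q dq v gv lv = 0.
Proof.
move=> hm hq hvv hg.
have zm j := zero_ext_grad_rel hX j hm; have zq j := zero_ext_div_rel hX j hq.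
have zv j := zero_ext_grad_rel hX j hvv; have zg j := zero_ext_div_rel hX j hg.
have hy : Vd (zero_ext X i m, (zero_ext X i q, zero_ext X i v)).
  split; last split.
  - exists (fun=> zero_ext X i gm); split; last exact: zm.
    exact: (zero_ext_L2 hO hX (grad_rel_dom hm).1).
  - exists (fun=> zero_ext X i dq); split; last exact: zq.
    exact: (zero_ext_L2vec hO hX (div_rel_dom hq).1).
  exists (fun=> zero_ext X i lv); split.
    exists (fun=> zero_ext X i gv); split; last exact: zv.
    exact: (zero_ext_L2 hO hX (grad_rel_dom hvv).1).
  move=> j; have hgr := gradP (zv j).
  apply: (div_rel_congr (@oT j) (grad_rel_dom hgr).2) (zg j) => r hr.
  by rewrite (grad_eq (@oT j) (zv j) hr).
have := hB hy; rewrite mesh_bformE (bigD1 i)//= big1 ?addr0; last first.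
  move=> j ji; rewrite (local_bform_rel (zm j) (zq j) (zv j) (zg j) (hxl j)).
  have [x1 x2 x3 x4 x5 x6 x7] := hxl j; have x6' := Hdiv_L2div x6; have x7' := Hdiv_L2div x7.
  have x8 := Hdiv_L2 x6; have x9 := Hdiv_L2 x7; have x4' := H1_L2 x4; have x5' := H1_L2 x5.
  have x4g := H1_L2grad x4; have x5g := H1_L2grad x5.
  have z1 f h : L2 (T j) f -> l2ip (T j) f (zero_ext X i h) = 0.
    by move=> hf; rewrite (l2ip_zero_ext hX _ _ hf) (negbTE ji).
  have z2 f h : L2vec (T j) f -> l2vip (T j) f (zero_ext X i h) = 0.
    by move=> hf; rewrite (l2vip_zero_ext hX _ _ hf) (negbTE ji).
  rewrite /local_rel_form (z1 _ _ x1) (z1 _ _ x1) (z1 _ _ x3) (z1 _ _ x3) (z1 _ _ x4') (z1 _ _ x5').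
  rewrite (z1 _ _ x6') (z1 _ _ x7') (z2 _ _ x2) (z2 _ _ x2) (z2 _ _ x2) (z2 _ _ x4g) (z2 _ _ x5g).
  by rewrite (z2 _ _ x8) (z2 _ _ x9) !(mulr0, addr0, subr0).
move=> <-; rewrite (local_bform_rel (zm i) (zq i) (zv i) (zg i) (hxl i)).
have [x1 x2 x3 x4 x5 x6 x7] := hxl i; have x6' := Hdiv_L2div x6; have x7' := Hdiv_L2div x7.
have x8 := Hdiv_L2 x6; have x9 := Hdiv_L2 x7; have x4' := H1_L2 x4; have x5' := H1_L2 x5.
have x4g := H1_L2grad x4; have x5g := H1_L2grad x5.
have z1 f h : L2 (T i) f -> l2ip (T i) f h = l2ip (T i) f (zero_ext X i h).
  by move=> hf; rewrite (l2ip_zero_ext hX _ _ hf) eqxx.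
have z2 f h : L2vec (T i) f -> l2vip (T i) f h = l2vip (T i) f (zero_ext X i h).
  by move=> hf; rewrite (l2vip_zero_ext hX _ _ hf) eqxx.
apply: sum12_congr.
- exact: z1.
- exact: z2.
- exact: (congr2 +%R (z1 _ _ x6') (z2 _ _ x8)).
- exact: z2.
- exact: z1.
- exact: (congr2 +%R (z1 _ _ x4') (z2 _ _ x4g)).
- exact: z2.
- exact: (congr2 +%R (z1 _ _ x7') (z2 _ _ x9)).
- exact: z1.
- exact: z1.
- exact: z2.
- exact: (congr2 +%R (z1 _ _ x5') (z2 _ _ x5g)).
Qed.

Let z1 i f : L2 (T i) f -> l2ip (T i) f 0 = 0. Proof. by move=> hf; exact: (ip0r (hl i) hf). Qed.
Let z2 i f : L2vec (T i) f -> l2vip (T i) f 0 = 0. Proof. by move=> hf; exact: (ip0r (hv i) hf). Qed.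

(** In strong form: on each element div sigma = rho, and the normal trace of sigma is that of
    q^a. *)
Lemma kernel_mu i m gm : grad_rel (T i) m gm ->
  l2ip (T i) (rr x) m + l2vip (T i) (rs x) gm = pairing (T i) (rqa x) m.
Proof.
move=> hm; have := kernel_local hm (div_rel0 (@oT i)) (grad_rel0 (@oT i)) (div_rel0 (@oT i)).
have [x1 x2 x3 x4 x5 x6 x7] := hxl i; have x6' := Hdiv_L2div x6; have x7' := Hdiv_L2div x7.
have x8 := Hdiv_L2 x6; have x9 := Hdiv_L2 x7; have x4' := H1_L2 x4; have x5' := H1_L2 x5.
have x4g := H1_L2grad x4; have x5g := H1_L2grad x5.
rewrite /local_rel_form (z1 x1) (z2 x2) (z1 x3) (z1 x4') (z2 x4g) (z1 x5') (z2 x5g) (z1 x7') (z2 x9).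
rewrite !(mulr0, addr0, subr0) => /eqP; rewrite subr_eq0 => /eqP ->.
by rewrite (pairing_rel (@oT i) (Hdiv_div x6) (grad_rel_H1 hm)) /green (grad_eqr (@oT i) x8 hm).
Qed.

(** In strong form: on each element grad u = eps^(-1/4) sigma, and the trace of u is that of w^a. *)
Lemma kernel_tau i q dq : div_rel (T i) q dq ->
  c1 * l2vip (T i) (rs x) q + l2ip (T i) (ru x) dq =
  l2ip (T i) (rwa x) dq + l2vip (T i) (grad (T i) (rwa x)) q.
Proof.
move=> hq; have := kernel_local (grad_rel0 (@oT i)) hq (grad_rel0 (@oT i)) (div_rel0 (@oT i)).
have [x1 x2 x3 x4 x5 x6 x7] := hxl i; have x6' := Hdiv_L2div x6; have x7' := Hdiv_L2div x7.
have x8 := Hdiv_L2 x6; have x9 := Hdiv_L2 x7; have x5' := H1_L2 x5; have x5g := H1_L2grad x5.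
rewrite /local_rel_form (z1 x1) (z2 x2) (z1 x3) (z1 x5') (z2 x5g) (z1 x7') (z2 x9) (z1 x6') (z2 x8).
by rewrite !(mulr0, addr0, subr0, add0r) => /eqP; rewrite subr_eq0 => /eqP.
Qed.

Lemma kernel_v i v gv lv : grad_rel (T i) v gv -> div_rel (T i) gv lv ->
  c2 * l2vip (T i) (rs x) gv - c2 * pairing (T i) (rqb x) v + l2ip (T i) (ru x) v +
  c3 * l2ip (T i) (rr x) lv + k * l2vip (T i) (rs x) gv -
  c5 * pairing (T i) gv (rwb x) = 0.
Proof.
move=> hvv hg; have := kernel_local (grad_rel0 (@oT i)) (div_rel0 (@oT i)) hvv hg.
have [x1 x2 x3 x4 x5 x6 x7] := hxl i; have x6' := Hdiv_L2div x6.
have x8 := Hdiv_L2 x6; have x9 := Hdiv_L2 x7; have x4' := H1_L2 x4.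
have x5' := H1_L2 x5; have x4g := H1_L2grad x4; have x5g := H1_L2grad x5.
have [g1 g2] := div_rel_dom hg.
rewrite /local_rel_form (z1 x1) (z2 x2) (z1 x3) (z1 x4') (z2 x4g) (z1 x6') (z2 x8).
rewrite !(mulr0, addr0, subr0, add0r) => <-.
rewrite (pairing_rel (@oT i) (Hdiv_div x7) (grad_rel_H1 hvv)) /green (grad_eqr (@oT i) x9 hvv).
rewrite (pairing_rel (@oT i) hg x5) /green (si_sym (hl i) g2 x5') (si_sym (hv i) g1 x5g).
by [].
Qed.

(** For a conforming v the skeleton terms add up to the pairing on the boundary of Omega, which
    vanishes for v in H^1_0. *)
Lemma kernel_global_mu v gv : grad_rel Omega v gv -> H10 Omega v ->
  l2ip Omega (rr x) v + l2vip Omega (rs x) gv = 0.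
Proof.
move=> hvv h10; have [hv1 hv2] := grad_rel_dom hvv.
refine (etrans _ (pairing_H10 oO (rd_qa hx) h10)).
rewrite (l2ip_mesh hO hX (rd_r hx) hv1) (l2vip_mesh hO hX (rd_s hx) hv2) -big_split /=.
refine (etrans (eq_bigr _ (fun i _ => kernel_mu (grad_rel_T hO hX i hvv))) _).
exact: (mesh_pairing_sum hO hX (Hdiv_div (rd_qa hx)) (H10_H1 h10)).
Qed.

Lemma kernel_global_tau q dq : div_rel Omega q dq -> c1 * l2vip Omega (rs x) q + l2ip Omega (ru x) dq = 0.
Proof.
move=> hq; have [hq1 hq2] := div_rel_dom hq; have [_ _ e] := (div_rel_green oO q dq).1 hq.
refine (etrans _ (e _ h10a)).
rewrite (l2ip_mesh hO hX (rd_u hx) hq2) (l2vip_mesh hO hX (rd_s hx) hq1) mulr_sumr -big_split /=.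
refine (etrans (eq_bigr _ (fun i _ => kernel_tau (div_rel_T hO hX i hq))) _).
rewrite (green_mesh hO hX hq2 hq1 (rd_wa hx)); apply: eq_bigr => i _.
have [x1 x2 x3 x4 x5 x6 x7] := hxl i; have [q1 q2] := div_rel_dom (div_rel_T hO hX i hq).
by rewrite /green (si_sym (hl i) q2 (H1_L2 x4)) (si_sym (hv i) q1 (H1_L2grad x4)).
Qed.

Let h10b : H10 Omega (rwb x).
Proof.
have -> : rwb x = rwa x - (rwa x - rwb x) by rewrite opprB addrCA subrr addr0.
exact: (subspaceB (H10_subspace oO) h10a (rd_bd hx)).
Qed.

Lemma kernel_global_v v gv lv : grad_rel Omega v gv -> H10 Omega v -> div_rel Omega gv lv ->
  (c2 + k) * l2vip Omega (rs x) gv + l2ip Omega (ru x) v + c3 * l2ip Omega (rr x) lv = 0.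
Proof.
move=> hvv h10 hg; have [v1 v2] := grad_rel_dom hvv; have [g1 g2] := div_rel_dom hg.
have p1 := pairing_H10 oO (rd_qb hx) h10; have [_ _ p2] := (div_rel_green oO gv lv).1 hg.
have s1 : \sum_i pairing (T i) (rqb x) v = 0.
  exact: etrans (mesh_pairing_sum hO hX (Hdiv_div (rd_qb hx)) (H10_H1 h10)) p1.
have s2 : \sum_i pairing (T i) gv (rwb x) = 0.
  exact: (etrans (mesh_pairing_sum hO hX hg (rd_wb hx)) (p2 _ h10b)).
have e0 : \sum_i ((c2 * l2vip (T i) (rs x) gv - c2 * pairing (T i) (rqb x) v + l2ip (T i) (ru x) v +
  c3 * l2ip (T i) (rr x) lv + k * l2vip (T i) (rs x) gv - c5 * pairing (T i) gv (rwb x))) = 0.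
  apply: big1 => i _; exact: (kernel_v (grad_rel_T hO hX i hvv) (div_rel_T hO hX i hg)).
have e := sum_split6 c2 c3 k c5 (l2vip_mesh hO hX (rd_s hx) v2) (esym s1)
  (l2ip_mesh hO hX (rd_u hx) v1) (l2ip_mesh hO hX (rd_r hx) g2) (esym s2).
have := etrans e e0; move: c2 c3 k c5 (l2vip _ _ _) (l2ip _ _ _) (l2ip _ _ _).
by clear; move=> k2 k3 k4 k5 S U V <-; ring.
Qed.

Let c10 : 0 < c1. Proof. exact: powR_gt0. Qed.
Let c20 : 0 < c2. Proof. exact: powR_gt0. Qed.

(* Take v in H^1_0 with v - eps^(1/2) lap v = u - eps^(3/4) rho. *)
Lemma kernel_u_rho : l2ip Omega (ru x - c2 *: rr x) (ru x - c2 *: rr x) = 0.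
Proof.
have [x1 x2 x3 _ _ _ _ _] := hx; have sl := si_subspace hlO; have sv := si_subspace hvO.
have [[k0 _ ek1 ek2] [ek3 ek4 _ _]] := quarter_powers eps0.
have k20 : 0 < k ^+ 2 by rewrite exprn_gt0.
have [f ef] : exists f, f = ru x - c2 *: rr x by eexists.
have L2cr := subspaceZ sl c2 x3.
have L2f : L2 Omega f by rewrite ef; exact: (subspaceB sl x1 L2cr).
have [v hv10 dv] := dirichlet_solve oO k20 L2f (subspace0 sv).
have hvg := H1_grad (H10_H1 hv10); have [L2v L2gv] := grad_rel_dom hvg.
have dgv : div_rel Omega (grad Omega v) ((k ^+ 2)^-1 *: (v - f)).
  have := div_rel_lin oO (- (k ^+ 2)^-1) dv (div_rel0 oO).
  rewrite !addr0 add0r scaleNr scalerN opprK scalerA mulVf ?gt_eqF// scale1r.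
  by rewrite scaleNr -scalerN opprB.
have L2vf := subspaceB sl L2v L2f.
have e1 := kernel_global_mu hvg hv10.
have e2 := kernel_global_tau dgv.
have e3 := kernel_global_v hvg hv10 dgv.
rewrite (ipZr hlO _ L2vf x1) (ipBr hlO L2v L2f x1) ek1 in e2.
rewrite (ipZr hlO _ L2vf x3) (ipBr hlO L2v L2f x3) ek3 ek2 in e3.
rewrite -ef {1}ef (ipBl hlO x1 L2cr L2f) (ipZl hlO c2 x3 L2f) ek2.
exact: (quarter_elimination k0 e1 e2 e3).
Qed.

(** By [kernel_tau] the pair u - w^a, eps^(-1/4) sigma - grad w^a satisfies the hypothesis of
    [H10_of_div_orthogonal]. So u has an H^1 representative on each element, with the trace of
    w^a. *)
Lemma kernel_w i : exists w g, [/\ grad_rel (T i) w g, H10 (T i) (w - rwa x),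
  l2ip (T i) (ru x - w) (ru x - w) = 0 & l2vip (T i) (c1 *: rs x - g) (c1 *: rs x - g) = 0].
Proof.
have [x1 x2 x3 x4 x5 x6 x7] := hxl i; have sl := si_subspace (hl i); have sv := si_subspace (hv i).
have x4' := H1_L2 x4; have x4g := H1_L2grad x4; have x2' := subspaceZ sv c1 x2.
have [|z [hz e1 e2]] := H10_of_div_orthogonal (@oT i) (subspaceB sl x1 x4') (subspaceB sv x2' x4g).
  move=> q dq hq; have [q1 q2] := div_rel_dom hq.
  rewrite (ipBl (hv i) x2' x4g q1) (ipBl (hl i) x1 x4' q2) (ipZl (hv i) _ x2 q1).
  exact: (linear_rearrange (kernel_tau hq)).
exists (rwa x + z), (grad (T i) (rwa x) + grad (T i) z).
rewrite !opprD !addrA; split; [|by rewrite addrAC subrr add0r|exact: e1|exact: e2].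
have := grad_rel_lin (@oT i) 1 (H1_grad x4) (H1_grad (H10_H1 hz)).
by rewrite !scale1r.
Qed.

(** Test [kernel_mu] on each element with the H^1 representative of u. The pairings add up to that
    of q^a with w^a on Omega, which is 0 as w^a is in H^1_0, and so (rho, u) + eps^(-1/4) |sigma|^2
    = 0. Since u = eps^(3/4) rho by [kernel_u_rho], this is a sum of two nonnegative terms. *)
Lemma kernel_fields : [/\ l2ip Omega (ru x) (ru x) = 0, l2vip Omega (rs x) (rs x) = 0 &
  l2ip Omega (rr x) (rr x) = 0].
Proof.
have [y1 y2 y3 y4 y5 y6 y7 y8] := hx.
have y3' := subspaceZ (si_subspace hlO) c2 y3.
have eur f : L2 Omega f -> l2ip Omega (ru x) f = c2 * l2ip Omega (rr x) f.
  by move=> hf; rewrite (ip_congr hlO y1 y3' hf kernel_u_rho) (ipZl hlO _ y3 hf).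
have e : l2ip Omega (rr x) (ru x) + c1 * l2vip Omega (rs x) (rs x) = 0.
  refine (etrans _ (pairing_H10 oO y6 h10a)).
  rewrite (l2ip_mesh hO hX y3 y1) (l2vip_mesh hO hX y2 y2) mulr_sumr -big_split /=.
  refine (etrans _ (mesh_pairing_sum hO hX (Hdiv_div y6) y4)); apply: eq_bigr => i _.
  have [x1 x2 x3 x4 x5 x6 x7] := hxl i; have [w [g [hw h10 e1 e2]]] := kernel_w i.
  have [w1 w2] := grad_rel_dom hw; have x2' := subspaceZ (si_subspace (hv i)) c1 x2.
  rewrite -(pairing_congr (@oT i) x6 (grad_rel_H1 hw) x4 h10) -(kernel_mu hw).
  rewrite (si_sym (hl i) x3 x1) (ip_congr (hl i) x1 w1 x3 e1) (si_sym (hl i) w1 x3).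
  by rewrite -(ipZl (hv i) c1 x2 x2) (ip_congr (hv i) x2' w2 x2 e2) (si_sym (hv i) w2 x2).
have s0 := si_ge0 hvO y2; have r0 := si_ge0 hlO y3.
have c1s : 0 <= c1 * l2vip Omega (rs x) (rs x) by rewrite mulr_ge0// ltW.
have c2r : 0 <= c2 * l2ip Omega (rr x) (rr x) by rewrite mulr_ge0// ltW.
rewrite (si_sym hlO y3 y1) (eur _ y3) in e.
have [/eqP r1 /eqP s1] : c2 * l2ip Omega (rr x) (rr x) == 0 /\ c1 * l2vip Omega (rs x) (rs x) == 0.
  by apply/andP; rewrite -paddr_eq0// e.
move: r1 s1 => /eqP; rewrite mulf_eq0 (gt_eqF c20) /= => /eqP r1 /eqP.
rewrite mulf_eq0 (gt_eqF c10) /= => /eqP s1.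
split; [|exact: s1|exact: r1].
by rewrite (eur _ y1) (ip_null hlO y3 y1 r1) mulr0.
Qed.

Let u0 i : l2ip (T i) (ru x) (ru x) = 0.
Proof.
have [e _ _] := kernel_fields; apply/le_anti; rewrite (si_ge0 (hl i) (rl_u (hxl i))) andbT -e.
exact: (l2ip_T_le hO hX i (rd_u hx)).
Qed.

Let s0 i : l2vip (T i) (rs x) (rs x) = 0.
Proof.
have [_ e _] := kernel_fields; apply/le_anti; rewrite (si_ge0 (hv i) (rl_s (hxl i))) andbT -e.
exact: (l2vip_T_le hO hX i (rd_s hx)).
Qed.

Let r0 i : l2ip (T i) (rr x) (rr x) = 0.
Proof.
have [_ _ e] := kernel_fields; apply/le_anti; rewrite (si_ge0 (hl i) (rl_r (hxl i))) andbT -e.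
exact: (l2ip_T_le hO hX i (rd_r hx)).
Qed.

(** w^a has the trace of an H^1 representative of u, and u vanishes almost everywhere. *)
Lemma kernel_wa i : H10 (T i) (rwa x).
Proof.
have [w [g [hw h10 e1 _]]] := kernel_w i; have [w1 _] := grad_rel_dom hw.
have x1 := rl_u (hxl i).
have hw0 : H10 (T i) w.
  apply: (H10_null (@oT i) (grad_rel_H1 hw)).
  by rewrite -(ip_congr (hl i) x1 w1 w1 e1) (ip_null (hl i) x1 w1 (u0 i)).
have -> : rwa x = w - (w - rwa x) by rewrite opprB addrCA subrr addr0.
exact: (subspaceB (H10_subspace (@oT i)) hw0 h10).
Qed.

Lemma kernel_qa i w : H1 (T i) w -> pairing (T i) (rqa x) w = 0.
Proof.
have [x1 x2 x3 x4 x5 x6 x7] := hxl i.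
move=> hw; have hg := H1_grad hw; have [w1 w2] := grad_rel_dom hg.
by rewrite -(kernel_mu hg) (ip_null (hl i) x3 w1 (r0 i)) (ip_null (hv i) x2 w2 (s0 i)) addr0.
Qed.

Let kernel_v0 i v gv lv : grad_rel (T i) v gv -> div_rel (T i) gv lv ->
  c2 * pairing (T i) (rqb x) v + c5 * pairing (T i) gv (rwb x) = 0.
Proof.
move=> hvv hg; have := kernel_v hvv hg; have [x1 x2 x3 x4 x5 x6 x7] := hxl i.
have [v1 v2] := grad_rel_dom hvv; have [g1 g2] := div_rel_dom hg.
rewrite (ip_null (hl i) x1 v1 (u0 i)) (ip_null (hv i) x2 v2 (s0 i)) (ip_null (hl i) x3 g2 (r0 i)).
exact: linear_zeros.
Qed.

(** Test functions v in H^1_0 of the element remove the term of q^b; the pairings of grad v with w^b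
    then vanish, which is the hypothesis of [H10_of_lap_orthogonal]. *)
Lemma kernel_wb i : H10 (T i) (rwb x).
Proof.
have [x1 x2 x3 x4 x5 x6 x7] := hxl i.
apply: (H10_of_lap_orthogonal (@oT i) x5) => v gv lv hv10 hvv hg.
have := kernel_v0 hvv hg; rewrite (pairing_H10 (@oT i) x7 hv10) mulr0 add0r => /eqP.
rewrite mulf_eq0 gt_eqF ?powR_gt0//= => /eqP <-.
by rewrite (pairing_rel (@oT i) hg x5).
Qed.

(** The term of w^b is gone by [kernel_wb]. What is left vanishes for every v with lap v = v, and
    these suffice by [pairing_zero]. *)
Lemma kernel_qb i w : H1 (T i) w -> pairing (T i) (rqb x) w = 0.
Proof.
have [x1 x2 x3 x4 x5 x6 x7] := hxl i; move: w; apply: (pairing_zero (@oT i) x7) => v hv' dv.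
have hq : Hdiv (T i) (grad (T i) v) by rewrite Hdiv_graph; exists v.
have := kernel_v0 (H1_grad hv') dv; rewrite (pairing_H10 (@oT i) hq (kernel_wb i)) mulr0 addr0 => /eqP.
by rewrite mulf_eq0 (gt_eqF c20) => /eqP.
Qed.

End kernel.

(** * The discrete space *)

Opaque facet_integral normal_trace.

Section null_representations.
Context (R : realType) (n : nat) (Omega : set 'rV[R]_n.+1) (I : finType).
Context (X : I -> 'M[R]_(n.+2, n.+1)) (hO : lipschitz_domain Omega) (hX : conforming_mesh Omega X).
Local Notation E := 'rV[R]_n.+1.
Local Notation T i := (open_simplex (X i)).
Local Notation mu := (lebesgue_rV R n.+1).

Let oO := Omega_open hO.
Let mO := mOmega hO.
Let oT := @T_open _ _ _ _ _ hX.
Let mTi := @mT _ _ _ _ _ hX.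
Let hlO := l2_semi_inner mO.
Let hvO := l2v_semi_inner mO.
Let hl i := l2_semi_inner (mTi i).
Let hv i := l2v_semi_inner (mTi i).
Context (eps : R) (eps0 : 0 < eps).
Local Notation Vd := (V_dom Omega X).
Local Notation Vi := (V_ip Omega X eps).
Local Notation rep := (rep R n).
Let hV : semi_inner Vd Vi := V_semi_inner hO hX eps0.

(** Representatives of the zero element of U: the extensions themselves may be nonzero, only their
    traces and normal traces on the elements vanish. *)
Record rep_null (x : rep) : Prop := RepNull {
  rn_u : l2ip Omega (ru x) (ru x) = 0 ; rn_s : l2vip Omega (rs x) (rs x) = 0 ;
  rn_r : l2ip Omega (rr x) (rr x) = 0 ;
  rn_wa : forall i, H10 (T i) (rwa x) ; rn_wb : forall i, H10 (T i) (rwb x) ;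
  rn_qa : forall i w, H1 (T i) w -> pairing (T i) (rqa x) w = 0 ;
  rn_qb : forall i w, H1 (T i) w -> pairing (T i) (rqb x) w = 0 }.

(** Both terms on the left of [coercivity] vanish. The first gives b(x, .) = 0 by Cauchy-Schwarz;
    the second puts phi, and with it w^a, into H^1_0(Omega). These are the hypotheses of the kernel
    lemmas. *)
Lemma rep_null_of_aform beta x : eps <= 1 -> 3 <= beta -> rep_dom Omega x ->
  rep_aform Omega X eps beta x x <= 0 -> rep_null x.
Proof.
move=> eps1 hb hx hA; have [phi [h1 h2 h3]] := coercivity hO hX eps0 eps1 hb hx.
have [tx ex] := thetaP hO hX eps0 hx.
have P0 := si_ge0 hlO (H1_L2 h1); have T0 := si_ge0 hV tx.
have c0 : 0 < 2^-1 * (eps `^ (1 / 2))^-1 by rewrite mulr_gt0// invr_gt0// powR_gt0.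
have [a1 a2] : Vi (theta Omega X eps x) (theta Omega X eps x) = 0 /\ l2ip Omega phi phi = 0.
  have p1 := mulr_ge0 (ltW c0) P0; have s := le_trans h3 hA.
  have t2 : 0 <= 2 * Vi (theta Omega X eps x) (theta Omega X eps x) by rewrite mulr_ge0.
  have /eqP : 2 * Vi (theta Omega X eps x) (theta Omega X eps x) +
      2^-1 * (eps `^ (1 / 2))^-1 * l2ip Omega phi phi = 0 by apply/le_anti; rewrite s addr_ge0.
  rewrite paddr_eq0// => /andP[e1 e2]; split; apply/eqP.
    by move: e1; rewrite mulf_eq0 pnatr_eq0.
  by move: e2; rewrite (mulf_eq0 (2^-1 * _)) (gt_eqF c0).
have hB y : Vd y -> mesh_bform X eps x y = 0.
  by move=> hy; exact: (etrans (esym (ex y hy)) (ip_null hV tx hy a1)).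
have h10 : H10 Omega (rwa x).
  have hp := H10_null oO h1 a2.
  have -> : rwa x = phi - (phi - rwa x) by rewrite opprB addrCA subrr addr0.
  exact: (subspaceB (H10_subspace oO) hp h2).
have [e1 e2 e3] := kernel_fields hO hX eps0 hx hB h10.
split; [exact: e1|exact: e2|exact: e3| | | |].
- exact: (kernel_wa hO hX eps0 hx hB h10).
- exact: (kernel_wb hO hX eps0 hx hB h10).
- exact: (kernel_qa hO hX eps0 hx hB h10).
- exact: (kernel_qb hO hX eps0 hx hB h10).
Qed.

Lemma rep_null_H10 x : rep_dom Omega x -> rep_null x -> H10 Omega (rwa x).
Proof. by move=> hx h; exact: (H10_mesh hO hX (rd_wa hx) (rn_wa h)). Qed.

Lemma rep_null_pairing x w : rep_dom Omega x -> rep_null x -> H1 Omega w ->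
  pairing Omega (rqa x) w = 0.
Proof.
move=> hx h hw; refine (etrans (esym (mesh_pairing_sum hO hX (Hdiv_div (rd_qa hx)) hw)) _).
by apply: big1 => i _; exact: (rn_qa h (H1_T hO hX i hw)).
Qed.

Lemma rep_null_bform x y : rep_dom Omega x -> rep_null x -> Vd y -> mesh_bform X eps x y = 0.
Proof.
move=> hx [u0 s0 r0 wa wb qa qb] hy; rewrite mesh_bformE; apply: big1 => i _.
have [x1 x2 x3 x4 x5 x6 x7] := rep_dom_local hO hX i hx.
have [y1 y2 y3] := V_dom_local i hy; have y1g := H1_L2grad y1; have y3g := H1_L2grad y3.1.
have y2d := Hdiv_L2div y2; have yl := L2lap y3.
have u1 : l2ip (T i) (ru x) (ru x) = 0.
  apply/le_anti; rewrite (si_ge0 (hl i) x1) andbT -u0; exact: (l2ip_T_le hO hX i (rd_u hx)).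
have s1 : l2vip (T i) (rs x) (rs x) = 0.
  apply/le_anti; rewrite (si_ge0 (hv i) x2) andbT -s0; exact: (l2vip_T_le hO hX i (rd_s hx)).
have r1 : l2ip (T i) (rr x) (rr x) = 0.
  apply/le_anti; rewrite (si_ge0 (hl i) x3) andbT -r0; exact: (l2ip_T_le hO hX i (rd_r hx)).
have z1 := ip_null (hl i) x3 (H1_L2 y1) r1; have z2 := ip_null (hv i) x2 y1g s1.
have z3 := qa i _ y1; have z4 := ip_null (hv i) x2 (Hdiv_L2 y2) s1.
have z5 := ip_null (hl i) x1 y2d u1; have z6 := pairing_H10 (@oT i) y2 (wa i).
have z7 := ip_null (hv i) x2 y3g s1; have z8 := qb i _ y3.1.
have z9 := ip_null (hl i) x1 (H1_L2 y3.1) u1; have z10 := ip_null (hl i) x3 yl r1.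
have z12 := pairing_H10 (@oT i) y3.2 (wb i).
refine (etrans (sum12_congr _ _ _ _ _ z1 z2 z3 z4 z5 z6 z7 z8 z9 z10 z7 z12) _).
by rewrite !mulr0 !subr0 !addr0.
Qed.

Lemma rep_null_aform beta x : rep_dom Omega x -> rep_null x -> rep_aform Omega X eps beta x x = 0.
Proof.
move=> hx h; have [tx ex] := thetaP hO hX eps0 hx.
have e1 := etrans (ex _ tx) (rep_null_bform hx h tx).
have e2 := rep_null_pairing hx h (rd_wa hx).
refine (etrans (congr2 (fun s t => beta * s + 2^-1 * eps `^ (1 / 4) * t) e1 (congr2 +%R e2 e2)) _).
by rewrite addr0 !mulr0 addr0.
Qed.

Lemma U_eq_of_null x y : rep_dom Omega x -> rep_dom Omega y -> rep_null (x - y) ->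
  U_eq Omega (tr X x) (tr X y).
Proof.
move=> hx hy [u0 s0 r0 wa wb qa qb].
have [x1 x2 x3 x4 x5 x6 x7 _] := hx; have [y1 y2 y3 y4 y5 y6 y7 _] := hy.
split.
- have au := l2ip_null_ae mO (subspaceB (si_subspace hlO) x1 y1) u0.
  have ar := l2ip_null_ae mO (subspaceB (si_subspace hlO) x3 y3) r0.
  have L2s := subspaceB (si_subspace hvO) x2 y2.
  have as_ : {ae mu, forall z, forall j, Omega z -> (rs x - rs y) z 0 j = 0}.
    apply: filter_forall => j; apply: (l2ip_null_ae mO (L2s j)).
    have e := l2vipE mO L2s L2s; have -> : l2ip Omega (fun z => (rs x - rs y) z 0 j) (fun z => (rs x - rs y) z 0 j)
      = l2ip Omega (comps (rs x - rs y) j) (comps (rs x - rs y) j) by [].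
    have : prod_ip (fun=> l2ip Omega) (comps (rs x - rs y)) (comps (rs x - rs y)) = 0 by rewrite -e.
    rewrite /prod_ip => /eqP; rewrite psumr_eq0 => [/allP/(_ j)|k _]; last exact: (si_ge0 hlO (L2s k)).
    by rewrite mem_index_enum => /(_ isT)/eqP.
  apply: filterS3 au ar as_ => z az bz cz hz; split.
  + by apply/eqP; rewrite -subr_eq0; apply/eqP; exact: (az hz).
  + by apply/rowP => j; have := cz j hz; rewrite !mxE => /eqP; rewrite subr_eq0 => /eqP.
  + by apply/eqP; rewrite -subr_eq0; apply/eqP; exact: (bz hz).
- apply/funext => i; apply: (trace_eqP (@oT i) (H1_T hO hX i x4) (H1_T hO hX i y4)).2; exact: wa.
- apply/funext => i; apply: (trace_eqP (@oT i) (H1_T hO hX i x5) (H1_T hO hX i y5)).2; exact: wb.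
- apply/funext => i; have hxi := Hdiv_T hO hX i x6; have hyi := Hdiv_T hO hX i y6.
  change (normal_trace (T i) (rqa x) = normal_trace (T i) (rqa y)).
  refine (Hmhalf_ext (normal_trace_Hmhalf (@oT i) hxi) (normal_trace_Hmhalf (@oT i) hyi) _) => w hw.
  rewrite (normal_trace_pairing (@oT i) hxi hw) (normal_trace_pairing (@oT i) hyi hw).
  have e : pairing (T i) (rqa x - rqa y) w = 0 by exact: (qa i w hw).
  rewrite subrEL (pairing_linl (@oT i) (-1) hyi hxi hw) mulN1r in e.
  by apply/eqP; rewrite -subr_eq0 addrC; apply/eqP; exact: e.
- apply/funext => i; have hxi := Hdiv_T hO hX i x7; have hyi := Hdiv_T hO hX i y7.
  change (normal_trace (T i) (rqb x) = normal_trace (T i) (rqb y)).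
  refine (Hmhalf_ext (normal_trace_Hmhalf (@oT i) hxi) (normal_trace_Hmhalf (@oT i) hyi) _) => w hw.
  rewrite (normal_trace_pairing (@oT i) hxi hw) (normal_trace_pairing (@oT i) hyi hw).
  have e : pairing (T i) (rqb x - rqb y) w = 0 by exact: (qb i w hw).
  rewrite subrEL (pairing_linl (@oT i) (-1) hyi hxi hw) mulN1r in e.
  by apply/eqP; rewrite -subr_eq0 addrC; apply/eqP; exact: e.
Qed.

End null_representations.

(** * Finitely many coordinates of a discrete trial element *)

Section discrete_coordinates.
Context (R : realType) (n : nat) (Omega : set 'rV[R]_n.+1) (I : finType).
Context (X : I -> 'M[R]_(n.+2, n.+1)) (hO : lipschitz_domain Omega) (hX : conforming_mesh Omega X).
Local Notation E := 'rV[R]_n.+1.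
Local Notation T i := (open_simplex (X i)).
Local Notation mu := (lebesgue_rV R n.+1).

Let oO := Omega_open hO.
Let mO := mOmega hO.
Let oT := @T_open _ _ _ _ _ hX.
Let mTi := @mT _ _ _ _ _ hX.
Let hlO := l2_semi_inner mO.
Let hvO := l2v_semi_inner mO.
Let hl i := l2_semi_inner (mTi i).
Let hv i := l2v_semi_inner (mTi i).
Local Notation rep := (rep R n).
Local Notation K := (I -> 'I_n.+2 -> R).

Definition P0_coord (w : E -> R) (a : I -> R) : Prop :=
  forall i, {ae mu, forall z, T i z -> w z = a i}.

(** The coordinates are the values at the vertices of the continuous, facetwise affine function on
    the skeleton. *)
Definition S1_coord (w : E -> R) (b : K) : Prop := exists g : E -> R,
  [/\ {within \bigcup_i frontier (T i), continuous g},
      forall i k, exists (a : E) (c : R), forall z, facet (X i) k z -> g z = dot a z + c,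
      forall i, is_trace_of (T i) g (trace (T i) w) & forall i l, g (row l (X i)) = b i l].

Definition P0_skel_coord (q : E -> E) (b : K) : Prop :=
  forall i v, H1 (T i) v -> {within closure (T i), continuous v} ->
    normal_trace (T i) q (trace (T i) v) = \sum_k b i k * facet_integral (X i) k v.

Lemma within_continuousL (A : set E) (t : R) (g h : E -> R) :
  {within A, continuous g} -> {within A, continuous h} -> {within A, continuous (t *: g + h)}.
Proof.
move=> cg ch z; apply: (@continuousD _ _ _ (t *: g : subspace A -> R) h z); last exact: ch.
by apply: (@continuousM _ _ (fun=> t) (g : subspace A -> R)); [exact: cst_continuous|exact: cg].
Qed.

Lemma is_trace_ofL (omega : set E) (t : R) g h v w : open omega -> H1 omega v -> H1 omega w ->
  is_trace_of omega g (trace omega v) -> is_trace_of omega h (trace omega w) ->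
  is_trace_of omega (t *: g + h) (trace omega (t *: v + w)).
Proof.
move=> oo hv1 hw1 [v' [hv2 cv ev tv]] [w' [hw2 cw ew tw]]; exists (t *: v' + w').
have hs := subspaceL (H1_subspace oo) t hv2 hw2; split; first exact: hs.
- exact: within_continuousL.
- move=> z hz; have e1 := ev z hz; have e2 := ew z hz.
  by rewrite -[LHS]/(t * v' z + w' z) -[RHS]/(t * g z + h z) e1 e2.
apply: (trace_eqP oo (subspaceL (H1_subspace oo) t hv1 hw1) hs).2.
have -> : t *: v + w - (t *: v' + w') = t *: (v - v') + (w - w').
  by rewrite opprD addrACA -scalerBr.
by apply: (subspaceL (H10_subspace oo)); [exact: ((trace_eqP oo hv1 hv2).1 tv)|exact: ((trace_eqP oo hw1 hw2).1 tw)].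
Qed.

Lemma dotL (t : R) (a b z : E) : dot (t *: a + b) z = t * dot a z + dot b z.
Proof.
rewrite /dot mulr_sumr -big_split /=; apply: eq_bigr => j _.
by rewrite !mxE mulrDl mulrA.
Qed.

Lemma P0_coordL (t : R) v w a b : P0_coord v a -> P0_coord w b ->
  P0_coord (fun z => t * v z + w z) (fun i => t * a i + b i).
Proof. by move=> h h' i; apply: filterS2 (h i) (h' i) => z e e' hz; rewrite e// e'. Qed.

Lemma S1_coordL (t : R) v w a b : H1 Omega v -> H1 Omega w -> S1_coord v a -> S1_coord w b ->
  S1_coord (t *: v + w) (fun i l => t * a i l + b i l).
Proof.
move=> hv1 hw1 [g [cg ag tg vg]] [h [ch ah th vh]]; exists (t *: g + h); split.
- exact: within_continuousL.
- move=> i k; have [a1 [c1 e1]] := ag i k; have [a2 [c2 e2]] := ah i k.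
  exists (t *: a1 + a2), (t * c1 + c2) => z hz.
  by rewrite -[LHS]/(t * g z + h z) e1// e2// dotL mulrDr addrACA.
- by move=> i; exact: (is_trace_ofL t (@oT i) (H1_T hO hX i hv1) (H1_T hO hX i hw1) (tg i) (th i)).
- by move=> i l; rewrite -[LHS]/(t * g _ + h _) vg vh.
Qed.

Lemma P0_skel_coordL (t : R) p q a b : Hdiv Omega p -> Hdiv Omega q ->
  P0_skel_coord p a -> P0_skel_coord q b ->
  P0_skel_coord (t *: p + q) (fun i l => t * a i l + b i l).
Proof.
move=> hp hq ep eq i v hv1 cv; have hpi := Hdiv_T hO hX i hp; have hqi := Hdiv_T hO hX i hq.
have e1 := ep i v hv1 cv; have e2 := eq i v hv1 cv.
rewrite (normal_trace_pairing (@oT i) hpi hv1) in e1; rewrite (normal_trace_pairing (@oT i) hqi hv1) in e2.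
have hs := subspaceL (Hdiv_subspace (@oT i)) t hpi hqi.
rewrite (normal_trace_pairing (@oT i) hs hv1) (pairing_linl (@oT i) t hpi hqi hv1) e1 e2.
by rewrite mulr_sumr -big_split /=; apply: eq_bigr => k _; rewrite mulrDl mulrA.
Qed.

Lemma P0_coord_null w : L2 Omega w -> P0_coord w (fun=> 0) -> l2ip Omega w w = 0.
Proof.
move=> hw h; rewrite (l2ip_mesh hO hX hw hw); apply: big1 => i _.
have hi := L2_T hO hX i hw; exact: (l2ip_ae0 (mTi i) (h i) hi hi).
Qed.

Lemma facet_row (Y : 'M[R]_(n.+2, n.+1)) k j : j != k -> facet Y k (row j Y).
Proof.
move=> jk; exists (delta_mx 0 j); split.
- by move=> l; rewrite mxE ler0n.
- by move=> l; rewrite !inE negbK mxE => /eqP ->; rewrite [k == j]eq_sym (negbTE jk) andbF.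
- rewrite (bigD1 j)//= big1 ?mxE ?eqxx ?addr0// => l lj; rewrite mxE eqxx /=.
  by rewrite (negbTE lj).
- by rewrite rowE.
Qed.

Lemma affine_facet_zero (Y : 'M[R]_(n.+2, n.+1)) k (a : E) (c : R) z :
  (forall j, j != k -> dot a (row j Y) + c = 0) -> facet Y k z -> dot a z + c = 0.
Proof.
move=> h [l [l0 lk l1 ->]].
have -> : dot a (l *m Y) = \sum_j l 0 j * dot a (row j Y).
  rewrite /dot; under eq_bigr do rewrite mxE mulr_sumr.
  rewrite exchange_big /=; apply: eq_bigr => j _; rewrite mulr_sumr; apply: eq_bigr => m _.
  by rewrite mxE mulrCA.
rewrite -[c]mul1r -l1 mulr_suml -big_split /=; apply: big1 => j _.
rewrite -mulrDr; have [->|jk] := eqVneq j k; last by rewrite h// mulr0.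
by rewrite lk ?mul0r// !inE negbK.
Qed.

(** A facetwise affine function that vanishes at the vertices vanishes on every facet, so a
    continuous function with this trace is 0 on the whole frontier, and [H10_of_continuous]
    applies. *)
Lemma S1_coord_null w i : H1 Omega w -> S1_coord w (fun _ _ => 0) -> H10 (T i) w.
Proof.
move=> hw [g [_ ag tg vg]]; have hwi := H1_T hO hX i hw.
have [w' [hw' cw ew tw]] := tg i.
have h10 : H10 (T i) w'.
  apply: (H10_of_continuous (@oT i) _ hw' cw).
    exact: (open_simplex_bounded (mesh_nondegenerate hX i)).
  move=> z hz; have e : w' z = g z by apply: ew; rewrite inE.
  rewrite e.
  have [k hk] := frontier_simplex (mesh_nondegenerate hX i) hz.
  have [a [c eg]] := ag i k; rewrite (eg z hk).
  refine (affine_facet_zero _ hk) => j jk.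
  exact: (etrans (esym (eg _ (facet_row (X i) jk))) (vg i j)).
have -> : w = (w - w') + w' by rewrite subrK.
by apply: (subspaceD (H10_subspace (@oT i))) h10; exact: ((trace_eqP (@oT i) hwi hw').1 tw).
Qed.

Lemma smooth_continuous_within (A : set E) v : smooth v -> {within A, continuous v}.
Proof.
by move=> sv; apply: continuous_subspaceT => z; exact: differentiable_continuous (sv [::] z).
Qed.

(** The facet formula is available only for functions continuous up to the boundary. Those on which
    the pairing vanishes form a closed subspace containing the smooth functions, hence all of H^1 by
    [smooth_dense]. *)
Lemma P0_skel_coord_null q i w : Hdiv Omega q -> P0_skel_coord q (fun _ _ => 0) -> H1 (T i) w ->
  pairing (T i) q w = 0.
Proof.
move=> hq h hw; have hqi := Hdiv_T hO hX i hq; have ni := mesh_nondegenerate hX i.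
pose N v := H1 (T i) v /\ pairing (T i) q v = 0.
have [c hc] := open_simplex_neq0 (X i).
suff [] : N w by [].
apply: (@smooth_dense R n.+1 (T i) c N w (@oT i) (open_simplex_bounded ni) hc _ _ _ _ _ hw).
- by move=> x y t; exact: (open_simplex_convex ni).
- split.
    have h0 := subspace0 (H1_subspace (@oT i)); split; first exact: h0.
    exact: (pairing_H10 (@oT i) hqi (subspace0 (H10_subspace (@oT i)))).
  move=> t u v [hu eu] [hv' ev]; split; first exact: (subspaceL (H1_subspace (@oT i)) t hu hv').
  by rewrite (pairing_linr (@oT i) t hqi hu hv') eu ev mulr0 addr0.
- by move=> v [].
- move=> u v hu hv' uv; split; first exact: hv'.
  have := green_cvg (@oT i) (Hdiv_L2div hqi) (Hdiv_L2 hqi) (fun k => (hu k).1) hv' uv.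
  have -> : (fun k => green (T i) (div (T i) q) q (u k)) = fun=> 0.
    by apply/funext => k; exact: (hu k).2.
  move=> cvg0; exact: (cvg_unique (@Rhausdorff R) cvg0 (cvg_cst (0 : R))).
- move=> v sv hv'; split; first exact: hv'.
  rewrite -(normal_trace_pairing (@oT i) hqi hv') (h i v hv' (smooth_continuous_within sv)).
  by apply: big1 => k _; rewrite mul0r.
Qed.

Local Notation J := ('I_7 * I * 'I_n.+2)%type.
(** The row is indexed by block, element and vertex (or facet). Only the seven block numbers below 7
    are meaningful, as [inord] sends any other to a default. *)
Definition entry (r : 'rV[R]_#|{: J}|) (k : nat) : K := fun i l => r 0 (enum_rank (inord k, i, l)).

Lemma entryL (t : R) r r' k : entry (t *: r + r') k = fun i l => t * entry r k i l + entry r' k i l.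
Proof. by apply/funext => i; apply/funext => l; rewrite /entry !mxE. Qed.

Lemma entry0 k : entry 0 k = fun _ _ => 0.
Proof. by apply/funext => i; apply/funext => l; rewrite /entry mxE. Qed.

(* The blocks of entries are the constants of u, sigma and rho, the values of w^a
   and w^b at the vertices, and the constants of q^a and q^b on the facets. *)
Definition coordinates (x : rep) (r : 'rV[R]_#|{: J}|) : Prop :=
  [/\ rep_dom Omega x, P0_coord (ru x) (entry r 0 ^~ ord0),
      forall j, P0_coord (fun z => rs x z 0 j) (entry r 1 ^~ (lift ord0 j)) &
      P0_coord (rr x) (entry r 2 ^~ ord0)] /\
  [/\ S1_coord (rwa x) (entry r 3), S1_coord (rwb x) (entry r 4),
      P0_skel_coord (rqa x) (entry r 5) & P0_skel_coord (rqb x) (entry r 6)].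

Lemma coordinatesL (t : R) x y r r' : coordinates x r -> coordinates y r' ->
  coordinates (t *: x + y) (t *: r + r').
Proof.
move=> [[hx x1 x2 x3] [x4 x5 x6 x7]] [[hy y1 y2 y3] [y4 y5 y6 y7]].
rewrite /coordinates !entryL; split; split.
- exact: (subspaceL (rep_dom_subspace hO) t hx hy).
- exact: (P0_coordL t x1 y1).
- move=> j i; apply: filterS (P0_coordL t (x2 j) (y2 j) i) => z e hz.
  have -> : rs (t *: x + y) z 0 j = t * rs x z 0 j + rs y z 0 j.
    by rewrite -[rs _ z]/(t *: rs x z + rs y z) !mxE.
  exact: (e hz).
- exact: (P0_coordL t x3 y3).
- exact: (S1_coordL t (rd_wa hx) (rd_wa hy) x4 y4).
- exact: (S1_coordL t (rd_wb hx) (rd_wb hy) x5 y5).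
- exact: (P0_skel_coordL t (rd_qa hx) (rd_qa hy) x6 y6).
- exact: (P0_skel_coordL t (rd_qb hx) (rd_qb hy) x7 y7).
Qed.

Lemma coordinates_null x : coordinates x 0 -> rep_null Omega X x.
Proof.
move=> [[hx x1 x2 x3] [x4 x5 x6 x7]].
rewrite !entry0 in x1 x3 x4 x5 x6 x7.
split.
- exact: (P0_coord_null (rd_u hx) x1).
- have hs := rd_s hx; rewrite (l2vipE mO hs hs) /prod_ip; apply: big1 => j _.
  apply: (P0_coord_null (hs j)); have := x2 j; by rewrite entry0.
- exact: (P0_coord_null (rd_r hx) x3).
- by move=> i; exact: (S1_coord_null i (rd_wa hx) x4).
- by move=> i; exact: (S1_coord_null i (rd_wb hx) x5).
- by move=> i w hw; exact: (P0_skel_coord_null (rd_qa hx) x6 hw).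
- by move=> i w hw; exact: (P0_skel_coord_null (rd_qb hx) x7 hw).
Qed.

Lemma entry_mk (A : nat -> K) : exists r, forall k, (k < 7)%N -> entry r k = A k.
Proof.
exists (\row_(j < #|{: J}|) (let z : J := enum_val j in A z.1.1 z.1.2 z.2)) => k k7.
by apply/funext => i; apply/funext => l; rewrite /entry mxE enum_rankK /= inordK.
Qed.

Lemma P0_coord_ex w : P0 X w -> exists a, P0_coord w a.
Proof. by move=> /choice[a ha]; exists a. Qed.

Lemma coordinates_Uh x : rep_dom Omega x -> Uh Omega X (tr X x) <-> exists r, coordinates x r.
Proof.
move=> hx; split.
  move=> [_ /P0_coord_ex[a0 h0] hs /P0_coord_ex[a2 h2] [_ [ga [ca aa ta]]] [_ [gb [cb ab tb]]]
    [_ /choice[a5 h5]] [_ /choice[a6 h6]]].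
  have [a1 h1] : exists a1 : 'I_n.+1 -> I -> R, forall j, P0_coord (fun z => rs x z 0 j) (a1 j).
    have /choice[a1 h1] := fun j => P0_coord_ex (hs j).
    by exists a1.
  have [r er] := entry_mk (nth (fun _ _ => 0) [:: (fun i _ => a0 i);
    (fun i l => if unlift ord0 l is Some j then a1 j i else 0); (fun i _ => a2 i);
    (fun i l => ga (row l (X i))); (fun i l => gb (row l (X i))); a5; a6]).
  exists r; rewrite /coordinates !er//=; split; split.
  - exact: hx.
  - exact: h0.
  - move=> j; have := h1 j; congr P0_coord; apply/funext => i.
    by rewrite -[RHS]/(if unlift ord0 (lift ord0 j) is Some j' then a1 j' i else 0) liftK.
  - exact: h2.
  - exists ga; split; [exact: ca|exact: aa|exact: ta|move=> i l; reflexivity].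
  - exists gb; split; [exact: cb|exact: ab|exact: tb|move=> i l; reflexivity].
  - exact: h5.
  - exact: h6.
move=> [r [[_ x1 x2 x3] [[ga [ca aa ta _]] [gb [cb ab tb _]] x6 x7]]].
have [u1 u2 u3 u4 u5 u6 u7 u8] := in_U_tr hO hX hx.
split.
- exact: in_U_tr hO hX _ hx.
- by move=> i; eexists; exact: (x1 i).
- by move=> j i; eexists; exact: (x2 j i).
- by move=> i; eexists; exact: (x3 i).
- by split; [exact: u4|exists ga; split; [exact: ca|exact: aa|exact: ta]].
- by split; [exact: u5|exists gb; split; [exact: cb|exact: ab|exact: tb]].
- by split; [exact: u6|move=> i; exists (entry r 5 i); exact: (x6 i)].
- by split; [exact: u7|move=> i; exists (entry r 6 i); exact: (x7 i)].
Qed.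

End discrete_coordinates.

(** * Nonnegative traces *)

Section nonnegative_traces.
Context (R : realType) (n : nat) (omega : set 'rV[R]_n.+1) (oo : open omega).
Local Notation E := 'rV[R]_n.+1.
Let mo : measurable omega := open_measurable_rV oo.
Let h1 : semi_inner (H1 omega) (h1ip omega 1 1) := h1_semi_inner oo ltr01 ltr01.
Let sH1 : lin_subspace (H1 omega : (E -> R) -> Prop) := H1_subspace oo.
Local Notation ip := (h1ip omega 1 1).

Definition nonneg_lipschitz (g : E -> R) : Prop :=
  [lipschitz g x | x in frontier omega] /\ forall x, frontier omega x -> 0 <= g x.

Definition nonneg_cone (w : E -> R) : Prop :=
  H1 omega w /\ exists2 g, nonneg_lipschitz g & is_trace_of omega g (trace omega w).

(** The norm closure in H^1 of the functions whose trace is a nonnegative Lipschitz function; unlike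
    the weak sequential closure in [Hhalf_ge0], it is visibly closed and convex. *)
Definition cone_closure (w : E -> R) : Prop :=
  H1 omega w /\ forall e : R, 0 < e -> exists2 c, nonneg_cone c & ip (w - c) (w - c) < e.

Lemma nonneg_cone0 : nonneg_cone 0.
Proof.
have h0 := subspace0 sH1; split; first exact: h0.
exists 0; first by split; [apply/lipschitzP; exists 0 => x y _ _; rewrite subrr normr0 mul0r|].
exists 0; split; [exact: h0| |by []|by []].
by apply: continuous_subspaceT => z; exact: cst_continuous.
Qed.

Lemma nonneg_coneL (a : R) v w : 0 <= a -> nonneg_cone v -> nonneg_cone w -> nonneg_cone (a *: v + w).
Proof.
move=> a0 [hv [g [/lipschitzP[k kg] g0] tg]] [hw [g' [/lipschitzP[k' kg'] g'0] tg']].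
split; first exact: (subspaceL sH1 a hv hw).
exists (a *: g + g'); last exact: (is_trace_ofL a oo hv hw tg tg').
split; last first.
  move=> x hx; rewrite -[X in _ <= X]/(a * g x + g' x).
  by rewrite addr_ge0// ?mulr_ge0// ?g0// g'0.
apply/lipschitzP; exists (a * k + k') => x y hx hy.
rewrite -[X in `|X|]/(a * g x + g' x - (a * g y + g' y)) opprD addrACA -mulrBr.
apply: le_trans (ler_normD _ _) _; rewrite normrM (ger0_norm a0) mulrDl -mulrA.
by rewrite lerD ?ler_wpM2l ?kg ?kg'.
Qed.

Lemma nonneg_cone_H10 w h : nonneg_cone w -> H10 omega h -> nonneg_cone (w + h).
Proof.
move=> [hw [g hg tg]] hh; have hwh := subspaceD sH1 hw (H10_H1 hh).
split; first exact: hwh.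
exists g; first exact: hg.
have -> : trace omega (w + h) = trace omega w; last exact: tg.
apply: (trace_eqP oo hwh hw).2; have -> : w + h - w = h by rewrite addrAC subrr add0r.
exact: hh.
Qed.

Lemma nonneg_cone_closure w : nonneg_cone w -> cone_closure w.
Proof.
move=> hw; split; first exact: hw.1.
move=> e e0; exists w; first exact: hw.
by rewrite subrr (ip0l h1 (subspace0 sH1)).
Qed.

Lemma cone_closure_approx w : H1 omega w ->
  (forall e : R, 0 < e -> exists2 c, cone_closure c & ip (w - c) (w - c) < e) -> cone_closure w.
Proof.
move=> hw h; split; first exact: hw.
move=> e e0; have e4 : 0 < e / 4 by rewrite divr_gt0.
have [c [hc hc'] lc] := h _ e4; have [c' c'C lc'] := hc' _ e4.
exists c'; first exact: c'C.
have -> : w - c' = (w - c) + (c - c') by rewrite addrA subrK.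
apply: le_lt_trans (ip_sqD_le h1 (subspaceB sH1 hw hc) (subspaceB sH1 hc c'C.1)) _.
by move: lc lc'; move: (ip _ _) (ip _ _) => *; lra.
Qed.

Lemma cone_closure_closed : ip_closed (H1 omega) ip cone_closure.
Proof.
move=> u x hu hx ux; apply: cone_closure_approx; first exact: hx.
move=> e e0; have [N hN] := ux e e0; exists (u N); first exact: hu.
by rewrite (ip_sqBC h1 hx (hu N).1); exact: hN.
Qed.

Lemma cone_closureL (a : R) v w : 0 <= a -> cone_closure v -> cone_closure w ->
  cone_closure (a *: v + w).
Proof.
move=> a0 [hv cv] [hw cw]; split; first exact: (subspaceL sH1 a hv hw).
move=> e e0; have a1 : 0 < a ^+ 2 + 1 by rewrite ltr_wpDl// sqr_ge0.
have [|c hc lc] := cv (e / 4 / (a ^+ 2 + 1)); first by rewrite !divr_gt0.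
have [|c' hc' lc'] := cw (e / 4); first by rewrite divr_gt0.
exists (a *: c + c'); first exact: nonneg_coneL.
have -> : a *: v + w - (a *: c + c') = a *: (v - c) + (w - c') by rewrite opprD addrACA -scalerBr.
have hvc := subspaceB sH1 hv hc.1; have hav := subspaceZ sH1 a hvc.
apply: le_lt_trans (ip_sqD_le h1 hav (subspaceB sH1 hw hc'.1)) _.
rewrite (ipZl h1 a hvc hav) (ipZr h1 a hvc hvc).
have p0 := si_ge0 h1 hvc; move: lc; rewrite ltr_pdivlMr// => lc.
move: lc lc' p0; move: (ip _ _) (ip _ _) => P Q lc lc' p0.
by nra.
Qed.

Lemma cone_closure_convex : convex_pred cone_closure.
Proof.
move=> x y t hx hy /andP[t0 t1].
have -> : x + t *: (y - x) = t *: y + ((1 - t) *: x + 0).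
  by rewrite addr0 scalerBr scalerBl scale1r addrCA.
apply: (cone_closureL t0 hy); apply: cone_closureL; [by rewrite subr_ge0|exact: hx|].
exact: nonneg_cone_closure nonneg_cone0.
Qed.

Lemma cone_closure_H10 w h : cone_closure w -> H10 omega h -> cone_closure (w + h).
Proof.
move=> [hw cw] hh; split; first exact: (subspaceD sH1 hw (H10_H1 hh)).
move=> e e0; have [c hc lc] := cw e e0; exists (c + h); first exact: nonneg_cone_H10.
by have -> : w + h - (c + h) = w - c by rewrite opprD addrACA subrr addr0.
Qed.

Lemma pairing_gradE r v : H1 omega r -> div_rel omega (grad omega r) r -> H1 omega v ->
  pairing omega (grad omega r) v = ip r v.
Proof. by move=> hr dr hv; rewrite (pairing_rel oo dr hv) /green /h1ip /graph_ip !mul1r. Qed.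

(* Separation of a point from the closed convex cone by a functional on traces (Mazur). *)
Lemma cone_closure_separation w : H1 omega w ->
  (forall r b, H1 omega r -> div_rel omega (grad omega r) r ->
     (forall c, cone_closure c -> pairing omega (grad omega r) c <= b) ->
     pairing omega (grad omega r) w <= b) ->
  cone_closure w.
Proof.
move=> hw h; have cH1 := h1_complete oo ltr01 ltr01.
have sub y : cone_closure y -> H1 omega y by case.
have c0 := nonneg_cone_closure nonneg_cone0.
have [p hp sp] := projection_convex h1 cH1 sub (ex_intro _ 0 c0) cone_closure_convex
  cone_closure_closed hw.
have hr := subspaceB sH1 hw hp.1; have hrg := H1_grad hr; have [r1 r2] := grad_rel_dom hrg.
have le1 c : cone_closure c -> ip (w - p) c <= ip (w - p) p.
  by move=> hc; have := sp c hc; rewrite (ipBr h1 hc.1 hp.1 hr) subr_le0.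
(* The cone is invariant under adding elements v of H^1_0, so p + v and p - v are in it and w - p is
   orthogonal to H^1_0. Hence lap r = r for r = w - p, and the separating functional is a functional
   on traces. *)
have dr : div_rel omega (grad omega (w - p)) (w - p).
  apply/(div_rel_green oo); split; [exact: r2|exact: r1|move=> v hv].
  have e u : H1 omega u -> green omega (w - p) (grad omega (w - p)) u = ip (w - p) u.
    by move=> hu; rewrite /green /h1ip /graph_ip !mul1r.
  rewrite (e _ (H10_H1 hv)); apply/le_anti/andP; split.
    have := le1 _ (cone_closure_H10 hp hv).
    by rewrite (ipDr h1 hp.1 (H10_H1 hv) hr) gerDl.
  have := le1 _ (cone_closure_H10 hp (subspaceN (H10_subspace oo) hv)).
  rewrite (ipDr h1 hp.1 (subspaceN sH1 (H10_H1 hv)) hr) (ipNr h1 (H10_H1 hv) hr).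
  by rewrite gerDl oppr_le0.
have := h _ (ip (w - p) p) hr dr.
rewrite (pairing_gradE hr dr hw) => /(_ _)/wrap[].
  by move=> c hc; rewrite (pairing_gradE hr dr hc.1); exact: le1.
move=> le2; apply: cone_closure_approx; first exact: hw.
move=> e e0; exists p; first exact: hp.
rewrite (ipBr h1 hw hp.1 hr); apply: le_lt_trans e0; by rewrite subr_le0.
Qed.

(** A weak limit satisfies every bound that holds on the cone, so [cone_closure_separation] puts it
    into the norm closure. Conversely, members of the cone within 1/(k+1) of w converge in norm, and
    functionals on traces are continuous by [Hmhalf_riesz]. *)
Lemma Hhalf_ge0_closure w : H1 omega w -> Hhalf_ge0 omega (trace omega w) <-> cone_closure w.
Proof.
move=> hw; split.
  move=> [_ [g [un [hg cvg_un]]]]; apply: (cone_closure_separation hw) => r b hr dr hb.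
  have hq : Hdiv omega (grad omega r) by rewrite Hdiv_graph; exists r.
  have cF := cvg_un _ (normal_trace_Hmhalf oo hq).
  rewrite -(normal_trace_pairing oo hq hw).
  apply: (ler_cvg_to cF (cvg_cst b)); apply: nearW => k.
  have [lg g0 [w' [hw' cw' ew' ->]]] := hg k.
  rewrite (normal_trace_pairing oo hq hw'); apply: hb; apply: nonneg_cone_closure.
  by split; [exact: hw'|exists (g k); [split; [exact: lg|exact: g0]|exists w'; split]].
move=> [_ hc]; split; first exact: (trace_Hhalf hw).
have H (k : nat) : exists cg : (E -> R) * (E -> R), [/\ H1 omega cg.1, nonneg_lipschitz cg.2,
    is_trace_of omega cg.2 (trace omega cg.1) & ip (w - cg.1) (w - cg.1) < k.+1%:R^-1].
  have [|c [hc1 [g hg tg]] lc] := hc k.+1%:R^-1; first by rewrite invr_gt0.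
  by exists (c, g); split; [exact: hc1|exact: hg|exact: tg|exact: lc].
have [cg hcg] := choice H; exists (fun k => (cg k).2), (fun k => trace omega (cg k).1); split.
  by move=> k; have [h2 [h3 h3'] h4 _] := hcg k; split; [exact: h3|exact: h3'|exact: h4].
move=> F hF; have [r [hr dr er]] := Hmhalf_riesz oo hF.
have hck k : H1 omega (cg k).1 by have [h2 _ _ _] := hcg k.
have gcvg : ip_cvg ip (fun k => (cg k).1) w.
  move=> e e0; have ei : 0 <= e^-1 by rewrite invr_ge0 ltW.
  exists (Num.truncn e^-1) => k hk; have [h2 _ _ h5] := hcg k.
  rewrite (ip_sqBC h1 h2 hw); apply: lt_trans h5 _.
  rewrite invf_plt ?posrE//.
  by apply: (lt_le_trans (truncnS_gt _)); rewrite ler_nat.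
have key := green_cvg oo (H1_L2 hr) (H1_L2grad hr) hck hw gcvg.
refine (eq_ind_r (fun l => _ --> l) _ (er w hw)).
exact: (eq_ind_r (fun u : nat -> R => u k @[k --> \oo] --> green omega r (grad omega r) w) key
  (funext (fun k => er _ (hck k)))).
Qed.

End nonnegative_traces.

(** * The variational inequality *)

Opaque rep_aform.

Lemma pairing0l (R : realType) (d : nat) (omega : set 'rV[R]_d) w : open omega -> H1 omega w ->
  pairing omega 0 w = 0.
Proof.
move=> oo hw; have h0 := subspace0 (Hdiv_subspace oo).
have := pairing_linl oo 1 h0 h0 hw; rewrite scaler0 addr0 mul1r.
by move=> /esym/eqP; rewrite -subr_eq0 addrK => /eqP.
Qed.

Section discrete_inequality.
Context (R : realType) (n : nat) (Omega : set 'rV[R]_n.+1) (I : finType).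
Context (X : I -> 'M[R]_(n.+2, n.+1)) (hO : lipschitz_domain Omega) (hX : conforming_mesh Omega X).
Local Notation E := 'rV[R]_n.+1.
Local Notation T i := (open_simplex (X i)).
Let oO := Omega_open hO.
Context (eps beta : R) (eps0 : 0 < eps) (eps1 : eps <= 1) (hb : 3 <= beta).
Local Notation Vd := (V_dom Omega X).
Local Notation Vi := (V_ip Omega X eps).
Local Notation rep := (rep R n).
Local Notation A := (rep_aform Omega X eps beta).
Local Notation theta := (theta Omega X eps).
Local Notation C := (cone_closure Omega).
Let hV : semi_inner Vd Vi := V_semi_inner hO hX eps0.

Definition discrete_space (x : rep) : Prop := exists r, coordinates Omega X x r.
Local Notation S := discrete_space.

Lemma aform_semi_inner : semi_inner (rep_dom Omega : rep -> Prop) A.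
Proof.
split; first exact: rep_dom_subspace hO.
- by move=> x y hx hy; exact: (rep_aform_sym hO hX eps0 beta hx hy).
- by move=> a x y z hx hy hz; exact: (rep_aform_lin hO hX eps0 beta a hx hy hz).
move=> x hx; have [phi [h1 _ h3]] := coercivity hO hX eps0 eps1 hb hx.
have [tx _] := thetaP hO hX eps0 hx; apply: le_trans h3.
have P0 := si_ge0 (l2_semi_inner (mOmega hO)) (H1_L2 h1); have T0 := si_ge0 hV tx.
by rewrite addr_ge0// mulr_ge0// mulr_ge0// invr_ge0 powR_ge0.
Qed.

Lemma discrete_space_dom x : S x -> rep_dom Omega x. Proof. by case=> r [[]]. Qed.

Lemma coordinates0 : coordinates Omega X 0 0.
Proof.
have s1 : S1_coord X (0 : E -> R) (fun _ _ => 0).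
  exists 0; split.
  - by apply: continuous_subspaceT => z; exact: cst_continuous.
  - move=> i k; exists 0, 0 => z _; rewrite addr0 /dot big1// => j _.
    by rewrite mxE mul0r.
  - move=> i; exists 0; split; [exact: (subspace0 (H1_subspace (@T_open _ _ _ _ _ hX i)))| |by []|by []].
    by apply: continuous_subspaceT => z; exact: cst_continuous.
  - by [].
have s2 : P0_skel_coord X (0 : E -> E) (fun _ _ => 0).
  move=> i v hv _; have h0 := subspace0 (Hdiv_subspace (@T_open _ _ _ _ _ hX i)).
  rewrite (normal_trace_pairing (@T_open _ _ _ _ _ hX i) h0 hv) (pairing0l (@T_open _ _ _ _ _ hX i) hv) big1// => k _.
  by rewrite mul0r.
rewrite /coordinates !entry0; split; split.
- exact: (subspace0 (rep_dom_subspace hO)).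
- by move=> i; apply: aeW.
- by move=> j i; apply: aeW => z _; rewrite -[rs 0 z]/(0 : E) mxE.
- by move=> i; apply: aeW.
- exact: s1.
- exact: s1.
- exact: s2.
- exact: s2.
Qed.

Lemma discrete_space_subspace : lin_subspace (S : rep -> Prop).
Proof.
split; first by exists 0; exact: coordinates0.
by move=> a x y [r hr] [r' hr']; exists (a *: r + r'); exact: (coordinatesL hO hX a hr hr').
Qed.

Let hA : semi_inner (S : rep -> Prop) A.
Proof. exact: (semi_inner_sub aform_semi_inner discrete_space_subspace discrete_space_dom). Qed.

Lemma discrete_spanning : exists m (v : 'I_m -> rep), spanning (S : rep -> Prop) A v.
Proof.
apply: (@coordinates_spanning _ _ _ _ _ (coordinates Omega X) hA).
- by move=> x [r hr]; exists r.
- by move=> x r hr; exists r.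
- by move=> t x y a b ha hb'; exact: (coordinatesL hO hX t ha hb').
- move=> x hx; have hd := discrete_space_dom (ex_intro _ _ hx).
  exact: (rep_null_aform hO hX eps0 beta hd (coordinates_null hO hX hx)).
Qed.

Lemma discrete_null x : S x -> A x x = 0 -> rep_null Omega X x.
Proof.
move=> /discrete_space_dom hx e; apply: (rep_null_of_aform hO hX eps0 eps1 hb hx).
by rewrite e.
Qed.

(** K_h^s on representatives, with both sign conditions expressed through the norm-closed cone. *)
Definition admissible (x : rep) : Prop :=
  [/\ S x, C (rwa x) & forall w, C w -> 0 <= pairing Omega (rqa x) w].

Lemma admissibleE x : rep_dom Omega x -> Kh Omega X (tr X x) <-> admissible x.
Proof.
move=> hx; have wa := rd_wa hx; have qa := rd_qa hx; split.
  move=> [h1 h2 h3]; rewrite (gamma0_tr hO hX hx) in h2; rewrite (gamman_tr hO hX hx) in h3.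
  split; first exact: ((coordinates_Uh hO hX hx).1 h1).
    exact: ((Hhalf_ge0_closure oO wa).1 h2).
  move=> w hw; rewrite -(normal_trace_pairing oO qa hw.1); apply: h3.2.
  exact: ((Hhalf_ge0_closure oO hw.1).2 hw).
move=> [h1 h2 h3]; split; first exact: ((coordinates_Uh hO hX hx).2 h1).
  rewrite (gamma0_tr hO hX hx); exact: ((Hhalf_ge0_closure oO wa).2 h2).
rewrite (gamman_tr hO hX hx); split; first exact: (normal_trace_Hmhalf oO qa).
move=> u hu; have [[w hw e] _] := hu; rewrite -e in hu *.
rewrite (normal_trace_pairing oO qa hw); apply: h3.
exact: ((Hhalf_ge0_closure oO hw).1 hu).
Qed.

Lemma admissible0 : admissible 0.
Proof.
split; first exact: (subspace0 discrete_space_subspace).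
  exact: (nonneg_cone_closure oO (nonneg_cone0 oO)).
move=> w hw; by have -> : pairing Omega (rqa 0) w = 0 by exact: (pairing0l oO hw.1).
Qed.

Lemma admissibleL (a : R) x y : 0 <= a -> admissible x -> admissible y -> admissible (a *: x + y).
Proof.
move=> a0 [x1 x2 x3] [y1 y2 y3]; split.
- exact: (subspaceL discrete_space_subspace a x1 y1).
- exact: (cone_closureL oO a0 x2 y2).
move=> w hw; have px := rd_qa (discrete_space_dom x1); have py := rd_qa (discrete_space_dom y1).
have -> : pairing Omega (rqa (a *: x + y)) w = a * pairing Omega (rqa x) w + pairing Omega (rqa y) w.
  exact: (pairing_linl oO a px py hw.1).
exact: (addr_ge0 (mulr_ge0 a0 (x3 w hw)) (y3 w hw)).
Qed.

Lemma admissible_convex : convex_pred (admissible : rep -> Prop).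
Proof.
move=> x y t hx hy /andP[t0 t1].
have -> : x + t *: (y - x) = t *: y + ((1 - t) *: x + 0).
  by rewrite addr0 scalerBr scalerBl scale1r addrCA.
apply: (admissibleL t0 hy); apply: admissibleL; [by rewrite subr_ge0|exact: hx|].
exact: admissible0.
Qed.

(** The pairings of a fixed field with w^a and of q^a with a fixed function vanish on null elements,
    so they are continuous on the finite-dimensional space by [finite_dim_cvg]. Inequalities pass to
    the limit: directly for gamma_n, and through [cone_closure_separation] for gamma_0. *)
Lemma admissible_closed : ip_closed (S : rep -> Prop) A admissible.
Proof.
move=> u x hu hx ux; have [m [v hv]] := discrete_spanning.
have hS k : S (u k) by have [] := hu k.
have dom := discrete_space_dom.
split; first exact: hx.
  apply: (cone_closure_separation oO (rd_wa (dom _ hx))) => r b hr dr hbnd.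
  have hq : Hdiv Omega (grad Omega r) by rewrite Hdiv_graph; exists r.
  have lin (a : R) (y z : rep) : S y -> S z -> pairing Omega (grad Omega r) (rwa (a *: y + z)) =
      a * pairing Omega (grad Omega r) (rwa y) + pairing Omega (grad Omega r) (rwa z).
    by move=> hy hz; exact: (pairing_linr oO a hq (rd_wa (dom _ hy)) (rd_wa (dom _ hz))).
  have nul (y : rep) : S y -> A y y = 0 -> pairing Omega (grad Omega r) (rwa y) = 0.
    move=> hy e; apply: (pairing_H10 oO hq).
    exact: (rep_null_H10 hO hX (dom _ hy) (discrete_null hy e)).
  have cF := @finite_dim_cvg _ _ _ _ hA m v (fun y => pairing Omega (grad Omega r) (rwa y)) u x
    hv lin nul hS hx ux.
  apply: (ler_cvg_to cF (cvg_cst b)); apply: nearW => k.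
  by apply: hbnd; have [] := hu k.
move=> w hw.
have lin (a : R) (y z : rep) : S y -> S z -> pairing Omega (rqa (a *: y + z)) w =
    a * pairing Omega (rqa y) w + pairing Omega (rqa z) w.
  by move=> hy hz; exact: (pairing_linl oO a (rd_qa (dom _ hy)) (rd_qa (dom _ hz)) hw.1).
have nul (y : rep) : S y -> A y y = 0 -> pairing Omega (rqa y) w = 0.
  by move=> hy e; exact: (rep_null_pairing hO hX (dom _ hy) (discrete_null hy e) hw.1).
have cF := @finite_dim_cvg _ _ _ _ hA m v (fun y => pairing Omega (rqa y) w) u x hv lin nul hS hx ux.
apply: (ler_cvg_to (cvg_cst 0) cF); apply: nearW => k.
by have [_ _ h] := hu k; exact: h.
Qed.

Context (f : E -> R) (hf : L2 Omega f).

Lemma Fform_riesz : exists2 rL, Vd rL &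
  forall x, rep_dom Omega x -> Fform Omega X eps beta f (tr X x) = beta * Vi rL (theta x).
Proof.
have [rL hL eL] := bounded_functional_riesz hO hX eps0 (Lform_bounded hO hX eps0 hf).
exists rL; first exact: hL.
move=> x hx; have [tx _] := thetaP hO hX eps0 hx.
have h := subspaceZ (si_subspace hV) beta tx.
exact: (etrans (esym (eL _ h)) (ipZr hV beta tx hL)).
Qed.

Local Notation F x := (Fform Omega X eps beta f (tr X x)).

Lemma FformL (a : R) x y : rep_dom Omega x -> rep_dom Omega y -> F (a *: x + y) = a * F x + F y.
Proof.
move=> hx hy; have [rL hL eF] := Fform_riesz.
have hs := subspaceL (rep_dom_subspace hO) a hx hy.
have [tx _] := thetaP hO hX eps0 hx; have [ty _] := thetaP hO hX eps0 hy.
have [ts _] := thetaP hO hX eps0 hs.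
have e := theta_lin hO hX eps0 a hx hy hL.
have s1 := si_sym hV hL ts; have s2 := si_sym hV hL tx; have s3 := si_sym hV hL ty.
refine (etrans (eF _ hs) (etrans (congr1 (fun t => beta * t) (etrans s1 e)) _)).
refine (etrans _ (esym (congr2 (fun s t => a * s + t) (eF _ hx) (eF _ hy)))).
refine (etrans _ (esym (congr2 (fun s t => a * (beta * s) + beta * t) s2 s3))).
by rewrite mulrDr mulrCA.
Qed.

(** F is beta times the V-product of a fixed element with Theta x, and by [coercivity] the squared
    V-norm of Theta x is at most a^s(x, x). *)
Lemma Fform_bounded : exists c, forall x, rep_dom Omega x -> F x ^+ 2 <= c * A x x.
Proof.
have [rL hL eF] := Fform_riesz; exists (beta ^+ 2 * Vi rL rL) => x hx.
have [tx _] := thetaP hO hX eps0 hx; have [phi [h1 _ h3]] := coercivity hO hX eps0 eps1 hb hx.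
have P0 := si_ge0 (l2_semi_inner (mOmega hO)) (H1_L2 h1); have T0 := si_ge0 hV tx.
have L0 := si_ge0 hV hL; have cs := cauchy_schwarz_ip hV hL tx.
have c0 : 0 <= 2^-1 * (eps `^ (1 / 2))^-1 * l2ip Omega phi phi.
  by rewrite !mulr_ge0// invr_ge0 powR_ge0.
have leT : Vi (theta x) (theta x) <= A x x.
  apply: le_trans h3; rewrite -[X in X <= _]addr0; apply: lerD; last exact: c0.
  exact: (ler_peMl T0 (ler1n R 2)).
refine (le_trans _ (ler_wpM2l _ leT)); last exact: (mulr_ge0 (sqr_ge0 beta) L0).
rewrite (eF _ hx) exprMn; refine (le_trans (ler_wpM2l (sqr_ge0 beta) cs) _).
by rewrite mulrA.
Qed.

(** Every element of U has a representative ([in_U_rep]), so quantifying over K_h^s is the same as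
    quantifying over admissible representatives, and differences of trial elements are represented
    by differences. *)
Lemma discrete_VI_rep x : rep_dom Omega x -> discrete_VI Omega X eps beta f (tr X x) <->
  admissible x /\ forall y, admissible y -> F (y - x) <= A x (y - x).
Proof.
move=> hx; have dB y := subspaceB (rep_dom_subspace hO) (x := y) (y := x); split.
  move=> [hK h]; split; first exact: ((admissibleE hx).1 hK).
  move=> y hy; have [/discrete_space_dom dy _ _] := hy; have := h _ ((admissibleE dy).2 hy).
  by rewrite (tr_sub hO hX dy hx) (aformE hO hX eps0 beta hx (dB _ dy hx)).
move=> [ha h]; split; first exact: ((admissibleE hx).2 ha).
move=> v hK; have [hU _ _] := hK; have [y dy ey] := in_U_rep hO hX (Uh_U hU).
rewrite -ey in hK *; rewrite (tr_sub hO hX dy hx).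
rewrite (aformE hO hX eps0 beta hx (dB _ dy hx)); apply: h.
exact: ((admissibleE dy).1 hK).
Qed.

(** With F = a^s(x0, .) the variational inequality reads a^s(x0 - p, y - p) <= 0 for all admissible
    y, which characterizes the projection p of x0. *)
Lemma discrete_solution : exists2 p, admissible p & forall y, admissible y -> F (y - p) <= A p (y - p).
Proof.
have dom := discrete_space_dom; have sS := discrete_space_subspace.
have [m [v hv]] := discrete_spanning; have cA := finite_dim_complete hA hv.
have [c hc] := Fform_bounded.
have [||x0 hx0 e0] := @riesz_representation _ _ _ _ hA cA (fun x => F x) c.
- by move=> a x y hx hy; exact: (FformL a (dom _ hx) (dom _ hy)).
- by move=> x hx; exact: (hc x (dom _ hx)).
have sub y : admissible y -> S y by case.
have [p hp sp] := projection_convex hA cA sub (ex_intro _ 0 admissible0) admissible_convex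
  admissible_closed hx0.
exists p; first exact: hp.
move=> y hy; have hyp := subspaceB sS (sub _ hy) (sub _ hp).
rewrite -(e0 _ hyp) -subr_le0 -(ipBl hA hx0 (sub _ hp) hyp); exact: (sp y hy).
Qed.

(** Test the inequality of p with q and that of q with p. By linearity of F their sum is a^s(q - p,
    q - p) <= 0, and [rep_null_of_aform] applies. *)
Lemma discrete_unique p q : admissible p -> admissible q ->
  (forall y, admissible y -> F (y - p) <= A p (y - p)) ->
  (forall y, admissible y -> F (y - q) <= A q (y - q)) -> rep_null Omega X (q - p).
Proof.
move=> hp hq vp vq; have dom := discrete_space_dom.
have [sp _ _] := hp; have [sq _ _] := hq.
have s1 := subspaceB discrete_space_subspace sq sp; have s2 := subspaceB discrete_space_subspace sp sq.
apply: (rep_null_of_aform hO hX eps0 eps1 hb (dom _ s1)).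
have e1 := vp _ hq; have e2 := vq _ hp.
have eF : F (p - q) = - F (q - p).
  have -> : p - q = -1 *: (q - p) + 0 by rewrite addr0 scaleN1r opprB.
  rewrite (FformL (-1) (dom _ s1) (subspace0 (rep_dom_subspace hO))).
  have -> : F 0 = 0.
    have d0 := subspace0 (rep_dom_subspace hO); have := FformL 1 d0 d0.
    rewrite scaler0 addr0 mul1r => /esym/eqP; rewrite -subr_eq0 addrK => /eqP; exact.
  by rewrite addr0 mulN1r.
have eA : A q (p - q) = - A q (q - p).
  by rewrite -(ipNr hA s1 sq) opprB.
rewrite (ipBl hA sq sp s1); rewrite eF eA lerN2 in e2.
by rewrite subr_le0; exact: le_trans e2 e1.
Qed.

End discrete_inequality.

Theorem theorem13 (R : realType) (n : nat) (hdim : n.+1 = 2%N \/ n.+1 = 3%N)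
  (eps : R) (heps : 0 < eps <= 1)
  (Omega : set 'rV[R]_n.+1) (hOmega : lipschitz_domain Omega)
  (I : finType) (X : I -> 'M[R]_(n.+2, n.+1)) (hX : conforming_mesh Omega X)
  (f : 'rV[R]_n.+1 -> R) (hf : L2 Omega f)
  (beta : R) (hbeta : 3 <= beta) :
  exists u : trial R n I,
    discrete_VI Omega X eps beta f u /\
    forall u' : trial R n I,
      discrete_VI Omega X eps beta f u' -> U_eq Omega u' u.
Proof.
have [eps0 eps1] := andP heps.
have [p hp vp] := discrete_solution hOmega hX eps0 eps1 hbeta hf.
have VI := discrete_VI_rep hOmega hX beta eps0 f.
have [/discrete_space_dom dp _ _] := hp.
exists (tr X p); split; first exact: ((VI p dp).2 (conj hp vp)).
move=> u' hu'; have [[hU _ _] _] := hu'; have [q dq eq] := in_U_rep hOmega hX (Uh_U hU).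
rewrite -eq in hu' *; have [hq vq] := (VI q dq).1 hu'.
apply: (U_eq_of_null hOmega hX dq dp).
exact: (discrete_unique hOmega hX eps0 eps1 hbeta hf hp hq vp vq).
Qed.
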